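(* Let $1\le k\le j\le\infty$ and let $\mathrm{L}_k\colon\mathrm{Op}^{\mathrm{un}}_{\le k}\to\mathrm{Op}^{\mathrm{un}}_{\le j}$ be the fully faithful functor given by left Kan extension along $i_k\colon\Omega^c_{\le k}\hookrightarrow\Omega^c_{\le j}$. A unital $j$-restricted $\infty$-operad $\mathcal F\in\mathrm{Op}^{\mathrm{un}}_{\le j}$ is in the (essential) image of $\mathrm{L}_k$ if and only if for each integer $n$ with $k<n\le j$ the canonical map $$\operatorname*{colim}_{X\in((\Omega^c_{\le k})_{\overline{C_n}/^{\mathrm{rmax}}})^{\mathrm{op}}}\mathcal F(X)\longrightarrow\mathcal F(\overline{C_n}),$$ induced by the restriction maps $g^*\colon\mathcal F(X)\to\mathcal F(\overline{C_n})$ for $g\colon\overline{C_n}\to X$, is an equivalence.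
   Context: **Trees.** A (dendroidal) tree $(T,L)$, often written $T$, is a finite poset $T$ with a minimal element (a least element, called the root) such that $\{y\le x\}$ is linearly ordered for every $x\in T$, together with a subset $L$ of the maximal elements of $T$ (the leaves). Elements of $T$ are called edges. For an edge $e$, $v(e)$ is the set of minimal elements of $T_{>e}$, and $|v(e)|$ is the valence of $e$. The edge $\eta$ is $(\{r\},\{r\})$; the $n$-corolla $C_n$ ($n\ge1$) is $\{0,1,\dots,n\}$ with $0$ least, $1,\dots,n$ pairwise incomparable and $L=\{1,\dots,n\}$; $C_0=(\{0\},\varnothing)$. **Category $\Omega$.** Objects are trees; $\mathrm{Hom}_\Omega(T,T')$ is the set of operad maps $\mathrm{Free}(T)\to\mathrm{Free}(T')$, where $\mathrm{Free}(T)$ is the coloured symmetric operad in sets with colours the edges of $T$, freely generated by one operation $v(e)\to e$ for each non-leaf edge $e$. **Closed trees.** A tree is closed if $L=\varnothing$; $\Omega^c\subset\Omega$ is the full subcategory of closed trees. (Explicitly: objects are finite rooted trees and morphisms are order-preserving maps that preserve independence, i.e. send incomparable pairs to incomparable pairs.) The inclusion $\Omega^c\hookrightarrow \Omega$ has left adjoint $(T,L)^c=(T,\varnothing)$; $\overline{C_n}:=C_n^c$. A tree is $k$-dendroidal if all its edges have valence $\le k$ (no condition if $k=\infty$); $\Omega^c_{\le k}\subset\Omega^c$ is the full subcategory of closed $k$-dendroidal trees, $\Omega^c_{\le\infty}=\Omega^c$. **Segal presheaves.** $\mathcal S$ is the $\infty$-category of spaces and $\mathcal P(\mathcal C)=\mathrm{Fun}(\mathcal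 C^{\mathrm{op}},\mathcal S)$. A morphism $f\colon T\to T'$ is a subtree inclusion if it is injective on edges and whenever $f(e_0)\le e'\le f(e_2)$ with $e'\in T'$, $e'$ lies in the image of $f$. For a tree $T$, $(\Omega^{\mathrm{el}})_{/T}\subset\Omega_{/T}$ is the full subcategory of subtree inclusions $f\colon X\to T$ with $X=\eta$ or $X=C_n$ for some $n$, where, if $X=C_n$ has root $x$, the edge $f(x)$ must also have valence $n$. A presheaf $\mathcal F$ on $\Omega^c_{\le k}$ is Segal if for every closed $k$-dendroidal $T$ the canonical map $\mathcal F(T)\to\lim_{X\in((\Omega^{\mathrm{el}})_{/T})^{\mathrm{op}}}\mathcal F(X^c)$ is an equivalence. Let $r\colon\Delta\to\Omega^c_{\le k}$ send $[n]$ to the closure of $(\{0\le1\le\dots\le n\},\{n\})$. A Segal presheaf $\mathcal F$ is complete if $r^*\mathcal F$ is a complete Segal space in the sense of Rezk. $\mathrm{Op}^{\mathrm{un}}_{\le k}$ is the full subcategory of $\mathcal P(\Omega^c_{\le k})$ on complete Segal presheaves; its objects are called unital $k$-restricted $\infty$-operads (same with $j$). Left Kan extension along $i_k$ sends $\mathrm{Op}^{\mathrm{un}}_{\le k}$ to $\mathrm{Op}^{\mathrm{un}}_{\le j}$. **Rooted max-surjective maps.** A morphism $f\colon T\to T'$ in $\Omega^c$ is rooted if it sends root to root, and max-surjective if for every $e'\in T'$ there is $e\in T$ with $f(e)\ge e'$. For a closed tree $T$, $(\Omega^c_{\le k})_{T/^{\mathrm{rmax}}}$ is the full subcategory of $(\Omega^c_{\le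 k})_{T/}=\Omega^c_{\le k}\times_{\Omega^c}(\Omega^c)_{T/}$ on the rooted max-surjective morphisms $T\to X$ with $X$ closed $k$-dendroidal. *)

(* Defs.v *)
From HB Require Import structures.
From mathcomp Require Import all_boot all_order.
From mathcomp Require Import boolp.

#[local] Obligation Tactic := simpl.
Set Implicit Arguments.
Unset Strict Implicit.
Unset Printing Implicit Defensive.

Import Order.TTheory.
Local Open Scope order_scope.

(* The oo-category S of spaces is modelled by simplicial sets: a functor from
   C^op to S is a strict presheaf of Kan complexes on C, an equivalence of such
   functors is a zigzag of objectwise weak homotopy equivalences, and limits,
   colimits and left Kan extensions are computed by the Bousfield-Kan
   constructions.                                                             *)

Lemma sig_ext (T : Type) (P : T -> Prop) (x y : {t : T | P t}) :
  sval x = sval y -> x = y.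
Proof. by case: x y => [x px] [y py] /=; apply: eq_exist. Qed.

(** * Categories *)

Record category := Category {
  ob :> Type;
  hom : ob -> ob -> Type;
  idm : forall a, hom a a;
  comp : forall a b c, hom b c -> hom a b -> hom a c;
  comp1m : forall a b (f : hom a b), comp (idm b) f = f;
  compm1 : forall a b (f : hom a b), comp f (idm a) = f;
  compA : forall a b c d (h : hom c d) (g : hom b c) (f : hom a b),
    comp h (comp g f) = comp (comp h g) f }.

Arguments hom {c} a b : rename.
Arguments idm {c} a : rename.
Arguments comp {c a b c'} g f : rename.

Record functor (C D : category) := Functor {
  fob :> C -> D;
  fmor : forall a b : C, hom a b -> hom (fob a) (fob b);
  fmor1 : forall a : C, fmor (idm a) = idm (fob a);
  fmorM : forall (a b c : C) (g : hom b c) (f : hom a b),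
    fmor (comp g f) = comp (fmor g) (fmor f) }.

Arguments fmor {C D} f {a b} u : rename.

Program Definition functor_comp (C D E : category) (G : functor D E)
    (F : functor C D) : functor C E :=
  @Functor C E (fun a => G (F a)) (fun a b u => fmor G (fmor F u)) _ _.
Next Obligation. by move=> *; rewrite !fmor1. Qed.
Next Obligation. by move=> *; rewrite !fmorM. Qed.

Program Definition op (C : category) : category :=
  @Category C (fun a b => @hom C b a) (fun a => idm a)
    (fun a b c g f => comp f g) _ _ _.
Next Obligation. by move=> *; exact: compm1. Qed.
Next Obligation. by move=> *; exact: comp1m. Qed.
Next Obligation. by move=> *; rewrite compA. Qed.

Program Definition op_functor (C D : category) (F : functor C D) :
    functor (op C) (op D) :=
  @Functor (op C) (op D) (fun a => F a) (fun a b u => @fmor C D F b a u) _ _.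
Next Obligation. by move=> *; exact: fmor1. Qed.
Next Obligation. by move=> *; exact: fmorM. Qed.

(* The category with objects A and the morphisms of C between their images; for
   an injective g this is the full subcategory on the image of g.             *)
Definition induced (C : category) (A : Type) (g : A -> C) : category :=
  @Category A (fun a b => hom (g a) (g b)) (fun a => idm (g a))
    (fun a b c v u => comp v u) (fun a b => @comp1m C _ _)
    (fun a b => @compm1 C _ _) (fun a b c d => @compA C _ _ _ _).

Definition induced_functor (C : category) (A : Type) (g : A -> C) :
    functor (induced g) C :=
  @Functor (induced g) C g (fun a b u => u) (fun=> erefl)
    (fun _ _ _ _ _ => erefl).

Program Definition slice (C : category) (T : C) : category :=
  @Category {X : C & hom X T}
    (fun a b => {u : hom (tag a) (tag b) | comp (tagged b) u = tagged a})
    (fun a => exist _ (idm (tag a)) _)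
    (fun a b c v u => exist _ (comp (sval v) (sval u)) _) _ _ _.
Next Obligation. by move=> *; exact: compm1. Qed.
Next Obligation.
by move=> C T a b c v u /=; rewrite compA (svalP v) (svalP u).
Qed.
Next Obligation. by move=> *; apply: sig_ext; exact: comp1m. Qed.
Next Obligation. by move=> *; apply: sig_ext; exact: compm1. Qed.
Next Obligation. by move=> *; apply: sig_ext; exact: compA. Qed.

Definition slice_functor (C : category) (T : C) : functor (slice T) C :=
  @Functor (slice T) C (fun a => tag a) (fun a b u => sval u) (fun=> erefl)
    (fun _ _ _ _ _ => erefl).

(* The category C x_D D_{d/}. *)
Program Definition under (C D : category) (i : functor C D) (d : D) :
    category :=
  @Category {X : C & hom d (i X)}
    (fun a b => {u : hom (tag a) (tag b) |
                 comp (fmor i u) (tagged a) = tagged b})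
    (fun a => exist _ (idm (tag a)) _)
    (fun a b c v u => exist _ (comp (sval v) (sval u)) _) _ _ _.
Next Obligation. by move=> *; rewrite fmor1 comp1m. Qed.
Next Obligation.
by move=> C D i d a b c v u /=; rewrite fmorM -compA (svalP u) (svalP v).
Qed.
Next Obligation. by move=> *; apply: sig_ext; exact: comp1m. Qed.
Next Obligation. by move=> *; apply: sig_ext; exact: compm1. Qed.
Next Obligation. by move=> *; apply: sig_ext; exact: compA. Qed.

Definition under_functor (C D : category) (i : functor C D) (d : D) :
    functor (under i d) C :=
  @Functor (under i d) C (fun a => tag a) (fun a b u => sval u) (fun=> erefl)
    (fun _ _ _ _ _ => erefl).

Record cocone (E C : category) (q : functor E C) (T : C) := Cocone {
  cocone_leg :> forall e : E, hom (q e) T;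
  cocone_nat : forall (e e' : E) (u : hom e e'),
    comp (cocone_leg e') (fmor q u) = cocone_leg e }.

Record cone (E C : category) (T : C) (q : functor E C) := Cone {
  cone_leg :> forall e : E, hom T (q e);
  cone_nat : forall (e e' : E) (u : hom e e'),
    comp (fmor q u) (cone_leg e) = cone_leg e' }.

(** * Simplicial sets *)

(* [simplex_map m n] is the set of order-preserving maps [m] -> [n].          *)
Record simplex_map (m n : nat) := SimplexMap {
  smfun :> 'I_m.+1 -> 'I_n.+1;
  smfun_mono : forall i j : 'I_m.+1, (i <= j)%N -> (smfun i <= smfun j)%N }.

Lemma simplex_map_ext m n (f g : simplex_map m n) : f =1 g -> f = g.
Proof.
case: f g => [f fP] [g gP] /= /funext fg; case: _ / fg gP => gP.
by congr SimplexMap; exact: Prop_irrelevance.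
Qed.

Definition simplex_id n : simplex_map n n :=
  @SimplexMap n n (fun i => i) (fun _ _ ij => ij).

Definition simplex_comp m n p (g : simplex_map n p) (f : simplex_map m n) :
    simplex_map m p :=
  @SimplexMap m p (fun i => g (f i))
    (fun i j ij => smfun_mono g (smfun_mono f ij)).

Definition Delta : category.
Proof.
by refine (@Category nat simplex_map simplex_id simplex_comp _ _ _) => *;
  apply: simplex_map_ext.
Defined.

(* The map [m] -> [n] constant at i. *)
Definition const_map m n (i : 'I_n.+1) : simplex_map m n :=
  @SimplexMap m n (fun=> i) (fun _ _ _ => leqnn i).

(* The coface map [n] -> [n+1] that misses i. *)
Program Definition coface n (i : 'I_n.+2) : simplex_map n n.+1 :=
  @SimplexMap n n.+1 (lift i) _.
Next Obligation. by move=> n i a b ab; rewrite /= leq_bump2. Qed.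

Record sset := SSet {
  cell :> nat -> Type;
  sact : forall m n, simplex_map m n -> cell n -> cell m;
  sact1 : forall n (x : cell n), sact (simplex_id n) x = x;
  sactM : forall m n p (g : simplex_map n p) (f : simplex_map m n) (x : cell p),
    sact (simplex_comp g f) x = sact f (sact g x) }.

Arguments sact X {m n} f x : rename.

Record smap (X Y : sset) := SMap {
  smap_fun :> forall n, X n -> Y n;
  smap_nat : forall m n (f : simplex_map m n) (x : X n),
    @smap_fun m (sact X f x) = sact Y f (@smap_fun n x) }.

Arguments smap_fun {X Y} f n x : rename.

Program Definition smap_comp (X Y Z : sset) (g : smap Y Z) (f : smap X Y) :
    smap X Z :=
  @SMap X Z (fun n x => g n (f n x)) _.
Next Obligation. by move=> *; rewrite !smap_nat. Qed.

Program Definition std_simplex (n : nat) : sset :=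
  @SSet (fun m => simplex_map m n) (fun l m f x => simplex_comp x f) _ _.
Next Obligation. by move=> *; exact: simplex_map_ext. Qed.
Next Obligation. by move=> *; exact: simplex_map_ext. Qed.

(* The union of the faces of Delta^n other than the face opposite to k. *)
Program Definition horn (n : nat) (k : 'I_n.+1) : sset :=
  @SSet (fun m => {x : simplex_map m n |
           exists2 i : 'I_n.+1, i != k & forall j, x j != i})
    (fun l m f x => exist _ (simplex_comp (sval x) f) _) _ _.
Next Obligation. by move=> n k l m f [x [i ik xi]]; exists i => // j; apply: xi. Qed.
Next Obligation. by move=> *; apply: sig_ext; exact: simplex_map_ext. Qed.
Next Obligation. by move=> *; apply: sig_ext; exact: simplex_map_ext. Qed.

Definition kan (X : sset) : Prop :=
  forall (n : nat) (k : 'I_n.+2) (h : smap (horn k) X),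
  exists s : smap (std_simplex n.+1) X,
    forall m (x : horn k m), s m (sval x) = h m x.

Program Definition sprod (X Y : sset) : sset :=
  @SSet (fun n => X n * Y n)%type
    (fun m n f x => (sact X f x.1, sact Y f x.2)) _ _.
Next Obligation. by move=> X Y n [x y]; rewrite !sact1. Qed.
Next Obligation. by move=> *; rewrite !sactM. Qed.

Definition homotopic (X Y : sset) (f g : smap X Y) : Prop :=
  exists H : smap (sprod X (std_simplex 1)) Y, forall n (x : X n),
    H n (x, const_map n ord0) = f n x /\ H n (x, const_map n ord_max) = g n x.

(* f induces bijections [Y, Z] -> [X, Z] for all Kan complexes Z. *)
Definition weak_equiv (X Y : sset) (f : smap X Y) : Prop :=
  forall Z : sset, kan Z ->
    (forall h : smap X Z, exists h' : smap Y Z, homotopic (smap_comp h' f) h) /\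
    (forall h h' : smap Y Z,
       homotopic (smap_comp h f) (smap_comp h' f) -> homotopic h h').

(* Two vertices of a Kan complex in the same path component. *)
Definition path_conn (X : sset) (a b : X 0) : Prop :=
  exists e : X 1, sact X (const_map 0 ord0) e = a /\
                  sact X (const_map 0 ord_max) e = b.

(** * Diagrams and presheaves of simplicial sets *)

Record diagram (I : category) := Diagram {
  dob :> I -> sset;
  dmor : forall a b : I, hom a b -> smap (dob a) (dob b);
  dmor1 : forall (a : I) n (x : dob a n), dmor (idm a) n x = x;
  dmorM : forall (a b c : I) (g : hom b c) (f : hom a b) n (x : dob a n),
    dmor (comp g f) n x = dmor g n (dmor f n x) }.

Arguments dmor {I} D {a b} f : rename.

Record diagram_map (I : category) (D D' : diagram I) := DiagramMap {
  dmap :> forall a : I, smap (D a) (D' a);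
  dmap_nat : forall (a b : I) (u : hom a b) n (x : D a n),
    dmap b n (dmor D u n x) = dmor D' u n (dmap a n x) }.

Definition presheaf (C : category) := diagram (op C).

Definition restrict (C : category) (F : presheaf C) (a b : C) (f : hom a b) :
    smap (F b) (F a) :=
  @dmor (op C) F b a f.

Program Definition reindex (I J : category) (p : functor I J) (D : diagram J) :
    diagram I :=
  @Diagram I (fun a => D (p a)) (fun a b u => dmor D (fmor p u)) _ _.
Next Obligation. by move=> *; rewrite fmor1 dmor1. Qed.
Next Obligation. by move=> *; rewrite fmorM dmorM. Qed.

Definition pullback (C D : category) (i : functor C D) (F : presheaf D) :
    presheaf C :=
  reindex (op_functor i) F.

Definition kan_valued (I : category) (D : diagram I) : Prop :=
  forall a : I, kan (D a).

Inductive diagram_equiv (I : category) : diagram I -> diagram I -> Prop :=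
  | DiagramEquivMap D D' (f : diagram_map D D') :
      (forall a : I, weak_equiv (f a)) -> diagram_equiv D D'
  | DiagramEquivSym D D' : diagram_equiv D D' -> diagram_equiv D' D
  | DiagramEquivTrans D D' D'' :
      diagram_equiv D D' -> diagram_equiv D' D'' -> diagram_equiv D D''.

(** * Homotopy limits, homotopy colimits and left Kan extensions *)

(* The n-simplices of the nerve of I: functors [n] -> I. *)
Record chain (n : nat) (I : category) := Chain {
  cob :> 'I_n.+1 -> I;
  cmor : forall i j : 'I_n.+1, (i <= j)%N -> hom (cob i) (cob j);
  cmor1 : forall (i : 'I_n.+1) (ii : (i <= i)%N), cmor ii = idm (cob i);
  cmorM : forall (i j l : 'I_n.+1) (ij : (i <= j)%N) (jl : (j <= l)%N)
      (il : (i <= l)%N), comp (cmor jl) (cmor ij) = cmor il }.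

Arguments cmor {n I} s {i j} ij : rename.

Definition chain_act (I : category) m n (f : simplex_map m n) (s : chain n I) :
    chain m I :=
  @Chain m I (fun i => s (f i)) (fun i j ij => cmor s (smfun_mono f ij))
    (fun i ii => cmor1 s _) (fun i j l ij jl il => cmorM _ _ _ _).

Definition chain_first (I : category) m n (f : simplex_map m n) (s : chain n I) :
    hom (s ord0) (s (f ord0)) :=
  cmor s (leq0n (f ord0) : (@ord0 n <= f ord0)%N).

Definition chain_last (I : category) m n (f : simplex_map m n) (s : chain n I) :
    hom (s (f ord_max)) (s ord_max) :=
  cmor s (leq_ord (f ord_max) : (f ord_max <= @ord_max n)%N).

Arguments chain_act : simpl never.
Arguments chain_first : simpl never.
Arguments chain_last : simpl never.

Lemma chain_firstM (I : category) m n p (g : simplex_map n p)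
    (f : simplex_map m n) (s : chain p I) :
  comp (chain_first f (chain_act g s)) (chain_first g s) =
  chain_first (simplex_comp g f) s.
Proof. exact: (@cmorM _ _ s). Qed.

Lemma chain_lastM (I : category) m n p (g : simplex_map n p)
    (f : simplex_map m n) (s : chain p I) :
  comp (chain_last g s) (chain_last f (chain_act g s)) =
  chain_last (simplex_comp g f) s.
Proof. exact: (@cmorM _ _ s). Qed.

Lemma chain_first1 (I : category) n (s : chain n I) :
  chain_first (simplex_id n) s = idm (s ord0).
Proof. exact: cmor1. Qed.

Lemma chain_last1 (I : category) n (s : chain n I) :
  chain_last (simplex_id n) s = idm (s ord_max).
Proof. exact: cmor1. Qed.

Lemma chain_existT (I : category) n (Q : ('I_n.+1 -> I) -> Type)
    (a : 'I_n.+1 -> I) (u : forall i j : 'I_n.+1, (i <= j)%N -> hom (a i) (a j))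
    p q p' q' (x y : Q a) :
  x = y ->
  existT (fun s : chain n I => Q s) (@Chain n I a u p q) x =
  existT (fun s : chain n I => Q s) (@Chain n I a u p' q') y.
Proof.
by move=> ->; rewrite (Prop_irrelevance p p') (Prop_irrelevance q q').
Qed.

(* The simplicial replacement of Bousfield-Kan: an n-simplex is a chain
   s 0 -> ... -> s n in I with an n-simplex of D (s 0).                       *)
Program Definition hocolim (I : category) (D : diagram I) : sset :=
  @SSet (fun n => {s : chain n I & D (s ord0) n})
    (fun m n f x => existT _ (chain_act f (tag x))
       (dmor D (chain_first f (tag x)) m (sact _ f (tagged x)))) _ _.
Next Obligation.
move=> I D n [[a u u1 uM] x] /=; rewrite sact1.
apply: (@chain_existT _ _ (fun a => D (a ord0) n)).
by rewrite chain_first1 dmor1.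
Qed.
Next Obligation.
move=> I D m n p g f [s x] /=.
apply: (@chain_existT _ _ (fun a => D (a ord0) m)).
by rewrite sactM -smap_nat -dmorM chain_firstM.
Qed.

(* Maps of diagrams Delta^n x N(I/-) -> D (Bousfield-Kan): such a map is
   determined by its values on the pairs (t, s -> s m = s m), and these are the
   families below.                                                            *)
Record holim_cell (I : category) (D : diagram I) (n : nat) := HolimCell {
  hlfun :> forall m, simplex_map m n -> forall s : chain m I, D (s ord_max) m;
  hlfunP : forall l m (f : simplex_map l m) (t : simplex_map m n)
      (s : chain m I),
    dmor D (chain_last f s) l (@hlfun l (simplex_comp t f) (chain_act f s)) =
    sact _ f (@hlfun m t s) }.

Lemma holim_cell_ext (I : category) (D : diagram I) n (x y : holim_cell D n) :
  (forall m t s, x m t s = y m t s) -> x = y.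
Proof.
case: x y => [x xP] [y yP] /= xy.
have e : x = y.
  by apply: functional_extensionality_dep => m;
     apply: functional_extensionality_dep => t;
     apply: functional_extensionality_dep => s.
by case: _ / e yP => yP; congr HolimCell; exact: Prop_irrelevance.
Qed.

Program Definition holim (I : category) (D : diagram I) : sset :=
  @SSet (holim_cell D)
    (fun n p g x => @HolimCell I D n (fun m t s => x m (simplex_comp g t) s) _)
    _ _.
Next Obligation.
by move=> I D n p g x l m f t s; rewrite -hlfunP.
Qed.
Next Obligation.
move=> I D n x; apply: holim_cell_ext => m t s /=.
by congr (x m _ s); exact: simplex_map_ext.
Qed.
Next Obligation. by move=> *; apply: holim_cell_ext. Qed.

(* The canonical map F T -> lim F q^op of a cocone under q, and the canonical
   map colim F q^op -> F c of a cone over q.                                  *)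
Program Definition lim_map (E C : category) (q : functor E C) (T : C)
    (f : cocone q T) (F : presheaf C) : smap (F T) (holim (pullback q F)) :=
  @SMap (F T) (holim (pullback q F))
    (fun n x => @HolimCell _ _ n
       (fun m t s => restrict F (f (s ord_max)) m (sact _ t x)) _) _.
Next Obligation.
move=> E C q T f F n x l m g t s /=.
rewrite sactM -[RHS]smap_nat /restrict -(@dmorM _ F).
congr (smap_fun (@dmor (op C) F _ _ _) l _); exact: cocone_nat.
Qed.
Next Obligation.
move=> E C q T f F m n g x; apply: holim_cell_ext => l t s /=.
by rewrite sactM.
Qed.

Program Definition colim_map (E C : category) (c : C) (q : functor E C)
    (g : cone c q) (F : presheaf C) : smap (hocolim (pullback q F)) (F c) :=
  @SMap (hocolim (pullback q F)) (F c)
    (fun n x => restrict F (g (tag x ord0)) n (tagged x)) _.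
Next Obligation.
move=> E C c q g F m n f [s x] /=.
rewrite /restrict -(@dmorM _ F) -smap_nat.
congr (smap_fun (@dmor (op C) F _ _ _) m _); exact: cone_nat.
Qed.

(* The (homotopy) left Kan extension of D along p by the bar construction: an
   n-simplex at c is a chain s 0 -> ... -> s n in I, a morphism p (s n) -> c and
   an n-simplex of D (s 0); that is, an n-simplex of the homotopy colimit of D
   over the category of pairs (a, p a -> c).                                  *)
Definition lan_cell (I J : category) (p : functor I J) (D : diagram I) (c : J)
    (n : nat) : Type :=
  {s : chain n I & hom (p (s ord_max)) c * D (s ord0) n}%type.

Program Definition lan_ob (I J : category) (p : functor I J) (D : diagram I)
    (c : J) : sset :=
  @SSet (lan_cell p D c)
    (fun m n f x => existT _ (chain_act f (tag x))
       (comp (tagged x).1 (fmor p (chain_last f (tag x))),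
        dmor D (chain_first f (tag x)) m (sact _ f (tagged x).2))) _ _.
Next Obligation.
move=> I J p D c n [[a u u1 uM] [w x]] /=; rewrite sact1.
apply: (@chain_existT _ _ (fun a => hom (p (a ord_max)) c * D (a ord0) n)%type).
by rewrite chain_first1 chain_last1 dmor1 fmor1 compm1.
Qed.
Next Obligation.
move=> I J p D c l m n g f [s [w x]] /=.
apply: (@chain_existT _ _ (fun a => hom (p (a ord_max)) c * D (a ord0) l)%type).
by rewrite sactM -smap_nat -dmorM chain_firstM -compA -fmorM chain_lastM.
Qed.

Program Definition lan (I J : category) (p : functor I J) (D : diagram I) :
    diagram J :=
  @Diagram J (lan_ob p D)
    (fun b c v => @SMap (lan_ob p D b) (lan_ob p D c)
       (fun n x => existT _ (tag x) (comp v (tagged x).1, (tagged x).2)) _) _ _.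
Next Obligation. by move=> I J p D b c v m n f [s [w x]] /=; rewrite compA. Qed.
Next Obligation. by move=> I J p D c n [s [w x]] /=; rewrite comp1m. Qed.
Next Obligation.
by move=> I J p D a b c g f n [s [w x]] /=; rewrite compA.
Qed.

(** * Complete Segal spaces *)

Definition inert m n (f : simplex_map m n) : bool :=
  [forall i, f i == (f ord0 + i)%N :> nat].

(* The full subcategory of Delta_{/[n]} on the inert maps from [0] and [1]. *)
Definition Delta_el (n : nat) : category :=
  @induced (@slice Delta n)
    {x : @slice Delta n | (tag x <= 1)%N && inert (tagged x)} sval.

Definition Delta_el_functor n : functor (Delta_el n) Delta :=
  functor_comp (@slice_functor Delta n) (induced_functor _).

Definition Delta_el_cocone n : @cocone (Delta_el n) Delta (Delta_el_functor n) n :=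
  @Cocone (Delta_el n) Delta (Delta_el_functor n) n
    (fun x => tagged (sval x)) (fun x y u => svalP u).

Definition segal_space (W : presheaf Delta) : Prop :=
  forall n, weak_equiv (lim_map (Delta_el_cocone n) W).

Definition face (W : presheaf Delta) n (i : 'I_n.+2) : smap (W n.+1) (W n) :=
  @restrict Delta W n n.+1 (coface i).

Definition degen (W : presheaf Delta) : smap (W 0) (W 1) :=
  @restrict Delta W 1 0 (const_map 1 ord0).

(* The vertices of W 1 that have a right inverse and a left inverse in the
   homotopy category of W: a vertex t of W 2 exhibits face 1 t as a composite of
   face 2 t followed by face 0 t. As W need not be Reedy fibrant, edges are
   compared up to paths in W 1; these may move the endpoints of an edge along
   paths in W 0, which does not affect its invertibility.                     *)
Definition hequiv (W : presheaf Delta) (g : W 1 0) : Prop :=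
  (exists t : W 2 0, path_conn (face W ord0 0 t) g /\
     exists y : W 0 0, path_conn (face W (inord 1) 0 t) (degen W 0 y)) /\
  (exists t : W 2 0, path_conn (face W ord_max 0 t) g /\
     exists x : W 0 0, path_conn (face W (inord 1) 0 t) (degen W 0 x)).

(* The union of the components of W 1 that consist of homotopy equivalences. *)
Program Definition hequiv_space (W : presheaf Delta) : sset :=
  @SSet
    (fun n => {x : W 1 n | forall v : simplex_map 0 n, hequiv (sact _ v x)})
    (fun m n f x => exist _ (sact _ f (sval x)) _) _ _.
Next Obligation. by move=> W m n f [x xP] v /=; rewrite -sactM. Qed.
Next Obligation. by move=> *; apply: sig_ext; exact: sact1. Qed.
Next Obligation. by move=> *; apply: sig_ext; exact: sactM. Qed.

Lemma hequiv_degen (W : presheaf Delta) (x : W 0 0) : hequiv (degen W 0 x).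
Proof.
have refl (X : sset) (a : X 0) : path_conn a a.
  exists (sact X (const_map 1 ord0) a); rewrite -!sactM.
  by split; rewrite -[RHS]sact1; congr sact; apply: simplex_map_ext => i;
     rewrite !ord1.
pose t : W 2 0 := @restrict Delta W 2 0 (const_map 2 ord0) 0 x.
have tE i : face W i 0 t = degen W 0 x.
  rewrite /t /face /degen /restrict -(@dmorM _ W) /=.
  by congr (smap_fun (@dmor (op Delta) W _ _ _) 0 _); apply: simplex_map_ext.
by split; exists t; rewrite !tE; split => //; exists x.
Qed.

Program Definition degen_hequiv (W : presheaf Delta) :
    smap (W 0) (hequiv_space W) :=
  @SMap (W 0) (hequiv_space W) (fun n x => exist _ (degen W n x) _) _.
Next Obligation. by move=> W n x v; rewrite -smap_nat; exact: hequiv_degen. Qed.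
Next Obligation. by move=> *; apply: sig_ext; exact: smap_nat. Qed.

Definition complete_segal_space (W : presheaf Delta) : Prop :=
  segal_space W /\ weak_equiv (degen_hequiv W).

(** * Trees *)

(* The root is the bottom element. *)
Record tree := Tree {
  tdisp : Order.disp_t;
  edge :> finBPOrderType tdisp;
  leaves : {set edge};
  tree_linear : forall x y z : edge, y <= x -> z <= x -> y >=< z;
  leaves_max : forall l x : edge, l \in leaves -> l <= x -> x = l }.

(* v(e) *)
Definition inputs (T : tree) (e : T) : {set T} :=
  [set x : T | (e < x) && [forall y : T, ~~ (e < y < x)]].

Definition valence (T : tree) (e : T) : nat := #|inputs e|.

(* The operations of the free operad on T, up to the order of their inputs: the
   inputs of an operation are pairwise distinct, and there is at most one
   operation with given inputs and output. So [free_op A e] holds when there is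
   an operation with set of inputs A and output e; it is either an identity or
   the composite of the generator v(e) -> e, for e not a leaf, with operations
   into the elements of v(e).                                                 *)
Inductive free_op (T : tree) : {set T} -> T -> Prop :=
  | FreeOpId (e : T) : free_op [set e] e
  | FreeOpComp (e : T) (A : T -> {set T}) :
      e \notin leaves T ->
      (forall x, x \in inputs e -> free_op (A x) x) ->
      free_op (\bigcup_(x in inputs e) A x) e.

(* A map of operads Free(T) -> Free(T') is a map of colours together with an
   operation (f e_1, ..., f e_n) -> f e for each generator (e_1, ..., e_n) -> e;
   this operation is unique if it exists.                                     *)
Record tree_hom (T T' : tree) := TreeHom {
  thfun :> T -> T';
  thfunP : forall e : T, e \notin leaves T ->
    {in inputs e &, injective thfun} /\ free_op (thfun @: inputs e) (thfun e) }.

Lemma tree_hom_ext T T' (f g : tree_hom T T') : f =1 g -> f = g.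
Proof.
case: f g => [f fP] [g gP] /= /funext fg; case: _ / fg gP => gP.
by congr TreeHom; exact: Prop_irrelevance.
Qed.

Section TreeTheory.
Variable T : tree.
Implicit Types (e x y : T) (A : {set T}).

Lemma inputs_lt e x : x \in inputs e -> e < x.
Proof. by rewrite inE => /andP[]. Qed.

Lemma inputs_le_eq e x y : x \in inputs e -> y \in inputs e -> x <= y -> x = y.
Proof.
rewrite !inE => /andP[ex _] /andP[_ /forallP/(_ x)]; rewrite ex /= => nxy.
by rewrite le_eqVlt (negPf nxy) orbF => /eqP.
Qed.

Lemma inputs_comp e x y : x \in inputs e -> y \in inputs e -> x >=< y -> x = y.
Proof.
move=> xe ye /orP[] le_xy; first exact: (inputs_le_eq xe).
by apply/esym; exact: (inputs_le_eq ye).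
Qed.

Lemma inputs_below e y : e < y -> exists2 x, x \in inputs e & x <= y.
Proof.
move=> ey; pose P x := (e < x) && (x <= y).
have Py : P y by rewrite /P ey lexx.
case: (arg_minnP (fun x => #|[set z | z <= x]|) Py) => x /andP[ex xy] xmin.
exists x => //; rewrite inE ex; apply/forallP => z; apply/negP => /andP[ez zx].
have /xmin : P z by rewrite /P ez (le_trans (ltW zx)).
rewrite leqNgt => /negP; apply; apply: proper_card; apply/properP; split.
  by apply/subsetP => w; rewrite !inE => /le_trans; apply; exact: ltW.
by exists x; rewrite !inE ?lexx // lt_geF.
Qed.

Lemma free_op_le A e x : free_op A e -> x \in A -> e <= x.
Proof.
move=> fA; elim: fA x => {A e} [e|e A _ _ IH] x; first by move=> /set1P ->.
by case/bigcupP => y ye /(IH _ ye); apply: le_trans; exact: ltW (inputs_lt ye).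
Qed.

Lemma free_op_antichain A e :
  free_op A e -> {in A &, forall x y, x >=< y -> x = y}.
Proof.
elim=> {A e} [e|e A _ fA IH] x y; first by move=> /set1P -> /set1P ->.
case/bigcupP => a ae xa /bigcupP[b be yb] xy.
have le_ax := free_op_le (fA _ ae) xa; have le_by := free_op_le (fA _ be) yb.
have ab : a = b.
  apply: (inputs_comp ae be); case/orP: xy => [le_xy|le_yx].
    exact: tree_linear (le_trans le_ax le_xy) le_by.
  exact: tree_linear le_ax (le_trans le_by le_yx).
by rewrite ab in xa; exact: (IH b be).
Qed.

Lemma free_op_subst A e (B : T -> {set T}) :
  free_op A e -> (forall x, x \in A -> free_op (B x) x) ->
  free_op (\bigcup_(x in A) B x) e.
Proof.
elim=> {A e} [e|e A le fA IH] fB; first by rewrite big_set1; apply/fB/set11.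
have -> : \bigcup_(x in \bigcup_(y in inputs e) A y) B x =
          \bigcup_(y in inputs e) \bigcup_(x in A y) B x.
  apply/setP => z; apply/bigcupP/bigcupP.
    by case=> x /bigcupP[y ye xy] zx; exists y => //; apply/bigcupP; exists x.
  by case=> y ye /bigcupP[x xy zx]; exists x => //; apply/bigcupP; exists y.
apply: FreeOpComp => // y ye; apply: IH => // x xy; apply: fB.
by apply/bigcupP; exists y.
Qed.

(* In a closed tree every antichain above e is the set of inputs of an operation
   with output e.                                                             *)
Lemma antichain_free_op A e :
  leaves T = set0 -> (forall x, x \in A -> e <= x) ->
  {in A &, forall x y, x >=< y -> x = y} -> free_op A e.
Proof.
move=> T0; have [n] := ubnP #|[set z : T | e <= z]|.
elim: n A e => // n IH A e le_n eA antiA.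
have [eIA|eNA] := boolP (e \in A).
  suff -> : A = [set e] by exact: FreeOpId.
  apply/setP => x; rewrite inE; apply/idP/eqP => [xA|-> //].
  by apply/esym/antiA; rewrite // /Order.comparable eA.
have -> : A = \bigcup_(x in inputs e) [set z in A | x <= z].
  apply/setP => z; apply/idP/bigcupP => [zA|[x _]]; last by rewrite inE => /andP[].
  have ez : e < z.
    by rewrite lt_neqAle eA // andbT; apply: contraNneq eNA => ->.
  by have [x xe xz] := inputs_below ez; exists x; rewrite // inE zA.
apply: FreeOpComp => [|x xe]; first by rewrite T0 inE.
apply: IH => [|z|z w]; last 2 first.
- by rewrite inE => /andP[].
- by rewrite !inE => /andP[zA _] /andP[wA _]; exact: antiA.
rewrite -ltnS; apply: leq_trans le_n; rewrite ltnS; apply: proper_card.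
have ex := inputs_lt xe; apply/properP; split.
  by apply/subsetP => z; rewrite !inE; apply: le_trans; exact: ltW.
by exists e; rewrite !inE ?lexx // lt_geF.
Qed.

End TreeTheory.

Lemma tree_hom_free_op T T' (f : tree_hom T T') (A : {set T}) (e : T) :
  free_op A e -> {in A &, injective f} /\ free_op (f @: A) (f e).
Proof.
elim=> {A e} [e|e A le fA IH].
  by rewrite imset_set1; split; [move=> x y /set1P -> /set1P -> | exact: FreeOpId].
have [inj_e op_e] := thfunP f le; split.
  move=> x y /bigcupP[a ae xa] /bigcupP[b be yb] fxy.
  have le_ax : f a <= f x by apply: free_op_le (IH a ae).2 _; exact: imset_f.
  have le_by : f b <= f y by apply: free_op_le (IH b be).2 _; exact: imset_f.
  have ab : a = b.
    apply: inj_e => //; apply: (free_op_antichain op_e); rewrite ?imset_f //.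
    by rewrite fxy in le_ax; exact: tree_linear le_ax le_by.
  by rewrite ab in xa; exact: (IH b be).1.
pose B y := \bigcup_(x in inputs e | f x == y) f @: A x.
have BE x : x \in inputs e -> B (f x) = f @: A x.
  move=> xe; rewrite /B (big_pred1 x) // => y; apply/andP/eqP => [[ye /eqP]|->//].
  by move/inj_e => ->.
have -> : f @: (\bigcup_(x in inputs e) A x) = \bigcup_(y in f @: inputs e) B y.
  rewrite big_imset //= (eq_bigr _ BE); apply/setP => z; apply/imsetP/bigcupP.
    by case=> x /bigcupP[y ye xy] ->; exists y => //; exact: imset_f.
  by case=> y ye /imsetP[x xy ->]; exists x => //; apply/bigcupP; exists y.
by apply: free_op_subst => // _ /imsetP[x xe ->]; rewrite BE //; exact: (IH x xe).2.
Qed.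

Program Definition tree_id (T : tree) : tree_hom T T :=
  @TreeHom T T (fun x => x) _.
Next Obligation.
move=> T e le; split; first by move=> x y _ _.
rewrite imset_id (_ : inputs e = \bigcup_(x in inputs e) [set x]).
  by apply: FreeOpComp => // x _; exact: FreeOpId.
apply/setP => z; apply/idP/bigcupP => [ze|[x xe /set1P ->//]].
by exists z; rewrite ?set11.
Qed.

Program Definition tree_comp (T T' T'' : tree) (g : tree_hom T' T'')
    (f : tree_hom T T') : tree_hom T T'' :=
  @TreeHom T T'' (fun x => g (f x)) _.
Next Obligation.
move=> T T' T'' g f e le; have [inj_e op_e] := thfunP f le.
have [inj_g op_g] := tree_hom_free_op g op_e; split.
  by move=> x y xe ye /inj_g fxy; apply: inj_e => //; apply: fxy; exact: imset_f.
by rewrite imset_comp.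
Qed.

Definition Omega : category.
Proof.
by refine (@Category tree tree_hom tree_id tree_comp _ _ _) => *;
  apply: tree_hom_ext.
Defined.

Definition rooted (T T' : tree) (f : tree_hom T T') : bool := f \bot == \bot.

Definition max_surjective (T T' : tree) (f : tree_hom T T') : bool :=
  [forall e', exists e, e' <= f e].

Definition subtree_inclusion (T T' : tree) (f : tree_hom T T') : bool :=
  injectiveb f &&
  [forall e0, forall e', forall e2, (f e0 <= e' <= f e2) ==> (e' \in codom f)].

(** * Linear trees and corollas *)

(* The library does not join the partial order of 'I_n.+1 with its bottom. *)
HB.instance Definition _ n := Order.POrder.on 'I_n.+1.

(* ({0 <= 1 <= ... <= n}, {n}) *)
Program Definition linear (n : nat) : tree :=
  @Tree _ 'I_n.+1 [set ord_max] _ _.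
Next Obligation. by move=> n x y z _ _; rewrite /Order.comparable; exact: le_total. Qed.
Next Obligation.
move=> n l x /set1P ->; rewrite leEord => nx; apply/val_inj/eqP.
by rewrite eqn_leq leq_ord.
Qed.

Definition eta : tree := linear 0.

(* The vertices of C_n: 0 is least and all other elements are incomparable. *)
Definition star (n : nat) := 'I_n.+1.
Definition star_le n (x y : star n) : bool := (x == ord0) || (x == y).
Fact star_display : Order.disp_t. Proof. exact: Order.Disp tt tt. Qed.

Fact star_le_refl n : reflexive (@star_le n).
Proof. by move=> x; rewrite /star_le eqxx orbT. Qed.

Fact star_le_anti n : antisymmetric (@star_le n).
Proof.
by move=> x y /andP[/orP[/eqP->|/eqP//] /orP[/eqP->//|/eqP->]].
Qed.

Fact star_le_trans n : transitive (@star_le n).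
Proof.
by move=> y x z /orP[/eqP->|/eqP->//] _; rewrite /star_le eqxx.
Qed.

HB.instance Definition _ n := Finite.on (star n).
HB.instance Definition _ n := Order.Le_isPOrder.Build star_display (star n)
  (@star_le_refl n) (@star_le_anti n) (@star_le_trans n).

Fact star_le0x n (x : star n) : (ord0 : star n) <= x.
Proof. by rewrite /Order.le /= /star_le eqxx. Qed.

HB.instance Definition _ n :=
  Order.hasBottom.Build star_display (star n) (@star_le0x n).

(* C_n *)
Program Definition corolla (n : nat) : tree :=
  @Tree _ (star n) [set x : star n | x != ord0] _ _.
Next Obligation.
move=> n x y z; rewrite /Order.comparable /Order.le /= /star_le.
by case/orP=> [/eqP->|/eqP->]; case/orP=> [/eqP->|/eqP->]; rewrite ?eqxx ?orbT.
Qed.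
Next Obligation.
by move=> n l x; rewrite inE => /negPf l0; rewrite /Order.le /= /star_le l0 => /eqP.
Qed.

(* The elementary trees: eta is None and C_n is Some n. *)
Definition elementary (x : option nat) : tree :=
  if x is Some n then corolla n else eta.

Lemma valence_le_card (T : tree) (e : T) : (valence e < #|T|)%N.
Proof.
rewrite -cardsT; apply: proper_card; apply/properP.
by split; [exact: subsetT | exists e; rewrite !inE ?ltxx].
Qed.

Lemma valence_corolla n (e : corolla n) : (valence e <= n)%N.
Proof. by have := valence_le_card e; rewrite card_ord ltnS. Qed.

Lemma valence_linear n (e : linear n) : (valence e <= 1)%N.
Proof.
rewrite /valence leqNgt; apply/negP => /card_gt1P[x [y [xe ye]]].
case/negP; apply/eqP/(inputs_comp xe ye).
by rewrite /Order.comparable; exact: le_total.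
Qed.

(** * Closed trees *)

(* Valence bounds, with None standing for infinity. *)
Definition leinf (a b : option nat) : bool :=
  match a, b with
  | _, None => true
  | None, Some _ => false
  | Some m, Some n => (m <= n)%N
  end.

Lemma leinf_trans b a c : leinf a b -> leinf b c -> leinf a c.
Proof. by case: a b c => [a|] [b|] [c|] //=; exact: leq_trans. Qed.

Definition dendroidal (k : option nat) (T : tree) : bool :=
  [forall e : T, leinf (Some (valence e)) k].

Record ctree (k : option nat) := CTree {
  ctree_tree :> tree;
  ctree_closed : leaves ctree_tree = set0;
  ctree_dendroidal : dendroidal k ctree_tree }.

(* Omega^c_{<= k} *)
Definition Omegac (k : option nat) : category :=
  @induced Omega (ctree k) (fun T => ctree_tree T).

Lemma dendroidal_le k j (T : tree) :
  leinf k j -> dendroidal k T -> dendroidal j T.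
Proof. by move=> kj /forallP Tk; apply/forallP => e; exact: leinf_trans kj. Qed.

Definition inclusion (k j : option nat) (kj : leinf k j) :
    functor (Omegac k) (Omegac j) :=
  @Functor (Omegac k) (Omegac j)
    (fun T => CTree (ctree_closed T) (dendroidal_le kj (ctree_dendroidal T)))
    (fun a b f => f) (fun=> erefl) (fun _ _ _ _ _ => erefl).

Program Definition closure (T : tree) : tree :=
  @Tree _ (edge T) set0 (@tree_linear T) _.
Next Obligation. by move=> T l x; rewrite inE. Qed.

Lemma dendroidal_closure k (T : tree) : dendroidal k (closure T) = dendroidal k T.
Proof. by []. Qed.

Definition ctree_closure k (T : tree) (Tk : dendroidal k T) : ctree k :=
  @CTree k (closure T) erefl Tk.

(* The unit of the adjunction between closure and the inclusion of closed trees
   and the adjunct of a map into a closed tree.                               *)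
Program Definition closure_unit (T : tree) : tree_hom T (closure T) :=
  @TreeHom T (closure T) (fun x => x) _.
Next Obligation.
move=> T e _; apply: (thfunP (tree_id (closure T))).
by rewrite inE.
Qed.

Program Definition closure_adjunct (T T' : tree) (T'0 : leaves T' = set0)
    (f : tree_hom T T') : tree_hom (closure T) T' :=
  @TreeHom (closure T) T' f _.
Next Obligation.
move=> T T' T'0 f e _; have [le|] := boolP (e \in leaves T); last exact: thfunP.
have -> : @inputs (closure T) e = set0.
  apply/setP => x; rewrite !inE; apply/negP => /andP[ex _].
  by have xE := leaves_max le (ltW ex); rewrite xE ltxx in ex.
split; first by move=> x; rewrite inE.
by rewrite imset0; apply: antichain_free_op => // x; rewrite inE.
Qed.

Definition closure_hom (T T' : tree) (f : tree_hom T T') :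
    tree_hom (closure T) (closure T') :=
  @closure_adjunct T (closure T') erefl (tree_comp (closure_unit T') f).

(* Maps of closed trees are the maps that preserve order and independence. *)
Lemma closed_hom_proof (T T' : tree) (f : T -> T') :
  leaves T' = set0 -> {homo f : x y / x <= y} ->
  (forall x y, f x >=< f y -> x >=< y) ->
  forall e : T, e \notin leaves T ->
  {in inputs e &, injective f} /\ free_op (f @: inputs e) (f e).
Proof.
move=> T'0 f_homo f_indep e _; split.
  move=> x y xe ye fxy; apply: (inputs_comp xe ye); apply: f_indep.
  by rewrite fxy /Order.comparable lexx.
apply: antichain_free_op => // [_ /imsetP[x /inputs_lt/ltW ex ->]|]; first exact: f_homo.
move=> _ _ /imsetP[x xe ->] /imsetP[y ye ->] /f_indep xy.
by rewrite (inputs_comp xe ye xy).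
Qed.

(** * Complete Segal presheaves *)

(* (Omega^el)_{/T} *)
Definition Omega_el_ob (T : tree) : Type :=
  {x : {X : option nat & tree_hom (elementary X) T} |
   subtree_inclusion (tagged x) &&
   (if tag x is Some n then valence (tagged x \bot) == n else true)}.

Definition Omega_el_slice (T : tree) (x : Omega_el_ob T) : @slice Omega T :=
  existT (fun X : Omega => @hom Omega X T)
    (elementary (tag (sval x))) (tagged (sval x)).

Definition Omega_el (T : tree) : category :=
  induced (@Omega_el_slice T).

Lemma dendroidal_elementary k (T : ctree k) (x : Omega_el_ob T) :
  dendroidal k (elementary (tag (sval x))).
Proof.
case: x => [[[n|] f] /= /andP[_ fn]]; apply/forallP => e.
  have /forallP/(_ (f \bot)) := ctree_dendroidal T; rewrite (eqP fn).
  by apply: leinf_trans; exact: valence_corolla.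
by case: k {T f fn} => //= k; have := valence_le_card e; rewrite card_ord ltnS leqn0 => /eqP ->.
Qed.

(* X |-> X^c *)
Program Definition Omega_el_functor k (T : ctree k) :
    functor (Omega_el T) (Omegac k) :=
  @Functor (Omega_el T) (Omegac k)
    (fun x => ctree_closure (dendroidal_elementary x))
    (fun x y u => closure_hom (sval u)) _ _.
Next Obligation. by move=> *; exact: tree_hom_ext. Qed.
Next Obligation. by move=> *; exact: tree_hom_ext. Qed.

Program Definition Omega_el_cocone k (T : ctree k) :
    @cocone (Omega_el T) (Omegac k) (Omega_el_functor T) T :=
  @Cocone (Omega_el T) (Omegac k) (Omega_el_functor T) T
    (fun x => closure_adjunct (ctree_closed T) (tagged (sval x))) _.
Next Obligation.
move=> k T x y u; apply: tree_hom_ext => e /=.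
have /= uP := svalP u.
by move: (congr1 (fun h : tree_hom (elementary (tag (sval x))) T => h e) uP).
Qed.

Definition segal k (F : presheaf (Omegac k)) : Prop :=
  forall T : ctree k, weak_equiv (lim_map (Omega_el_cocone T) F).

Lemma dendroidal_linear k n : leinf (Some 1) k -> dendroidal k (linear n).
Proof.
move=> k1; apply/forallP => e; apply: leinf_trans k1; exact: valence_linear.
Qed.

(* The functor r. *)
Program Definition Delta_Omegac k (k1 : leinf (Some 1) k) :
    functor Delta (Omegac k) :=
  @Functor Delta (Omegac k)
    (fun n => ctree_closure (dendroidal_linear n k1))
    (fun m n f => @TreeHom (closure (linear m)) (closure (linear n)) f _) _ _.
Next Obligation.
move=> k k1 m n f.
apply: (@closed_hom_proof (closure (linear m)) (closure (linear n)) f) => // x y.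
  exact: smfun_mono.
Qed.
Next Obligation. by move=> *; exact: tree_hom_ext. Qed.
Next Obligation. by move=> *; exact: tree_hom_ext. Qed.

Definition complete k (k1 : leinf (Some 1) k) (F : presheaf (Omegac k)) : Prop :=
  complete_segal_space (pullback (Delta_Omegac k1) F).

(* The objects of Op^un_{<= k}. *)
Definition unital_operad k (k1 : leinf (Some 1) k) (F : presheaf (Omegac k)) :
    Prop :=
  [/\ kan_valued F, segal F & complete k1 F].

(* The essential image of L_k. *)
Definition in_image_L k j (k1 : leinf (Some 1) k) (kj : leinf k j)
    (F : presheaf (Omegac j)) : Prop :=
  exists2 G : presheaf (Omegac k), unital_operad k1 G &
    diagram_equiv (lan (op_functor (inclusion kj)) G) F.

(** * Rooted max-surjective maps *)

(* (Omega^c_{<= k})_{T/^rmax} *)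
Definition rmax k j (kj : leinf k j) (T : ctree j) : category :=
  @induced (under (inclusion kj) T)
    {x : under (inclusion kj) T |
     rooted (tagged x : tree_hom _ _) && max_surjective (tagged x : tree_hom _ _)}
    sval.

Definition rmax_functor k j (kj : leinf k j) (T : ctree j) :
    functor (rmax kj T) (Omegac j) :=
  functor_comp (inclusion kj)
    (functor_comp (under_functor (inclusion kj) T) (induced_functor _)).

Definition rmax_cone k j (kj : leinf k j) (T : ctree j) :
    @cone (rmax kj T) (Omegac j) T (rmax_functor kj T) :=
  @Cone (rmax kj T) (Omegac j) T (rmax_functor kj T)
    (fun x => tagged (sval x)) (fun x y u => svalP u).

Lemma dendroidal_corolla k n : leinf (Some n) k -> dendroidal k (corolla n).
Proof.
move=> kn; apply/forallP => e; apply: leinf_trans kn; exact: valence_corolla.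
Qed.

Definition closed_corolla j n (nj : leinf (Some n) j) : ctree j :=
  ctree_closure (dendroidal_corolla nj).

(* Main.v *)
(* The counit at F of left Kan extension along i_k and restriction is, at a tree T,
   the map from the colimit over all maps T -> X with X k-dendroidal. The rooted
   max-surjective maps are coreflective among these: replace X by the edges that
   lie above the image of the root and below the image of some edge. So the
   condition of the theorem says that the counit is an equivalence at the closed
   corollas of valence n > k; as restriction preserves unital operads and i_k is
   fully faithful, F is in the image if and only if the counit is an equivalence
   at every T.

   This is shown by induction on the number of edges of T. If T is k-dendroidal,
   the identity of T is initial. If T has an edge e that is neither the root nor
   maximal, cut T at e into the edges T0 not strictly above e and the edges T1 at
   or above e. Cutting X at the image of e is an equivalence from the category of
   rooted max-surjective maps T -> X to the product of those for T0 and T1, since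
   conversely two trees can be glued along an edge. By the Segal condition F(X) is
   the homotopy fibre product of F(X0) and F(X1) over the value S of F at the edge,
   modelled by the paths in S, and such fibre products commute with homotopy
   colimits because pulling back along S^I -> S x S preserves weak equivalences.
   In the remaining case T is a closed corolla. *)

From HB Require Import structures.
From mathcomp Require Import all_boot all_order.
From mathcomp Require Import boolp zify.
Require Import Defs.

#[local] Obligation Tactic := simpl.
Set Implicit Arguments.
Unset Strict Implicit.
Unset Printing Implicit Defensive.

Import Order.TTheory.

(** * Simplicial maps *)

(** Weak equivalences are tested only on maps into Kan complexes, so every comparison of homotopy
    colimits, pullbacks and Kan extensions is reduced to extending maps into a Kan complex [Z]. The
    tool is the equivalence of [kan] with the homotopy extension property [hep], which passes by
    transposition to function complexes and, along maps with path lifting, to dependent products.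
    Pulling back along S^I -> S x S is homotopy invariant because a map from X x_B Q to Z is a map
    over B from X to a dependent product, which is Kan again. Invariance of homotopy colimits is
    obtained by extending over the cells of the nerve.

    The second obstacle is strictness: the Segal conditions for a tree and its two parts are stated
    over different categories, with relabelled corollas. All three limits are rewritten as limits
    over posets of edges and vertices of the same tree. There the limit for the whole tree is the
    strict fibre product of those for the parts, and it agrees with the homotopy fibre product
    because evaluation of the lower part at the cut edge lifts paths. *)

Lemma smap_ext (X Y : sset) (f g : smap X Y) :
  (forall n x, f n x = g n x) -> f = g.
Proof.
case: f g => [f fN] [g gN] /= fg.
have e : f = g.
  by apply: functional_extensionality_dep => n; apply: funext => x; exact: fg.
by case: _ / e gN {fg} => gN; congr SMap; exact: Prop_irrelevance.
Qed.

Definition smap_id (X : sset) : smap X X :=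
  @SMap X X (fun n x => x) (fun _ _ _ _ => erefl).

Definition sfst (X Y : sset) : smap (sprod X Y) X :=
  @SMap (sprod X Y) X (fun n x => x.1) (fun _ _ _ _ => erefl).

Definition ssnd (X Y : sset) : smap (sprod X Y) Y :=
  @SMap (sprod X Y) Y (fun n x => x.2) (fun _ _ _ _ => erefl).

Program Definition spair (W X Y : sset) (f : smap W X) (g : smap W Y) :
    smap W (sprod X Y) :=
  @SMap W (sprod X Y) (fun n x => (f n x, g n x)) _.
Next Obligation. by move=> *; rewrite !smap_nat. Qed.

Definition sprod_map (X X' Y Y' : sset) (f : smap X X') (g : smap Y Y') :
    smap (sprod X Y) (sprod X' Y') :=
  spair (smap_comp f (sfst X Y)) (smap_comp g (ssnd X Y)).

Notation interval := (std_simplex 1).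

Definition endpoint (b : bool) (n : nat) : simplex_map n 1 :=
  const_map n (if b then ord_max else ord0).

Lemma endpoint_comp b m n (f : simplex_map m n) :
  simplex_comp (endpoint b n) f = endpoint b m.
Proof. exact: simplex_map_ext. Qed.

Program Definition at_end (b : bool) (X : sset) : smap X (sprod X interval) :=
  @SMap X (sprod X interval) (fun n x => (x, endpoint b n)) _.
Next Obligation. by move=> *; rewrite endpoint_comp. Qed.

Lemma simplex_compA l m n p (h : simplex_map n p) (g : simplex_map m n)
    (f : simplex_map l m) :
  simplex_comp h (simplex_comp g f) = simplex_comp (simplex_comp h g) f.
Proof. exact: simplex_map_ext. Qed.

Lemma simplex_comp1m m n (f : simplex_map m n) :
  simplex_comp (simplex_id n) f = f.
Proof. exact: simplex_map_ext. Qed.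

Lemma simplex_compm1 m n (f : simplex_map m n) :
  simplex_comp f (simplex_id m) = f.
Proof. exact: simplex_map_ext. Qed.

(** * Extension cell by cell *)

Definition surj m n (f : simplex_map m n) : bool :=
  [forall i, exists j, f j == i].

Lemma nonsurj_factor l n (g : simplex_map l n.+1) :
  ~~ surj g -> exists (d : simplex_map n n.+1) (g' : simplex_map l n),
    g = simplex_comp d g'.
Proof.
move=> /forallPn[i] /existsPn gi; exists (coface i).
have gP a : g a = lift i (odflt ord0 (unlift i (g a))).
  by case: unliftP => [j ->|/eqP e] //; rewrite (negPf (gi a)) in e.
have mono (a b : 'I_l.+1) : (a <= b)%N -> (odflt ord0 (unlift i (g a)) <= odflt ord0 (unlift i (g b)))%N.
  by move/(smfun_mono g); rewrite (gP a) (gP b) /= leq_bump2 -!gP.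
by exists (SimplexMap mono); apply: simplex_map_ext => a /=; rewrite -gP.
Qed.

Lemma surj_endo n (f : simplex_map n n) : surj f -> f = simplex_id n.
Proof.
move=> /forallP fS; apply: simplex_map_ext => /= i; apply/val_inj => /=.
have le_f k (kn : (k < n.+1)%N) : (f (Ordinal kn) <= k)%N.
  elim: k kn => [|k IH] kn.
    by have /existsP[j /eqP f0] := fS ord0; rewrite -[leqRHS]/(val (@ord0 n)) -f0; exact: smfun_mono.
  rewrite leqNgt; apply/negP => lt_f.
  have kf : (k.+1 < n.+1)%N by [].
  have /existsP[j /eqP fj] := fS (Ordinal kf).
  have [jk|kj] := leqP j k.
    have kn' : (k < n.+1)%N by exact: ltnW.
    have /leq_trans/(_ (IH kn')) : (f j <= f (Ordinal kn'))%N by exact: smfun_mono.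
    by rewrite fj /= ltnn.
  have : (f (Ordinal kn) <= f j)%N by exact: smfun_mono.
  by rewrite fj /= leqNgt lt_f.
case: i => i i_n /=; apply/eqP; rewrite eqn_leq le_f /=.
suff H d : forall i, (i < n.+1)%N -> (i + d = n)%N -> forall ii : (i < n.+1)%N, (i <= f (Ordinal ii))%N.
  by apply: (H (n - i)%N) => //; rewrite subnKC.
elim: d {i i_n} => [|d IH] i i_n.
  rewrite addn0 => e ii; have /existsP[j /eqP fj] := fS ord_max.
  rewrite {1}e -[leqLHS]/(val (@ord_max n)) -fj; apply: smfun_mono => /=.
  by rewrite e -ltnS.
move=> e ii; rewrite leqNgt; apply/negP => lt_f.
have /existsP[j /eqP fj] := fS (Ordinal ii).
have [ji|ij] := leqP j i.
  have : (f j <= f (Ordinal ii))%N by exact: smfun_mono.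
  by rewrite fj /= leqNgt lt_f.
have i1n : (i.+1 < n.+1)%N by rewrite ltnS -e addnS ltnS leq_addr.
have IHi : (i.+1 <= f (Ordinal i1n))%N by apply: (IH i.+1) => //; rewrite addSnnS.
have : (f (Ordinal i1n) <= f j)%N by exact: smfun_mono.
by rewrite fj /= => /(leq_trans IHi); rewrite ltnn.
Qed.

(* Two surjections to nondegenerate cells of the same dimension with the same
   result are equal: a section of f at which g differs from the identity exhibits
   the cell as a proper face or degeneracy of itself. *)
Lemma surj_act_inj (N : sset) (K : forall n, N n -> Prop) m (s s' : N m) :
  ~ K m s -> (forall l (g : simplex_map l m), ~~ surj g -> K l (sact N g s)) ->
  (forall l (g : simplex_map l m), ~~ surj g -> K l (sact N g s')) ->
  forall l (f g : simplex_map l m),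
  ~ K l (sact N f s) -> sact N f s = sact N g s' -> s = s' /\ f = g.
Proof.
move=> Ks bK bK' l f g Kf fg.
have sf : surj f by apply: contra_notT Kf; exact: bK.
(* The section passes through the given [i], so that [g D = id] evaluated at [f i] gives
   [g i = f i]. *)
have section i : exists D : simplex_map m l, simplex_comp f D = simplex_id m /\ D (f i) = i.
  have [j|d dP] := @choice _ _ (fun (j : 'I_m.+1) (y : 'I_l.+1) => f y = j /\ (j = f i -> y = i)).
    have [->|ji] := eqVneq j (f i); first by exists i.
    have /forallP/(_ j)/existsP[y /eqP fy] := sf; exists y; split=> // e.
    by rewrite e eqxx in ji.
  have dmono (a b : 'I_m.+1) : (a <= b)%N -> (d a <= d b)%N.
    rewrite leq_eqVlt => /orP[/eqP/val_inj->//|ab].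
    rewrite leqNgt; apply/negP => /ltnW/(smfun_mono f).
    by rewrite (dP a).1 (dP b).1 leqNgt ab.
  exists (SimplexMap dmono); split; last exact: (dP (f i)).2.
  by apply: simplex_map_ext => j /=; exact: (dP j).1.
have comp_id D : simplex_comp f D = simplex_id m -> simplex_comp g D = simplex_id m.
  move=> fD; apply: surj_endo; apply: contra_notT Ks => /bK'.
  by rewrite sactM -fg -sactM fD sact1.
split.
  have [D [fD _]] := section ord0.
  have := congr1 (sact N D) fg; rewrite -!sactM fD (comp_id _ fD) !sact1 //.
apply: simplex_map_ext => i; have [D [fD Di]] := section i.
by have := congr1 (fun h : simplex_map m m => h (f i)) (comp_id _ fD); rewrite /= Di.
Qed.

Section CellExtension.
Variables (N X Z : sset) (q : smap X N).
Variable good : forall n, X n -> Z n -> Prop.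

(** A map to [Z] on the part of [X] over a subcomplex of [N]. The domain lives in [N], so that
    attaching one cell of [N] attaches the whole part of [X] over it; for homotopy colimits [N] is
    the nerve of the index category. [good] collects the pointwise conditions on the extension. *)
Record partial_map := PartialMap {
  pdom : forall n, N n -> Prop;
  pdom_act : forall m n (f : simplex_map m n) s, @pdom n s -> @pdom m (sact N f s);
  pfun : forall n (x : X n), @pdom n (q n x) -> Z n;
  pfun_nat : forall m n (f : simplex_map m n) (x : X n) d d',
    @pfun m (sact X f x) d' = sact Z f (@pfun n x d);
  pfun_good : forall n (x : X n) d, good x (@pfun n x d) }.

Definition partial_le (P Q : partial_map) : Prop :=
  (forall n s, @pdom P n s -> @pdom Q n s) /\
  (forall n x d d', @pfun P n x d = @pfun Q n x d').

Lemma pfun_irr (P : partial_map) n (x : X n) d d' : @pfun P n x d = @pfun P n x d'.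
Proof. by congr pfun; exact: Prop_irrelevance. Qed.

Lemma partial_le_refl P : partial_le P P.
Proof. by split=> // n x d d'; exact: pfun_irr. Qed.

Lemma partial_le_trans Q P R : partial_le P Q -> partial_le Q R -> partial_le P R.
Proof.
move=> [PQ PQf] [QR QRf]; split=> [n s /PQ/QR//|n x d d'].
by rewrite (PQf _ _ _ (PQ _ _ d)) (QRf _ _ _ d').
Qed.

(** [psi] is a map on the pullback of [X] along [s : Delta^m -> N]. Goodness is asked only outside
    the domain of [P], where it does not already follow from [pfun_good]. *)
Definition extends_over_cell (P : partial_map) m (s : N m) :=
  exists psi : forall l (g : simplex_map l m) (x : X l), q l x = sact N g s -> Z l,
  [/\ forall k l (f : simplex_map k l) g x e e',
        psi k (simplex_comp g f) (sact X f x) e' = sact Z f (psi l g x e),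
      forall l g x e d, psi l g x e = @pfun P l x d &
      forall l g x e, ~ @pdom P l (q l x) -> good x (psi l g x e)].

(** All [m]-cells are attached at once. A new cell of [N] is [sact N g s] for exactly one pair of a
    missing [s] and a map [g], by [surj_act_inj]; hence the choice of such a pair by [cid] does not
    affect the value. *)
Lemma attach_cells P m :
  (forall (s : N m) l (g : simplex_map l m), ~~ surj g -> @pdom P l (sact N g s)) ->
  (forall s : N m, ~ @pdom P m s -> extends_over_cell P s) ->
  exists2 Q, partial_le P Q & forall s : N m, @pdom Q m s.
Proof.
move=> bP ext.
pose D n (y : N n) := @pdom P n y \/
  exists (s : {s : N m | ~ @pdom P m s}) (g : simplex_map n m), y = sact N g (sval s).
have Dact k n (f : simplex_map k n) y : D n y -> D k (sact N f y).
  case=> [Py|[s [g ->]]]; first by left; exact: pdom_act.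
  by right; exists s, (simplex_comp g f); rewrite sactM.
have Dcell n (y : N n) : D n y -> ~ @pdom P n y ->
    exists c : {s : N m | ~ @pdom P m s} * simplex_map n m, y = sact N c.2 (sval c.1).
  by case=> // -[s [g e]] _; exists (s, g).
have ext' (s : {s : N m | ~ @pdom P m s}) : extends_over_cell P (sval s).
  by case: s => s Ps; exact: ext.
pose psi s := sval (cid (ext' s)).
have psiN s k l (f : simplex_map k l) g x e e' :
    psi s k (simplex_comp g f) (sact X f x) e' = sact Z f (psi s l g x e).
  by rewrite /psi; case: cid => /= ? [].
have psiP s l g x e d : psi s l g x e = @pfun P l x d.
  by rewrite /psi; case: cid => /= ? [].
have psi_good s l g x e : ~ @pdom P l (q l x) -> good x (psi s l g x e).
  by rewrite /psi; case: cid => /= ? [? ?]; exact.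
pose F n (x : X n) (d : D n (q n x)) : Z n :=
  match pselect (@pdom P n (q n x)) with
  | left Px => pfun Px
  | right nPx => let: exist c e := cid (Dcell _ _ d nPx) in psi c.1 n c.2 x e
  end.
have FE n x (d : D n (q n x)) Px : F n x d = @pfun P n x Px.
  by rewrite /F; case: pselect => // H; exact: pfun_irr.
have FE' n x (d : D n (q n x)) s g e : F n x d = psi s n g x e.
  rewrite /F; case: pselect => [Px|nPx]; first by rewrite (psiP _ _ _ _ _ Px).
  case: cid => -[s' g'] /= e'.
  have [] := @surj_act_inj N (@pdom P) m (sval s') (sval s) (svalP s') (bP _) (bP _) n g' g.
  - by rewrite -e'.
  - by rewrite -e'.
  move=> /sig_ext ss' gg'; case: _ / gg' e => e; case: _ / ss' e => e.
  by congr (psi _ _ _ _ _); exact: Prop_irrelevance.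
have Fnat k n (f : simplex_map k n) (x : X n) d d' : F k (sact X f x) d' = sact Z f (F n x d).
  have [Px|[s [g e]]] : D n (q n x) by [].
    have Pfx : @pdom P k (q k (sact X f x)) by rewrite smap_nat; exact: pdom_act.
    by rewrite (FE _ _ d Px) (FE _ _ d' Pfx); exact: pfun_nat.
  have e' : q k (sact X f x) = sact N (simplex_comp g f) (sval s) by rewrite smap_nat e sactM.
  by rewrite (FE' _ _ d s g e) (FE' _ _ d' s _ e'); exact: psiN.
have Fgood n (x : X n) d : good x (F n x d).
  rewrite /F; case: pselect => [Px|nPx]; first exact: pfun_good.
  by case: cid => g e; exact: psi_good.
exists (PartialMap Dact Fnat Fgood).
  by split=> [n y Py|n x Px d]; [left | apply/esym/FE].
move=> s; have [Ps|nPs] := pselect (@pdom P m s); first by left.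
by right; exists (exist _ s nPs), (simplex_id m); rewrite sact1.
Qed.

(** Cells are attached dimension by dimension. The stages form an increasing sequence of partial
    maps, and an [n]-cell takes its value at stage [n + 1]. *)
Lemma cell_extension (P0 : partial_map) :
  (forall P, partial_le P0 P -> forall m (s : N m), ~ @pdom P m s ->
     (forall l (g : simplex_map l m), ~~ surj g -> @pdom P l (sact N g s)) ->
     extends_over_cell P s) ->
  exists h : smap X Z, (forall n x d, h n x = @pfun P0 n x d) /\
                       (forall n x, good x (h n x)).
Proof.
move=> ext.
pose T m := {P | partial_le P0 P /\ forall n (s : N n), (n < m)%N -> @pdom P n s}.
have step m (P : T m) : exists Q : T m.+1, partial_le (sval P) (sval Q).
  case: P => [P [P0P Pm]].
  have bP (s : N m) l (g : simplex_map l m) : ~~ surj g -> @pdom P l (sact N g s).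
    case: m s g Pm => [|m] s g Pm sg.
      by case/forallPn: sg => i /existsPn/(_ ord0); rewrite !ord1.
    by have [d [g' ->]] := nonsurj_factor sg; rewrite sactM; apply: pdom_act; exact: Pm.
  have [|Q PQ Qm] := attach_cells bP; first by move=> s Ps; apply: ext => //; exact: bP.
  have QT n (s : N n) : (n < m.+1)%N -> @pdom Q n s.
    rewrite ltnS leq_eqVlt => /orP[/eqP e|nm]; last exact/PQ.1/Pm.
    by case: _ / e Qm => Qm; exact: Qm.
  by exists (exist _ Q (conj (partial_le_trans P0P PQ) QT)).
have T0P : partial_le P0 P0 /\ forall n (s : N n), (n < 0)%N -> @pdom P0 n s.
  by split=> //; exact: partial_le_refl.
pose S := fix S m : T m :=
  if m is m'.+1 then sval (cid (step m' (S m'))) else exist _ P0 T0P.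
have S_le d m : partial_le (sval (S m)) (sval (S (d + m)%N)).
  elim: d => [|d IH]; first exact: partial_le_refl.
  by apply: partial_le_trans IH _; exact: svalP (cid (step _ (S (d + m)%N))).
have S_leq m n : (m <= n)%N -> partial_le (sval (S m)) (sval (S n)).
  by move=> mn; rewrite -(subnK mn).
have dom n (s : N n) : @pdom (sval (S n.+1)) n s by apply: (svalP (S n.+1)).2.
pose F n (x : X n) := @pfun (sval (S n.+1)) n x (dom _ _).
have FE m n x d : F n x = @pfun (sval (S m)) n x d.
  by have [mn|/ltnW nm] := leqP m n.+1; [apply/esym|]; apply: (S_leq _ _ _).2.
have FN m n (f : simplex_map m n) x : F m (sact X f x) = sact Z f (F n x).
  have dx : @pdom (sval (S (maxn m n).+1)) n (q n x).
    by apply: (svalP (S _)).2; rewrite ltnS leq_maxr.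
  have dfx : @pdom (sval (S (maxn m n).+1)) m (q m (sact X f x)).
    by apply: (svalP (S _)).2; rewrite ltnS leq_maxl.
  by rewrite (FE _ _ _ dx) (FE _ _ _ dfx); exact: pfun_nat.
exists (SMap FN); split=> [n x d|n x] /=; last exact: pfun_good.
by rewrite (FE 0%N n x d).
Qed.

End CellExtension.

(** * Filling open boxes in Kan complexes *)

Definition any (X Z : sset) : forall n, X n -> Z n -> Prop := fun _ _ _ => True.
Arguments any : clear implicits.

(** The domain of [P] meets the simplex [s] exactly in the horn at [k], so [P] restricts to a horn
    in [Z]. Injectivity of the characteristic map of [s] makes a filler a well-defined function of
    the simplices of [s]. *)
Lemma attach_horn (Y Z : sset) (P : partial_map (smap_id Y) (any Y Z)) m
    (s : Y m.+1) (k : 'I_m.+2) :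
  kan Z ->
  (forall l (g : simplex_map l m.+1),
     pdom P (sact Y g s) <-> exists2 i, i != k & forall j, g j != i) ->
  (forall l (g g' : simplex_map l m.+1), sact Y g s = sact Y g' s -> g = g') ->
  exists2 Q, partial_le P Q &
    forall n y, @pdom _ _ _ _ _ Q n y <-> pdom P y \/ exists g, y = sact Y g s.
Proof.
move=> kanZ PE s_inj.
have dom l (g : horn k l) : pdom P (sact Y (sval g) s) by apply/PE; exact: (svalP g).
pose h0 l (g : horn k l) : Z l := @pfun _ _ _ _ _ P l (sact Y (sval g) s) (dom l g).
have irr n y y' (d : pdom P y) (d' : pdom P y') : y = y' ->
    @pfun _ _ _ _ _ P n y d = @pfun _ _ _ _ _ P n y' d'.
  by move=> e; case: _ / e d' => d'; exact: pfun_irr.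
have h0N l l' (f : simplex_map l l') (x : horn k l') :
    h0 l (sact (horn k) f x) = sact Z f (h0 l' x).
  have d : pdom P (sact Y f (sact Y (sval x) s)) by apply: pdom_act; exact: dom.
  by rewrite -(@pfun_nat _ _ _ _ _ P l l' f _ _ d); apply: irr; rewrite /= sactM.
have [h hP] := kanZ m k (SMap h0N).
pose D n y := pdom P y \/ exists g : simplex_map n m.+1, y = sact Y g s.
have Dact a b (f : simplex_map a b) y : D b y -> D a (sact Y f y).
  case=> [Py|[g ->]]; first by left; exact: pdom_act.
  by right; exists (simplex_comp g f); rewrite sactM.
have Dcell n (y : Y n) : D n y -> ~ pdom P y -> exists g : simplex_map n m.+1, y = sact Y g s.
  by case.
pose F n (y : Y n) (d : D n y) : Z n :=
  match pselect (pdom P y) with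
  | left Py => @pfun _ _ _ _ _ P n y Py
  | right nPy => let: exist g e := cid (Dcell _ _ d nPy) in h n g
  end.
have FE n (y : Y n) (d : D n y) Py : F n y d = @pfun _ _ _ _ _ P n y Py.
  by rewrite /F; case: pselect => // H; exact: irr.
have FE' n (y : Y n) (d : D n y) g : y = sact Y g s -> F n y d = h n g.
  move=> e; rewrite /F; case: pselect => [Py|nPy].
    have gk := Py; rewrite e PE in gk.
    by rewrite (hP n (exist _ g gk)) /= /h0; exact: irr.
  by case: cid => g' e' /=; rewrite (s_inj _ g' g) // -e' -e.
have FN a b (f : simplex_map a b) (y : Y b) d d' : F a (sact Y f y) d' = sact Z f (F b y d).
  have [Py|[g e]] : D b y by [].
    have Pfy : pdom P (sact Y f y) by exact: pdom_act.
    by rewrite (FE _ _ d Py) (FE _ _ d' Pfy); exact: pfun_nat.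
  rewrite (FE' _ _ d g e) (FE' _ _ d' (simplex_comp g f)) ?e ?sactM //.
  exact: (smap_nat h f g).
exists (@PartialMap Y Y Z (smap_id Y) (any Y Z) D Dact F FN (fun _ _ _ => I)) => //.
by split=> [n y Py|n y Py d]; [left | apply/esym/FE].
Qed.

Section Prism.
Variables (Z : sset) (kanZ : kan Z) (n : nat) (b : bool).
Let Y : sset := sprod (std_simplex n) interval.

(** The codegeneracy that takes the value [i] twice, at [i] and at [i + 1]. *)
Definition collapse_fun (i : 'I_n.+1) (a : 'I_n.+2) : 'I_n.+1 :=
  inord (if (a <= i)%N then a : nat else a.-1).

Lemma collapse_funE i a :
  collapse_fun i a = (if (a <= i)%N then a : nat else a.-1) :> nat.
Proof.
rewrite inordK //; case: ifP => ai; first exact: leq_ltn_trans ai _.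
by have := ltn_ord a; case: (val a) ai => //= a' _; rewrite ltnS.
Qed.

Lemma collapse_mono i (a c : 'I_n.+2) : (a <= c)%N -> (collapse_fun i a <= collapse_fun i c)%N.
Proof. by move=> ac; rewrite !collapse_funE; case: (leqP a i); case: (leqP c i); lia. Qed.

Lemma jump_mono (i : 'I_n.+1) (a c : 'I_n.+2) : (a <= c)%N ->
  ((if (a <= i)%N then ord0 else ord_max : 'I_2) <= (if (c <= i)%N then ord0 else ord_max : 'I_2))%N.
Proof. by move=> ac; case: (leqP a i) => ai; case: (leqP c i) => ci //=; lia. Qed.

(** The shuffle (0,0), ..., (i,0), (i,1), ..., (n,1) of the prism. The n + 1 shuffles are attached
    one by one, each along a horn. *)
Definition prism_cell (i : 'I_n.+1) : Y n.+1 :=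
  (SimplexMap (@collapse_mono i), SimplexMap (@jump_mono i)).

(** The simplices of the [l]-th shuffle; see [below_cell]. *)
Definition below (l : nat) m (y : Y m) : Prop :=
  forall a, if y.2 a == ord0 then (y.1 a <= l)%N else (l <= y.1 a)%N.

Definition open_box m (y : Y m) : Prop := ~~ surj y.1 \/ y.2 = endpoint b m.

(** The shuffles attached after [c] steps. From the end 1 they come in the order 0, ..., n, from the
    end 0 in the order n, ..., 0. Subtraction is truncated, so [n < c] is what includes l = 0 once
    everything is attached. *)
Definition done (c l : nat) : bool := if b then (l < c)%N else (n - c < l)%N || (n < c)%N.

Definition stage (c : nat) m (y : Y m) : Prop :=
  open_box y \/ exists2 l, (l <= n)%N && done c l & below l y.

Lemma I2_neq0 (a : 'I_2) : a != ord0 -> a = ord_max.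
Proof. by move=> a0; apply/val_inj; case: a a0 => [[|[|]]]. Qed.

Lemma prism_snd l (g : simplex_map l n.+1) i a :
  ((sact Y g (prism_cell i)).2 a == ord0) = (g a <= i)%N.
Proof. by rewrite /=; case: leqP. Qed.

Lemma prism_fst l (g : simplex_map l n.+1) i a :
  (sact Y g (prism_cell i)).1 a = (if (g a <= i)%N then g a : nat else (g a).-1) :> nat.
Proof. exact: collapse_funE. Qed.

Lemma prism_cell_inj i l (g g' : simplex_map l n.+1) :
  sact Y g (prism_cell i) = sact Y g' (prism_cell i) -> g = g'.
Proof.
move=> e; apply: simplex_map_ext => a; apply/val_inj => /=.
have := prism_fst g i a; have := prism_snd g i a.
by rewrite e prism_fst prism_snd; case: (leqP (g a) i); case: (leqP (g' a) i); lia.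
Qed.

(** The face common to the shuffle [i] and the one attached next or, for the last shuffle, the
    opposite end of the prism. All other faces lie in the open box or in the shuffle attached
    before. *)
Definition missing (i : 'I_n.+1) : 'I_n.+2 := inord (if b then i.+1 else i).

Lemma missingE i : missing i = (if b then i.+1 else i : nat) :> nat.
Proof. by have := ltn_ord i => ?; rewrite inordK //; case: (b); lia. Qed.

Lemma stage_horn c (i : 'I_n.+1) l (g : simplex_map l n.+1) :
  i = (if b then c else (n - c)%N) :> nat -> (c <= n)%N ->
  stage c (sact Y g (prism_cell i)) <-> exists2 j, j != missing i & forall a, g a != j.
Proof.
move=> iE cn; split.
- case=> [[/forallPn[j /existsPn jP]|e]|[l' /andP[l'n lc] lP]].
  (* A value [j] missed by the first coordinate means that vertex [j] is missed before the jump and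
     vertex [j + 1] after it. For [j = i] both [i] and [i + 1] are missed, and the bound [i + b]
     selects the one different from [missing i]. *)
  + have [ji|ij] := ltnP j (i + b).
      have J_n : (j < n.+2)%N by exact: leqW.
      exists (Ordinal J_n); first by rewrite -val_eqE /= missingE; move: ji; case: (b) => /=; lia.
      move=> a; have := jP a; rewrite -!val_eqE [val _]prism_fst /=; move: ji.
      by case: (b) => /=; case: (leqP (g a) i); lia.
    have J_n : (j.+1 < n.+2)%N by rewrite ltnS ltn_ord.
    exists (Ordinal J_n); first by rewrite -val_eqE /= missingE; move: ij; case: (b) => /=; lia.
    move=> a; have := jP a; rewrite -!val_eqE [val _]prism_fst /=; move: ij.
    by case: (b) => /=; case: (leqP (g a) i); lia.
  + have J_n : ((if b then i : nat else i.+1) < n.+2)%N by have := ltn_ord i; case: (b); lia.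
    exists (Ordinal J_n); first by rewrite -val_eqE /= missingE; case: (b); lia.
    move=> a; rewrite -val_eqE /=.
    by have := prism_snd g i a; rewrite e -val_eqE /=; case: (b) => /=; case: (leqP (g a) i); lia.
  + have J_n : ((if b then i : nat else i.+1) < n.+2)%N by have := ltn_ord i; case: (b); lia.
    exists (Ordinal J_n); first by rewrite -val_eqE /= missingE; case: (b); lia.
    move=> a; rewrite -val_eqE /=.
    have := lP a; rewrite prism_snd prism_fst.
    by move: lc iE; rewrite /done; case: (b) => lc iE; case: (leqP (g a) i); lia.
- case=> j jm jP.
  have jm' : j <> (if b then i.+1 else i : nat) :> nat by move=> e; case/eqP: jm; apply/val_inj; rewrite /= e missingE.
  have gj a : g a <> j :> nat by move=> e; have := jP a; rewrite -val_eqE /= e eqxx.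
  have [ji|ij] := ltnP j i.
    left; left; apply/forallPn; exists (inord j); apply/existsPn => a.
    rewrite -val_eqE [val _]prism_fst /= inordK; have := gj a; have := ltn_ord i; case: (leqP (g a) i); lia.
  have [ij'|ji'] := ltnP i.+1 j.
    left; left; apply/forallPn; exists (inord j.-1); apply/existsPn => a.
    rewrite -val_eqE [val _]prism_fst /= inordK; have := gj a; have := ltn_ord j; case: (leqP (g a) i); lia.
  have ga_n a := ltn_ord (g a).
  case: {iE}(boolP b) iE jm' (iE) => bb iE jm' _.
    have [i0|i0] := posnP i.
      left; right; rewrite bb; apply: simplex_map_ext => a; apply: I2_neq0.
      by rewrite prism_snd; have := gj a; lia.
    right; exists i.-1; first by rewrite /done bb; have := ltn_ord i; lia.
    by move=> a; rewrite prism_snd prism_fst; have := gj a; case: (leqP (g a) i); lia.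
  have [iN|iN] := eqVneq (i : nat) n.
    left; right; rewrite (negPf bb); apply: simplex_map_ext => a; apply/eqP.
    by rewrite prism_snd; have := gj a; have := ga_n a; lia.
  right; exists i.+1; first by rewrite /done (negPf bb); have := ltn_ord i; lia.
  by move=> a; rewrite prism_snd prism_fst; have := gj a; case: (leqP (g a) i); lia.
Qed.

Lemma below_cell (i : 'I_n.+1) m (y : Y m) :
  below i y <-> exists g : simplex_map m n.+1, y = sact Y g (prism_cell i).
Proof.
split=> [yi|[g -> a]]; last by rewrite prism_snd prism_fst; case: (leqP (g a) i); lia.
(* The point (x,0) is vertex [x] of the shuffle and (x,1) is vertex [x + 1]. *)
pose G (a : 'I_m.+1) : 'I_n.+2 := inord (y.1 a + (y.2 a != ord0)).
have GE a : G a = (y.1 a + (y.2 a != ord0))%N :> nat.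
  by rewrite inordK //; have := ltn_ord (y.1 a); case: (_ == _) => /=; lia.
have Gmono (a c : 'I_m.+1) : (a <= c)%N -> (G a <= G c)%N.
  move=> ac; rewrite !GE; have := smfun_mono y.1 ac; have := smfun_mono y.2 ac.
  by rewrite -!val_eqE /=; lia.
exists (SimplexMap Gmono); case: y @G GE Gmono yi => f t G GE Gmono yi.
congr pair; apply: simplex_map_ext => a.
  apply/val_inj => /=; rewrite collapse_funE GE.
  by have := yi a => /=; case: (t a == ord0) => /=; case: (leqP (f a + _)%N i); lia.
rewrite /= GE; have := yi a => /=.
by case: eqP => [->|/eqP/I2_neq0 ->] /=; case: (leqP (f a + _)%N i) => //; lia.
Qed.

(** The shuffle is read off from the largest first coordinate over the end 0; if no vertex lies
    there, the shuffle 0 contains the simplex. *)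
Lemma below_ex m (y : Y m) : exists2 l, (l <= n)%N & below l y.
Proof.
have [[a0 y0]|none] := pselect (exists a, y.2 a == ord0); last first.
  exists 0%N => // a; case: ifP => // ya; by case: none; exists a.
case: (@arg_maxnP _ a0 (fun a => y.2 a == ord0) val y0) => a ya amax.
exists (y.1 a); first by rewrite -ltnS.
move=> c; case: ifP => [yc|yc]; first exact/smfun_mono/amax.
apply: smfun_mono; rewrite leqNgt; apply/negP => /ltnW/(smfun_mono y.2).
by rewrite (eqP ya) leqn0 => /eqP e; move: yc; rewrite -val_eqE /= e eqxx.
Qed.

Lemma prism_extension (P : partial_map (smap_id Y) (any Y Z)) :
  (forall m y, @pdom _ _ _ _ _ P m y <-> open_box y) ->
  exists h : smap Y Z, forall m y d, h m y = @pfun _ _ _ _ _ P m y d.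
Proof.
move=> PE.
have [Q PQ QE] : exists2 Q, partial_le P Q &
    forall m y, @pdom _ _ _ _ _ Q m y <-> stage n.+1 y.
  elim: {-2}n.+1 (leqnn n.+1) => [|c IH] cn.
    exists P => [|m y]; first exact: partial_le_refl.
    rewrite PE; split=> [|[//|[l /andP[ln]]]]; first by left.
    by rewrite /done; case: (b); lia.
  have [Q PQ QE] := IH (ltnW cn).
  pose i : 'I_n.+1 := inord (if b then c else (n - c)%N).
  have iE : i = (if b then c else (n - c)%N) :> nat by rewrite inordK //; case: (b); lia.
  have [||Q' QQ' Q'E] := @attach_horn Y Z Q n (prism_cell i) (missing i) kanZ.
  - by move=> l g; rewrite QE; exact: stage_horn.
  - by move=> l g g'; exact: prism_cell_inj.
  exists Q' => [|m y]; first exact: partial_le_trans QQ'.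
  rewrite Q'E QE -below_cell; split.
  + case=> [[bx|[l /andP[ln lc] ly]]|yi]; first by left.
      by right; exists l => //; rewrite ln; move: lc; rewrite /done; case: (b); lia.
    right; exists (i : nat) => //; rewrite -ltnS ltn_ord iE /done.
    by case: (b); lia.
  + case=> [bx|[l /andP[ln lc] ly]]; first by left; left.
    have [e|li] := eqVneq l i; first by right; rewrite -e.
    left; right; exists l => //; rewrite ln.
    by move: lc li; rewrite iE /done; case: (b); lia.
have Qall m (y : Y m) : pdom Q y.
  rewrite QE; have [l ln ly] := below_ex y; right; exists l => //.
  by rewrite ln /done; case: (b); lia.
have hN m m' (f : simplex_map m m') y :
    @pfun _ _ _ _ _ Q m (sact Y f y) (Qall _ _) = sact Z f (@pfun _ _ _ _ _ Q m' y (Qall _ _)).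
  exact: pfun_nat.
by exists (SMap hN) => m y d; apply/esym/PQ.2.
Qed.

End Prism.

(** * The homotopy extension property *)

Definition injective_smap (X Y : sset) (j : smap X Y) : Prop :=
  forall n, injective (j n).

(* The homotopy extension property, from either end of the interval. *)
Definition hep (Z : sset) : Prop :=
  forall (A X : sset) (j : smap A X) (b : bool) (w : smap X Z)
    (u : smap (sprod A interval) Z),
  injective_smap j ->
  (forall n a, u n (a, endpoint b n) = w n (j n a)) ->
  exists h : smap (sprod X interval) Z,
    (forall n x, h n (x, endpoint b n) = w n x) /\
    (forall n a t, h n (j n a, t) = u n (a, t)).

Lemma surj_section m n (f : simplex_map m n) :
  surj f -> exists d : simplex_map n m, simplex_comp f d = simplex_id n.
Proof.
move=> /forallP sf.
have [j|d dP] := @choice _ _ (fun (j : 'I_n.+1) (y : 'I_m.+1) => f y = j).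
  by have /existsP[y /eqP fy] := sf j; exists y.
have dmono (a b : 'I_n.+1) : (a <= b)%N -> (d a <= d b)%N.
  rewrite leq_eqVlt => /orP[/eqP/val_inj->//|ab].
  by rewrite leqNgt; apply/negP => /ltnW/(smfun_mono f); rewrite !dP leqNgt ab.
by exists (SimplexMap dmono); apply: simplex_map_ext => j /=.
Qed.

Lemma endpoint_inj n : endpoint true n <> endpoint false n.
Proof. by move=> /(congr1 (fun f : simplex_map n 1 => val (f ord0))). Qed.

(** Over a nondegenerate cell [s] of [X] outside [A] the problem lives on Delta^m x I: the boundary
    is given by earlier cells, the end [b] by [w], and [prism_extension] fills this open box. [good]
    records agreement with [u] over [A] and with [w] at the end. *)
Lemma kan_hep (Z : sset) : kan Z -> hep Z.
Proof.
move=> kanZ A X j b w u j_inj uw.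
pose X' := sprod X interval.
pose good n (x : X' n) (z : Z n) :=
  (forall a, x.1 = j n a -> z = u n (a, x.2)) /\ (x.2 = endpoint b n -> z = w n x.1).
pose D n (x : X n) := exists a, x = j n a.
have Dact m n (f : simplex_map m n) x : D n x -> D m (sact X f x).
  by case=> a ->; exists (sact A f a); rewrite smap_nat.
pose F n (x : X' n) (d : D n (sfst X interval n x)) : Z n := u n (sval (cid d), x.2).
have FE n (x : X' n) d a : x.1 = j n a -> F n x d = u n (a, x.2).
  rewrite /F; case: cid => a' /= -> /j_inj -> //.
have FN m n (f : simplex_map m n) (x : X' n) d d' : F m (sact X' f x) d' = sact Z f (F n x d).
  case: (cid d) => a e.
  have e' : (sact X' f x).1 = j m (sact A f a) by rewrite smap_nat -e.
  by rewrite (FE _ _ d a e) (FE _ _ d' _ e'); exact: (smap_nat u f (a, x.2)).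
have Fgood n (x : X' n) d : good n x (F n x d).
  split=> [a e|e]; first exact: FE.
  by case: (cid d) => a ea; rewrite (FE _ _ d _ ea) e uw -ea.
have [P P0P m s Ps bP|h [hP hg]] :=
    @cell_extension X X' Z (sfst X interval) good (PartialMap Dact FN Fgood); last first.
  exists h; split=> [n x|n a t]; first by have [_ /(_ erefl)] := hg n (x, endpoint b n).
  by have [/(_ a erefl)] := hg n (j n a, t).
pose pf := @pfun X X' Z (sfst X interval) good P.
have Psurj l (g : simplex_map l m) : pdom P (sact X g s) -> ~~ surj g.
  move=> Pgs; apply/negP => /surj_section[d gd]; apply: Ps.
  by rewrite -[s]sact1 -gd sactM; exact: pdom_act.
pose Y := sprod (std_simplex m) interval.
pose B l (y : Y l) := open_box b y.
have Bact k l (f : simplex_map k l) y : B l y -> B k (sact Y f y).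
  case=> [ns|e]; [left|right].
    apply: contra ns => /forallP sf; apply/forallP => i; have /existsP[a /eqP fa] := sf i.
    by apply/existsP; exists (f a); apply/eqP.
  by rewrite /= e; exact: simplex_map_ext.
(* Where boundary and end overlap, the two prescriptions agree by the goodness of [P]. *)
pose G l (y : Y l) (_ : B l y) : Z l :=
  match pselect (pdom P (sact X y.1 s)) with
  | left d => pf l (sact X y.1 s, y.2) d
  | right _ => w l (sact X y.1 s)
  end.
have GE l y (By : B l y) d : G l y By = pf l (sact X y.1 s, y.2) d.
  by rewrite /G; case: pselect => // d'; exact: pfun_irr.
have GE' l y (By : B l y) : y.2 = endpoint b l -> G l y By = w l (sact X y.1 s).
  move=> e; rewrite /G; case: pselect => // d.
  by have [_ /(_ e)] := @pfun_good X X' Z (sfst X interval) good P l (sact X y.1 s, y.2) d.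
have pfunE l (x x' : X' l) (d : pdom P x.1) (d' : pdom P x'.1) :
    x = x' -> pf l x d = pf l x' d'.
  by move=> e; case: _ / e d' => d'; exact: pfun_irr.
have GN k l (f : simplex_map k l) (y : Y l) d d' : G k (sact Y f y) d' = sact Z f (G l y d).
  have [ns|e] := (d).
    have dy := bP _ _ ns.
    have dfy : pdom P (sact X (sact Y f y).1 s) by rewrite /= sactM; exact: pdom_act.
    have dfy' : pdom P (sact X f (sact X y.1 s)) by exact: pdom_act.
    rewrite (GE _ _ d dy) (GE _ _ d' dfy) -(@pfun_nat X X' Z (sfst X interval) good P _ _ f (sact X y.1 s, y.2) _ dfy').
    by apply: pfunE; rewrite /= sactM.
  rewrite (GE' _ _ d e) (GE' _ _ d'); last by rewrite /= e; exact: simplex_map_ext.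
  by rewrite /= sactM smap_nat.
have [//|h hP] := @prism_extension Z kanZ m b
  (@PartialMap Y Y Z (smap_id Y) (any Y Z) B Bact G GN (fun _ _ _ => I)).
exists (fun l g x _ => h l (g, x.2)); split.
- by move=> k l f g x _ _; rewrite -smap_nat.
- move=> l g [x t] e d /=; move: (e) => /= ex.
  have sg : B l (g, t) by left; apply: Psurj; rewrite -ex.
  have d' : pdom P (sact X g s) by rewrite -ex.
  by rewrite (hP _ (g, t) sg) /= (GE _ _ sg d'); apply: pfunE; rewrite /= ex.
- move=> l g [x t] /= ex dx; split=> [a /= xa|/= te].
    by case: dx; apply: P0P.1; exists a.
  have bg : B l (g, t) by right.
  by rewrite (hP _ (g, t) bg) /= (GE' _ _ bg te) ex.
Qed.

(* The horn with vertex k is a retract of its open box at the initial end of the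
   interval, by min(-, k), or at the final end, by max(-, k). *)
Lemma hep_kan (Z : sset) : hep Z -> kan Z.
Proof.
move=> hepZ n k h.
(* At the end [b] the retraction has to miss a vertex other than [k]: min(-, k) misses the last
   vertex unless [k] is the last one, and then max(-, k) is constant and misses 0. *)
pose b := val k == n.+1.
pose R (x : 'I_n.+2) (t : 'I_2) : 'I_n.+2 :=
  if b then (if t == ord0 then x else (if (x <= k)%N then k else x))
  else (if t == ord0 then (if (x <= k)%N then x else k) else x).
have Rmono (x y : 'I_n.+2) (t u : 'I_2) : (x <= y)%N -> (t <= u)%N -> (R x t <= R y u)%N.
  have kn := ltn_ord k; have xn := ltn_ord x; have yn := ltn_ord y.
  rewrite /R -!val_eqE /= => xy tu.
  case: (boolP b) => [/eqP kN|_].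
    have {}kN : k = n.+1 :> nat by [].
    by case: (eqVneq (t : nat) 0%N) => t0; case: (eqVneq (u : nat) 0%N) => u0;
       case: (leqP x k) => xk; case: (leqP y k) => yk //=; lia.
  by case: (eqVneq (t : nat) 0%N) => t0; case: (eqVneq (u : nat) 0%N) => u0;
     case: (leqP x k) => xk; case: (leqP y k) => yk //=; lia.
pose Rm m (f : simplex_map m n.+1) (t : simplex_map m 1) : simplex_map m n.+1 :=
  @SimplexMap m n.+1 (fun a => R (f a) (t a))
    (fun a c ac => Rmono _ _ _ _ (smfun_mono f ac) (smfun_mono t ac)).
have Rk x t i : i != k -> x != i -> R x t != i.
  move=> ik xi; have ki : k != i by rewrite eq_sym.
  by rewrite /R; case: ifP => _; case: ifP => _ //; case: ifP => _.
have R_end m (f : simplex_map m n.+1) : exists2 i, i != k & forall a, Rm m f (endpoint b m) a != i.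
  have kn := ltn_ord k; rewrite /Rm /R /=; case: (boolP b) => [/eqP kN|/eqP kN].
    have {}kN : k = n.+1 :> nat by [].
    exists ord0; first by rewrite -val_eqE /= kN.
    by move=> a /=; rewrite -val_eqE /=; case: (leqP (f a) k) => /=; lia.
  have {}kN : k <> n.+1 :> nat by [].
  exists ord_max; first by rewrite -val_eqE /=; lia.
  by move=> a /=; rewrite -val_eqE /=; case: (leqP (f a) k) => /=; lia.
have wN l m (f : simplex_map l m) (x : std_simplex n.+1 m) :
    h l (exist _ (Rm l (sact (std_simplex n.+1) f x) (endpoint b l)) (R_end _ _)) =
    sact Z f (h m (exist _ (Rm m x (endpoint b m)) (R_end _ _))).
  by rewrite -smap_nat; congr (h l _); apply: sig_ext; exact: simplex_map_ext.
have jN l m (f : simplex_map l m) (x : horn k m) :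
    sval (sact (horn k) f x) = sact (std_simplex n.+1) f (sval x) by [].
have uP m (x : sprod (horn k) interval m) :
    exists2 i, i != k & forall a, Rm m (sval x.1) x.2 a != i.
  case: x => [[x [i ik xi]] t]; exists i => // a; exact: Rk.
have uN l m (f : simplex_map l m) (x : sprod (horn k) interval m) :
    h l (exist _ (Rm l (sval (sact (sprod (horn k) interval) f x).1) (sact (sprod (horn k) interval) f x).2) (uP _ _)) =
    sact Z f (h m (exist _ (Rm m (sval x.1) x.2) (uP _ x))).
  by rewrite -smap_nat; congr (h l _); apply: sig_ext; exact: simplex_map_ext.
pose J := @SMap (horn k) (std_simplex n.+1) (fun m x => sval x) jN.
pose W := @SMap (std_simplex n.+1) Z (fun m x =>
  h m (exist _ (Rm m x (endpoint b m)) (R_end _ _))) wN.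
pose U := @SMap (sprod (horn k) interval) Z (fun m x =>
  h m (exist _ (Rm m (sval x.1) x.2) (uP m x))) uN.
have [||H [_ HP]] := hepZ _ _ J b W U.
- by move=> m x y /= /sig_ext.
- by move=> m x /=; congr (h m _); exact: sig_ext.
have sN l m (f : simplex_map l m) (x : std_simplex n.+1 m) :
    H l (sact (std_simplex n.+1) f x, endpoint (~~ b) l) = sact Z f (H m (x, endpoint (~~ b) m)).
  by rewrite -smap_nat /= endpoint_comp.
exists (@SMap (std_simplex n.+1) Z (fun m x => H m (x, endpoint (~~ b) m)) sN) => m x /=; rewrite (HP m x (endpoint (~~ b) m)) /=.
congr (h m _); apply: sig_ext; apply: simplex_map_ext => a /=.
by rewrite /R; case: (b).
Qed.

(** * Subobjects, sums and the point *)

Program Definition ssub (X : sset) (P : forall n, X n -> Prop)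
    (Pact : forall m n (f : simplex_map m n) x, P n x -> P m (sact X f x)) : sset :=
  @SSet (fun n => {x : X n | P n x})
    (fun m n f x => exist _ (sact X f (sval x)) (Pact _ _ _ _ (proj2_sig x))) _ _.
Next Obligation. by move=> *; apply: sig_ext; exact: sact1. Qed.
Next Obligation. by move=> *; apply: sig_ext; exact: sactM. Qed.

Program Definition ssum (X Y : sset) : sset :=
  @SSet (fun n => X n + Y n)%type
    (fun m n f x => match x with inl x => inl (sact X f x) | inr y => inr (sact Y f y) end) _ _.
Next Obligation. by move=> X Y n [x|y]; rewrite sact1. Qed.
Next Obligation. by move=> X Y m n p g f [x|y]; rewrite sactM. Qed.

Program Definition copair (X Y Z : sset) (f : smap X Z) (g : smap Y Z) :
    smap (ssum X Y) Z :=
  @SMap (ssum X Y) Z (fun n x => match x with inl x => f n x | inr y => g n y end) _.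
Next Obligation. by move=> X Y Z f g m n h [x|y]; rewrite smap_nat. Qed.

Program Definition copair_prod (X Y W Z : sset) (f : smap (sprod X W) Z)
    (g : smap (sprod Y W) Z) : smap (sprod (ssum X Y) W) Z :=
  @SMap (sprod (ssum X Y) W) Z
    (fun n x => match x.1 with inl a => f n (a, x.2) | inr a => g n (a, x.2) end) _.
Next Obligation. by move=> X Y W Z f g m n h [[x|y] w] /=; rewrite -smap_nat. Qed.

Program Definition sempty : sset :=
  @SSet (fun=> False) (fun m n f (x : False) => match x with end) _ _.
Next Obligation. by move=> n []. Qed.
Next Obligation. by move=> m n p g f []. Qed.

Program Definition from_empty (Z : sset) : smap sempty Z :=
  @SMap sempty Z (fun n (x : False) => match x with end) _.
Next Obligation. by move=> Z m n f []. Qed.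

Program Definition from_empty_prod (W Z : sset) : smap (sprod sempty W) Z :=
  @SMap (sprod sempty W) Z (fun n x => match x.1 with end) _.
Next Obligation. by move=> W Z m n f [[]]. Qed.

Definition spoint : sset := std_simplex 0.

Program Definition to_point (X : sset) : smap X spoint :=
  @SMap X spoint (fun n x => const_map n ord0) _.
Next Obligation. by move=> *; exact: simplex_map_ext. Qed.

Lemma spoint_eq n (x y : spoint n) : x = y.
Proof. by apply: simplex_map_ext => i; rewrite !ord1. Qed.

(** Homotopy extension is applied to the image of [c], to which [u] descends because it is constant
    on the fibres of [c]. Unions of subobjects are thus handled as covers by sums. *)
Lemma hep_cover (Z C X : sset) (c : smap C X) (b : bool) (w : smap X Z)
    (u : smap (sprod C interval) Z) :
  hep Z ->
  (forall n a a' t, c n a = c n a' -> u n (a, t) = u n (a', t)) ->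
  (forall n a, u n (a, endpoint b n) = w n (c n a)) ->
  exists h : smap (sprod X interval) Z,
    (forall n x, h n (x, endpoint b n) = w n x) /\
    (forall n a t, h n (c n a, t) = u n (a, t)).
Proof.
move=> hepZ u_c uw.
pose P n (x : X n) := exists a, x = c n a.
have Pact m n (f : simplex_map m n) x : P n x -> P m (sact X f x).
  by case=> a ->; exists (sact C f a); rewrite smap_nat.
pose A := ssub Pact.
pose F n (x : sprod A interval n) : Z n := u n (sval (cid (proj2_sig x.1)), x.2).
have FE n (x : sprod A interval n) a : sval x.1 = c n a -> F n x = u n (a, x.2).
  by rewrite /F; case: cid => a' /= -> ?; apply: u_c.
have FN m n (f : simplex_map m n) (x : sprod A interval n) :
    F m (sact (sprod A interval) f x) = sact Z f (F n x).
  have [a e] := proj2_sig x.1; rewrite (FE _ x _ e) (FE _ _ (sact C f a)) /=.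
    exact: (smap_nat u f (a, x.2)).
  by rewrite smap_nat e.
have jN m n (f : simplex_map m n) (x : A n) : sval (sact A f x) = sact X f (sval x) by [].
have [||h [hw hu]] := hepZ A X (@SMap A X (fun n x => sval x) jN) b w (SMap FN).
- by move=> n x y /sig_ext.
- move=> n x; have [a e] := proj2_sig x.
  by rewrite [LHS](FE _ (x, endpoint b n) a) //= uw e.
exists h; split=> // n a t.
have Pca : P n (c n a) by exists a.
by have /= -> := hu n (exist _ _ Pca) t; apply: FE.
Qed.

(** Coordinates are (x, s, t): [H] is the side t = 0, [L] and [R] are the sides s = 0 and s = 1, and
    [U] prescribes the square over [A]. The extension is a single homotopy of X x I in the direction
    [t], relative to the ends in [s] and to A x I. *)
Lemma hep_square (Z A X : sset) (j : smap A X)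
    (H L R : smap (sprod X interval) Z) (U : smap (sprod (sprod A interval) interval) Z) :
  hep Z -> injective_smap j ->
  (forall n x, L n (x, endpoint false n) = H n (x, endpoint false n)) ->
  (forall n x, R n (x, endpoint false n) = H n (x, endpoint true n)) ->
  (forall n a s, U n (a, s, endpoint false n) = H n (j n a, s)) ->
  (forall n a t, U n (a, endpoint false n, t) = L n (j n a, t)) ->
  (forall n a t, U n (a, endpoint true n, t) = R n (j n a, t)) ->
  exists G : smap (sprod (sprod X interval) interval) Z,
  [/\ forall n x s, G n (x, s, endpoint false n) = H n (x, s),
      forall n x t, G n (x, endpoint false n, t) = L n (x, t),
      forall n x t, G n (x, endpoint true n, t) = R n (x, t) &
      forall n a s t, G n (j n a, s, t) = U n (a, s, t)].
Proof.
move=> hepZ j_inj LH RH UH UL UR.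
pose c := copair (copair (at_end false X) (at_end true X)) (sprod_map j (smap_id interval)).
pose u := copair_prod (copair_prod L R) U.
have [|n a|G [GH Gu]] := @hep_cover Z _ _ c false H u hepZ.
- have e01 k := @endpoint_inj k; have e10 k := nesym (@endpoint_inj k).
  move=> n [[a|a]|[a s]] [[a'|a']|[a' s']] t e;
    have := congr1 (fun y : sprod X interval n => y.2) e;
    have := congr1 (fun y : sprod X interval n => y.1) e => {e} /=.
  + by move=> ->.
  + by move=> _ e; case: (e10 _ e).
  + by move=> -> <-; rewrite UL.
  + by move=> _ e; case: (e01 _ e).
  + by move=> ->.
  + by move=> -> <-; rewrite UR.
  + by move=> <- ->; rewrite UL.
  + by move=> <- ->; rewrite UR.
  + by move=> /j_inj -> ->.
- by case: a => [[a|a]|[a s]] /=.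
exists G; split=> // [n x t|n x t|n a s t].
- by have := Gu n (inl (inl x)) t.
- by have := Gu n (inl (inr x)) t.
- by have := Gu n (inr (a, s)) t.
Qed.

(** * Homotopy *)

Lemma homotopic_refl (X Z : sset) (f : smap X Z) : homotopic f f.
Proof. by exists (smap_comp f (sfst X interval)). Qed.

Lemma homotopicE (X Z : sset) (f g : smap X Z) :
  homotopic f g <-> exists H : smap (sprod X interval) Z,
    (forall n x, H n (x, endpoint false n) = f n x) /\
    (forall n x, H n (x, endpoint true n) = g n x).
Proof.
split=> -[H HP]; exists H; first by split=> n x; case: (HP n x).
by move=> n x; split; [exact: HP.1 | exact: HP.2].
Qed.

(** The fourth side of a square. Symmetry and transitivity follow by taking constant sides. *)
Lemma homotopic_square (X Z : sset) (f f' g g' : smap X Z) :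
  hep Z -> homotopic f f' -> homotopic f g -> homotopic g g' -> homotopic f' g'.
Proof.
move=> hepZ /homotopicE[L [L0 L1]] /homotopicE[H [H0 H1]] /homotopicE[R [R0 R1]].
have [||||||G [_ GL GR _]] := @hep_square Z sempty X (from_empty X) H L R
    (@smap_comp _ (sprod sempty interval) _ (from_empty_prod interval Z) (sfst _ _)) hepZ.
- by move=> n [].
- by move=> n x; rewrite L0 H0.
- by move=> n x; rewrite R0 H1.
- by move=> n [].
- by move=> n [].
- by move=> n [].
apply/homotopicE; exists (smap_comp G (at_end true _)).
by split=> n x /=; [rewrite GL L1 | rewrite GR R1].
Qed.

Lemma homotopic_sym (X Z : sset) (f g : smap X Z) :
  hep Z -> homotopic f g -> homotopic g f.
Proof.
move=> hepZ fg; apply: (homotopic_square hepZ fg); exact: homotopic_refl.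
Qed.

Lemma homotopic_trans (X Z : sset) (g f h : smap X Z) :
  hep Z -> homotopic f g -> homotopic g h -> homotopic f h.
Proof.
by move=> hepZ fg; apply: (homotopic_square hepZ _ fg); exact: homotopic_refl.
Qed.

Lemma homotopic_comp (W X Y Z : sset) (h : smap Y Z) (f g : smap X Y) (k : smap W X) :
  homotopic f g -> homotopic (smap_comp h (smap_comp f k)) (smap_comp h (smap_comp g k)).
Proof.
move=> /homotopicE[H [H0 H1]]; apply/homotopicE.
exists (smap_comp h (smap_comp H (sprod_map k (smap_id interval)))).
by split=> n x /=; rewrite ?H0 ?H1.
Qed.

(** * Weak equivalences *)

(** For a general target [homotopic] is neither symmetric nor transitive; after composition with
    maps to Kan complexes it is both, and this is all that [weak_equiv] detects. *)
Definition weakly_homotopic (X Y : sset) (f g : smap X Y) : Prop :=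
  forall Z (h : smap Y Z), kan Z -> homotopic (smap_comp h f) (smap_comp h g).

Lemma homotopic_weakly (X Y : sset) (f g : smap X Y) :
  homotopic f g -> weakly_homotopic f g.
Proof. by move=> fg Z h _; exact: (homotopic_comp h (smap_id X) fg). Qed.

Lemma weakly_homotopic_refl (X Y : sset) (f : smap X Y) : weakly_homotopic f f.
Proof. by move=> Z h _; exact: homotopic_refl. Qed.

Lemma weakly_homotopic_sym (X Y : sset) (f g : smap X Y) :
  weakly_homotopic f g -> weakly_homotopic g f.
Proof. by move=> fg Z h kanZ; apply: homotopic_sym (fg _ _ _) => //; exact: kan_hep. Qed.

Lemma weak_equiv_weakly_homotopic (X Y : sset) (f g : smap X Y) :
  weakly_homotopic f g -> weak_equiv f -> weak_equiv g.
Proof.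
move=> fg wf Z kanZ; have hepZ := kan_hep kanZ; have [surj_f inj_f] := wf Z kanZ.
split=> [h|h h' hh'].
  have [h' h'f] := surj_f h; exists h'.
  apply: homotopic_trans h'f => //; apply: homotopic_sym => //; exact: fg.
apply: inj_f; apply: (homotopic_trans hepZ (fg Z h kanZ)).
apply: (homotopic_trans hepZ hh'); apply: homotopic_sym => //; exact: fg.
Qed.

Lemma weak_equiv_inverse (X Y : sset) (f : smap X Y) (g : smap Y X) :
  weakly_homotopic (smap_comp g f) (smap_id X) ->
  weakly_homotopic (smap_comp f g) (smap_id Y) -> weak_equiv f.
Proof.
move=> gf fg Z kanZ; have hepZ := kan_hep kanZ; split=> [h|h h' hh'].
  by exists (smap_comp h g); exact: gf.
apply: (homotopic_trans hepZ (homotopic_sym hepZ (fg Z h kanZ))).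
apply: homotopic_trans (fg Z h' kanZ) => //.
exact: (homotopic_comp (smap_id Z) g hh').
Qed.

Lemma weak_equiv_id (X : sset) : weak_equiv (smap_id X).
Proof.
by apply: (@weak_equiv_inverse _ _ _ (smap_id X)); exact: weakly_homotopic_refl.
Qed.

Lemma weak_equiv_comp (X Y Z : sset) (g : smap Y Z) (f : smap X Y) :
  weak_equiv f -> weak_equiv g -> weak_equiv (smap_comp g f).
Proof.
move=> wf wg V kanV; have hepV := kan_hep kanV.
have [surj_f inj_f] := wf V kanV; have [surj_g inj_g] := wg V kanV.
split=> [h|h h' hh']; last exact/inj_g/inj_f.
have [h1 h1f] := surj_f h; have [h2 h2g] := surj_g h1; exists h2.
apply: homotopic_trans h1f => //; exact: (homotopic_comp (smap_id V) f h2g).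
Qed.

Lemma weak_equiv_cancel_right (X Y Z : sset) (g : smap Y Z) (f : smap X Y) :
  weak_equiv f -> weak_equiv (smap_comp g f) -> weak_equiv g.
Proof.
move=> wf wgf V kanV; have hepV := kan_hep kanV.
have [surj_f inj_f] := wf V kanV; have [surj_gf inj_gf] := wgf V kanV.
split=> [h|h h' hh']; last first.
  apply: inj_gf; exact: (homotopic_comp (smap_id V) f hh').
have [h1 h1gf] := surj_gf (smap_comp h f); exists h1; exact: inj_f.
Qed.

Lemma weak_equiv_cancel_left (X Y Z : sset) (g : smap Y Z) (f : smap X Y) :
  weak_equiv g -> weak_equiv (smap_comp g f) -> weak_equiv f.
Proof.
move=> wg wgf V kanV; have hepV := kan_hep kanV.
have [surj_g inj_g] := wg V kanV; have [surj_gf inj_gf] := wgf V kanV.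
split=> [h|h h' hh'].
  by have [h1 h1gf] := surj_gf h; exists (smap_comp h1 g).
have [k kg] := surj_g h; have [k' k'g] := surj_g h'.
have kgf := homotopic_comp (smap_id V) f kg.
have k'gf := homotopic_comp (smap_id V) f k'g.
have kk' : homotopic k k'.
  apply: inj_gf; apply: (homotopic_trans hepV kgf).
  by apply: (homotopic_trans hepV hh'); exact: homotopic_sym.
apply: (homotopic_trans hepV (homotopic_sym hepV kg)).
exact: homotopic_trans (homotopic_comp (smap_id V) g kk') k'g.
Qed.

Lemma weak_equiv_iso (X Y : sset) (f : smap X Y) (g : smap Y X) :
  (forall n x, g n (f n x) = x) -> (forall n y, f n (g n y) = y) -> weak_equiv f.
Proof.
move=> gf fg; apply: (@weak_equiv_inverse _ _ _ g).
  by rewrite (_ : smap_comp g f = smap_id X); [exact: weakly_homotopic_refl | exact: smap_ext].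
by rewrite (_ : smap_comp f g = smap_id Y); [exact: weakly_homotopic_refl | exact: smap_ext].
Qed.

(** * Function complexes *)

Program Definition sexp (K Z : sset) : sset :=
  @SSet (fun n => smap (sprod (std_simplex n) K) Z)
    (fun m n f phi => @SMap (sprod (std_simplex m) K) Z
       (fun l x => phi l (simplex_comp f x.1, x.2)) _) _ _.
Next Obligation.
by move=> K Z m n f phi k l g [x y] /=; rewrite -smap_nat /= simplex_compA.
Qed.
Next Obligation. by move=> K Z n phi; apply: smap_ext => l [x y] /=; rewrite simplex_comp1m. Qed.
Next Obligation.
by move=> K Z m n p g f phi; apply: smap_ext => l [x y] /=; rewrite simplex_compA.
Qed.

Program Definition curry (X K Z : sset) (h : smap (sprod X K) Z) : smap X (sexp K Z) :=
  @SMap X (sexp K Z) (fun n x => @SMap (sprod (std_simplex n) K) Z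
    (fun l y => h l (sact X y.1 x, y.2)) _) _.
Next Obligation. by move=> X K Z h n x k l f [g y] /=; rewrite -smap_nat /= sactM. Qed.
Next Obligation.
by move=> X K Z h m n f x; apply: smap_ext => l [g y] /=; rewrite sactM.
Qed.

Program Definition eval (K Z : sset) : smap (sprod (sexp K Z) K) Z :=
  @SMap (sprod (sexp K Z) K) Z (fun n x => x.1 n (simplex_id n, x.2)) _.
Next Obligation.
by move=> K Z m n f [phi y] /=; rewrite -smap_nat /= simplex_compm1 simplex_comp1m.
Qed.

Definition uncurry (X K Z : sset) (h : smap X (sexp K Z)) : smap (sprod X K) Z :=
  smap_comp (eval K Z) (sprod_map h (smap_id K)).

Lemma curry_eval (X K Z : sset) (h : smap (sprod X K) Z) n x y :
  eval K Z n (curry h n x, y) = h n (x, y).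
Proof. by rewrite /= sact1. Qed.

Lemma sexp_ext (K Z : sset) n (phi psi : sexp K Z n) :
  (forall l (g : simplex_map l n) y,
     eval K Z l (sact (sexp K Z) g phi, y) = eval K Z l (sact (sexp K Z) g psi, y)) ->
  phi = psi.
Proof.
by move=> e; apply: smap_ext => l [g y]; have := e l g y; rewrite /= simplex_compm1.
Qed.

(** The extension problem transposes to one along A x K -> X x K. Since [hep] is equivalent to
    [kan], function complexes are then Kan without any analysis of horns times [K]. *)
Lemma hep_sexp (K Z : sset) : hep Z -> hep (sexp K Z).
Proof.
move=> hepZ A X j b w u j_inj uw.
pose swap W := spair (spair (smap_comp (sfst _ _) (sfst _ _)) (ssnd _ _))
  (smap_comp (ssnd _ _) (sfst _ _)) : smap (sprod (sprod W K) interval) (sprod (sprod W interval) K).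
pose swap' W := spair (spair (smap_comp (sfst _ _) (sfst _ _)) (ssnd _ _))
  (smap_comp (ssnd _ _) (sfst _ _)) : smap (sprod (sprod W interval) K) (sprod (sprod W K) interval).
have [||h [hw hu]] := hepZ (sprod A K) (sprod X K) (sprod_map j (smap_id K)) b
   (uncurry w) (smap_comp (uncurry u) (swap A)).
- by move=> n [x k] [x' k'] [/j_inj -> ->].
- by move=> n [a k] /=; rewrite uw.
exists (curry (smap_comp h (swap' X))); split=> [n x|n a t]; apply: sexp_ext => l g y.
  by rewrite -!smap_nat curry_eval /= endpoint_comp hw.
rewrite -!smap_nat curry_eval /= -smap_nat.
by have /= := hu l (sact A g a, y) (simplex_comp t g).
Qed.

Lemma kan_sexp (K Z : sset) : kan Z -> kan (sexp K Z).
Proof. by move=> /kan_hep/hep_sexp/hep_kan. Qed.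

(** Homotopy classes of maps X x K -> Z are those of maps X -> Z^K, and Z^K is Kan. *)
Lemma weak_equiv_prod (X Y K : sset) (f : smap X Y) :
  weak_equiv f -> weak_equiv (sprod_map f (smap_id K)).
Proof.
move=> wf Z kanZ; have [surj_f inj_f] := wf _ (@kan_sexp K Z kanZ); split=> [h|h h' /homotopicE[H [H0 H1]]].
  have [h' /homotopicE[H [H0 H1]]] := surj_f (curry h); exists (uncurry h').
  apply/homotopicE; exists (smap_comp (uncurry H)
    (spair (spair (smap_comp (sfst _ _) (sfst _ _)) (ssnd _ _)) (smap_comp (ssnd _ _) (sfst _ _)))).
  by split=> n [x k]; rewrite /= ?H0 // H1 /= sact1.
have /homotopicE[G [G0 G1]] : homotopic (curry h) (curry h').
  apply: inj_f; apply/homotopicE; exists (curry (smap_comp H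
    (spair (spair (smap_comp (sfst _ _) (sfst _ _)) (ssnd _ _)) (smap_comp (ssnd _ _) (sfst _ _))))).
  split=> n x; apply: sexp_ext => l g k; rewrite -smap_nat curry_eval /= -!smap_nat /= ?endpoint_comp.
    by rewrite H0 /= ?sact1 simplex_compm1 smap_nat.
  by rewrite H1 /= ?sact1 simplex_compm1 smap_nat.
apply/homotopicE; exists (smap_comp (uncurry G)
    (spair (spair (smap_comp (sfst _ _) (sfst _ _)) (ssnd _ _)) (smap_comp (ssnd _ _) (sfst _ _)))).
by split=> n [x k]; rewrite /= ?G0 ?G1 /= sact1.
Qed.

(** * Injective weak equivalences *)

(** An extension exists up to homotopy because [j] is a weak equivalence; homotopy extension makes
    it strict. *)
Lemma acyclic_extension (A X Z : sset) (j : smap A X) (g : smap A Z) :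
  injective_smap j -> weak_equiv j -> kan Z ->
  exists h : smap X Z, forall n a, h n (j n a) = g n a.
Proof.
move=> j_inj wj kanZ; have [h' /homotopicE[H [H0 H1]]] := (wj Z kanZ).1 g.
have [|G [G0 GH]] := kan_hep kanZ (b := false) (w := h') (u := H) j_inj.
  by move=> n a; rewrite H0.
by exists (smap_comp G (at_end true X)) => n a; rewrite /= GH H1.
Qed.

Definition swap (X Y : sset) : smap (sprod X Y) (sprod Y X) := spair (ssnd X Y) (sfst X Y).

Definition sexp_map (A X Z : sset) (j : smap A X) : smap (sexp X Z) (sexp A Z) :=
  curry (smap_comp (eval X Z) (sprod_map (smap_id _) j)).

(* For a fibration p that is a homotopy equivalence with section s, a homotopy H
   from s p to the identity is made vertical by the square with sides s p H and H:
   here p is the restriction Z^X -> Z^A and s is given by P. *)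
Lemma acyclic_shrinkable (A X Z : sset) (j : smap A X) :
  injective_smap j -> weak_equiv j -> kan Z ->
  exists (P : smap (sprod X (sexp A Z)) Z)
         (V : smap (sprod (sprod X (sexp X Z)) interval) Z),
  [/\ forall n a phi, P n (j n a, phi) = eval A Z n (phi, a),
      forall n x phi, V n (x, phi, endpoint false n) = P n (x, sexp_map Z j n phi),
      forall n x phi, V n (x, phi, endpoint true n) = eval X Z n (phi, x) &
      forall n a phi t, V n (j n a, phi, t) = eval X Z n (phi, j n a)].
Proof.
move=> j_inj wj kanZ; have hepZ := kan_hep kanZ.
have [||P PE] := @acyclic_extension _ _ Z (sprod_map j (smap_id (sexp A Z)))
    (smap_comp (eval A Z) (swap A (sexp A Z))) _ _ kanZ.
- by move=> n [a x] [b y] [/j_inj -> ->].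
- exact: weak_equiv_prod.
have {}PE n a phi : P n (j n a, phi) = eval A Z n (phi, a) by exact: (PE n (a, phi)).
have sexp_mapE n phi a : eval A Z n (sexp_map Z j n phi, a) = eval X Z n (phi, j n a).
  by rewrite curry_eval.
pose k0 := smap_comp P (sprod_map (smap_id X) (sexp_map Z j)).
pose k1 := smap_comp (eval X Z) (swap X (sexp X Z)).
have k01 n a phi : k0 n (j n a, phi) = k1 n (j n a, phi).
  exact: etrans (PE _ _ _) (sexp_mapE _ _ _).
have /homotopicE[H [H0 H1]] : homotopic k0 k1.
  apply: (@weak_equiv_prod _ _ (sexp X Z) _ wj Z kanZ).2.
  rewrite [X in homotopic X](_ : _ = smap_comp k1 (sprod_map j (smap_id (sexp X Z)))).
    exact: homotopic_refl.
  by apply: smap_ext => n [a phi]; exact: k01.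
pose assoc (W V : sset) := spair (spair (ssnd _ _) (smap_comp (sfst _ _) (sfst _ _)))
  (smap_comp (ssnd _ _) (sfst _ _)) : smap (sprod (sprod W interval) V) (sprod (sprod V W) interval).
pose psi := curry (smap_comp H (smap_comp (sprod_map (sprod_map j (smap_id (sexp X Z))) (smap_id interval))
  (assoc (sexp X Z) A))).
have psiE n phi t a : eval A Z n (psi n (phi, t), a) = H n (j n a, phi, t).
  by rewrite curry_eval.
have psi_end b n phi : psi n (phi, endpoint b n) = sexp_map Z j n phi.
  apply: sexp_ext => l g a; rewrite -!smap_nat sexp_mapE.
  rewrite (_ : sact (sprod (sexp X Z) interval) g (phi, endpoint b n) = (sact (sexp X Z) g phi, endpoint b l)); last first.
    by congr pair; exact: endpoint_comp.
  by rewrite psiE; case: b; [exact: H1 | rewrite H0 k01].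
(* [L] is the side s p H. Over [A] it agrees with [H], so there the square is filled by [U],
   constant in the other direction; the side opposite to the constant one is [V]. *)
pose L := smap_comp P (spair (smap_comp (sfst _ _) (sfst _ _))
  (smap_comp psi (spair (smap_comp (ssnd _ _) (sfst _ _)) (ssnd _ _))))
  : smap (sprod (sprod X (sexp X Z)) interval) Z.
pose jj := sprod_map j (smap_id (sexp X Z)).
pose U := smap_comp H (smap_comp (sprod_map jj (smap_id interval))
  (spair (smap_comp (sfst _ _) (sfst _ _)) (ssnd _ _)))
  : smap (sprod (sprod (sprod A (sexp X Z)) interval) interval) Z.
have [||||||G [GH GL GR GU]] := @hep_square Z _ _ jj (smap_comp k0 (sfst _ _)) L H U hepZ.
- by move=> n [a x] [b y] [/j_inj -> ->].
- by move=> n [x phi]; congr (P n (_, _)); exact: psi_end.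
- by move=> n [x phi]; exact: H0.
- by move=> n [a phi] s; exact: H0.
- by move=> n [a phi] t; apply/esym; rewrite [LHS]PE psiE.
- by [].
exists P, (smap_comp G (at_end true _)); split=> //.
- by move=> n x phi /=; rewrite GL; congr (P n (_, _)); exact: psi_end.
- by move=> n x phi /=; rewrite GR H1.
- by move=> n a phi t; rewrite [LHS](GU n (a, phi)); exact: H1.
Qed.

(** The section [P] applied to the transpose of [a] extends [a] to X x M. On X x L it differs from
    [b] by the vertical homotopy [V], which is constant over [A]; homotopy extension along the union
    of A x M and X x L replaces it by an extension that restricts to [b]. *)
Lemma acyclic_pushout_product (A X L M Z : sset) (j : smap A X) (i : smap L M)
    (a : smap (sprod A M) Z) (b : smap (sprod X L) Z) :
  injective_smap j -> weak_equiv j -> injective_smap i -> kan Z ->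
  (forall n x l, a n (x, i n l) = b n (j n x, l)) ->
  exists h : smap (sprod X M) Z,
    (forall n x m, h n (j n x, m) = a n (x, m)) /\
    (forall n x l, h n (x, i n l) = b n (x, l)).
Proof.
move=> j_inj wj i_inj kanZ ab.
have [P [V [PE V0 V1 VA]]] := acyclic_shrinkable j_inj wj kanZ.
pose a' := curry (smap_comp a (swap M A)); pose b' := curry (smap_comp b (swap L X)).
have a'E n m x : eval A Z n (a' n m, x) = a n (x, m) by rewrite curry_eval.
have b'E n l x : eval X Z n (b' n l, x) = b n (x, l) by rewrite curry_eval.
have ab' n l : sexp_map Z j n (b' n l) = a' n (i n l).
  apply: sexp_ext => k g x; rewrite -!smap_nat a'E ab -b'E.
  exact: curry_eval.
pose c := copair (sprod_map j (smap_id M)) (sprod_map (smap_id X) i).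
pose w := smap_comp P (sprod_map (smap_id X) a').
pose u := copair_prod (smap_comp a (sfst _ _))
  (smap_comp V (sprod_map (sprod_map (smap_id X) b') (smap_id interval))).
have [||G [_ Gu]] := @hep_cover Z _ _ c false w u (kan_hep kanZ).
- move=> n [[x m]|[x l]] [[x' m']|[x' l']] t e;
    have := congr1 (fun y : sprod X M n => y.2) e;
    have := congr1 (fun y : sprod X M n => y.1) e => {e} /=.
  + by move=> /j_inj -> ->.
  + by move=> <- ->; rewrite VA b'E ab.
  + by move=> -> <-; rewrite VA b'E ab.
  + by move=> -> /i_inj ->.
- move=> n [[x m]|[x l]]; apply/esym; first by rewrite [LHS]PE a'E.
  by rewrite [RHS]V0 ab'.
exists (smap_comp G (at_end true _)); split=> n x.
  by move=> m; exact: (Gu n (inl (x, m)) (endpoint true n)).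
move=> l; rewrite [LHS](Gu n (inr (x, l)) (endpoint true n)) [LHS]V1; exact: b'E.
Qed.

(** * Mapping cylinders *)

Section Cylinder.
Variables (X Y : sset) (f : smap X Y).

(** The pushout of X x I and [Y] without a quotient: the cells of X x I off the end 1 are normal
    forms, and [cyl_norm] sends those at the end 1 to [Y]. *)
Definition cyl_cell n : Type := ({p : X n * interval n | p.2 <> endpoint true n} + Y n)%type.

Definition cyl_norm n (p : X n * interval n) : cyl_cell n :=
  match pselect (p.2 = endpoint true n) with
  | left _ => inr (f n p.1)
  | right ne => inl (exist _ p ne)
  end.

Lemma cyl_norm_end n (p : X n * interval n) : p.2 = endpoint true n -> cyl_norm p = inr (f n p.1).
Proof. by rewrite /cyl_norm; case: pselect. Qed.

Lemma cyl_norm_inl n (p : {p : X n * interval n | p.2 <> endpoint true n}) :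
  cyl_norm (sval p) = inl p.
Proof.
case: p => p ne; rewrite /cyl_norm; case: pselect => // ne'.
by congr inl; exact: sig_ext.
Qed.

Definition cyl_act m n (g : simplex_map m n) (c : cyl_cell n) : cyl_cell m :=
  match c with
  | inl p => cyl_norm (sact (sprod X interval) g (sval p))
  | inr y => inr (sact Y g y)
  end.

Lemma cyl_act_norm m n (g : simplex_map m n) (p : X n * interval n) :
  cyl_act g (cyl_norm p) = cyl_norm (sact (sprod X interval) g p).
Proof.
rewrite {1}/cyl_norm; case: pselect => //= e; rewrite cyl_norm_end /= ?smap_nat //.
by rewrite e endpoint_comp.
Qed.

Program Definition cyl : sset := @SSet cyl_cell cyl_act _ _.
Next Obligation. by move=> n [p|y]; rewrite /cyl_act ?sact1 // cyl_norm_inl. Qed.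
Next Obligation.
by move=> m n p g h [c|y]; rewrite [LHS]/cyl_act [in RHS]/(cyl_act g) ?cyl_act_norm sactM.
Qed.

Definition cyl_left : smap (sprod X interval) cyl :=
  @SMap (sprod X interval) cyl (@cyl_norm) (fun m n g p => esym (cyl_act_norm g p)).

Definition cyl_right : smap Y cyl := @SMap Y cyl (fun n y => inr y) (fun _ _ _ _ => erefl).

Lemma cyl_leftE n x : cyl_left n (x, endpoint true n) = cyl_right n (f n x).
Proof. by rewrite /= cyl_norm_end. Qed.

Lemma cyl_ind n (c : cyl n) : (exists p, c = cyl_left n p) \/ (exists y, c = cyl_right n y).
Proof.
case: c => [p|y]; [left|by right; exists y].
by exists (sval p); rewrite /= cyl_norm_inl.
Qed.

Section Out.
Variables (V W : sset) (K : smap (sprod (sprod X interval) V) W) (G : smap (sprod Y V) W).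
Hypothesis KG : forall n x v, K n (x, endpoint true n, v) = G n (f n x, v).

(** The factor [V] serves homotopies on the cylinder: a product with [V] preserves the pushout. *)
Definition cyl_out_fun n (c : sprod cyl V n) : W n :=
  match c.1 with inl p => K n (sval p, c.2) | inr y => G n (y, c.2) end.

Lemma cyl_out_norm n (p : X n * interval n) v : cyl_out_fun (cyl_norm p, v) = K n (p, v).
Proof.
by rewrite /cyl_norm; case: pselect => //= e; rewrite /cyl_out_fun /= -KG -e; case: p {e}.
Qed.

Program Definition cyl_out : smap (sprod cyl V) W := @SMap (sprod cyl V) W cyl_out_fun _.
Next Obligation.
move=> m n g [[p|y] v].
  by rewrite /= cyl_out_norm /cyl_out_fun /= -smap_nat.
by rewrite /cyl_out_fun /= -smap_nat.
Qed.

Lemma cyl_out_left n p v : cyl_out n (cyl_left n p, v) = K n (p, v).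
Proof. exact: cyl_out_norm. Qed.

End Out.

Definition cyl_in : smap X cyl := smap_comp cyl_left (at_end false X).

Lemma cyl_in_inj : injective_smap cyl_in.
Proof.
have ne := nesym (@endpoint_inj _).
move=> n x y; rewrite /= /cyl_norm; case: pselect => [/ne//|n0].
exact: (congr1 (fun c : cyl_cell n => if c is inl p then (sval p).1 else x)).
Qed.

Program Definition cyl_proj : smap cyl Y :=
  @SMap cyl Y (fun n c => match c with inl p => f n (sval p).1 | inr y => y end) _.
Next Obligation.
move=> m n g [p|y] //=; rewrite -smap_nat.
by rewrite /cyl_norm; case: pselect.
Qed.

Lemma cyl_proj_left n p : cyl_proj n (cyl_left n p) = f n p.1.
Proof. by rewrite /= /cyl_norm; case: pselect. Qed.

Program Definition interval_max : smap (sprod interval interval) interval :=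
  @SMap (sprod interval interval) interval
    (fun n p => @SimplexMap n 1 (fun i => if p.1 i == ord0 then p.2 i else p.1 i) _) _.
Next Obligation.
move=> n [s t] i k ik; have := smfun_mono s ik; have := smfun_mono t ik => /=.
rewrite -!val_eqE /=; have := ltn_ord (s k); have := ltn_ord (t i).
by case: (eqVneq (s i : nat) 0%N) => ?; case: (eqVneq (s k : nat) 0%N) => ? //=; lia.
Qed.
Next Obligation. by move=> *; exact: simplex_map_ext. Qed.

Lemma interval_max0 n t : interval_max n (t, endpoint false n) = t.
Proof. by apply: simplex_map_ext => i /=; case: eqP. Qed.

Lemma interval_max1 n t : interval_max n (t, endpoint true n) = endpoint true n.
Proof. by apply: simplex_map_ext => i /=; case: eqP => // /eqP/I2_neq0. Qed.

Lemma interval_max1l n t : interval_max n (endpoint true n, t) = endpoint true n.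
Proof. by apply: simplex_map_ext => i. Qed.

Let stretch : smap (sprod (sprod X interval) interval) cyl :=
  smap_comp cyl_left (spair (smap_comp (sfst _ _) (sfst _ _))
    (smap_comp interval_max (sprod_map (ssnd X interval) (smap_id interval)))).

Fact cyl_homotopy_compat n x v :
  stretch n (x, endpoint true n, v) = smap_comp cyl_right (sfst Y interval) n (f n x, v).
Proof.
by apply: etrans (cyl_leftE x); congr (cyl_left n (_, _)); exact: interval_max1l.
Qed.

Definition cyl_homotopy : smap (sprod cyl interval) cyl := cyl_out cyl_homotopy_compat.

Lemma cyl_homotopy_left n x s t :
  cyl_homotopy n (cyl_left n (x, s), t) = cyl_left n (x, interval_max n (s, t)).
Proof.
exact: cyl_out_left.
Qed.

Lemma cyl_homotopy_right n y t : cyl_homotopy n (cyl_right n y, t) = cyl_right n y.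
Proof. by []. Qed.

Lemma cyl_homotopy0 n c : cyl_homotopy n (c, endpoint false n) = c.
Proof.
case: (cyl_ind c) => [[[x s] ->]|[y ->]]; rewrite ?cyl_homotopy_right //.
by rewrite cyl_homotopy_left interval_max0.
Qed.

Lemma cyl_homotopy1 n c : cyl_homotopy n (c, endpoint true n) = cyl_right n (cyl_proj n c).
Proof.
case: (cyl_ind c) => [[[x s] ->]|[y ->]]; rewrite ?cyl_homotopy_right //.
by rewrite cyl_homotopy_left interval_max1 cyl_leftE cyl_proj_left.
Qed.

Lemma cyl_proj_homotopy n c t : cyl_proj n (cyl_homotopy n (c, t)) = cyl_proj n c.
Proof.
case: (cyl_ind c) => [[[x s] ->]|[y ->]] //.
by rewrite cyl_homotopy_left !cyl_proj_left.
Qed.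

Lemma weak_equiv_cyl_proj : weak_equiv cyl_proj.
Proof.
apply: (@weak_equiv_inverse _ _ _ cyl_right); last first.
  by rewrite (_ : smap_comp _ _ = smap_id Y); [exact: weakly_homotopic_refl | exact: smap_ext].
apply/weakly_homotopic_sym/homotopic_weakly/homotopicE; exists cyl_homotopy.
by split=> n c; [rewrite cyl_homotopy0 | rewrite cyl_homotopy1].
Qed.

Lemma weak_equiv_cyl_in : weak_equiv f -> weak_equiv cyl_in.
Proof.
move=> wf; apply: weak_equiv_cancel_left weak_equiv_cyl_proj _.
by rewrite (_ : smap_comp _ _ = f) //; apply: smap_ext => n x; exact: cyl_proj_left.
Qed.

End Cylinder.

(** * Homotopy colimits *)

Lemma existT_inj (A : Type) (P : A -> Type) a (x y : P a) :
  existT P a x = existT P a y -> x = y.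
Proof.
move=> e; have := projT2_eq e => /=.
by rewrite (Prop_irrelevance (projT1_eq e) erefl).
Qed.

Lemma chain_act1 (I : category) n (s : chain n I) : chain_act (simplex_id n) s = s.
Proof.
by case: s => a u p q; rewrite /chain_act; congr Chain; exact: Prop_irrelevance.
Qed.

Definition nerve (I : category) : sset :=
  @SSet (fun n => chain n I) (fun m n f s => chain_act f s)
    (fun n s => chain_act1 s) (fun _ _ _ _ _ _ => erefl).

Definition hocolim_base (I : category) (D : diagram I) : smap (hocolim D) (nerve I) :=
  @SMap (hocolim D) (nerve I) (fun n x => tag x) (fun _ _ _ _ => erefl).

Definition hocolim_cell (I : category) (D : diagram I) n (s : chain n I)
  (x : D (s ord0) n) : hocolim D n := existT (fun s : chain n I => D (s ord0) n) s x.

Program Definition hocolim_map (I : category) (D D' : diagram I) (f : diagram_map D D') :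
    smap (hocolim D) (hocolim D') :=
  @SMap (hocolim D) (hocolim D')
    (fun n x => hocolim_cell (f (tag x ord0) n (tagged x))) _.
Next Obligation.
by move=> I D D' f m n g [s x] /=; congr existT; rewrite dmap_nat smap_nat.
Qed.

Lemma hocolim_map_homotopic (I : category) (D D' : diagram I) (f g : diagram_map D D')
    (H : forall a, smap (sprod (D a) interval) (D' a)) :
  (forall a b (u : hom a b) n x t, H b n (dmor D u n x, t) = dmor D' u n (H a n (x, t))) ->
  (forall a n x, H a n (x, endpoint false n) = f a n x) ->
  (forall a n x, H a n (x, endpoint true n) = g a n x) ->
  homotopic (hocolim_map f) (hocolim_map g).
Proof.
move=> HN H0 H1; apply/homotopicE.
pose F n (x : sprod (hocolim D) interval n) : hocolim D' n :=
  hocolim_cell (H (tag x.1 ord0) n (tagged x.1, x.2)).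
have FN m n (h : simplex_map m n) x : F m (sact _ h x) = sact (hocolim D') h (F n x).
  by case: x => [[s x] t]; congr existT; rewrite /= HN -smap_nat.
by exists (SMap FN); split=> n [s x]; congr existT; rewrite /= ?H0 ?H1.
Qed.

Section Cells.
Variables (I : category) (D : diagram I) (m : nat) (s : chain m I).

(** The characteristic map Delta^m x D (s 0) -> hocolim D of the chain [s]. *)
Definition over_cell l (g : simplex_map l m) (x : D (s ord0) l) : hocolim D l :=
  hocolim_cell (D := D) (s := chain_act g s) (dmor D (chain_first g s) l x).

Lemma over_cell_act k l (f : simplex_map k l) (g : simplex_map l m) (x : D (s ord0) l) :
  sact (hocolim D) f (over_cell g x) = over_cell (simplex_comp g f) (sact _ f x).
Proof.
rewrite /over_cell /hocolim_cell /=; congr existT.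
by rewrite -!smap_nat -dmorM chain_firstM.
Qed.

Lemma surj_first l (g : simplex_map l m) : surj g -> g ord0 = ord0.
Proof.
move=> /forallP/(_ ord0)/existsP[i /eqP gi]; apply/val_inj/eqP.
by rewrite -leqn0 -[leqRHS]/(val (@ord0 m)) -gi; exact: smfun_mono.
Qed.

(** A surjection preserves 0, so the chain has morphisms in both directions between [s ord0] and
    [s (g ord0)]; they are mutually inverse and replace a transport along an equality of objects. *)
Lemma over_cell_surj l (g : simplex_map l m) : surj g ->
  (forall y : D (chain_act g s ord0) l, exists x, dmor D (chain_first g s) l x = y) /\
  (forall x x' : D (s ord0) l, dmor D (chain_first g s) l x = dmor D (chain_first g s) l x' -> x = x').
Proof.
move=> /surj_first g0; have le : (g ord0 <= @ord0 m)%N by rewrite g0.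
pose back : hom (chain_act g s ord0) (s ord0) := cmor s le.
have bK : comp back (chain_first g s) = idm _.
  have := @cmorM _ _ s ord0 (g ord0) ord0 (leq0n (g ord0)) le (leqnn _).
  by rewrite cmor1; exact.
have Kb : comp (chain_first g s) back = idm _ :> hom (chain_act g s ord0) _.
  have := @cmorM _ _ s (g ord0) ord0 (g ord0) le (leq0n (g ord0)) (leqnn _).
  by rewrite cmor1; exact.
split=> [y|x x' e].
  by exists (dmor D back l y); rewrite -dmorM Kb dmor1.
by rewrite -[x]dmor1 -[x']dmor1 -bK !dmorM e.
Qed.

Lemma over_cell_inj l (g : simplex_map l m) x x' :
  surj g -> over_cell g x = over_cell g x' -> x = x'.
Proof. by move=> /over_cell_surj[_ inj] e; apply: inj; exact: existT_inj e. Qed.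

Lemma over_cell_onto l (g : simplex_map l m) (x : hocolim D l) :
  surj g -> tag x = chain_act g s -> exists y, x = over_cell g y.
Proof.
move=> /over_cell_surj[onto _]; case: x => s' x /= e; case: _ / (esym e) x => x.
by have [y <-] := onto x; exists y.
Qed.

End Cells.

Section HocolimExtension.
Variables (I : category) (D D' : diagram I) (j : diagram_map D D').
Hypothesis j_inj : forall a, injective_smap (j a).
Hypothesis wj : forall a, weak_equiv (j a).

Lemma map_over_cell m (s : chain m I) l (g : simplex_map l m) x :
  hocolim_map j l (over_cell g x) = over_cell g (j (s ord0) l x).
Proof. by rewrite /over_cell /hocolim_cell /= /hocolim_cell; congr existT; rewrite dmap_nat. Qed.

(** Induction over the chains [s] in the nerve. Over a nondegenerate [s] the new part is D' (s 0) x
    Delta^m x M. Values are known on D (s 0) x Delta^m x M and, over the boundary of Delta^m or over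
    [L], on all of D' (s 0). This is a pushout product of the acyclic [j (s 0)] with the inclusion
    [i'] of that part of Delta^m x M. *)
Lemma hocolim_extension (L M Z : sset) (i : smap L M)
    (a : smap (sprod (hocolim D) M) Z) (b : smap (sprod (hocolim D') L) Z) :
  injective_smap i -> kan Z ->
  (forall n x l, a n (x, i n l) = b n (hocolim_map j n x, l)) ->
  exists h : smap (sprod (hocolim D') M) Z,
    (forall n x w, h n (hocolim_map j n x, w) = a n (x, w)) /\
    (forall n x l, h n (x, i n l) = b n (x, l)).
Proof.
move=> i_inj kanZ ab.
pose X := sprod (hocolim D') M; pose N := nerve I.
pose q : smap X N := smap_comp (hocolim_base D') (sfst _ _).
pose good n (x : X n) (z : Z n) :=
  (forall y, x.1 = hocolim_map j n y -> z = a n (y, x.2)) /\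
  (forall l, x.2 = i n l -> z = b n (x.1, l)).
have act0 m n (f : simplex_map m n) (s : N n) : False -> False by [].
pose F0 n (x : X n) (d : False) : Z n := match d with end.
have F0N m n (f : simplex_map m n) (x : X n) d d' : F0 m (sact X f x) d' = sact Z f (F0 n x d) by [].
have F0g n (x : X n) d : good n x (F0 n x d) by [].
have [P _ m s Ps bP|h [_ hg]] := @cell_extension N X Z q good
    (@PartialMap N X Z q good (fun _ _ => False) act0 F0 F0N F0g); last first.
  exists h; split=> [n x w|n x l].
    by have [/(_ x erefl)] := hg n (hocolim_map j n x, w).
  by have [_ /(_ l erefl)] := hg n (x, i n l).
pose pf := @pfun N X Z q good P.
have pfE l (x x' : X l) (d : pdom P (q l x)) (d' : pdom P (q l x')) :
    x = x' -> pf l x d = pf l x' d'.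
  by move=> e; case: _ / e d' => d'; exact: pfun_irr.
pose M' := sprod (std_simplex m) M.
pose Q l (x : M' l) := ~~ surj x.1 \/ exists w, x.2 = i l w.
have Qact k l (f : simplex_map k l) x : Q l x -> Q k (sact M' f x).
  case=> [ns|[w e]]; [left|right].
    apply: contra ns => /forallP sf; apply/forallP => v; have /existsP[u /eqP fu] := sf v.
    by apply/existsP; exists (f u); apply/eqP.
  by exists (sact L f w); rewrite /= e smap_nat.
pose L' := ssub Qact.
have i'N k l (f : simplex_map k l) (x : L' l) : sval (sact L' f x) = sact M' f (sval x) by [].
pose i' : smap L' M' := @SMap L' M' (fun l x => sval x) i'N.
have aN k l (f : simplex_map k l) (x : sprod (D (s ord0)) M' l) :
    a k (over_cell (sact (sprod (D (s ord0)) M') f x).2.1 (sact (sprod (D (s ord0)) M') f x).1,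
         (sact (sprod (D (s ord0)) M') f x).2.2) = sact Z f (a l (over_cell x.2.1 x.1, x.2.2)).
  by rewrite -smap_nat /= -over_cell_act.
pose a' : smap (sprod (D (s ord0)) M') Z :=
  @SMap (sprod (D (s ord0)) M') Z (fun l x => a l (over_cell x.2.1 x.1, x.2.2)) aN.
have bdom l (x : L' l) : ~ pdom P (chain_act (sval x).1 s) -> exists w, (sval x).2 = i l w.
  by move=> nP; case: (proj2_sig x) => // /bP.
(* Over the boundary the value comes from earlier cells, over [L] from [b]; goodness of [P] gives
   agreement on the overlap. *)
pose b0 l (x : sprod (D' (s ord0)) L' l) : Z l :=
  match pselect (pdom P (chain_act (sval x.2).1 s)) with
  | left d => pf l (over_cell (sval x.2).1 x.1, (sval x.2).2) d
  | right nd => b l (over_cell (sval x.2).1 x.1, sval (cid (bdom l x.2 nd)))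
  end.
have b0P l (x : sprod (D' (s ord0)) L' l) d :
    b0 l x = pf l (over_cell (sval x.2).1 x.1, (sval x.2).2) d.
  by rewrite /b0; case: pselect => // d'; exact: pfun_irr.
have b0b l (x : sprod (D' (s ord0)) L' l) w : (sval x.2).2 = i l w ->
    b0 l x = b l (over_cell (sval x.2).1 x.1, w).
  move=> e; rewrite /b0; case: pselect => d; last by case: cid => w' /=; rewrite e => /i_inj ->.
  by have [_ /(_ w e)] := @pfun_good N X Z q good P l (over_cell (sval x.2).1 x.1, (sval x.2).2) d.
have b0N k l (f : simplex_map k l) (x : sprod (D' (s ord0)) L' l) :
    b0 k (sact (sprod (D' (s ord0)) L') f x) = sact Z f (b0 l x).
  case: (proj2_sig x.2) => [ns|[w e]].
    have d := bP _ _ ns; rewrite (b0P _ _ d).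
    have d' : pdom P (chain_act (simplex_comp (sval x.2).1 f) s).
      exact: (pdom_act (p := P) f d).
    rewrite (b0P k (sact (sprod (D' (s ord0)) L') f x) d').
    rewrite -(@pfun_nat N X Z q good P k l f (over_cell (sval x.2).1 x.1, (sval x.2).2) d d');
      apply: pfE.
    by rewrite /= -over_cell_act.
  have e' : (sval (sact (sprod (D' (s ord0)) L') f x).2).2 = i k (sact L f w).
    by rewrite /= e smap_nat.
  by rewrite (b0b _ _ _ e) (b0b _ _ _ e') -smap_nat /= -over_cell_act.
have [||h [ha hb]] := acyclic_pushout_product (a := a') (b := SMap b0N) (@j_inj (s ord0))
    (wj (s ord0)) (i := i') _ kanZ.
- by move=> l x y /sig_ext.
- move=> l x w; case: (proj2_sig w) => [ns|[v e]]; apply/esym; last first.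
    by rewrite [LHS](b0b _ _ v) //= -map_over_cell -ab -e.
  have d := bP _ _ ns; rewrite [LHS](b0P _ (_, _) d) /=.
  have [gd _] := @pfun_good N X Z q good P l
    (over_cell (sval w).1 (j (s ord0) l x), (sval w).2) d.
  by apply: (gd (over_cell (sval w).1 x)); exact/esym/map_over_cell.
have onto l (g : simplex_map l m) (x : X l) :
    ~ pdom P (q l x) -> q l x = chain_act g s -> exists y, x.1 = over_cell (s := s) g y.
  move=> nd e; have sg : surj g by apply: contra_notT nd => /bP; rewrite e.
  exact: over_cell_onto sg e.
pose psi l (g : simplex_map l m) (x : X l) (e : q l x = chain_act g s) : Z l :=
  match pselect (pdom P (q l x)) with
  | left d => pf l x d
  | right nd => h l (sval (cid (onto l g x nd e)), (g, x.2))
  end.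
have psiP l g (x : X l) e d : psi l g x e = pf l x d.
  by rewrite /psi; case: pselect => // d'; exact: pfun_irr.
have psih l g (x : X l) e y : ~ pdom P (q l x) -> x.1 = over_cell g y -> psi l g x e = h l (y, (g, x.2)).
  move=> nd xy; rewrite /psi; case: pselect => // nd'; case: cid => y' /= xy'.
  have sg : surj g by apply: contra_notT nd => /bP; rewrite e.
  by rewrite (over_cell_inj sg (etrans (esym xy') xy)).
have hdom l (g : simplex_map l m) y w d : h l (y, (g, w)) = pf l (over_cell g y, w) d.
  have ns : ~~ surj g.
    apply/negP => /surj_section[c gc]; apply: Ps.
    rewrite -[s]chain_act1 -gc; exact: (pdom_act (p := P) c d).
  have Qw : Q l (g, w) by left.
  rewrite -[(g, w)]/(i' l (exist _ (g, w) Qw)) hb.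
  exact: (b0P l (y, exist _ (g, w) Qw) d).
exists psi; split.
- move=> k l f g x e e'; have [d|nd] := pselect (pdom P (q l x)).
    have d' : pdom P (q k (sact X f x)) by rewrite smap_nat; exact: pdom_act.
    by rewrite (psiP _ _ _ _ d) (psiP _ _ _ _ d'); exact: pfun_nat.
  have [y xy] := onto l g x nd e; rewrite (psih _ _ _ e y nd xy).
  have xy' : (sact X f x).1 = over_cell (simplex_comp g f) (sact _ f y).
    by rewrite -over_cell_act -xy.
  rewrite -smap_nat; have [d'|nd'] := pselect (pdom P (q k (sact X f x))).
    rewrite (psiP _ _ _ _ d').
    have d2 : pdom P (chain_act (simplex_comp g f) s) by have := d'; rewrite e'.
    rewrite [RHS](hdom _ _ _ _ d2); apply: pfE.
    by rewrite -xy'.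
  by rewrite (psih _ _ _ e' _ nd' xy').
- by move=> l g x e d; exact: psiP.
move=> l g x e nd; have [y xy] := onto l g x nd e.
rewrite (psih _ _ _ e y nd xy).
have sg : surj g by apply: contra_notT nd => /bP; rewrite e.
split=> [y0 xy0|w xw].
  have ty0 : tag y0 = chain_act g s by rewrite -[RHS]e /q /= xy0.
  have [z y0z] := over_cell_onto sg ty0.
  have -> : y = j (s ord0) l z.
    by apply: (over_cell_inj sg); rewrite -xy xy0 y0z map_over_cell.
  by rewrite ha /= y0z.
have Qw : Q l (g, x.2) by right; exists w.
rewrite -[(g, x.2)]/(i' l (exist _ (g, x.2) Qw)) hb.
by rewrite [LHS](b0b l (y, exist _ (g, x.2) Qw) w xw) /= -xy.
Qed.

(** The inclusion of the empty set in a point gives extensions of maps, the inclusion of the two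
    ends in the interval gives extensions of homotopies. *)
Lemma weak_equiv_hocolim_mono : weak_equiv (hocolim_map j).
Proof.
move=> Z kanZ; split=> [h|h h' /homotopicE[H [H0 H1]]].
  have [||h' [h'j _]] := @hocolim_extension sempty spoint Z (from_empty spoint)
    (smap_comp h (sfst _ _)) (smap_comp (from_empty_prod (hocolim D') Z) (swap _ _)) _ kanZ.
  - by move=> n [].
  - by move=> n x [].
  exists (smap_comp h' (spair (smap_id _) (to_point _))).
  rewrite [X in homotopic X](_ : _ = h); first exact: homotopic_refl.
  by apply: smap_ext => n x /=; rewrite h'j.
have [||G [_ Gb]] := @hocolim_extension (ssum spoint spoint) interval Z
  (copair (smap_comp (ssnd spoint interval) (at_end false spoint))
          (smap_comp (ssnd spoint interval) (at_end true spoint)))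
  H (smap_comp (copair_prod (smap_comp h (ssnd spoint _)) (smap_comp h' (ssnd spoint _)))
       (swap _ _)) _ kanZ.
- have e01 k := @endpoint_inj k; have e10 k := nesym (@endpoint_inj k).
  move=> n [x|x] [y|y] /=; rewrite ?(spoint_eq x y) //; [by move/e10 | by move/e01].
- by move=> n x [l|l] /=; [exact: H0 | exact: H1].
apply/homotopicE; exists G; split=> n x.
  by have := Gb n x (inl (const_map n ord0)).
by have := Gb n x (inr (const_map n ord0)).
Qed.

End HocolimExtension.

Section HocolimInvariance.
Variables (I : category) (D D' : diagram I) (f : diagram_map D D').

Definition cyl_map_fun a b (u : hom a b) n (c : cyl (f a) n) : cyl (f b) n :=
  match c with
  | inl p => cyl_left (f b) n (dmor D u n (sval p).1, (sval p).2)
  | inr y => cyl_right (f b) n (dmor D' u n y)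
  end.

Lemma cyl_map_left a b (u : hom a b) n x t :
  cyl_map_fun u (cyl_left (f a) n (x, t)) = cyl_left (f b) n (dmor D u n x, t).
Proof.
rewrite /= {1}/cyl_norm; case: pselect => //= e.
by rewrite cyl_norm_end //= dmap_nat.
Qed.

Lemma cyl_map_nat a b (u : hom a b) m n (g : simplex_map m n) (c : cyl (f a) n) :
  cyl_map_fun u (sact (cyl (f a)) g c) = sact (cyl (f b)) g (cyl_map_fun u c).
Proof.
case: (cyl_ind c) => [[[x t] ->]|[y ->]].
  rewrite -smap_nat [LHS](cyl_map_left u (sact _ g x) (sact interval g t)).
  by rewrite cyl_map_left -smap_nat; congr (cyl_left _ _ (_, _)); exact: smap_nat.
by rewrite /= smap_nat.
Qed.

Definition cyl_map a b (u : hom a b) : smap (cyl (f a)) (cyl (f b)) :=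
  @SMap (cyl (f a)) (cyl (f b)) (@cyl_map_fun a b u) (@cyl_map_nat a b u).

Lemma cyl_map1 a n (c : cyl (f a) n) : cyl_map (idm a) n c = c.
Proof.
case: (cyl_ind c) => [[[x t] ->]|[y ->]]; last by rewrite /= dmor1.
by rewrite [LHS]cyl_map_left dmor1.
Qed.

Lemma cyl_mapM a b c (g : hom b c) (h : hom a b) n (k : cyl (f a) n) :
  cyl_map (comp g h) n k = cyl_map g n (cyl_map h n k).
Proof.
case: (cyl_ind k) => [[[x t] ->]|[y ->]]; last by rewrite /= dmorM.
by rewrite [LHS]cyl_map_left [cyl_map h _ _]cyl_map_left [RHS]cyl_map_left dmorM.
Qed.

Definition cyl_diagram : diagram I :=
  @Diagram I (fun a => cyl (f a)) (fun a b u => cyl_map u) cyl_map1 cyl_mapM.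

Lemma cyl_in_nat a b (u : hom a b) n (x : D a n) :
  cyl_in (f b) n (dmor D u n x) = cyl_map u n (cyl_in (f a) n x).
Proof. exact/esym/cyl_map_left. Qed.

Definition cyl_diagram_in : diagram_map D cyl_diagram :=
  @DiagramMap I D cyl_diagram (fun a => cyl_in (f a)) cyl_in_nat.

Lemma cyl_proj_nat a b (u : hom a b) n (c : cyl (f a) n) :
  cyl_proj (f b) n (cyl_map u n c) = dmor D' u n (cyl_proj (f a) n c).
Proof.
case: (cyl_ind c) => [[[x t] ->]|[y ->]] //.
by rewrite [cyl_map u _ _]cyl_map_left !cyl_proj_left dmap_nat.
Qed.

Definition cyl_diagram_proj : diagram_map cyl_diagram D' :=
  @DiagramMap I cyl_diagram D' (fun a => cyl_proj (f a)) cyl_proj_nat.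

Definition cyl_diagram_right : diagram_map D' cyl_diagram :=
  @DiagramMap I D' cyl_diagram (fun a => cyl_right (f a)) (fun _ _ _ _ _ => erefl).

Definition diagram_id (E : diagram I) : diagram_map E E :=
  @DiagramMap I E E (fun a => smap_id _) (fun _ _ _ _ _ => erefl).

Program Definition diagram_comp (E E' E'' : diagram I) (h : diagram_map E' E'')
    (g : diagram_map E E') : diagram_map E E'' :=
  @DiagramMap I E E'' (fun a => smap_comp (h a) (g a)) _.
Next Obligation. by move=> *; rewrite !dmap_nat. Qed.

(** The deformation of a cylinder onto its right end is strictly natural, so it induces a homotopy
    of homotopy colimits. *)
Lemma weak_equiv_hocolim_cyl : weak_equiv (hocolim_map cyl_diagram_proj).
Proof.
apply: (@weak_equiv_inverse _ _ _ (hocolim_map cyl_diagram_right)); last first.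
  rewrite (_ : smap_comp _ _ = smap_id _); first exact: weakly_homotopic_refl.
  by apply: smap_ext => n [s x].
apply/weakly_homotopic_sym/homotopic_weakly.
have := @hocolim_map_homotopic I _ _ (diagram_id cyl_diagram)
  (diagram_comp cyl_diagram_right cyl_diagram_proj) (fun a => cyl_homotopy (f a)).
rewrite (_ : hocolim_map (diagram_id _) = smap_id _); last by apply: smap_ext => n [s x].
rewrite (_ : hocolim_map (diagram_comp _ _) = smap_comp (hocolim_map cyl_diagram_right) (hocolim_map cyl_diagram_proj)); last exact: smap_ext.
apply=> [a b u n c t|a n c|a n c].
- case: (cyl_ind c) => [[[x r] ->]|[y ->]] //.
  by rewrite [dmor _ _ _ _]cyl_map_left !cyl_homotopy_left [RHS]cyl_map_left.
- exact: cyl_homotopy0.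
- exact: cyl_homotopy1.
Qed.

(** Objectwise factorization through mapping cylinders reduces the claim to an injective map. *)
Lemma weak_equiv_hocolim : (forall a, weak_equiv (f a)) -> weak_equiv (hocolim_map f).
Proof.
move=> wf; rewrite (_ : hocolim_map f =
    smap_comp (hocolim_map cyl_diagram_proj) (hocolim_map cyl_diagram_in)).
  apply: weak_equiv_comp weak_equiv_hocolim_cyl; apply: weak_equiv_hocolim_mono => a.
    exact: cyl_in_inj.
  by apply: weak_equiv_cyl_in.
apply: smap_ext => n [s x] /=; rewrite /hocolim_cell; congr existT.
by apply/esym; exact: (cyl_proj_left (f (s ord0)) (x, endpoint false n)).
Qed.

End HocolimInvariance.

(** * Pullbacks along maps with the homotopy lifting property *)

Definition hlp (Q B : sset) (q : smap Q B) : Prop :=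
  forall (X : sset) (b : bool) (w : smap X Q) (v : smap (sprod X interval) B),
  (forall n x, v n (x, endpoint b n) = q n (w n x)) ->
  exists h : smap (sprod X interval) Q,
    (forall n y, q n (h n y) = v n y) /\ (forall n x, h n (x, endpoint b n) = w n x).

Lemma spull_act (X Q B : sset) (x : smap X B) (q : smap Q B) m n (f : simplex_map m n)
    (p : sprod X Q n) :
  x n p.1 = q n p.2 -> x m (sact (sprod X Q) f p).1 = q m (sact (sprod X Q) f p).2.
Proof. by move=> e; rewrite /= !smap_nat e. Qed.

Definition spull (X Q B : sset) (x : smap X B) (q : smap Q B) : sset :=
  @ssub (sprod X Q) (fun n p => x n p.1 = q n p.2) (fun m n f p => @spull_act X Q B x q m n f p).

Definition spull_cell (X Q B : sset) (x : smap X B) (q : smap Q B) n a y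
  (e : x n a = q n y) : spull x q n := exist _ (a, y) e.

Lemma spull_ext (X Q B : sset) (x : smap X B) (q : smap Q B) n (p p' : spull x q n) :
  (sval p).1 = (sval p').1 -> (sval p).2 = (sval p').2 -> p = p'.
Proof. by move=> e1 e2; apply: sig_ext; case: p p' e1 e2 => [[a y] /= _] [[a' y'] /= _] -> ->. Qed.

Program Definition into_spull (W X Q B : sset) (x : smap X B) (q : smap Q B)
    (f : smap W X) (g : smap W Q) (e : forall n w, x n (f n w) = q n (g n w)) :
    smap W (spull x q) :=
  @SMap W (spull x q) (fun n w => spull_cell (e n w)) _.
Next Obligation. by move=> *; apply: spull_ext; rewrite /= smap_nat. Qed.

Definition spull_fst (X Q B : sset) (x : smap X B) (q : smap Q B) : smap (spull x q) X :=
  @SMap (spull x q) X (fun n p => (sval p).1) (fun _ _ _ _ => erefl).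

Definition spull_snd (X Q B : sset) (x : smap X B) (q : smap Q B) : smap (spull x q) Q :=
  @SMap (spull x q) Q (fun n p => (sval p).2) (fun _ _ _ _ => erefl).

Lemma spullP (X Q B : sset) (x : smap X B) (q : smap Q B) n (p : spull x q n) :
  x n (spull_fst x q n p) = q n (spull_snd x q n p).
Proof. exact: (proj2_sig p). Qed.

Section SpullMap.
Variables (X Y Q B : sset) (f : smap X Y) (x : smap X B) (y : smap Y B) (q : smap Q B).
Hypothesis fxy : forall n a, y n (f n a) = x n a.

Fact spull_map_proof n (p : spull x q n) :
  y n (smap_comp f (spull_fst x q) n p) = q n (spull_snd x q n p).
Proof. by rewrite /= fxy; exact: spullP. Qed.

Definition spull_map : smap (spull x q) (spull y q) :=
  into_spull (f := smap_comp f (spull_fst x q)) (g := spull_snd x q) spull_map_proof.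
End SpullMap.

(** * Dependent products along q *)

Section DependentProduct.
Variables (Q B Z : sset) (q : smap Q B).

(* An n-simplex consists of b : Delta^n -> B and a map Delta^n x_B Q -> Z, encoded
   as a partial function. *)
Record pi_cell (n : nat) := PiCell {
  pi_base : B n;
  pi_fun : forall l, simplex_map l n -> Q l -> option (Z l);
  pi_dom : forall l g y, @pi_fun l g y <> None <-> sact B g pi_base = q l y;
  pi_nat : forall k l (f : simplex_map k l) g y z,
    @pi_fun l g y = Some z -> @pi_fun k (simplex_comp g f) (sact Q f y) = Some (sact Z f z) }.

Lemma pi_cell_ext n (c c' : pi_cell n) :
  pi_base c = pi_base c' ->
  (forall l g y z, @pi_fun _ c l g y = Some z -> @pi_fun _ c' l g y = Some z) -> c = c'.
Proof.
move=> eb ef.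
have e : @pi_fun n c = @pi_fun n c'.
  apply: functional_extensionality_dep => l; apply: funext => g; apply: funext => y.
  case e : (@pi_fun _ c l g y) => [z|]; first by rewrite (ef _ _ _ _ e).
  apply/esym; apply: contrapT => /pi_dom; rewrite -eb => /(pi_dom c).
  by rewrite e.
case: c c' eb e {ef} => [b F d N] [b' F' d' N'] /= eb e.
case: _ / eb d' => d'; case: _ / e d' N' => d' N'.
by congr PiCell; exact: Prop_irrelevance.
Qed.

Program Definition pi_act m n (f : simplex_map m n) (c : pi_cell n) : pi_cell m :=
  @PiCell m (sact B f (pi_base c)) (fun l g y => @pi_fun _ c l (simplex_comp f g) y) _ _.
Next Obligation. by move=> m n f c l g y; rewrite pi_dom sactM. Qed.
Next Obligation. by move=> m n f c k l h g y z e; rewrite simplex_compA; exact: pi_nat. Qed.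

Program Definition dep_prod : sset := @SSet pi_cell pi_act _ _.
Next Obligation.
move=> n c; apply: pi_cell_ext => [|l g y z]; first exact: sact1.
by rewrite /= simplex_comp1m.
Qed.
Next Obligation.
move=> m n p g f c; apply: pi_cell_ext => [|l h y z]; first exact: sactM.
by rewrite /= simplex_compA.
Qed.

Definition dep_base : smap dep_prod B :=
  @SMap dep_prod B (fun n c => pi_base c) (fun _ _ _ _ => erefl).

Section Adjunction.
Variables (X : sset) (x : smap X B).

Program Definition to_pi_cell (phi : smap (spull x q) Z) n (a : X n) : pi_cell n :=
  @PiCell n (x n a) (fun l g y => match pselect (x l (sact X g a) = q l y) with
     | left e => Some (phi l (spull_cell e)) | right _ => None end) _ _.
Next Obligation.
by move=> phi n a l g y; case: pselect => [e|e]; rewrite -smap_nat.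
Qed.
Next Obligation.
move=> phi n a k l f g y z; case: pselect => // e [<-]; case: pselect => [e'|[]].
  by rewrite -smap_nat; congr (Some (phi k _)); apply: spull_ext => //=; rewrite sactM.
by rewrite sactM [LHS]smap_nat e [RHS]smap_nat.
Qed.

Program Definition to_pi (phi : smap (spull x q) Z) : smap X dep_prod :=
  @SMap X dep_prod (to_pi_cell phi) _.
Next Obligation.
move=> phi m n f a; apply: pi_cell_ext => [|l g y z] /=; first exact: smap_nat.
case: pselect => // e [<-]; case: pselect => [e'|[]].
  by congr (Some (phi l _)); apply: spull_ext => //=; rewrite sactM.
by rewrite sactM.
Qed.

Lemma to_piP (phi : smap (spull x q) Z) n (a : X n) l g y (e : x l (sact X g a) = q l y) :
  @pi_fun _ (to_pi phi n a) l g y = Some (phi l (spull_cell e)).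
Proof.
rewrite /=; case: pselect => // e'.
by congr (Some (phi l _)); exact: spull_ext.
Qed.

Variable u : smap X dep_prod.
Hypothesis ux : forall n a, pi_base (u n a) = x n a.

Lemma from_pi_ex n (p : spull x q n) :
  exists z, @pi_fun _ (u n (sval p).1) n (simplex_id n) (sval p).2 = Some z.
Proof.
case e : (@pi_fun _ _ _ _ _) => [z|]; first by exists z.
have /pi_dom : sact B (simplex_id n) (pi_base (u n (sval p).1)) = q n (sval p).2.
  by rewrite sact1 ux; exact: (proj2_sig p).
by rewrite e.
Qed.

Definition from_pi_fun n (p : spull x q n) : Z n := sval (cid (from_pi_ex p)).

Lemma from_piE n (p : spull x q n) z :
  @pi_fun _ (u n (sval p).1) n (simplex_id n) (sval p).2 = Some z -> from_pi_fun p = z.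
Proof. by rewrite /from_pi_fun; case: cid => z' /= -> []. Qed.

Program Definition from_pi : smap (spull x q) Z := @SMap (spull x q) Z from_pi_fun _.
Next Obligation.
move=> m n f p; apply: from_piE; rewrite /= smap_nat /=.
rewrite simplex_compm1 -[X in pi_fun _ X _](simplex_comp1m f); apply: pi_nat.
by rewrite /from_pi_fun; case: cid.
Qed.

End Adjunction.

Lemma to_pi_eq (X : sset) (x : smap X B) (phi : smap (spull x q) Z) n (a : X n) (c : dep_prod n) :
  pi_base c = x n a ->
  (forall l g y (e : x l (sact X g a) = q l y), @pi_fun _ c l g y = Some (phi l (spull_cell e))) ->
  to_pi phi n a = c.
Proof.
move=> ec cP; apply: pi_cell_ext => [|l g y z]; first by rewrite ec.
by rewrite [pi_fun _ _ _]/=; case: pselect => // e [<-]; exact: cP.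
Qed.

Hypothesis hlp_q : hlp q.

(** Maximum for [b] true and minimum for [b] false: a contraction of the interval to its end [b],
    which is the identity at the other end of the time parameter. *)
Program Definition interval_contract (b : bool) : smap (sprod interval interval) interval :=
  @SMap (sprod interval interval) interval (fun n p => @SimplexMap n 1
    (fun i => if (p.1 i == ord0) == b then p.2 i else p.1 i) _) _.
Next Obligation.
move=> b n [s t] i k ik; have := smfun_mono s ik; have := smfun_mono t ik => /=.
rewrite -!val_eqE /=; have := ltn_ord (s k); have := ltn_ord (t k).
have := ltn_ord (s i); have := ltn_ord (t i).
by case: b; case: (eqVneq (s i : nat) 0%N) => ?; case: (eqVneq (s k : nat) 0%N) => ? /=; lia.
Qed.
Next Obligation. by move=> *; exact: simplex_map_ext. Qed.

Lemma interval_contract_id b n t : interval_contract b n (t, endpoint (~~ b) n) = t.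
Proof.
apply: simplex_map_ext => i /=; case: b => /=; case: (eqVneq (t i) ord0) => //= ti.
by apply/esym/I2_neq0.
Qed.

Lemma interval_contract_end b n t : interval_contract b n (t, endpoint b n) = endpoint b n.
Proof.
apply: simplex_map_ext => i /=; case: b => /=; case: (eqVneq (t i) ord0) => //= ti.
exact: I2_neq0.
Qed.

Lemma interval_contract_fix b n t : interval_contract b n (endpoint b n, t) = endpoint b n.
Proof. by apply: simplex_map_ext => i /=; case: b. Qed.

(** By adjunction a map to [Z] has to be extended to the pullback [E] of [Q] along [v] from its part
    over the end [b] and over [A]. The contraction of the interval to the end [b], lifted along [q],
    deforms [E] into that part while preserving it. So the given map is defined on the deformed [E],
    and homotopy extension run backwards gives values on [E] itself. *)
Lemma dep_prod_lift (A X : sset) (j : smap A X) (b : bool) (w : smap X dep_prod)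
    (u : smap (sprod A interval) dep_prod) (v : smap (sprod X interval) B) :
  hep Z -> injective_smap j ->
  (forall n x, pi_base (w n x) = v n (x, endpoint b n)) ->
  (forall n a t, pi_base (u n (a, t)) = v n (j n a, t)) ->
  (forall n a, u n (a, endpoint b n) = w n (j n a)) ->
  exists h : smap (sprod X interval) dep_prod,
  [/\ forall n y, pi_base (h n y) = v n y,
      forall n x, h n (x, endpoint b n) = w n x &
      forall n a t, h n (j n a, t) = u n (a, t)].
Proof.
move=> hepZ j_inj wv uv uw.
pose E := spull v q.
pose P n (p : E n) := (sval p).1.2 = endpoint b n \/ exists a, (sval p).1.1 = j n a.
have Pact m n (f : simplex_map m n) p : P n p -> P m (sact E f p).
  case=> [e|[a e]]; [left; rewrite /= e|right; exists (sact A f a)].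
    exact: simplex_map_ext.
  by rewrite /= e smap_nat.
pose Bx := ssub Pact.
pose c := copair (at_end b X) (sprod_map j (smap_id interval)).
pose phi_spec n (p : Bx n) (z : Z n) :=
  (forall a, (sval (sval p)).1.1 = j n a ->
     @pi_fun _ (u n (a, (sval (sval p)).1.2)) n (simplex_id n) (sval (sval p)).2 = Some z) /\
  ((sval (sval p)).1.2 = endpoint b n ->
     @pi_fun _ (w n (sval (sval p)).1.1) n (simplex_id n) (sval (sval p)).2 = Some z).
have phi_ex n (p : Bx n) : exists z, phi_spec n p z.
  case: p => [[[[x t] y] /= e] [/= te|[a /= xa]]].
    have [z zP] : exists z, @pi_fun _ (w n x) n (simplex_id n) y = Some z.
      case ez : (@pi_fun _ _ _ _ _) => [z|]; first by exists z.
      have /pi_dom : sact B (simplex_id n) (pi_base (w n x)) = q n y.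
        by rewrite sact1 wv -te.
      by rewrite ez.
    by exists z; split=> //= a xa; rewrite te uw -xa.
  have [z zP] : exists z, @pi_fun _ (u n (a, t)) n (simplex_id n) y = Some z.
    case ez : (@pi_fun _ _ _ _ _) => [z|]; first by exists z.
    have /pi_dom : sact B (simplex_id n) (pi_base (u n (a, t))) = q n y.
      by rewrite sact1 uv -xa.
    by rewrite ez.
  exists z; split=> /= [a'|te]; first by rewrite xa => /j_inj <-.
  by rewrite xa -uw -te.
pose phi n p := sval (cid (phi_ex n p)).
have phiP n p : phi_spec n p (phi n p) by exact: (proj2_sig (cid (phi_ex n p))).
have phi_uniq n p z z' : phi_spec n p z -> phi_spec n p z' -> z = z'.
  by case: (proj2_sig p) => [te|[a xa]] [h1 h2] [h1' h2'];
     [have := h2 te; rewrite h2' // => -[] | have := h1 a xa; rewrite (h1' a xa) => -[]].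
have phi_act m n (f : simplex_map m n) p : phi_spec m (sact Bx f p) (sact Z f (phi n p)).
  have [h1 h2] := phiP n p; case: (proj2_sig p) => [te|[a xa]].
    have e : @pi_fun _ (w m (sact X f (sval (sval p)).1.1)) m (simplex_id m)
        (sact Q f (sval (sval p)).2) = Some (sact Z f (phi n p)).
      rewrite smap_nat /= simplex_compm1 -[X in pi_fun _ X _](simplex_comp1m f).
      by apply: pi_nat; exact: h2.
    split=> //= a xa; rewrite te (_ : simplex_comp _ _ = endpoint b m); last exact: simplex_map_ext.
    by rewrite uw -xa.
  have e : @pi_fun _ (u m (sact A f a, simplex_comp (sval (sval p)).1.2 f)) m (simplex_id m)
      (sact Q f (sval (sval p)).2) = Some (sact Z f (phi n p)).
    rewrite -[(sact A f a, _)]/(sact (sprod A interval) f (a, (sval (sval p)).1.2)).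
    rewrite smap_nat /= simplex_compm1 -[X in pi_fun _ X _](simplex_comp1m f).
    by apply: pi_nat; exact: h1.
  split=> /= [a'|te].
    by rewrite xa -smap_nat => /j_inj <-.
  by move: e; rewrite te uw xa smap_nat.
have phiN m n (f : simplex_map m n) p : phi m (sact Bx f p) = sact Z f (phi n p).
  by apply: phi_uniq (phiP _ _) _; exact: phi_act.
pose Phi : smap Bx Z := SMap phiN.
(* Contract E towards the end b of the interval by lifting along q. *)
pose contr : smap (sprod E interval) (sprod X interval) :=
  spair (smap_comp (sfst _ _) (smap_comp (spull_fst v q) (sfst _ _)))
    (smap_comp (interval_contract b)
       (sprod_map (smap_comp (ssnd _ _) (spull_fst v q)) (smap_id interval))).
have [|G [Gv Gid]] := @hlp_q E (~~ b) (spull_snd v q) (smap_comp v contr).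
  move=> n p; rewrite -spullP /=; congr (v n _).
  by case: p => [[[x t] y] e] /=; congr pair; exact: interval_contract_id.
have GvE n p : v n (contr n p) = q n (G n p) by rewrite Gv.
pose Gamma : smap (sprod E interval) E := into_spull GvE.
have Gamma_id n p : Gamma n (p, endpoint (~~ b) n) = p.
  apply: spull_ext; last exact: Gid.
  by case: p => [[[x t] y] e] /=; congr pair; exact: interval_contract_id.
have Gamma_end n p : P n (Gamma n (p, endpoint b n)).
  by left; exact: interval_contract_end.
have Gamma_box n p t : P n p -> P n (Gamma n (p, t)).
  by case=> [e|[a e]]; [left; rewrite /= e; exact: interval_contract_fix | right; exists a].
have wN m n (f : simplex_map m n) p :
    phi m (exist _ _ (Gamma_end m (sact E f p))) = sact Z f (phi n (exist _ _ (Gamma_end n p))).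
  rewrite -phiN; congr (phi m _); apply: sig_ext.
  apply: etrans (smap_nat Gamma f (p, endpoint b n)).
  by congr (Gamma m (_, _)); exact: simplex_map_ext.
have uN m n (f : simplex_map m n) (p : sprod Bx interval n) :
    phi m (exist _ _ (Gamma_box m _ (sact (sprod Bx interval) f p).2 (proj2_sig (sact (sprod Bx interval) f p).1))) =
    sact Z f (phi n (exist _ _ (Gamma_box n _ p.2 (proj2_sig p.1)))).
  rewrite -phiN; congr (phi m _); apply: sig_ext.
  exact: (smap_nat Gamma f (sval p.1, p.2)).
have jN m n (f : simplex_map m n) (p : Bx n) : sval (sact Bx f p) = sact E f (sval p) by [].
have [||K [_ KP]] := hepZ Bx E (@SMap Bx E (fun n p => sval p) jN) b (SMap wN) (SMap uN).
- by move=> n p p' /sig_ext.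
- by move=> n p /=; congr (phi n _); exact: sig_ext.
pose psi : smap E Z := smap_comp K (at_end (~~ b) E).
have psiE n (p : Bx n) : psi n (sval p) = phi n p.
  by rewrite /= [LHS]KP /=; congr (phi n _); apply: sig_ext; exact: Gamma_id.
exists (to_pi psi); split=> [n y //|n x|n a t].
- apply: to_pi_eq => // l g y e; have Pp : P l (spull_cell e) by left; exact: simplex_map_ext.
  rewrite [psi l _](psiE l (exist _ _ Pp)).
  have te : simplex_comp (endpoint b n) g = endpoint b l by exact: simplex_map_ext.
  by have := (phiP l (exist _ _ Pp)).2 te; rewrite /= smap_nat /= simplex_compm1.
- apply: to_pi_eq => // l g y e.
  have Pp : P l (spull_cell e) by right; exists (sact A g a); exact/esym/smap_nat.
  rewrite [psi l _](psiE l (exist _ _ Pp)).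
  have := (phiP l (exist _ _ Pp)).1 (sact A g a) (esym (smap_nat j g a)) => /=.
  rewrite -[(sact A g a, _)]/(sact (sprod A interval) g (a, t)) [u l _]smap_nat /=.
  by rewrite simplex_compm1.
Qed.

(** The base is extended in [B], and the map is then lifted over this extension. *)
Lemma hep_dep_prod : hep Z -> hep B -> hep dep_prod.
Proof.
move=> hepZ hepB A X j b w u j_inj uw.
have [|v [vw vu]] := hepB A X j b (smap_comp dep_base w) (smap_comp dep_base u) j_inj.
  by move=> n a /=; rewrite uw.
have [|||h [hv hw hu]] := @dep_prod_lift A X j b w u v hepZ j_inj => //.
by exists h; split.
Qed.

End DependentProduct.

(** * Right properness *)

Section RightProper.
Variables (Q B : sset) (q : smap Q B).
Hypotheses (hlp_q : hlp q) (kanB : kan B).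

(** Since [dep_prod] is Kan, the map extends, but possibly with a base other than [v]. As [B] is
    Kan, this base can be joined to [v] relative to the given part, and the extension is transported
    along the homotopy. *)
Lemma dep_prod_acyclic_lift (Z A Y L M : sset) (j : smap A Y) (i : smap L M)
    (a : smap (sprod A M) (dep_prod Z q)) (b : smap (sprod Y L) (dep_prod Z q))
    (v : smap (sprod Y M) B) :
  kan Z -> injective_smap j -> weak_equiv j -> injective_smap i ->
  (forall n x m, pi_base (a n (x, m)) = v n (j n x, m)) ->
  (forall n x l, pi_base (b n (x, l)) = v n (x, i n l)) ->
  (forall n x l, a n (x, i n l) = b n (j n x, l)) ->
  exists h : smap (sprod Y M) (dep_prod Z q),
  [/\ forall n y, pi_base (h n y) = v n y,
      forall n x m, h n (j n x, m) = a n (x, m) &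
      forall n x l, h n (x, i n l) = b n (x, l)].
Proof.
move=> kanZ j_inj wj i_inj av bv ab.
have hepP : hep (dep_prod Z q) by apply: hep_dep_prod => //; exact: kan_hep.
have [h0 [h0a h0b]] := acyclic_pushout_product j_inj wj i_inj (hep_kan hepP) ab.
(* A homotopy from the projection of h0 to v that is constant on the domain. *)
pose MI := sprod M interval.
pose P n (p : MI n) := p.2 = endpoint false n \/ p.2 = endpoint true n \/ exists l, p.1 = i n l.
have Pact m n (f : simplex_map m n) p : P n p -> P m (sact MI f p).
  case=> [e|[e|[l e]]]; [left|right; left|right; right; exists (sact L f l)];
    by rewrite /= e ?endpoint_comp ?smap_nat.
pose L' := ssub Pact.
have i'N m n (f : simplex_map m n) (p : L' n) : sval (sact L' f p) = sact MI f (sval p) by [].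
pose i' : smap L' MI := @SMap L' MI (fun n p => sval p) i'N.
pose b'0 n (p : sprod Y L' n) : B n :=
  match pselect ((sval p.2).2 = endpoint false n) with
  | left _ => pi_base (h0 n (p.1, (sval p.2).1))
  | right _ => v n (p.1, (sval p.2).1)
  end.
have b'0E n (p : sprod Y L' n) : (sval p.2).2 = endpoint false n ->
    b'0 n p = pi_base (h0 n (p.1, (sval p.2).1)) by rewrite /b'0; case: pselect.
have b'1E n (p : sprod Y L' n) : (sval p.2).2 <> endpoint false n ->
    b'0 n p = v n (p.1, (sval p.2).1) by rewrite /b'0; case: pselect.
have b'lE n (p : sprod Y L' n) l : (sval p.2).1 = i n l -> b'0 n p = v n (p.1, (sval p.2).1).
  by move=> e; rewrite /b'0; case: pselect => // _; rewrite e h0b bv.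
have b'N m n (f : simplex_map m n) (p : sprod Y L' n) :
    b'0 m (sact (sprod Y L') f p) = sact B f (b'0 n p).
  case: (proj2_sig p.2) => [e|[e|[l e]]].
  - rewrite b'0E /= ?e ?endpoint_comp // b'0E //.
    by rewrite -[(sact Y f _, _)]/(sact (sprod Y M) f (p.1, (sval p.2).1)) smap_nat.
  - rewrite b'1E /= ?e ?endpoint_comp; last exact: endpoint_inj.
    rewrite b'1E ?e; last exact: endpoint_inj.
    by rewrite -[(sact Y f _, _)]/(sact (sprod Y M) f (p.1, (sval p.2).1)) smap_nat.
  - have e' : (sval (sact (sprod Y L') f p).2).1 = i m (sact L f l) by rewrite /= e smap_nat.
    rewrite (b'lE _ _ _ e) (b'lE _ _ _ e').
    by rewrite -[RHS]smap_nat.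
have [||V [Va Vb]] := @acyclic_pushout_product A Y L' MI B j i'
    (smap_comp v (smap_comp (sfst _ interval) (spair (sprod_map j (sfst M interval))
       (smap_comp (ssnd M interval) (ssnd A MI))))) (SMap b'N) j_inj wj _ kanB.
- by move=> n p p' /sig_ext.
- move=> n x p; apply/esym; rewrite /= /b'0; case: pselect => //= e.
  by rewrite h0a av.
pose A' := ssum (sprod A M) (sprod Y L).
have P2act m n (f : simplex_map m n) (p : sprod Y M n) :
    (exists a0, p.1 = j n a0) \/ (exists l, p.2 = i n l) ->
    (exists a0, (sact (sprod Y M) f p).1 = j m a0) \/ (exists l, (sact (sprod Y M) f p).2 = i m l).
  by case=> -[z e]; [left; exists (sact A f z)|right; exists (sact L f z)]; rewrite /= e smap_nat.
pose A2 := ssub P2act.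
have j2N m n (f : simplex_map m n) (p : A2 n) : sval (sact A2 f p) = sact (sprod Y M) f (sval p) by [].
pose j2 : smap A2 (sprod Y M) := @SMap A2 (sprod Y M) (fun n p => sval p) j2N.
pose V2 : smap (sprod (sprod Y M) interval) B := smap_comp V
  (spair (smap_comp (sfst _ _) (sfst _ _)) (spair (smap_comp (ssnd _ _) (sfst _ _)) (ssnd _ _))).
have b'end n x m (t : interval n) : (P n (m, t)) -> V n (x, (m, t)) =
    match pselect (t = endpoint false n) with left _ => pi_base (h0 n (x, m)) | right _ => v n (x, m) end.
  by move=> Pmt; exact: (Vb n x (exist _ (m, t) Pmt)).
have [||||h [hV hw hu]] := @dep_prod_lift Q B Z q hlp_q A2 (sprod Y M) j2 false h0
    (smap_comp h0 (smap_comp j2 (sfst _ _))) V2 (kan_hep kanZ).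
- by move=> n p p' /sig_ext.
- move=> n [x m] /=; rewrite b'end; last by left.
  by case: pselect.
- move=> n p t; case: (proj2_sig p) => [[x e]|[l e]].
    rewrite /= [sval p]surjective_pairing e h0a av /=.
    by apply/esym; exact: (Va n x ((sval p).2, t)).
  rewrite /= b'end; last by right; right; exists l.
  case: pselect => _; first by rewrite -surjective_pairing.
  by rewrite [sval p]surjective_pairing e h0b bv.
- by [].
have hfix n (p : sprod Y M n) : (exists a0, p.1 = j n a0) \/ (exists l, p.2 = i n l) ->
    h n (p, endpoint true n) = h0 n p.
  by move=> Pp; exact: (hu n (exist _ p Pp)).
exists (smap_comp h (at_end true _)); split=> [n [x m]|n x m|n x l] /=.
- rewrite hV /= b'end; last by right; left.
  by case: pselect => // /endpoint_inj.
- by rewrite hfix ?h0a //; left; exists x.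
- by rewrite hfix ?h0b //; right; exists l.
Qed.

(** A map from the pullback of [Y] to [Z] is a map over [B] from [Y] to [dep_prod], so both halves
    become lifting problems along the acyclic [j]; their parameters are the empty set in a point and
    the two ends in the interval. *)
Lemma weak_equiv_spull_mono (A Y : sset) (j : smap A Y) (x : smap A B) (y : smap Y B)
    (e : forall n a, y n (j n a) = x n a) :
  injective_smap j -> weak_equiv j -> weak_equiv (spull_map q e).
Proof.
move=> j_inj wj Z kanZ; split=> [g|g g' /homotopicE[H [H0 H1]]].
  have [||||h [hb ha _]] := @dep_prod_acyclic_lift Z A Y sempty spoint j (from_empty spoint)
     (smap_comp (to_pi g) (sfst _ _)) (smap_comp (from_empty_prod Y _) (swap _ _))
     (smap_comp y (sfst _ _)) kanZ j_inj wj.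
  - by move=> n [].
  - by move=> n a p; rewrite /= e.
  - by move=> n a [].
  - by move=> n a [].
  pose h' : smap Y (dep_prod Z q) := smap_comp h (spair (smap_id Y) (to_point Y)).
  have h'y n a : pi_base (h' n a) = y n a by rewrite hb.
  exists (from_pi h'y).
  rewrite [X in homotopic X](_ : _ = g); first exact: homotopic_refl.
  apply: smap_ext => n p; apply: from_piE; rewrite /= ha.
  have ep : x n (sact A (simplex_id n) (sval p).1) = q n (sval p).2.
    by rewrite sact1; exact: (proj2_sig p).
  rewrite [LHS](to_piP g ep); congr (Some (g n _)).
  by apply: spull_ext => //=; rewrite sact1.
pose xI : smap (sprod A interval) B := smap_comp x (sfst _ _).
have HE n (p : spull xI q n) : x n (smap_comp (sfst A interval) (spull_fst xI q) n p) = q n (spull_snd xI q n p).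
  exact: (proj2_sig p).
pose HI : smap (spull xI q) Z := smap_comp H (spair (into_spull HE)
   (smap_comp (ssnd A interval) (spull_fst xI q))).
have [||||h [hb ha hL]] := @dep_prod_acyclic_lift Z A Y (ssum spoint spoint) interval j
  (copair (smap_comp (ssnd spoint interval) (at_end false spoint))
          (smap_comp (ssnd spoint interval) (at_end true spoint)))
  (to_pi HI) (smap_comp (copair_prod (smap_comp (to_pi g) (ssnd spoint _)) (smap_comp (to_pi g') (ssnd spoint _)))
       (swap _ _)) (smap_comp y (sfst _ _)) kanZ j_inj wj.
- have e01 k := @endpoint_inj k; have e10 k := nesym (@endpoint_inj k).
  move=> n [u|u] [w|w] /=; rewrite ?(spoint_eq u w) //; [by move/e10 | by move/e01].
- by move=> n a t; rewrite /= e.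
- by move=> n a [l|l].
- move=> n a [l|l].
    apply: to_pi_eq => [|m f z ez]; first by rewrite /= e.
    have ez' : y m (sact Y f (j n a)) = q m z by rewrite -smap_nat e.
    rewrite [LHS](to_piP g ez'); congr Some; apply/esym.
    rewrite [LHS]/= (_ : simplex_comp _ _ = endpoint false m); last exact: simplex_map_ext.
    by rewrite H0; congr (g m _); apply: spull_ext; rewrite /= ?smap_nat.
  apply: to_pi_eq => [|m f z ez]; first by rewrite /= e.
  have ez' : y m (sact Y f (j n a)) = q m z by rewrite -smap_nat e.
  rewrite [LHS](to_piP g' ez'); congr Some; apply/esym.
  rewrite [LHS]/= (_ : simplex_comp _ _ = endpoint true m); last exact: simplex_map_ext.
  by rewrite H1; congr (g' m _); apply: spull_ext; rewrite /= ?smap_nat.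
have HE' n (p : sprod (spull y q) interval n) :
    smap_comp y (sfst Y interval) n (sprod_map (spull_fst y q) (smap_id interval) n p) =
    q n (smap_comp (spull_snd y q) (sfst _ _) n p).
  exact: (proj2_sig p.1).
apply/homotopicE; exists (smap_comp (from_pi hb) (into_spull HE')).
have hend b (k : smap (spull y q) Z) : (forall n a, h n (a, endpoint b n) = to_pi k n a) ->
    forall n p, smap_comp (from_pi hb) (into_spull HE') n (p, endpoint b n) = k n p.
  move=> hk n p; apply: from_piE; rewrite [h n _]hk.
  have ep : y n (sact Y (simplex_id n) (sval p).1) = q n (sval p).2.
    by rewrite sact1; exact: (proj2_sig p).
  rewrite [LHS](to_piP k ep); congr (Some (k n _)).
  by apply: spull_ext => //=; rewrite sact1.
split; apply: hend => n a.
  exact: (hL n a (inl (const_map n ord0))).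
exact: (hL n a (inr (const_map n ord0))).
Qed.

(** The cylinder of [f] lies over [B] through its projection, and its deformation onto [Y] moves
    points within the fibres of this projection. Hence the deformation lifts to the pullback, and
    only the injective map into the cylinder remains. *)
Lemma weak_equiv_spull (X Y : sset) (f : smap X Y) (x : smap X B) (y : smap Y B)
    (e : forall n a, y n (f n a) = x n a) :
  weak_equiv f -> weak_equiv (spull_map q e).
Proof.
move=> wf; pose yc := smap_comp y (cyl_proj f).
have e1 n a : yc n (cyl_in f n a) = x n a.
  by rewrite -e /yc; congr (y n _); exact: (cyl_proj_left f (a, endpoint false n)).
have e2 n a : y n (cyl_proj f n a) = yc n a by [].
have e3 n a : yc n (cyl_right f n a) = y n a by [].
rewrite (_ : spull_map q e = smap_comp (spull_map q e2) (spull_map q e1)); last first.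
  apply: smap_ext => n p; apply: spull_ext => //=.
  by apply/esym; exact: (cyl_proj_left f (_, endpoint false n)).
apply: weak_equiv_comp.
  by apply: weak_equiv_spull_mono; [exact: cyl_in_inj | exact: weak_equiv_cyl_in].
apply: (@weak_equiv_inverse _ _ _ (spull_map q e3)); last first.
  rewrite (_ : smap_comp _ _ = smap_id _); first exact: weakly_homotopic_refl.
  by apply: smap_ext => n p; exact: spull_ext.
apply/weakly_homotopic_sym/homotopic_weakly/homotopicE.
have HE n (p : sprod (spull yc q) interval n) :
    yc n (smap_comp (cyl_homotopy f) (sprod_map (spull_fst yc q) (smap_id interval)) n p) =
    q n (smap_comp (spull_snd yc q) (sfst _ _) n p).
  case: p => [[[c z] /= cz] t]; rewrite -cz; congr (y n _).
  exact: cyl_proj_homotopy.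
exists (into_spull HE); split=> n p; apply: spull_ext => //.
  exact: cyl_homotopy0.
exact: cyl_homotopy1.
Qed.

End RightProper.

(** * Homotopies from natural transformations *)

Lemma chain_hom_ext (I : category) n (Q : ('I_n.+1 -> I) -> Type) (a : 'I_n.+1 -> I)
    (u u' : forall i j : 'I_n.+1, (i <= j)%N -> hom (a i) (a j)) p q p' q' (x y : Q a) :
  (forall i j ij, u i j ij = u' i j ij) -> x = y ->
  existT (fun s : chain n I => Q s) (@Chain n I a u p q) x =
  existT (fun s : chain n I => Q s) (@Chain n I a u' p' q') y.
Proof.
move=> uu' xy; have e : u = u'.
  by apply: functional_extensionality_dep => i; apply: functional_extensionality_dep => j;
     apply: functional_extensionality_dep => ij.
by case: _ / e p' q' {uu'} => p' q'; exact: chain_existT.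
Qed.

Lemma holim_cell_hom_ext (I : category) (D : diagram I) n (h : holim_cell D n) m
    (t t' : simplex_map m n) (a : 'I_m.+1 -> I)
    (u u' : forall i j : 'I_m.+1, (i <= j)%N -> hom (a i) (a j)) p q p' q' :
  t =1 t' -> (forall i j ij, u i j ij = u' i j ij) ->
  h m t (@Chain m I a u p q) = h m t' (@Chain m I a u' p' q').
Proof.
move=> /simplex_map_ext -> uu'; have e : u = u'.
  by apply: functional_extensionality_dep => i; apply: functional_extensionality_dep => j;
     apply: functional_extensionality_dep => ij.
by case: _ / e p' q' {uu'} => p' q'; rewrite (Prop_irrelevance p p') (Prop_irrelevance q q').
Qed.

Section Mix.
Variables (I : category) (n : nat) (r s : chain n I) (th : forall i, hom (r i) (s i)).
Hypothesis thN : forall (i j : 'I_n.+1) (ij : (i <= j)%N),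
  comp (cmor s ij) (th i) = comp (th j) (cmor r ij).

Definition mix_ob (b : bool) (i : 'I_n.+1) : I := if b then s i else r i.

Definition mix_hom (b b' : bool) (i j : 'I_n.+1) (ij : (i <= j)%N) :
    b ==> b' -> hom (mix_ob b i) (mix_ob b' j) :=
  match b, b' return b ==> b' -> hom (mix_ob b i) (mix_ob b' j) with
  | false, false => fun _ => cmor r ij
  | false, true => fun _ => comp (cmor s ij) (th i)
  | true, true => fun _ => cmor s ij
  | true, false => fun e => match notF e with end
  end.

Definition mix_in (b : bool) i : hom (r i) (mix_ob b i) :=
  if b return hom (r i) (mix_ob b i) then th i else idm (r i).

Definition mix_out (b : bool) i : hom (mix_ob b i) (s i) :=
  if b return hom (mix_ob b i) (s i) then idm (s i) else th i.

Lemma mix_hom_in b b' (i j : 'I_n.+1) (ij : (i <= j)%N) bb' :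
  comp (@mix_hom b b' i j ij bb') (mix_in b i) = comp (mix_in b' j) (cmor r ij).
Proof. by case: b b' bb' => [] [] //= _; rewrite ?thN ?comp1m ?compm1. Qed.

Lemma mix_hom_out b b' (i j : 'I_n.+1) (ij : (i <= j)%N) bb' :
  comp (mix_out b' j) (@mix_hom b b' i j ij bb') = comp (cmor s ij) (mix_out b i).
Proof. by case: b b' bb' => [] [] //= _; rewrite ?thN ?comp1m ?compm1. Qed.

Variable t : simplex_map n 1.

Definition late (i : 'I_n.+1) : bool := t i != ord0.

Lemma late_mono (i j : 'I_n.+1) : (i <= j)%N -> late i ==> late j.
Proof.
move=> /(smfun_mono t); rewrite /late -!val_eqE /= -!lt0n => ij.
by apply/implyP => /leq_trans; apply.
Qed.

Fact mix_hom1 (i : 'I_n.+1) (ii : (i <= i)%N) :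
  mix_hom ii (late_mono ii) = idm (mix_ob (late i) i).
Proof. by case: (late i) (late_mono ii) => e /=; rewrite cmor1. Qed.

Fact mix_homM (i j l : 'I_n.+1) (ij : (i <= j)%N) (jl : (j <= l)%N) (il : (i <= l)%N) :
  comp (mix_hom jl (late_mono jl)) (mix_hom ij (late_mono ij)) = mix_hom il (late_mono il).
Proof.
case: (late i) (late j) (late l) (late_mono ij) (late_mono jl) (late_mono il) => [] [] [] //= _ _ _;
  rewrite ?compA ?cmorM //.
by rewrite -compA -thN compA cmorM.
Qed.

(* The chain that follows r where t is 0 and s where t is 1. *)
Definition mix_chain : chain n I :=
  @Chain n I (fun i => mix_ob (late i) i) (fun i j ij => mix_hom ij (late_mono ij))
    mix_hom1 mix_homM.

End Mix.

Lemma mix_hom_irr (I : category) n (r s : chain n I) (th th' : forall i, hom (r i) (s i))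
    b b' (i j : 'I_n.+1) (ij ij' : (i <= j)%N) bb' bb'' :
  (forall i, th i = th' i) -> mix_hom th (b := b) (b' := b') ij bb' = mix_hom th' ij' bb''.
Proof.
by move=> e; rewrite (bool_irrelevance ij ij') (bool_irrelevance bb' bb'');
   case: b b' bb' bb'' => [] [] //= _ _; rewrite e.
Qed.

Lemma mix_hom_act (I : category) m n (f : simplex_map m n) (r s : chain n I)
    (th : forall i, hom (r i) (s i)) b b' (i j : 'I_m.+1) (ij : (i <= j)%N) (fij : (f i <= f j)%N)
    (bb' bb'' : b ==> b') :
  @mix_hom I m (chain_act f r) (chain_act f s) (fun i => th (f i)) b b' i j ij bb' =
  @mix_hom I n r s th b b' (f i) (f j) fij bb''.
Proof.
rewrite (bool_irrelevance fij (smfun_mono f ij)).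
by case: b b' bb' bb'' => [] [] //= bb' bb''; case: (notF bb').
Qed.

(** * Functoriality of homotopy colimits *)

Program Definition chain_map (I J : category) (p : functor I J) n (s : chain n I) : chain n J :=
  @Chain n J (fun i => p (s i)) (fun i j ij => fmor p (cmor s ij)) _ _.
Next Obligation. by move=> *; rewrite cmor1 fmor1. Qed.
Next Obligation. by move=> I J p n s i j l ij jl il; rewrite -fmorM cmorM. Qed.

Section HocolimPush.
Variables (I J : category) (E : diagram I) (D : diagram J).

Record diagram_over (p : functor I J) := DiagramOver {
  dover :> forall a : I, smap (E a) (D (p a));
  dover_nat : forall (a b : I) (u : hom a b) n (x : E a n),
    dover b n (dmor E u n x) = dmor D (fmor p u) n (dover a n x) }.

Program Definition hocolim_push (p : functor I J) (phi : diagram_over p) :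
    smap (hocolim E) (hocolim D) :=
  @SMap (hocolim E) (hocolim D)
    (fun n x => hocolim_cell (s := chain_map p (tag x)) (phi (tag x ord0) n (tagged x))) _.
Next Obligation.
move=> p phi m n f [s x] /=.
apply: (@chain_hom_ext J m (fun a => D (a ord0) m)) => //.
by rewrite dover_nat smap_nat.
Qed.

(** Over (s, t) the chain passes from the image under [p] to the image under [q] where [t] becomes
    1. The value sits at the first object, so it is moved by [th] only if [t] is 1 from the start;
    this is [mix_in]. *)
Lemma hocolim_push_homotopic (p q : functor I J) (phi : diagram_over p) (psi : diagram_over q)
    (th : forall a, hom (p a) (q a)) :
  (forall a b (u : hom a b), comp (fmor q u) (th a) = comp (th b) (fmor p u)) ->
  (forall a n x, psi a n x = dmor D (th a) n (phi a n x)) ->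
  homotopic (hocolim_push phi) (hocolim_push psi).
Proof.
move=> thN psiE; apply/homotopicE.
pose th' n (s : chain n I) i : hom (chain_map p s i) (chain_map q s i) := th (s i).
have th'N n (s : chain n I) (i j : 'I_n.+1) (ij : (i <= j)%N) :
    comp (cmor (chain_map q s) ij) (th' n s i) = comp (th' n s j) (cmor (chain_map p s) ij).
  exact: thN.
pose F n (x : sprod (hocolim E) interval n) : hocolim D n :=
  hocolim_cell (D := D) (s := mix_chain (th'N n (tag x.1)) x.2)
    (dmor D (mix_in (th' n (tag x.1)) (late x.2 ord0) ord0) n (phi (tag x.1 ord0) n (tagged x.1))).
have FN m n (f : simplex_map m n) x : F m (sact (sprod (hocolim E) interval) f x) = sact (hocolim D) f (F n x).
  case: x => [[s x] t].
  apply: (@chain_hom_ext J m (fun a => D (a ord0) m)) => [i j ij|].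
    exact: (@mix_hom_act J m n f (chain_map p s) (chain_map q s) (th' n s)).
  rewrite /= dover_nat -!smap_nat -!dmorM.
  congr (smap_fun (dmor D _) m _); apply/esym.
  exact: (@mix_hom_in J n _ _ _ (th'N n s) (late t ord0) (late t (f ord0)) ord0 (f ord0)).
exists (SMap FN); split=> n [s x].
  apply: (@chain_hom_ext J n (fun a => D (a ord0) n)) => //.
  by rewrite /= dmor1.
apply: (@chain_hom_ext J n (fun a => D (a ord0) n)) => //.
by rewrite /= psiE.
Qed.

End HocolimPush.

Definition functor_id (I : category) : functor I I :=
  @Functor I I (fun a => a) (fun a b u => u) (fun=> erefl) (fun _ _ _ _ _ => erefl).

Definition reindex_over (I J : category) (c : functor I J) (D : diagram J) :
    diagram_over (reindex c D) D c :=
  @DiagramOver I J (reindex c D) D c (fun a => smap_id _) (fun _ _ _ _ _ => erefl).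

Section Cofinality.
Variables (I J : category) (c : functor I J) (p : functor J I) (D : diagram J).
Variable al : forall a : J, hom a (c (p a)).
Hypothesis alN : forall a b (u : hom a b), comp (fmor c (fmor p u)) (al a) = comp (al b) u.
Variable be : forall a : I, hom a (p (c a)).
Hypothesis beN : forall a b (u : hom a b), comp (fmor p (fmor c u)) (be a) = comp (be b) u.
Hypothesis be_al : forall a n x, dmor D (fmor c (be a)) n x = dmor D (al (c a)) n x.

(** Natural transformations from the identities to both composites give the homotopies that make the
    map invertible; [be_al] identifies their actions on values. *)
Lemma hocolim_cofinal : weak_equiv (hocolim_push (reindex_over c D)).
Proof.
have gN a b (u : hom a b) n (x : D a n) :
    dmor D (al b) n (dmor D u n x) = dmor (reindex c D) (fmor p u) n (dmor D (al a) n x).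
  by rewrite /= -!dmorM alN.
pose g : diagram_over D (reindex c D) p := @DiagramOver _ _ D (reindex c D) p (fun a => dmor D (al a)) gN.
have idN (K : category) (X : diagram K) a b (u : hom a b) n (x : X a n) :
  smap_id (X b) n (dmor X u n x) = dmor X (fmor (functor_id K) u) n (smap_id (X a) n x) by [].
pose idO (K : category) (X : diagram K) := @DiagramOver K K X X (functor_id K) (fun a => smap_id (X a)) (idN K X).
have idE (K : category) (X : diagram K) : hocolim_push (idO K X) = smap_id _.
  by apply: smap_ext => n [[a u u1 uM] x]; apply: (@chain_hom_ext K n (fun a => X (a ord0) n)).
have cpN a b (u : hom a b) n (x : D a n) :
    dmor D (al b) n (dmor D u n x) = dmor D (fmor (functor_comp c p) u) n (dmor D (al a) n x).
  by rewrite /= -!dmorM alN.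
pose cp : diagram_over D D (functor_comp c p) := @DiagramOver _ _ D D (functor_comp c p) (fun a => dmor D (al a)) cpN.
have pcN a b (u : hom a b) n (x : D (c a) n) :
    dmor D (al (c b)) n (dmor D (fmor c u) n x) =
    dmor (reindex c D) (fmor (functor_comp p c) u) n (dmor D (al (c a)) n x).
  by rewrite /= -!dmorM alN.
pose pc : diagram_over (reindex c D) (reindex c D) (functor_comp p c) :=
  @DiagramOver _ _ (reindex c D) (reindex c D) (functor_comp p c) (fun a => dmor D (al (c a))) pcN.
apply: (@weak_equiv_inverse _ _ _ (hocolim_push g)).
  apply/weakly_homotopic_sym/homotopic_weakly; rewrite -idE.
  rewrite (_ : smap_comp _ _ = hocolim_push pc); last first.
    by apply: smap_ext => n [s x]; apply: (@chain_hom_ext I n (fun a => reindex c D (a ord0) n)).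
  apply: (@hocolim_push_homotopic I I _ _ (functor_id I) (functor_comp p c) (idO I _) pc be beN).
  by move=> a n x; exact/esym/be_al.
apply/weakly_homotopic_sym/homotopic_weakly; rewrite -idE.
rewrite (_ : smap_comp _ _ = hocolim_push cp); last first.
  by apply: smap_ext => n [s x]; apply: (@chain_hom_ext J n (fun a => D (a ord0) n)).
exact: (@hocolim_push_homotopic J J _ _ (functor_id J) (functor_comp c p) (idO J _) cp al alN).
Qed.

End Cofinality.

(** * Restriction of homotopy limits *)

Section HolimPull.
Variables (I J : category) (D : diagram J) (E : diagram I).

Record diagram_under (p : functor I J) := DiagramUnder {
  dunder :> forall a : I, smap (D (p a)) (E a);
  dunder_nat : forall (a b : I) (u : hom a b) n (x : D (p a) n),
    dunder b n (dmor D (fmor p u) n x) = dmor E u n (dunder a n x) }.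

Program Definition holim_pull (p : functor I J) (phi : diagram_under p) :
    smap (holim D) (holim E) :=
  @SMap (holim D) (holim E) (fun n x => @HolimCell I E n
    (fun m t s => phi (s ord_max) m (x m t (chain_map p s))) _) _.
Next Obligation.
move=> p phi n x l m f t s; rewrite -dunder_nat -smap_nat.
rewrite -[X in _ = phi _ l X](hlfunP x f t (chain_map p s)).
by congr (phi _ l (dmor D _ l _)); exact: holim_cell_hom_ext.
Qed.
Next Obligation. by move=> *; exact: holim_cell_ext. Qed.

(** Dual to the case of homotopy colimits: a value sits at the last object of a chain, so it is
    moved by [th] unless the mixed chain already ends in the image under [q]; this is [mix_out]. *)
Lemma holim_pull_homotopic (p q : functor I J) (phi : diagram_under p) (psi : diagram_under q)
    (th : forall a, hom (p a) (q a)) :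
  (forall a b (u : hom a b), comp (fmor q u) (th a) = comp (th b) (fmor p u)) ->
  (forall a n x, phi a n x = psi a n (dmor D (th a) n x)) ->
  homotopic (holim_pull phi) (holim_pull psi).
Proof.
move=> thN phiE; apply/homotopicE.
pose th' n (s : chain n I) i : hom (chain_map p s i) (chain_map q s i) := th (s i).
have th'N n (s : chain n I) (i j : 'I_n.+1) (ij : (i <= j)%N) :
    comp (cmor (chain_map q s) ij) (th' n s i) = comp (th' n s j) (cmor (chain_map p s) ij).
  exact: thN.
pose G n (x : sprod (holim D) interval n) m (t : simplex_map m n) (s : chain m I) : E (s ord_max) m :=
  psi (s ord_max) m (dmor D (mix_out (th' m s) (late (simplex_comp x.2 t) ord_max) ord_max) m
    (x.1 m t (mix_chain (th'N m s) (simplex_comp x.2 t)))).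
have GP n (x : sprod (holim D) interval n) l m (f : simplex_map l m) (t : simplex_map m n) (s : chain m I) :
    dmor E (chain_last f s) l (@G n x l (simplex_comp t f) (chain_act f s)) = sact _ f (G n x m t s).
  rewrite -dunder_nat -smap_nat; congr (psi _ l _); rewrite -smap_nat.
  rewrite -[X in _ = dmor D _ l X](hlfunP x.1 f t (mix_chain (th'N m s) (simplex_comp x.2 t))).
  rewrite -!dmorM.
  have -> : comp (fmor q (chain_last f s)) (mix_out (th' l (chain_act f s)) (late (simplex_comp x.2 (simplex_comp t f)) ord_max) ord_max)
    = comp (mix_out (th' m s) (late (simplex_comp x.2 t) ord_max) ord_max)
           (chain_last f (mix_chain (th'N m s) (simplex_comp x.2 t))).
    apply/esym.
    exact: (@mix_hom_out J m _ _ _ (th'N m s) (late (simplex_comp x.2 t) (f ord_max)) (late (simplex_comp x.2 t) ord_max)).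
  congr (smap_fun (dmor D _) l _).
  apply: (@holim_cell_hom_ext J D n x.1 l (simplex_comp t f) (simplex_comp t f) (fun i =>
    @mix_ob J m (chain_map p s) (chain_map q s) (late (simplex_comp x.2 t) (f i)) (f i))) => // i j ij.
  exact: (@mix_hom_act J l m f (chain_map p s) (chain_map q s) (th' m s)).
pose F n x : holim E n := @HolimCell I E n (G n x) (@GP n x).
have FN m n (f : simplex_map m n) x : F m (sact (sprod (holim D) interval) f x) = sact (holim E) f (F n x).
  apply: holim_cell_ext => l t s /=.
  by congr (psi _ l (dmor D _ l _)).
exists (SMap FN); split=> n x; apply: holim_cell_ext => m t s.
  rewrite [RHS]/= phiE; congr (psi _ m (dmor D _ m _)).
  by apply/esym; apply: (@holim_cell_hom_ext J D n x m t t (fun i => p (s i))).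
apply: etrans (congr1 (psi (s ord_max) m) (@dmor1 J D (q (s ord_max)) m _)) _; congr (psi _ m _).
by apply/esym; apply: (@holim_cell_hom_ext J D n x m t t (fun i => q (s i))).
Qed.

End HolimPull.

Section HolimEquivalence.
Variables (I J : category) (c : functor I J) (p : functor J I) (D : diagram J) (E : diagram I).
Variables (phi : diagram_under D E c) (ga : diagram_under E D p).
Variable al : forall a : J, hom a (c (p a)).
Hypothesis alN : forall a b (u : hom a b), comp (fmor c (fmor p u)) (al a) = comp (al b) u.
Variable be : forall a : I, hom a (p (c a)).
Hypothesis beN : forall a b (u : hom a b), comp (fmor p (fmor c u)) (be a) = comp (be b) u.
Hypothesis ga_phi : forall a n x, ga a n (phi (p a) n (dmor D (al a) n x)) = x.
Hypothesis phi_ga : forall a n x, phi a n (ga (c a) n (dmor E (be a) n x)) = x.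

(** It is the effect of [al] and [be] on values that [phi] and [ga] invert, not the morphisms
    themselves. This fits indexing categories in which different objects carry the same value. *)
Lemma holim_pull_equiv : weak_equiv (holim_pull phi).
Proof.
have idN (K : category) (X : diagram K) a b (u : hom a b) n (x : X a n) :
  smap_id (X b) n (dmor X (fmor (functor_id K) u) n x) = dmor X u n (smap_id (X a) n x) by [].
pose idU (K : category) (X : diagram K) := @DiagramUnder K K X X (functor_id K) (fun a => smap_id (X a)) (idN K X).
have idE (K : category) (X : diagram K) : holim_pull (idU K X) = smap_id _.
  apply: smap_ext => n x; apply: holim_cell_ext => m t [a u u1 uM].
  by apply/esym; apply: (@holim_cell_hom_ext K X n x m t t a u).
have cpN a b (u : hom a b) n (x : D (c (p a)) n) :
    ga b n (phi (p b) n (dmor D (fmor (functor_comp c p) u) n x)) =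
    dmor D u n (ga a n (phi (p a) n x)).
  by rewrite /= dunder_nat dunder_nat.
pose cp : diagram_under D D (functor_comp c p) := @DiagramUnder _ _ D D (functor_comp c p)
  (fun a => smap_comp (ga a) (phi (p a))) cpN.
have pcN a b (u : hom a b) n (x : E (p (c a)) n) :
    phi b n (ga (c b) n (dmor E (fmor (functor_comp p c) u) n x)) =
    dmor E u n (phi a n (ga (c a) n x)).
  by rewrite /= dunder_nat dunder_nat.
pose pc : diagram_under E E (functor_comp p c) := @DiagramUnder _ _ E E (functor_comp p c)
  (fun a => smap_comp (phi a) (ga (c a))) pcN.
apply: (@weak_equiv_inverse _ _ _ (holim_pull ga)).
  apply/weakly_homotopic_sym/homotopic_weakly; rewrite -idE.
  rewrite (_ : smap_comp _ _ = holim_pull cp); last first.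
    apply: smap_ext => n x; apply: holim_cell_ext => m t s /=.
    by congr (ga _ m (phi _ m _)); apply: holim_cell_hom_ext.
  apply: (@holim_pull_homotopic J J _ _ (functor_id J) (functor_comp c p) (idU J _) cp al alN).
  by move=> a n x; exact/esym/ga_phi.
apply/weakly_homotopic_sym/homotopic_weakly; rewrite -idE.
rewrite (_ : smap_comp _ _ = holim_pull pc); last first.
  apply: smap_ext => n x; apply: holim_cell_ext => m t s /=.
  by congr (phi _ m (ga _ m _)); apply: holim_cell_hom_ext.
apply: (@holim_pull_homotopic I I _ _ (functor_id I) (functor_comp p c) (idU I _) pc be beN).
by move=> a n x; exact/esym/phi_ga.
Qed.

End HolimEquivalence.

(** * Left Kan extensions *)

Program Definition over (I J : category) (p : functor I J) (c : J) : category :=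
  @Category {a : I & hom (p a) c}
    (fun a b => {u : hom (tag a) (tag b) | comp (tagged b) (fmor p u) = tagged a})
    (fun a => exist _ (idm (tag a)) _)
    (fun a b d v u => exist _ (comp (sval v) (sval u)) _) _ _ _.
Next Obligation. by move=> *; rewrite fmor1 compm1. Qed.
Next Obligation. by move=> I J p c a b d v u /=; rewrite fmorM compA (svalP v) (svalP u). Qed.
Next Obligation. by move=> *; apply: sig_ext; exact: comp1m. Qed.
Next Obligation. by move=> *; apply: sig_ext; exact: compm1. Qed.
Next Obligation. by move=> *; apply: sig_ext; exact: compA. Qed.

Definition over_functor (I J : category) (p : functor I J) (c : J) : functor (over p c) I :=
  @Functor (over p c) I (fun a => tag a) (fun a b u => sval u) (fun=> erefl) (fun _ _ _ _ _ => erefl).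

Section LanHocolim.
Variables (I J : category) (p : functor I J) (D : diagram I) (c : J).
Let O := over p c.
Let DO := reindex (over_functor p c) D.

Definition lan_of_cell n (s : chain n I) (w : hom (p (s ord_max)) c) (x : D (s ord0) n) :
    lan_ob p D c n :=
  existT (fun s : chain n I => hom (p (s ord_max)) c * D (s ord0) n)%type s (w, x).

Program Definition lan_of_hocolim : smap (hocolim DO) (lan_ob p D c) :=
  @SMap (hocolim DO) (lan_ob p D c) (fun n x =>
    lan_of_cell (s := chain_map (over_functor p c) (tag x)) (tagged (tag x ord_max)) (tagged x)) _.
Next Obligation.
move=> m n f [s x].
apply: (@chain_hom_ext I m (fun a => hom (p (a ord_max)) c * D (a ord0) m)%type) => //.
congr pair; exact/esym/(svalP (chain_last f s)).
Qed.

Program Definition over_chain n (s : chain n I) (w : hom (p (s ord_max)) c) : chain n O :=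
  @Chain n O (fun i => existT _ (s i) (comp w (fmor p (cmor s (leq_ord i : (i <= @ord_max n)%N)))))
    (fun i j ij => exist _ (cmor s ij) _) _ _.
Next Obligation.
by move=> n s w i j ij /=; rewrite -compA -fmorM; congr (comp w (fmor p _)); exact: cmorM.
Qed.
Next Obligation. by move=> n s w i ii; apply: sig_ext; exact: cmor1. Qed.
Next Obligation. by move=> n s w i j l ij jl il; apply: sig_ext; exact: cmorM. Qed.

Lemma over_chain_ext n (X : 'I_n.+1 -> I) (w w' : forall i, hom (p (X i)) c)
    (u : forall i j : 'I_n.+1, (i <= j)%N -> @hom O (existT _ (X i) (w i)) (existT _ (X j) (w j))) q1 q2
    (u' : forall i j : 'I_n.+1, (i <= j)%N -> @hom O (existT _ (X i) (w' i)) (existT _ (X j) (w' j))) q1' q2'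
    (x : D (X ord0) n) :
  (forall i, w i = w' i) -> (forall i j ij, sval (u i j ij) = sval (u' i j ij)) ->
  hocolim_cell (D := DO) (s := @Chain n O (fun i => existT _ (X i) (w i)) u q1 q2) x =
  hocolim_cell (D := DO) (s := @Chain n O (fun i => existT _ (X i) (w' i)) u' q1' q2') x.
Proof.
move=> ww; have e : w = w' by exact: functional_extensionality_dep.
case: _ / e u' q1' q2' {ww} => u' q1' q2' uu.
apply: (@chain_hom_ext O n (fun a => DO (a ord0) n)) => // i j ij.
exact/sig_ext/uu.
Qed.

Program Definition hocolim_of_lan : smap (lan_ob p D c) (hocolim DO) :=
  @SMap (lan_ob p D c) (hocolim DO) (fun n x =>
    hocolim_cell (D := DO) (s := over_chain (tagged x).1) (tagged x).2) _.
Next Obligation.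
move=> m n f [s [w x]]; apply: over_chain_ext => // i /=.
by rewrite -compA -fmorM; congr (comp w (fmor p _)); exact: cmorM.
Qed.

Lemma hocolim_of_lanK n x : lan_of_hocolim n (hocolim_of_lan n x) = x.
Proof.
case: x => [[a u u1 uM] [w x]].
apply: (@chain_hom_ext I n (fun a => hom (p (a ord_max)) c * D (a ord0) n)%type) => //.
congr pair; rewrite /= u1 fmor1; exact: compm1.
Qed.

Lemma lan_of_hocolimK n x : hocolim_of_lan n (lan_of_hocolim n x) = x.
Proof.
case: x => [[a u u1 uM] x].
(* Splitting the objects of the chain into a family of objects and a family of structure maps lets
   [over_chain_ext] compare structure maps that are only propositionally equal. *)
have [X [w E]] : exists (X : 'I_n.+1 -> I) (w : forall i, hom (p (X i)) c),
    a = (fun i => existT (fun b => hom (p b) c) (X i) (w i)).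
  exists (fun i => tag (a i)), (fun i => tagged (a i)); apply: funext => i.
  by case: (a i).
subst a.
apply: over_chain_ext => // i.
exact: (svalP (u i ord_max _)).
Qed.

Lemma weak_equiv_lan_of_hocolim : weak_equiv lan_of_hocolim.
Proof. exact: weak_equiv_iso lan_of_hocolimK hocolim_of_lanK. Qed.

End LanHocolim.

Section LanMap.
Variables (I J : category) (p : functor I J).

Program Definition lan_map (D D' : diagram I) (f : diagram_map D D') :
    diagram_map (lan p D) (lan p D') :=
  @DiagramMap J (lan p D) (lan p D') (fun c => @SMap (lan_ob p D c) (lan_ob p D' c)
    (fun n x => lan_of_cell (s := tag x) (tagged x).1 (f (tag x ord0) n (tagged x).2)) _) _.
Next Obligation.
move=> D D' f c m n g [s [w x]].
by rewrite /lan_of_cell /=; congr existT; congr pair; rewrite dmap_nat smap_nat.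
Qed.
Next Obligation. by []. Qed.

Lemma weak_equiv_lan_map (D D' : diagram I) (f : diagram_map D D') c :
  (forall a, weak_equiv (f a)) -> weak_equiv (lan_map f c).
Proof.
move=> wf.
pose fO : diagram_map (reindex (over_functor p c) D) (reindex (over_functor p c) D') :=
  @DiagramMap _ (reindex (over_functor p c) D) (reindex (over_functor p c) D')
    (fun a => f (tag a)) (fun a b u n x => dmap_nat f (sval u) x).
apply: (weak_equiv_cancel_right (weak_equiv_lan_of_hocolim p D c)).
rewrite (_ : smap_comp _ _ = smap_comp (lan_of_hocolim p D' c) (hocolim_map fO)); last first.
  by apply: smap_ext => n [s x].
apply: weak_equiv_comp (weak_equiv_lan_of_hocolim p D' c).
by apply: weak_equiv_hocolim => a; exact: wf.
Qed.

Definition chain_total (K : category) n (s : chain n K) : hom (s ord0) (s ord_max) :=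
  cmor s (leq0n (@ord_max n) : (@ord0 n <= @ord_max n)%N).

Lemma chain_totalE (K : category) m n (f : simplex_map m n) (s : chain n K) :
  comp (chain_last f s) (comp (chain_total (chain_act f s)) (chain_first f s)) = chain_total s.
Proof.
rewrite compA.
have -> : comp (chain_last f s) (chain_total (chain_act f s)) =
    cmor s (leq_ord (f ord0) : (f ord0 <= @ord_max n)%N).
  exact: (@cmorM _ _ s).
exact: (@cmorM _ _ s).
Qed.

Program Definition lan_counit (F : diagram J) : diagram_map (lan p (reindex p F)) F :=
  @DiagramMap J (lan p (reindex p F)) F (fun c => @SMap (lan_ob p (reindex p F) c) (F c)
    (fun n x => dmor F (comp (tagged x).1 (fmor p (chain_total (tag x)))) n (tagged x).2) _) _.
Next Obligation.
move=> F c m n f [s [w x]] /=; rewrite -smap_nat -dmorM.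
congr (smap_fun (dmor F _) m _).
by rewrite -!compA -!fmorM -(chain_totalE f s).
Qed.
Next Obligation. by move=> F a b u n [s [w x]] /=; rewrite -dmorM compA. Qed.

Lemma lan_counit_nat (F F' : diagram J) (f : diagram_map F F') c :
  smap_comp (f c) (lan_counit F c) =
  smap_comp (lan_counit F' c)
    (lan_map (@DiagramMap I (reindex p F) (reindex p F') (fun a => f (p a))
       (fun a b u n x => dmap_nat f (fmor p u) x)) c).
Proof. by apply: smap_ext => n [s [w x]] /=; rewrite dmap_nat. Qed.

(** Naturality of the counit, homotopy invariance of [lan_map] and two out of three, for each step
    of the zigzag. *)
Lemma lan_counit_invariant (F F' : diagram J) :
  diagram_equiv F F' ->
  ((forall c, weak_equiv (lan_counit F c)) <-> (forall c, weak_equiv (lan_counit F' c))).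
Proof.
elim=> {F F'} [F F' f wf|F F' _ ->//|F F' F'' _ -> _ ->//].
pose g : diagram_map (reindex p F) (reindex p F') :=
  @DiagramMap I (reindex p F) (reindex p F') (fun a => f (p a))
    (fun a b u n x => dmap_nat f (fmor p u) x).
have wg c : weak_equiv (lan_map g c) by apply: weak_equiv_lan_map => a; exact: wf.
split=> wF c.
  apply: (weak_equiv_cancel_right (wg c)); rewrite -(lan_counit_nat f c).
  exact: weak_equiv_comp.
apply: (weak_equiv_cancel_left (wf c)); rewrite lan_counit_nat.
exact: weak_equiv_comp.
Qed.

Variable full : forall a b : I, hom (p a) (p b) -> hom a b.
Hypothesis fullK : forall a b (v : hom (p a) (p b)), fmor p (full v) = v.
Hypothesis Kfull : forall a b (u : hom a b), full (fmor p u) = u.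

Lemma full_compr a b c (v : hom (p b) (p c)) (u : hom a b) :
  comp (full v) u = full (comp v (fmor p u)).
Proof. by rewrite -[LHS]Kfull fmorM fullK. Qed.

Lemma full_compl a b c (u : hom b c) (v : hom (p a) (p b)) :
  comp u (full v) = full (comp (fmor p u) v).
Proof. by rewrite -[LHS]Kfull fmorM fullK. Qed.

Program Definition lan_restrict (G : diagram I) : diagram_map (reindex p (lan p G)) G :=
  @DiagramMap I (reindex p (lan p G)) G (fun a => @SMap (lan_ob p G (p a)) (G a)
    (fun n x => dmor G (comp (full (tagged x).1) (chain_total (tag x))) n (tagged x).2) _) _.
Next Obligation.
move=> G a m n f [s [w x]] /=; rewrite -smap_nat -dmorM.
congr (smap_fun (dmor G _) m _).
by rewrite -full_compr -!compA -(chain_totalE f s).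
Qed.
Next Obligation. by move=> G a b u n [s [w x]] /=; rewrite -dmorM -full_compl compA. Qed.

Definition const_chain (K : category) n (a : K) : chain n K :=
  @Chain n K (fun=> a) (fun _ _ _ => idm a) (fun _ _ => erefl) (fun _ _ _ _ _ _ => comp1m _).

(** As [p] is fully faithful, the identity of [p a] is terminal among the maps p b -> p a. The
    homotopy joins a chain to the constant chain at [a] through [th]. *)
Lemma weak_equiv_lan_restrict (G : diagram I) a : weak_equiv (lan_restrict G a).
Proof.
pose G1 n (x : G a n) : lan_ob p G (p a) n :=
  lan_of_cell (s := const_chain n a) (idm (p a)) x.
have G1N m n (f : simplex_map m n) x : G1 m (sact (G a) f x) = sact (lan_ob p G (p a)) f (G1 n x).
  apply: (@chain_hom_ext I m (fun b => hom (p (b ord_max)) (p a) * G (b ord0) m)%type) => //.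
  by congr pair; rewrite /= ?fmor1 ?comp1m ?dmor1.
pose g : smap (G a) (lan_ob p G (p a)) := SMap G1N.
apply: (@weak_equiv_inverse _ _ _ g).
  apply/weakly_homotopic_sym/homotopic_weakly/homotopicE.
  pose th n (s : chain n I) (w : hom (p (s ord_max)) (p a)) (i : 'I_n.+1) :
      hom (s i) (const_chain n a i) := comp (full w) (cmor s (leq_ord i : (i <= @ord_max n)%N)).
  have thN n (s : chain n I) w (i j : 'I_n.+1) (ij : (i <= j)%N) :
      comp (cmor (const_chain n a) ij) (th n s w i) = comp (th n s w j) (cmor s ij).
    by rewrite /th /= comp1m -compA; congr (comp (full w) _); exact/esym/cmorM.
  (* The structure map of the mixed chain: the identity once the chain has reached [a]. *)
  pose outw n (s : chain n I) (w : hom (p (s ord_max)) (p a)) (b : bool) :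
      hom (p (@mix_ob I n s (const_chain n a) b ord_max)) (p a) :=
    if b return hom (p (@mix_ob I n s (const_chain n a) b ord_max)) (p a) then idm (p a) else w.
  pose F n (x : sprod (lan_ob p G (p a)) interval n) : lan_ob p G (p a) n :=
    lan_of_cell (D := G) (s := mix_chain (thN n (tag x.1) (tagged x.1).1) x.2)
      (outw n (tag x.1) (tagged x.1).1 (late x.2 ord_max))
      (dmor G (mix_in (th n (tag x.1) (tagged x.1).1) (late x.2 ord0) ord0) n (tagged x.1).2).
  have outwE n (s : chain n I) w b (j : 'I_n.+1) (jn : (j <= @ord_max n)%N) (bj : bool) e :
      comp (outw n s w b) (fmor p (@mix_hom I n s (const_chain n a) (th n s w) bj b j ord_max jn e)) =
      if bj return hom (p (@mix_ob I n s (const_chain n a) bj j)) (p a) then idm (p a)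
      else comp w (fmor p (cmor s jn)).
    case: bj b e => [] [] //= e; rewrite ?fmor1 ?comp1m //.
    by rewrite fmorM fullK; congr (comp w (fmor p (cmor s _))); exact: bool_irrelevance.
  have FN m n (f : simplex_map m n) x :
      F m (sact (sprod (lan_ob p G (p a)) interval) f x) = sact (lan_ob p G (p a)) f (F n x).
    case: x => [[s [w x]] t].
    have thE i : th m (chain_act f s) (comp w (fmor p (chain_last f s))) i = th n s w (f i).
      by rewrite /th -full_compr -compA; congr comp; exact: (@cmorM _ _ s).
    apply: (@chain_hom_ext I m (fun b => hom (p (b ord_max)) (p a) * G (b ord0) m)%type).
      move=> i j ij.
      apply: etrans (mix_hom_irr ij ij _ _ thE) _; first exact: (late_mono (simplex_comp t f) ij).
      move=> e; exact: (@mix_hom_act I m n f s (const_chain n a) (th n s w)).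
    congr pair.
      apply/esym; rewrite /chain_last [LHS](outwE n s w (late t ord_max) (f ord_max)).
      by rewrite /outw /=.
    rewrite /= -!smap_nat -!dmorM.
    congr (smap_fun (dmor G _) m _).
    have -> : mix_in (th m (chain_act f s) (comp w (fmor p (chain_last f s)))) (late t (f ord0)) ord0
       = mix_in (th n s w) (late t (f ord0)) (f ord0).
      by rewrite /mix_in; case: (late t (f ord0)); rewrite ?thE.
    apply/esym; exact: (@mix_hom_in I n _ _ _ (thN n s w) (late t ord0) (late t (f ord0)) ord0 (f ord0)).
  exists (SMap FN); split=> n [s [w x]].
    case: s w x => [b u u1 uM] w x.
    apply: (@chain_hom_ext I n (fun b => hom (p (b ord_max)) (p a) * G (b ord0) n)%type) => //.
    by congr pair; rewrite /= dmor1.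
  apply: (@chain_hom_ext I n (fun b => hom (p (b ord_max)) (p a) * G (b ord0) n)%type) => //.
  congr pair; congr (smap_fun (dmor G _) n _).
  by rewrite /= /th; congr (comp _ (cmor s _)); exact: bool_irrelevance.
rewrite (_ : smap_comp _ _ = smap_id _); first exact: weakly_homotopic_refl.
apply: smap_ext => n x /=; rewrite compm1 -(fmor1 p) Kfull; exact: dmor1.
Qed.

(** A simplex consists of an outer chain [ss] with a map to [c] and an inner chain [rr] with a map
    to the start of [ss]. The counit keeps [rr] and the other map keeps [ss]; [th] leads from [rr]
    to [ss] through the end of [rr] and the start of [ss]. *)
Lemma lan_counit_restrict (G : diagram I) c :
  homotopic (lan_counit (lan p G) c) (lan_map (lan_restrict G) c).
Proof.
pose L := lan_ob p (reindex p (lan p G)) c; apply/homotopicE.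
pose ss n (x : L n) : chain n I := tag x.
pose ww n (x : L n) : hom (p (ss n x ord_max)) c := (tagged x).1.
pose yy n (x : L n) : lan_ob p G (p (ss n x ord0)) n := (tagged x).2.
pose rr n (x : L n) : chain n I := tag (yy n x).
pose vv n (x : L n) : hom (p (rr n x ord_max)) (p (ss n x ord0)) := (tagged (yy n x)).1.
pose th n (x : L n) (i : 'I_n.+1) : hom (rr n x i) (ss n x i) :=
  comp (cmor (ss n x) (leq0n i : (@ord0 n <= i)%N))
    (comp (full (vv n x)) (cmor (rr n x) (leq_ord i : (i <= @ord_max n)%N))).
have thN n (x : L n) (i j : 'I_n.+1) (ij : (i <= j)%N) :
    comp (cmor (ss n x) ij) (th n x i) = comp (th n x j) (cmor (rr n x) ij).
  apply: etrans (compA _ _ _) _.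
  apply: etrans (congr1 (fun h => comp h _) (@cmorM _ _ (ss n x) ord0 i j (leq0n i) ij (leq0n j))) _.
  rewrite /th -!compA; congr (comp _ (comp _ _)); exact/esym/cmorM.
pose outw n (x : L n) (b : bool) : hom (p (@mix_ob I n (rr n x) (ss n x) b ord_max)) c :=
  if b return hom (p (@mix_ob I n (rr n x) (ss n x) b ord_max)) c then ww n x
  else comp (ww n x) (fmor p (th n x ord_max)).
pose F n (x : sprod L interval n) : lan_ob p G c n :=
  lan_of_cell (D := G) (s := mix_chain (thN n x.1) x.2) (outw n x.1 (late x.2 ord_max))
    (dmor G (mix_in (th n x.1) (late x.2 ord0) ord0) n (tagged (yy n x.1)).2).
have outwE n (x : L n) b (j : 'I_n.+1) (jn : (j <= @ord_max n)%N) (bj : bool) e :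
    comp (outw n x b) (fmor p (@mix_hom I n (rr n x) (ss n x) (th n x) bj b j ord_max jn e)) =
    if bj return hom (p (@mix_ob I n (rr n x) (ss n x) bj j)) c then comp (ww n x) (fmor p (cmor (ss n x) jn))
    else comp (ww n x) (fmor p (comp (cmor (ss n x) jn) (th n x j))).
  by case: bj b e => [] [] //= e; rewrite -compA -fmorM -thN.
have thE m n (f : simplex_map m n) (x : L n) i : th m (sact L f x) i = th n x (f i).
  case: x => [s [w [r [v x]]]]; rewrite /th /=.
  rewrite /vv /=.
  rewrite -full_compl -full_compr.
  rewrite -[RHS](congr1 (fun h => comp h _) (@cmorM _ _ s ord0 (f ord0) (f i) (leq0n _) (smfun_mono f (leq0n i : (@ord0 m <= i)%N)) (leq0n _))).
  rewrite -[X in _ = comp _ (comp _ X)](@cmorM _ _ r (f i) (f ord_max) ord_max (smfun_mono f (leq_ord i : (i <= @ord_max m)%N)) (leq_ord _) (leq_ord _)).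
  by rewrite !compA.
have FN m n (f : simplex_map m n) x :
    F m (sact (sprod L interval) f x) = sact (lan_ob p G c) f (F n x).
  case: x => [x t]; have thE' := thE m n f x; case: x thE' => [s [w [r [v x]]]] thE'.
  set X : L n := existT _ s _.
  apply: (@chain_hom_ext I m (fun b => hom (p (b ord_max)) c * G (b ord0) m)%type).
    move=> i j ij.
    apply: etrans (mix_hom_irr ij ij _ _ thE') _; first exact: (late_mono (simplex_comp t f) ij).
    move=> e; exact: (@mix_hom_act I m n f r s (th n X)).
  congr pair.
    have outwA bj : outw m (sact L f X) bj =
        if bj return hom (p (@mix_ob I n r s bj (f ord_max))) c
        then comp w (fmor p (chain_last f s))
        else comp w (fmor p (comp (chain_last f s) (th n X (f ord_max)))).
      case: bj => //; rewrite /outw thE'; apply: etrans (esym (compA _ _ _)) _.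
      by rewrite -fmorM.
    apply: etrans (outwA (late t (f ord_max))) _; apply/esym.
    exact: (outwE n X (late t ord_max) (f ord_max) (leq_ord (f ord_max)) (late t (f ord_max))).
  rewrite /= -!smap_nat -!dmorM.
  congr (smap_fun (dmor G _) m _).
  have -> : mix_in (th m (sact L f X)) (late t (f ord0)) ord0 = mix_in (th n X) (late t (f ord0)) (f ord0).
    by rewrite /mix_in; case: (late t (f ord0)); rewrite ?thE'.
  apply/esym; exact: (@mix_hom_in I n _ _ _ (thN n X) (late t ord0) (late t (f ord0)) ord0 (f ord0)).
exists (SMap FN); split=> n [s [w [r [v x]]]].
  case: r v x => [b u u1 uM] v x.
  apply: (@chain_hom_ext I n (fun b => hom (p (b ord_max)) c * G (b ord0) n)%type) => //.
  congr pair; rewrite /= ?dmor1 //.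
  by rewrite /th /= u1 compm1 !fmorM fullK compA.
case: s w r v x => [b u u1 uM] w r v x.
apply: (@chain_hom_ext I n (fun b => hom (p (b ord_max)) c * G (b ord0) n)%type) => //.
congr pair; rewrite /=; congr (smap_fun (dmor G _) n _).
rewrite /th /= u1 comp1m; congr (comp _ (cmor _ _)); exact: bool_irrelevance.
Qed.

(** The counit at [lan p G] is homotopic to [lan_map] of a weak equivalence, which takes the place
    of a triangle identity; the zigzag carries this to [F]. *)
Lemma lan_image_counit (G : diagram I) (F : diagram J) :
  diagram_equiv (lan p G) F -> forall c, weak_equiv (lan_counit F c).
Proof.
move=> /lan_counit_invariant e; apply/e => c.
apply: (@weak_equiv_weakly_homotopic _ _ (lan_map (lan_restrict G) c)).
  exact/weakly_homotopic_sym/homotopic_weakly/lan_counit_restrict.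
by apply: weak_equiv_lan_map => a; exact: weak_equiv_lan_restrict.
Qed.

End LanMap.

Local Open Scope order_scope.

(** * Maps of closed trees *)

Section ClosedHom.
Variables (T T' : tree) (f : tree_hom T T').
Hypothesis T0 : leaves T = set0.

(** In a closed tree every edge y above x is the input of a unary operation with output x, since {y}
    is an antichain. *)
Lemma closed_hom_mono x y : x <= y -> f x <= f y.
Proof.
move=> xy; have opy : free_op [set y] x.
  apply: antichain_free_op => // [z /set1P ->//|z w /set1P -> /set1P ->//].
have [_ /free_op_le] := tree_hom_free_op f opy; apply.
by rewrite imset_set1 set11.
Qed.

(** Incomparable x and y are the inputs of an operation with output the root; its image has
    distinct, incomparable inputs. *)
Lemma closed_hom_reflect x y : f x >=< f y -> x >=< y.
Proof.
move=> fxy; apply: contraT => nxy.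
have anti : {in [set x; y] &, forall z w, z >=< w -> z = w}.
  move=> z w /set2P[->|->] /set2P[->|->] // zw; first by rewrite zw in nxy.
  by rewrite comparable_sym zw in nxy.
have op2 : free_op [set x; y] (\bot : T).
  by apply: antichain_free_op => // z _; exact: le0x.
have [inj2 op2'] := tree_hom_free_op f op2.
have xy : x = y.
  apply: inj2; rewrite ?set21 ?set22 //.
  by apply: (free_op_antichain op2') => //; apply: imset_f; rewrite ?set21 ?set22.
by rewrite xy /Order.comparable lexx in nxy.
Qed.

Lemma closed_hom_le x y : injective f -> (f x <= f y) = (x <= y).
Proof.
move=> inj_f; apply/idP/idP => [fxy|]; last exact: closed_hom_mono.
have /closed_hom_reflect/orP[//|yx] : f x >=< f y by rewrite /Order.comparable fxy.
have /inj_f -> // : f x = f y.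
by apply/le_anti; rewrite fxy closed_hom_mono.
Qed.

Lemma closed_hom_lt x y : injective f -> (f x < f y) = (x < y).
Proof. by move=> inj_f; rewrite !lt_neqAle closed_hom_le // (inj_eq inj_f). Qed.

End ClosedHom.

Definition closed_hom (T T' : tree) (T'0 : leaves T' = set0) (f : T -> T')
    (fm : {homo f : x y / x <= y}) (fr : forall x y, f x >=< f y -> x >=< y) : tree_hom T T' :=
  @TreeHom T T' f (closed_hom_proof T'0 fm fr).

Lemma factor_ex (A B T : tree) (a : tree_hom A T) (b : tree_hom B T) :
  leaves A = set0 -> leaves B = set0 -> injective b -> (forall x, exists y, b y = a x) ->
  exists u : tree_hom A B, tree_comp b u = a.
Proof.
move=> A0 B0 b_inj ab; have [u uP] := choice ab.
have um : {homo u : x y / x <= y}.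
  by move=> x y xy; rewrite -(closed_hom_le B0 _ _ b_inj) !uP; exact: closed_hom_mono.
have ur x y : u x >=< u y -> x >=< y.
  move=> /orP uxy; apply: (closed_hom_reflect (f := a) A0); rewrite -!uP.
  by apply/orP; case: uxy => /(closed_hom_mono b B0); [left|right].
by exists (closed_hom B0 um ur); apply: tree_hom_ext.
Qed.

Definition factor (A B T : tree) (a : tree_hom A T) (b : tree_hom B T) A0 B0 b_inj ab :
    tree_hom A B := sval (cid (@factor_ex A B T a b A0 B0 b_inj ab)).

Lemma factorE (A B T : tree) (a : tree_hom A T) (b : tree_hom B T) A0 B0 b_inj ab x :
  b (@factor A B T a b A0 B0 b_inj ab x) = a x.
Proof. by rewrite -[in RHS](proj2_sig (cid (factor_ex A0 B0 b_inj ab))). Qed.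

Lemma tree_hom_cancel (A B T : tree) (b : tree_hom B T) (u v : tree_hom A B) :
  injective b -> (forall x, b (u x) = b (v x)) -> u = v.
Proof. by move=> b_inj e; apply: tree_hom_ext => x; exact: b_inj. Qed.

(** * Trees from posets *)

Section PosetTree.
Variables (E : finType) (le : rel E) (b : E).

Record poset_axioms : Prop := PosetAxioms {
  pa_refl : reflexive le;
  pa_anti : antisymmetric le;
  pa_trans : transitive le;
  pa_bot : forall x, le b x;
  pa_linear : forall x y z, le y x -> le z x -> le y z || le z y }.

End PosetTree.

(** The alias carries the proof [H], which lets the order instances be inferred from the type. *)
Definition poset_edge (E : finType) (le : rel E) (b : E) (H : poset_axioms le b) : Type := E.

Fact poset_display : Order.disp_t. Proof. exact: Order.Disp tt tt. Qed.

Section PosetEdge.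
Variables (E : finType) (le : rel E) (b : E) (H : poset_axioms le b).
HB.instance Definition _ := Finite.copy (poset_edge H) E.
HB.instance Definition _ := Order.Le_isPOrder.Build poset_display (poset_edge H)
  (pa_refl H) (pa_anti H) (pa_trans H).
Fact poset_bot (x : poset_edge H) : (b : poset_edge H) <= x.
Proof. exact: (pa_bot H). Qed.
HB.instance Definition _ := Order.hasBottom.Build poset_display (poset_edge H) poset_bot.
End PosetEdge.

Program Definition poset_tree (E : finType) (le : rel E) (b : E) (H : poset_axioms le b) : tree :=
  @Tree _ (poset_edge H) set0 _ _.
Next Obligation. by move=> E le b H x y z yx zx; exact: (pa_linear H yx zx). Qed.
Next Obligation. by move=> E le b H l x; rewrite inE. Qed.

(** * Subtrees *)

Section Subtree.
Variables (T : tree) (Q : pred T) (r : T).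
Hypotheses (Qr : Q r) (Qmin : forall x, Q x -> r <= x).

Fact subtree_axioms :
  @poset_axioms {x : T | Q x} (fun x y => sval x <= sval y) (exist _ r Qr).
Proof.
split=> [x|x y|y x z|x|x y z] /=.
- exact: lexx.
- by move=> xy; apply: val_inj; exact: le_anti.
- exact: le_trans.
- exact/Qmin/(proj2_sig x).
- by move=> yx zx; exact: (tree_linear yx zx).
Qed.

Definition subtree : tree := poset_tree subtree_axioms.

Hypothesis T0 : leaves T = set0.

Fact subtree_homo : {homo (fun x : subtree => sval (x : {x : T | Q x})) : x y / x <= y}.
Proof. by []. Qed.

Fact subtree_reflect (x y : subtree) :
  sval (x : {x : T | Q x}) >=< sval (y : {x : T | Q x}) -> x >=< y.
Proof. by []. Qed.

Definition subtree_map : tree_hom subtree T := closed_hom T0 subtree_homo subtree_reflect.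

Lemma subtree_map_inj : injective subtree_map.
Proof. by move=> x y; exact: val_inj. Qed.

Lemma subtree_map_in x : Q (subtree_map x).
Proof. exact: (proj2_sig x). Qed.

Lemma subtree_map_onto x : Q x -> exists y, subtree_map y = x.
Proof. by move=> Qx; exists (exist _ x Qx). Qed.

End Subtree.

Lemma inputs_closed (T : tree) (e x : T) :
  (x \in inputs e) <-> e < x /\ forall y, e < y -> y <= x -> y = x.
Proof.
rewrite inE; split=> [/andP[ex /forallP nx]|[ex xmin]].
  split=> // y ey yx; apply: contraTeq isT => yx'.
  by have := nx y; rewrite ey lt_neqAle yx' yx.
rewrite ex; apply/forallP => y; apply/negP => /andP[ey yx].
by have := xmin y ey (ltW yx) => e'; rewrite e' ltxx in yx.
Qed.

Lemma inputs_embedding (A T : tree) (m : tree_hom A T) (e : A) :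
  leaves A = set0 -> injective m ->
  (forall x y, e < x -> m e <= y -> y <= m x -> exists z, m z = y) ->
  m @: inputs e \subset inputs (m e).
Proof.
move=> A0 m_inj conv; apply/subsetP => _ /imsetP[x /inputs_closed[ex xmin] ->].
apply/inputs_closed; split=> [|y ey yx]; first by rewrite closed_hom_lt.
have [z zy] := conv x y ex (ltW ey) yx.
by rewrite -zy (xmin z) // -?(closed_hom_lt A0 _ _ m_inj) -?(closed_hom_le A0 _ _ m_inj) zy.
Qed.

(** For a convex [Q] a cover in the subtree is a cover in [T], so valences do not grow. *)
Lemma dendroidal_subtree k (T : tree) (Q : pred T) (r : T) (Qr : Q r)
    (Qmin : forall x, Q x -> r <= x) :
  leaves T = set0 -> dendroidal k T ->
  (forall x y z, Q x -> Q z -> x <= y -> y <= z -> Q y) ->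
  dendroidal k (subtree Qr Qmin).
Proof.
move=> T0 /forallP Tk conv; apply/forallP => e.
have m_inj := @subtree_map_inj T Q r Qr Qmin T0.
apply: leinf_trans (Tk (subtree_map Qr Qmin T0 e)).
rewrite /= /valence -(card_imset _ m_inj); apply: subset_leq_card.
apply: inputs_embedding => // x y ex ey yx; apply: subtree_map_onto.
exact: conv (subtree_map_in T0 e) (subtree_map_in T0 x) ey yx.
Qed.

(** * The coreflection onto rooted max-surjective maps *)

Section Rmax.
Variables (k j : option nat) (kj : leinf k j) (T : ctree j).
Let p := op_functor (inclusion kj).
Let O := over p T.

Definition hull (X : tree) (f : tree_hom T X) : pred X :=
  fun y => (f \bot <= y) && [exists e, y <= f e].

Lemma hull_root (X : tree) (f : tree_hom T X) : hull f (f \bot).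
Proof. by rewrite /hull lexx; apply/existsP; exists \bot. Qed.

Lemma hull_min (X : tree) (f : tree_hom T X) y : hull f y -> f \bot <= y.
Proof. by case/andP. Qed.

Lemma hull_convex (X : tree) (f : tree_hom T X) x y z :
  hull f x -> hull f z -> x <= y -> y <= z -> hull f y.
Proof.
move=> /andP[fx _] /andP[_ /existsP[e ze]] xy yz.
by rewrite /hull (le_trans fx xy); apply/existsP; exists e; exact: le_trans ze.
Qed.

Definition hull_ctree (X : ctree k) (f : tree_hom T X) : ctree k :=
  @CTree k (subtree (hull_root f) (@hull_min X f)) erefl
    (dendroidal_subtree (hull_root f) (@hull_min X f) (ctree_closed X) (ctree_dendroidal X) (@hull_convex X f)).

Definition hull_map (X : ctree k) (f : tree_hom T X) : tree_hom (hull_ctree f) X :=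
  subtree_map (hull_root f) (@hull_min X f) (ctree_closed X).

Lemma hull_map_inj (X : ctree k) (f : tree_hom T X) : injective (hull_map f).
Proof. exact: subtree_map_inj. Qed.

Lemma in_hull (X : ctree k) (f : tree_hom T X) e : hull f (f e).
Proof.
rewrite /hull (closed_hom_mono f (ctree_closed T)) ?le0x //=.
by apply/existsP; exists e.
Qed.

Lemma hull_unit_ex (X : ctree k) (f : tree_hom T X) e : exists y, hull_map f y = f e.
Proof. exact/subtree_map_onto/in_hull. Qed.

Definition hull_unit (X : ctree k) (f : tree_hom T X) : tree_hom T (hull_ctree f) :=
  factor (ctree_closed T) (ctree_closed (hull_ctree f)) (@hull_map_inj X f) (hull_unit_ex f).

Lemma hull_unitE (X : ctree k) (f : tree_hom T X) e : hull_map f (hull_unit f e) = f e.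
Proof. exact: factorE. Qed.

Lemma hull_unit_rmax (X : ctree k) (f : tree_hom T X) :
  rooted (hull_unit f) && max_surjective (hull_unit f).
Proof.
apply/andP; split.
  by apply/eqP/hull_map_inj; rewrite hull_unitE.
apply/forallP => y; have /andP[_ /existsP[e ye]] := subtree_map_in (Qr := hull_root f) (Qmin := @hull_min X f) (ctree_closed X) y.
apply/existsP; exists e.
by rewrite -(closed_hom_le (f := hull_map f) (ctree_closed (hull_ctree f)) _ _ (@hull_map_inj X f)) hull_unitE.
Qed.

Definition rmax_ob (X : ctree k) (f : tree_hom T X) (fP : rooted f && max_surjective f) :
    rmax kj T :=
  exist (fun x : under (inclusion kj) T => rooted (tagged x : tree_hom _ _) && max_surjective (tagged x : tree_hom _ _))
    (existT (fun X : Omegac k => @hom (Omegac j) T (inclusion kj X)) X f) fP.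

Definition coreflect (a : O) : op (rmax kj T) :=
  rmax_ob (hull_unit_rmax (X := tag a) (tagged a)).

Lemma hull_functor_ex (a b : O) (u : hom a b) x :
  exists y, hull_map (X := tag a) (tagged a) y = tree_comp (sval u) (hull_map (X := tag b) (tagged b)) x.
Proof.
case: a b u x => [X f] [Y g] [u /= ug] x.
have ugE e : u (g e) = f e by rewrite -ug.
apply: (subtree_map_onto (hull_root f) (@hull_min X f) (ctree_closed X)); rewrite /=.
have /andP[gx /existsP[e xe]] := subtree_map_in (Qr := hull_root g) (Qmin := @hull_min Y g) (ctree_closed Y) x.
have um := closed_hom_mono u (ctree_closed Y).
apply/andP; split; first by rewrite -ugE; exact: um.
by apply/existsP; exists e; rewrite -ugE; exact: um.
Qed.

Definition hull_functor (a b : O) (u : hom a b) :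
    tree_hom (hull_ctree (X := tag b) (tagged b)) (hull_ctree (X := tag a) (tagged a)) :=
  factor (ctree_closed _) (ctree_closed _) (@hull_map_inj (tag a) (tagged a)) (hull_functor_ex u).

Lemma hull_functorE (a b : O) (u : hom a b) x :
  hull_map (X := tag a) (tagged a) (hull_functor u x) = sval u (hull_map (X := tag b) (tagged b) x).
Proof. exact: factorE. Qed.

Program Definition coreflection : functor O (op (rmax kj T)) :=
  @Functor O (op (rmax kj T)) coreflect (fun a b u => exist _ (hull_functor u) _) _ _.
Next Obligation.
move=> a b u; apply: (tree_hom_cancel (@hull_map_inj (tag a) (tagged a))) => e.
rewrite [LHS](hull_functorE u) !hull_unitE.
exact: (congr1 (fun h : tree_hom T (tag a) => h e) (svalP u)).
Qed.
Next Obligation.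
move=> a; apply: sig_ext; apply: (tree_hom_cancel (@hull_map_inj (tag a) (tagged a))) => x.
exact: etrans (hull_functorE (@idm O a) x) erefl.
Qed.
Next Obligation.
move=> a b c v u; apply: sig_ext; apply: (tree_hom_cancel (@hull_map_inj (tag a) (tagged a))) => x.
by rewrite [LHS](hull_functorE (@comp O a b c v u)) [RHS](@hull_functorE a b u) (@hull_functorE b c v).
Qed.

Program Definition rmax_over : functor (op (rmax kj T)) O :=
  @Functor (op (rmax kj T)) O
    (fun x => existT (fun X : op (Omegac k) => @hom (op (Omegac j)) (p X) T) (tag (sval x)) (tagged (sval x)))
    (fun x y u => exist _ (sval u) (svalP u)) _ _.
Next Obligation. by move=> x; exact: sig_ext. Qed.
Next Obligation. by move=> x y z v u; exact: sig_ext. Qed.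

Lemma rmax_cofinal (D : diagram O) : weak_equiv (hocolim_push (reindex_over rmax_over D)).
Proof.
have alP (a : O) : comp (tagged (rmax_over (coreflection a))) (fmor p (hull_map (X := tag a) (tagged a))) = tagged a.
  by apply: tree_hom_ext => e; exact: hull_unitE.
pose al (a : O) : hom a (rmax_over (coreflection a)) := exist _ (hull_map (X := tag a) (tagged a)) (alP a).
have beP (x : op (rmax kj T)) : tree_comp (hull_map (X := tag (sval x)) (tagged (sval x)))
    (hull_unit (X := tag (sval x)) (tagged (sval x))) = tagged (sval x).
  by apply: tree_hom_ext => e; exact: hull_unitE.
pose be (x : op (rmax kj T)) : hom x (coreflection (rmax_over x)) :=
  exist _ (hull_map (X := tag (sval x)) (tagged (sval x))) (beP x).
apply: (@hocolim_cofinal _ _ rmax_over coreflection D al _ be).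
- move=> a b u; apply: sig_ext; apply: tree_hom_ext => x; exact: (hull_functorE u).
- move=> a b u; apply: sig_ext; apply: tree_hom_ext => x; exact: (hull_functorE (fmor rmax_over u)).
- move=> a n x; congr (smap_fun (dmor D _) n x); exact: sig_ext.
Qed.

Lemma weak_equiv_colim_rmax (F : presheaf (Omegac j)) :
  weak_equiv (colim_map (rmax_cone kj T) F) <-> weak_equiv (lan_counit p F T).
Proof.
pose D : diagram O := reindex (over_functor p T) (reindex p F).
pose E := pullback (rmax_functor kj T) F.
(* [i] is the identity on values; it mediates between two presentations of the same diagram. *)
pose i : diagram_map E (reindex rmax_over D) :=
  @DiagramMap _ E (reindex rmax_over D) (fun x => smap_id _) (fun _ _ _ _ _ => erefl).
pose c := smap_comp (lan_of_hocolim p (reindex p F) T)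
  (smap_comp (hocolim_push (reindex_over rmax_over D)) (hocolim_map i)).
have wc : weak_equiv c.
  apply: weak_equiv_comp; last exact: weak_equiv_lan_of_hocolim.
  apply: weak_equiv_comp; last exact: rmax_cofinal.
  by apply: weak_equiv_hocolim => x; exact: weak_equiv_id.
have -> : colim_map (rmax_cone kj T) F = smap_comp (lan_counit p F T) c.
  apply: smap_ext => n [s x]; congr (smap_fun (dmor F _) n x).
  exact/esym/(svalP (chain_total s)).
split=> w; first exact: weak_equiv_cancel_right wc w.
exact: weak_equiv_comp.
Qed.

End Rmax.

#[local] Obligation Tactic := idtac.

(** * Edges and vertices of a closed tree *)

Lemma dendroidal_eta j : dendroidal j eta.
Proof.
apply/forallP => e; have := valence_le_card e.
by rewrite card_ord ltnS leqn0 => /eqP ->; case: j.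
Qed.

Definition point_tree j : ctree j := ctree_closure (dendroidal_eta j).

Lemma point_tree_eq j (x y : point_tree j) : x = y.
Proof. by apply/val_inj; case: x y => [[|//] ?] [[|//] ?]. Qed.

Lemma point_homo j (X : ctree j) (x : X) : {homo (fun _ : point_tree j => x) : y z / y <= z}.
Proof. by []. Qed.

Lemma point_reflect j (X : ctree j) (x : X) (y z : point_tree j) : x >=< x -> y >=< z.
Proof. by move=> _; rewrite (point_tree_eq y z) /Order.comparable lexx. Qed.

Definition point_map j (X : ctree j) (x : X) : tree_hom (point_tree j) X :=
  closed_hom (ctree_closed X) (@point_homo j X x) (@point_reflect j X x).

Section Elements.
Variables (j : option nat) (X : ctree j).

Definition in_star (x y : X) : bool := (y == x) || (y \in inputs x).

Lemma in_star_root x : in_star x x. Proof. by rewrite /in_star eqxx. Qed.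

Lemma in_star_min x y : in_star x y -> x <= y.
Proof. by case/orP => [/eqP ->|/inputs_lt/ltW]. Qed.

Lemma in_star_convex v x y z : in_star v x -> in_star v z -> x <= y -> y <= z -> in_star v y.
Proof.
move=> vx /orP[/eqP->|zv] xy yz.
  have /le_anti -> : y <= v <= y by rewrite yz (le_trans (in_star_min vx) xy).
  exact: in_star_root.
have [->|yv] := eqVneq y v; first exact: in_star_root.
have /inputs_closed[_ zmin] := zv.
rewrite (zmin y) // ?/in_star ?zv ?orbT // lt_neqAle eq_sym yv.
exact: le_trans (in_star_min vx) xy.
Qed.

Definition star_ctree (x : X) : ctree j :=
  @CTree j (subtree (in_star_root x) (@in_star_min x)) erefl
    (dendroidal_subtree (in_star_root x) (@in_star_min x) (ctree_closed X) (ctree_dendroidal X)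
       (@in_star_convex x)).

(* (false, x) is the edge x and (true, x) the vertex with output x; a vertex
   without inputs is omitted because its closed corolla is the edge x. *)
Definition element : Type := {p : bool * X | p.1 ==> (inputs p.2 != set0)}.

Definition elt (p : element) : ctree j :=
  if (sval p).1 then star_ctree (sval p).2 else point_tree j.

Definition elm (p : element) : tree_hom (elt p) X :=
  if (sval p).1 as b return tree_hom (if b then star_ctree (sval p).2 else point_tree j) X
  then subtree_map (in_star_root (sval p).2) (@in_star_min (sval p).2) (ctree_closed X)
  else point_map (sval p).2.

Definition el_in (p : element) (y : X) : bool :=
  if (sval p).1 then in_star (sval p).2 y else y == (sval p).2.

Lemma elm_inj p : injective (elm p).
Proof.
rewrite /elm /elt; case: (sval p).1 => x y; first exact: subtree_map_inj.
by move=> _; exact: point_tree_eq.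
Qed.

Lemma el_inP p y : reflect (exists z, elm p z = y) (el_in p y).
Proof.
apply: (iffP idP); rewrite /el_in /elm /elt; case: (sval p).1.
- exact: subtree_map_onto.
- by move/eqP => ->; exists ord0.
- by case=> z <-; exact: subtree_map_in.
- by case=> z <-.
Qed.

Definition edge_el (x : X) : element :=
  exist (fun p : bool * X => p.1 ==> (inputs p.2 != set0)) (false, x) isT.

Lemma star_el_proof (x : X) : inputs x != set0 -> (true, x).1 ==> (inputs (true, x).2 != set0).
Proof. by []. Qed.

Definition star_el (x : X) (xi : inputs x != set0) : element :=
  exist (fun p : bool * X => p.1 ==> (inputs p.2 != set0)) (true, x) (star_el_proof xi).

Lemma elementP (p : element) :
  (exists x, p = edge_el x) \/ (exists x (xi : inputs x != set0), p = star_el xi).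
Proof.
case: p => [[[] x] xi]; last by left; exists x; apply: val_inj.
by right; exists x, xi; apply: val_inj.
Qed.

Lemma el_in_edge x y : el_in (edge_el x) y = (y == x). Proof. by []. Qed.
Lemma el_in_star x xi y : el_in (@star_el x xi) y = in_star x y. Proof. by []. Qed.

Lemma el_sub_edge p x : (forall y, el_in p y -> y = x) -> p = edge_el x.
Proof.
case: (elementP p) => [[z ->] e|[z [zi ->]] e]; first by rewrite (e z) // el_in_edge.
have [w wz] := set0Pn _ zi.
have ez : z = x by apply: e; rewrite el_in_star in_star_root.
have ew : w = x by apply: e; rewrite el_in_star /in_star wz orbT.
by have := inputs_lt wz; rewrite [X in X < _]ez ew ltxx.
Qed.

(** The output [x] and one input [w] of the vertex both lie in [p], which rules out an edge and any
    vertex with another output. *)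
Lemma el_star_sub x xi p : (forall y, el_in (@star_el x xi) y -> el_in p y) -> p = star_el xi.
Proof.
have [w wx] := set0Pn _ xi; have xw := inputs_lt wx.
move=> sub; have px : el_in p x by apply: sub; rewrite el_in_star in_star_root.
have pw : el_in p w by apply: sub; rewrite el_in_star /in_star wx orbT.
case: (elementP p) px pw {sub} => [[z ->]|[z [zi ->]]].
  by rewrite !el_in_edge => /eqP xz /eqP wz; rewrite xz wz ltxx in xw.
rewrite !el_in_star => /orP[/eqP xz _|xz].
  by subst z; apply: val_inj.
rewrite /in_star => /orP[/eqP wz|wz].
  by rewrite wz in xw; have := lt_trans xw (inputs_lt xz); rewrite ltxx.
have /inputs_closed[_ wmin] := wz.
have e := wmin x (inputs_lt xz) (ltW xw).
by rewrite e ltxx in xw.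
Qed.

Variable P : element -> Prop.

Definition el_slice (p : {p : element | P p}) : @slice (Omegac j) X :=
  existT (fun Y : Omegac j => @hom (Omegac j) Y X) (elt (sval p)) (elm (sval p)).

(** A preorder: a morphism exists exactly for an inclusion of edge sets, and it is unique because
    the maps [elm] are injective. *)
Definition El : category := induced el_slice.

Definition El_functor : functor El (Omegac j) :=
  functor_comp (@slice_functor (Omegac j) X) (induced_functor el_slice).

Lemma El_homE (p q : El) (u : hom p q) x : elm (sval q) (sval u x) = elm (sval p) x.
Proof. exact: (congr1 (fun h : tree_hom _ _ => h x) (svalP u)). Qed.

Lemma El_thin (p q : El) (u v : hom p q) : u = v.
Proof.
apply: sig_ext; apply: (tree_hom_cancel (@elm_inj (sval q))) => x.
have eu := congr1 (fun h : tree_hom _ _ => h x) (svalP u).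
by have ev := congr1 (fun h : tree_hom _ _ => h x) (svalP v); rewrite [LHS]eu -[LHS]ev.
Qed.

Lemma El_homP (p q : El) : (exists u : hom p q, True) <-> (forall y, el_in (sval p) y -> el_in (sval q) y).
Proof.
split=> [[u _] y /el_inP[z <-]|sub].
  by apply/el_inP; exists (sval u z); exact: (congr1 (fun h : tree_hom _ _ => h z) (svalP u)).
have ex x : exists y, elm (sval q) y = elm (sval p) x.
  by apply/el_inP/sub/el_inP; exists x.
have uP : tree_comp (elm (sval q)) (factor (ctree_closed _) (ctree_closed _) (@elm_inj (sval q)) ex) =
    elm (sval p) by apply: tree_hom_ext => x; exact: factorE.
by exists (exist (fun u : tree_hom _ _ => tree_comp (elm (sval q)) u = elm (sval p)) _ uP).
Qed.

Definition El_hom (p q : El) (sub : forall y, el_in (sval p) y -> el_in (sval q) y) : hom p q :=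
  sval (cid ((El_homP p q).2 sub)).

End Elements.

Lemma restrict_comp j (F : presheaf (Omegac j)) (A B C : ctree j) (g : tree_hom B C)
    (f : tree_hom A B) n x :
  @restrict (Omegac j) F A B f n (@restrict (Omegac j) F B C g n x) =
  @restrict (Omegac j) F A C (tree_comp g f) n x.
Proof. by rewrite /restrict -(@dmorM _ F). Qed.

Lemma restrict_id j (F : presheaf (Omegac j)) (A : ctree j) (f : tree_hom A A) n x :
  (forall a, f a = a) -> @restrict (Omegac j) F A A f n x = x.
Proof.
move=> fE; have -> : f = tree_id A by exact: tree_hom_ext.
exact: (@dmor1 _ F).
Qed.

Lemma corolla_leaf n (x : corolla n) : (x \in leaves (corolla n)) = (x != ord0).
Proof. by rewrite inE. Qed.

Lemma card_corolla_leaves n : #|leaves (corolla n)| = n.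
Proof.
rewrite (_ : leaves _ = ~: [set (ord0 : corolla n)]) ?cardsC1 ?card_ord //.
by apply/setP => x; rewrite corolla_leaf !inE.
Qed.

Lemma corolla_inputs n : inputs (ord0 : corolla n) = leaves (corolla n).
Proof.
apply/setP => x; rewrite !inE; apply/andP/idP => [[lt0 _]|x0]; first by rewrite gt_eqF.
rewrite lt_neqAle eq_sym x0 star_le0x; split=> //; apply/forallP => y.
apply/negP => /andP[y0 yx]; move: (ltW yx); rewrite {1}/Order.le /= /star_le.
by case/orP => /eqP e; [rewrite e ltxx in y0 | rewrite e ltxx in yx].
Qed.

Lemma thin_functor_ex (C D : category) (o : C -> D) :
  (forall (a b : D) (u v : hom a b), u = v) ->
  (forall (a b : C) (u : hom a b), exists v : hom (o a) (o b), True) ->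
  exists f : functor C D, f = o :> (C -> D).
Proof.
move=> thin ex; pose f a b u := sval (cid (@ex a b u)).
by exists (@Functor C D o f (fun _ => thin _ _ _ _) (fun _ _ _ _ _ => thin _ _ _ _)).
Qed.

Lemma choice_dep (A : Type) (B : A -> Type) (R : forall a, B a -> Prop) :
  (forall a, exists b, R a b) -> exists f : forall a, B a, forall a, R a (f a).
Proof. by move=> ex; exists (fun a => sval (cid (ex a))) => a; exact: proj2_sig (cid (ex a)). Qed.

(** * The Segal condition in terms of elements *)

Section SegalElements.
Variables (j : option nat) (F : presheaf (Omegac j)).
Hypothesis segalF : segal F.
Variables (X X' : ctree j) (m : tree_hom X' X) (P : element X -> Prop).
Hypothesis m_inj : injective m.
Hypothesis m_inputs : forall x, inputs x != set0 -> inputs (m x) = m @: inputs x.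
Hypothesis PE : forall p, P p <-> (forall y, el_in p y -> exists z, m z = y).

Lemma el_lift_ex (p : El P) x : exists y, m y = elm (sval p) x.
Proof. by apply: (PE _).1 (proj2_sig p) _ _; apply/el_inP; exists x. Qed.

Definition el_lift (p : El P) : tree_hom (elt (sval p)) X' :=
  factor (ctree_closed _) (ctree_closed _) m_inj (@el_lift_ex p).

Lemma el_liftE (p : El P) x : m (el_lift p x) = elm (sval p) x.
Proof. exact: factorE. Qed.

Program Definition El_cocone : @cocone (El P) (Omegac j) (El_functor P) X' :=
  @Cocone (El P) (Omegac j) (El_functor P) X' (fun p => el_lift p) _.
Next Obligation.
move=> p q u; apply: (tree_hom_cancel m_inj) => x.
rewrite [LHS]el_liftE el_liftE.
exact: (congr1 (fun h : tree_hom _ _ => h x) (svalP u)).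
Qed.

Let W := Omega_el X'.
Definition oel_map (a : W) : tree_hom (elementary (tag (sval a))) X' := tagged (sval a).

Lemma oel_inj (a : W) : injective (oel_map a).
Proof. by have /andP[/andP[/injectiveP inj _] _] := proj2_sig a. Qed.

Lemma oel_homE (a b : W) (u : hom a b) x : oel_map b (sval u x) = oel_map a x.
Proof. exact: (congr1 (fun h : tree_hom _ _ => h x) (svalP u)). Qed.

Definition oel_tree (a : W) : ctree j := Omega_el_functor X' a.

Definition oel_emb (a : W) : tree_hom (oel_tree a) X :=
  tree_comp m (closure_adjunct (ctree_closed X') (oel_map a)).

Lemma oel_emb_inj (a : W) : injective (oel_emb a).
Proof. by move=> x y /m_inj/oel_inj. Qed.

Lemma oel_hom_emb (a b : W) (u : hom a b) x : oel_emb b (sval u x) = oel_emb a x.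
Proof. by congr (m _); exact: oel_homE. Qed.

Lemma oel_thin (a b : W) (u v : hom a b) : u = v.
Proof.
apply: sig_ext; apply: (tree_hom_cancel (@oel_inj b)) => x.
have eu := congr1 (fun h : tree_hom _ _ => h x) (svalP u).
by have ev := congr1 (fun h : tree_hom _ _ => h x) (svalP v); rewrite [LHS]eu -[LHS]ev.
Qed.

(** The image of a subtree inclusion is convex, so leaves go to inputs of the image of the root; the
    valence condition makes this injection a bijection by counting. *)
Lemma oel_star n (f : tree_hom (corolla n) X') aP :
  let a : W := exist _ (existT (fun t => tree_hom (elementary t) X') (Some n) f) aP in
  forall y, (exists z, f z = y) <-> in_star (f ord0) y.
Proof.
have /andP[f_incl /eqP f_val] := aP => a.
have f_inj : injective f := @oel_inj a.
have [] := thfunP f (e := (ord0 : corolla n)); first by rewrite corolla_leaf.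
rewrite corolla_inputs => _ op.
have sub : f @: leaves (corolla n) \subset inputs (f ord0).
  apply/subsetP => _ /imsetP[z zl ->].
  have lz : f ord0 < f z.
    rewrite lt_neqAle (inj_eq f_inj) eq_sym -corolla_leaf zl /=.
    by apply: free_op_le op _; exact: imset_f.
  apply/inputs_closed; split=> // y ly yz.
  have /andP[_ /forallP/(_ (ord0 : corolla n))/forallP/(_ y)/forallP/(_ z)] := f_incl.
  rewrite (ltW ly) yz => /codomP[w yw].
  have wl : w \in leaves (corolla n).
    by rewrite corolla_leaf; apply: contraTneq ly => w0; rewrite yw w0 ltxx.
  rewrite yw; apply: (free_op_antichain op); rewrite ?imset_f //.
  by rewrite -yw /Order.comparable yz.
have im : f @: leaves (corolla n) = inputs (f ord0).
  apply/eqP; rewrite eqEcard sub (card_imset _ f_inj) card_corolla_leaves.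
  exact: eq_leq f_val.
move=> y; split=> [[z <-]|].
  rewrite /in_star -im; have [->|z0] := eqVneq z ord0; first by rewrite eqxx.
  by rewrite imset_f ?orbT // corolla_leaf.
case/orP=> [/eqP ->|]; first by exists ord0.
by rewrite -im => /imsetP[z _ ->]; exists z.
Qed.

Lemma corolla_hom_ex n (x : X') : valence x = n ->
  exists2 a : W, tag (sval a) = Some n & forall y, (exists z, oel_map a z = y) <-> in_star x y.
Proof.
move=> <-; pose f (z : corolla (valence x)) : X' := if unlift ord0 z is Some i then enum_val i else x.
have f0 : f ord0 = x by rewrite /f unlift_none.
have fS i : f (lift ord0 i) = enum_val i by rewrite /f liftK.
have f_inputs z : z != ord0 -> f z \in inputs x.
  by case: (unliftP ord0 z) => [i -> _|->]; rewrite ?eqxx // fS enum_valP.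
have f_inj : injective f.
  move=> y z; case: (unliftP ord0 y) => [i ->|->]; case: (unliftP ord0 z) => [i' ->|->] //.
  - by rewrite !fS => /enum_val_inj ->.
  - rewrite fS f0 => e; have := enum_valP i; rewrite e => /inputs_lt.
    by rewrite ltxx.
  - rewrite fS f0 => e; have := enum_valP i'; rewrite -e => /inputs_lt.
    by rewrite ltxx.
have fP (e : corolla (valence x)) : e \notin leaves (corolla (valence x)) ->
    {in inputs e &, injective f} /\ free_op (f @: inputs e) (f e).
  rewrite corolla_leaf negbK => /eqP ->; split; first by move=> y z _ _ /f_inj.
  apply: antichain_free_op; first exact: ctree_closed.
    by move=> y /imsetP[z]; rewrite corolla_inputs corolla_leaf f0 => /f_inputs/inputs_lt/ltW xz ->.
  move=> _ _ /imsetP[y yi ->] /imsetP[z zi ->]; move: yi zi.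
  by rewrite corolla_inputs !corolla_leaf => /f_inputs yi /f_inputs zi /(inputs_comp yi zi).
pose g : tree_hom (elementary (Some (valence x))) X' := @TreeHom (corolla (valence x)) X' f fP.
have f_img y : (exists z, f z = y) <-> in_star x y.
  split=> [[z <-]|/orP[/eqP->|yx]].
  - rewrite /in_star; have [->|/f_inputs ->] := eqVneq z ord0; rewrite ?orbT //.
    by rewrite f0 eqxx.
  - by exists ord0.
  - by exists (lift ord0 (enum_rank_in yx y)); rewrite fS enum_rankK_in.
have gP : subtree_inclusion g && (valence (g \bot) == valence x).
  apply/andP; split; last by rewrite -[g _]/(f ord0) f0.
  apply/andP; split; first exact/injectiveP.
  apply/forallP => a; apply/forallP => b; apply/forallP => c; apply/implyP => /andP[ab bc].
  have /f_img[z <-] : in_star x b; last exact: codom_f.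
  apply: (@in_star_convex j X' x (f a) b (f c)) => //; apply/f_img; first by exists a.
  by exists c.
by exists (exist _ (existT (fun t => tree_hom (elementary t) X') (Some (valence x)) g) gP).
Qed.

Lemma point_hom_ex (x : X') :
  exists2 a : W, tag (sval a) = None & forall y, (exists z, oel_map a z = y) <-> y = x.
Proof.
have eta1 (y z : eta) : y = z by apply/val_inj; case: y z => [[|//] ?] [[|//] ?].
have fP (e : eta) : e \notin leaves eta -> {in inputs e &, injective (fun=> x)} /\
    free_op ((fun=> x) @: inputs e) x.
  by rewrite (eta1 e ord_max) inE eqxx.
pose g : tree_hom (elementary None) X' := @TreeHom eta X' (fun=> x) fP.
have gP : subtree_inclusion g && true.
  rewrite andbT; apply/andP; split; first by apply/injectiveP => y z _; exact: eta1.
  apply/forallP => a; apply/forallP => b; apply/forallP => c; apply/implyP => ab.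
  by rewrite -(@le_anti _ _ x b ab) -[x in x \in _]/(g ord0) codom_f.
exists (exist _ (existT (fun t => tree_hom (elementary t) X') None g) gP) => //.
by move=> y; split=> [[z <-] //|->]; exists ord0.
Qed.

(** The operation of a corolla must go to an operation of the elementary tree [b] itself, not of its
    closure. From [eta] containment of edges suffices, while for a corolla [b] has to be a corolla
    with the same edges. *)
Lemma oel_hom_ex (a b : W) :
  (forall y, (exists z, oel_map a z = y) -> exists z, oel_map b z = y) ->
  (tag (sval a) -> tag (sval b) /\
     forall y, (exists z, oel_map b z = y) -> exists z, oel_map a z = y) ->
  exists u : hom a b, True.
Proof.
move=> sub eqv.
have ex x : exists y, oel_map b y = oel_map a x by apply: sub; exists x.
have [h hP] := choice ex.
suff hh (e : elementary (tag (sval a))) : e \notin leaves (elementary (tag (sval a))) ->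
    {in inputs e &, injective h} /\ free_op (h @: inputs e) (h e).
  have uP : tree_comp (oel_map b) (TreeHom hh) = oel_map a by exact: tree_hom_ext.
  by exists (exist (fun u : tree_hom _ _ => tree_comp (oel_map b) u = oel_map a) _ uP).
have h_inj : injective h by move=> x y hxy; apply: (@oel_inj a); rewrite -!hP hxy.
case: a b sub eqv ex h hP e h_inj => [[[n|] f] aP] [[[n'|] g] bP] /= sub eqv ex h hP e h_inj eN.
- split; first by move=> x y _ _ /h_inj.
  have [_ /(_ _ _)] := eqv isT => bus.
  have nn' : n = n'.
    apply/eqP; rewrite -eqSS -[X in X == _]card_ord -[X in _ == X]card_ord.
    rewrite -!cardsT -(card_imset _ (@oel_inj (exist _ (existT (fun t => tree_hom (elementary t) X') (Some n) f) aP))).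
    rewrite -(card_imset _ (@oel_inj (exist _ (existT (fun t => tree_hom (elementary t) X') (Some n') g) bP))).
    apply/eqP; congr #|pred_of_set _|; apply/setP => y; apply/imsetP/imsetP.
      by case=> z _ ->; have [z' <-] := ex z; exists z'.
    by case=> z _ ->; have [] := bus (g z) (ex_intro _ z erefl) => z' <-; exists z'.
  subst n'; move: eN; rewrite corolla_leaf negbK => /eqP ->.
  have h0 : h ord0 = ord0.
    apply: (@oel_inj (exist _ (existT (fun t => tree_hom (elementary t) X') (Some n) g) bP)).
    rewrite [LHS]hP; apply/le_anti/andP; split.
      have [z zE] := bus (g ord0) (ex_intro _ ord0 erefl).
      rewrite -[X in _ <= X]zE; apply: (@in_star_min j X'); apply/(oel_star aP).
      by exists z.
    by rewrite -[X in _ <= X]hP; apply: (@in_star_min j X'); apply/(oel_star bP); exists (h ord0).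
  have -> : h @: inputs (ord0 : corolla n) = inputs (ord0 : corolla n).
    rewrite corolla_inputs; apply/eqP; rewrite eqEcard (card_imset _ h_inj) leqnn andbT.
    apply/subsetP => _ /imsetP[z zl ->]; rewrite !corolla_leaf in zl *.
    by rewrite -h0 (inj_eq h_inj).
  have [|_] := thfunP (tree_id (corolla n)) (e := (ord0 : corolla n)); first by rewrite corolla_leaf.
  by rewrite imset_id h0.
- by have [] := eqv isT.
- by move: eN; rewrite (_ : e = ord_max) ?inE ?eqxx //; apply/val_inj; case: e => [[|//] ?].
- by move: eN; rewrite (_ : e = ord_max) ?inE ?eqxx //; apply/val_inj; case: e => [[|//] ?].
Qed.

Lemma oel_emb_hom_ex (a b : W) :
  (forall y, (exists z, oel_emb a z = y) -> exists z, oel_emb b z = y) ->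
  (tag (sval a) -> tag (sval b) /\
     forall y, (exists z, oel_emb b z = y) -> exists z, oel_emb a z = y) ->
  exists u : hom a b, True.
Proof.
move=> sub eqv; apply: oel_hom_ex => [_ [z <-]|ta].
  by have [z' /m_inj z'E] := sub _ (ex_intro _ z erefl); exists z'.
have [tb bus] := eqv ta; split=> // _ [z <-].
by have [z' /m_inj z'E] := bus _ (ex_intro _ z erefl); exists z'.
Qed.

Lemma in_star_image x y : inputs x != set0 ->
  (exists2 z, in_star x z & m z = y) <-> in_star (m x) y.
Proof.
move=> xi; rewrite /in_star m_inputs //; split=> [[z /orP[/eqP->|zx] <-]|/orP[/eqP->|/imsetP[z zx ->]]].
- by rewrite eqxx.
- by rewrite imset_f ?orbT.
- by exists x; rewrite ?eqxx.
- by exists z; rewrite ?zx ?orbT.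
Qed.

Lemma el_to_oel (p : El P) : exists a : W,
  (forall y, (exists z, oel_emb a z = y) <-> el_in (sval p) y) /\
  (tag (sval a) -> (sval (sval p)).1).
Proof.
case: p => p Pp; have pm := (PE p).1 Pp; case: (elementP p) => [[x xE]|[x [xi xE]]]; subst p.
  have [x' x'E] := pm x (eqxx _); have [a aN aE] := point_hom_ex x'.
  exists a; split; last by rewrite aN.
  move=> y; rewrite el_in_edge -x'E; split=> [[z <-]|/eqP ->].
    by rewrite /oel_emb /=; apply/eqP; congr (m _); apply/aE; exists z.
  by have [z zE] := (aE x').2 erefl; exists z; rewrite -zE.
have [x' x'E] := pm x (in_star_root x).
have x'i : inputs x' != set0.
  have [w wx] := set0Pn _ xi.
  have [|w' w'E] := pm w; first by rewrite el_in_star /in_star wx orbT.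
  have := inputs_lt wx; rewrite -x'E -w'E (closed_hom_lt (ctree_closed X')) // => /inputs_below[v vx _].
  by apply/set0Pn; exists v.
have [a aN aE] := corolla_hom_ex (erefl (valence x')).
exists a; split=> // y; rewrite el_in_star -x'E -in_star_image //; split=> [[z <-]|[z /aE[w <-] <-]].
  by exists (oel_map a z) => //; apply/aE; exists z.
by exists w.
Qed.

(** A corolla without leaves goes to an edge element, hence the second clause is only an
    implication. *)
Lemma oel_to_el (a : W) : exists p : El P,
  (forall y, (exists z, oel_emb a z = y) <-> el_in (sval p) y) /\
  ((sval (sval p)).1 -> tag (sval a)).
Proof.
suff [p pE pt] : exists2 p : element X,
    (forall y, (exists z, oel_emb a z = y) <-> el_in p y) & ((sval p).1 -> tag (sval a)).
  have Pp : P p by apply/PE => y /pE[z <-]; exists (oel_map a z).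
  by exists (exist _ p Pp).
have edge (x : X') : (forall z, oel_map a z = x) -> exists2 p : element X,
    (forall y, (exists z, oel_emb a z = y) <-> el_in p y) & ((sval p).1 -> tag (sval a)).
  move=> xE; exists (edge_el (m x)) => // y; rewrite el_in_edge; split=> [[z <-]|/eqP ->].
    by apply/eqP; congr (m _); exact: xE.
  by exists \bot; congr (m _); exact: xE.
case: a edge => [[[n|] f] aP] edge; last first.
  by apply: (edge (f ord0)) => z; congr (f _); apply/val_inj; case: z => [[|//] ?].
have aE := oel_star aP.
have [i0|i0] := eqVneq (inputs (f ord0)) set0.
  apply: (edge (f ord0)) => z.
  have /aE : exists z', f z' = f z by exists z.
  by rewrite /in_star i0 inE orbF => /eqP.
have i0' : inputs (m (f ord0)) != set0.
  rewrite m_inputs //; have [w wi] := set0Pn _ i0.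
  by apply/set0Pn; exists (m w); exact: imset_f.
exists (star_el i0') => // y; rewrite el_in_star -in_star_image //.
split=> [[z <-]|[z /aE[w <-] <-]]; last by exists w.
by exists (f z) => //; apply/aE; exists z.
Qed.

(** The elementary subtrees of [X'] are replaced by the elements of [X] in the image of [m]. The
    categories differ in two ways: a corolla occurs with all labellings of its leaves, and a corolla
    without leaves is not an element. The latter goes to its edge, which has the same closure up to
    isomorphism; so [phi] and [ga] are inverse on values although [al] is not invertible there. *)
Lemma weak_equiv_El_cocone : weak_equiv (lim_map El_cocone F).
Proof.
have [c0 c0P] := choice el_to_oel; have [p0 p0P] := choice oel_to_el.
have [c cE] : exists c : functor (op (El P)) (op W), c = c0 :> (El P -> W).
  have [||c cE] := @thin_functor_ex (op (El P)) (op W) c0; last by exists c.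
    by move=> a b; exact: oel_thin.
  move=> q p u; have sub : forall y, el_in (sval p) y -> el_in (sval q) y.
    by apply/El_homP; exists u.
  apply: oel_emb_hom_ex => [y /(c0P p).1 yp|tp]; first exact/(c0P q).1/sub.
  have p1 := (c0P p).2 tp; suff -> : q = p by [].
  apply: sig_ext; move: p1 sub; case: (elementP (sval p)) => [[x ->] //|[x [xi ->]] _].
  exact: el_star_sub.
have [p pE] : exists p : functor (op W) (op (El P)), p = p0 :> (W -> El P).
  have [||p pE] := @thin_functor_ex (op W) (op (El P)) p0; last by exists p.
    by move=> a b; exact: El_thin.
  move=> b a u; apply/El_homP => y /(p0P a).1[z <-]; apply/(p0P b).1.
  by exists (sval u z); exact: (@oel_hom_emb a b u).
have cP q y : (exists z, oel_emb (c q) z = y) <-> el_in (sval q) y.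
  by rewrite cE; exact: (c0P q).1.
have cT q : tag (sval (c q : W)) -> (sval (sval q)).1 by rewrite cE; exact: (c0P q).2.
have pP a y : (exists z, oel_emb a z = y) <-> el_in (sval (p a : El P)) y.
  by rewrite pE; exact: (p0P a).1.
have pT a : (sval (sval (p a : El P))).1 -> tag (sval a) by rewrite pE; exact: (p0P a).2.
have [al _] : exists al : forall a, @hom (op W) a (c (p a)), True.
  suff /choice_dep[al _] : forall a, exists al : @hom (op W) a (c (p a)), True by exists al.
  move=> a; apply: oel_emb_hom_ex => [y /cP/pP //|/cT/pT ta]; split=> // y yE.
  exact/cP/pP.
have [be _] : exists be : forall q, @hom (op (El P)) q (p (c q)), True.
  suff /choice_dep[be _] : forall q, exists be : @hom (op (El P)) q (p (c q)), True by exists be.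
  by move=> q; apply/El_homP => y /pP/cP.
have phi_ex (q : El P) : exists g : tree_hom (elt (sval q)) (oel_tree (c q)),
    forall x, oel_emb (c q) (g x) = elm (sval q) x.
  have ex x : exists y, oel_emb (c q) y = elm (sval q) x by apply/cP/el_inP; exists x.
  by exists (factor (ctree_closed _) (ctree_closed _) (@oel_emb_inj (c q)) ex) => x; exact: factorE.
have ga_ex (a : W) : exists g : tree_hom (oel_tree a) (elt (sval (p a : El P))),
    forall x, elm (sval (p a : El P)) (g x) = oel_emb a x.
  have ex x : exists y, elm (sval (p a : El P)) y = oel_emb a x.
    by apply/el_inP/pP; exists x.
  by exists (factor (ctree_closed _) (ctree_closed _) (@elm_inj j X (sval (p a : El P))) ex) => x; exact: factorE.
have [phi0 phi0E] := choice_dep phi_ex; have [ga0 ga0E] := choice_dep ga_ex.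
pose D := pullback (Omega_el_functor X') F; pose E := pullback (El_functor P) F.
have phiN (q r : El P) (u : @hom (op (El P)) q r) n (x : D (c q) n) :
    @restrict (Omegac j) F _ _ (phi0 r) n (dmor D (fmor c u) n x) =
    dmor E u n (@restrict (Omegac j) F _ _ (phi0 q) n x).
  rewrite [LHS]restrict_comp [RHS]restrict_comp.
  congr (smap_fun (@restrict (Omegac j) F _ _ _) n x).
  apply: (tree_hom_cancel (@oel_emb_inj (c q))) => z.
  rewrite [LHS](@oel_hom_emb _ _ (fmor c u)) phi0E [RHS]phi0E.
  exact/esym/(@El_homE j X P r q u).
have gaN (a b : W) (u : @hom (op W) a b) n (x : E (p a) n) :
    @restrict (Omegac j) F _ _ (ga0 b) n (dmor E (fmor p u) n x) =
    dmor D u n (@restrict (Omegac j) F _ _ (ga0 a) n x).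
  rewrite [LHS]restrict_comp [RHS]restrict_comp.
  congr (smap_fun (@restrict (Omegac j) F _ _ _) n x).
  apply: (tree_hom_cancel (@elm_inj j X (sval (p a : El P)))) => z.
  rewrite [LHS](@El_homE j X P _ _ (fmor p u)) ga0E [RHS]ga0E.
  exact/esym/(@oel_hom_emb b a u).
pose phi : diagram_under D E c := @DiagramUnder _ _ D E c (fun q => @restrict (Omegac j) F _ _ (phi0 q)) phiN.
pose ga : diagram_under E D p := @DiagramUnder _ _ E D p (fun q => @restrict (Omegac j) F _ _ (ga0 q)) gaN.
have w : weak_equiv (holim_pull phi).
  apply: (@holim_pull_equiv _ _ c p D E phi ga al _ be).
  - by move=> *; exact: oel_thin.
  - by move=> *; exact: El_thin.
  - move=> a n x; rewrite [LHS]restrict_comp [LHS]restrict_comp; apply: restrict_id => z.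
    apply: (@oel_emb_inj a); rewrite [LHS](@oel_hom_emb _ _ (al a)) phi0E.
    exact: ga0E.
  - move=> q n x; rewrite [LHS]restrict_comp [LHS]restrict_comp; apply: restrict_id => z.
    apply: (@elm_inj j X (sval q)); rewrite [LHS](@El_homE j X P _ _ (be q)) ga0E.
    exact: phi0E.
rewrite (_ : lim_map _ _ = smap_comp (holim_pull phi) (lim_map (Omega_el_cocone X') F)).
  exact: weak_equiv_comp (segalF X') w.
apply: smap_ext => n x; apply: holim_cell_ext => l t s; apply/esym.
rewrite [LHS]restrict_comp; congr (smap_fun (@restrict (Omegac j) F _ _ _) l _).
apply: (tree_hom_cancel m_inj) => z; rewrite [RHS]el_liftE.
exact: phi0E.
Qed.

End SegalElements.

Lemma weak_equiv_prod_map (X X' Y Y' : sset) (f : smap X X') (g : smap Y Y') :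
  weak_equiv f -> weak_equiv g -> weak_equiv (sprod_map f g).
Proof.
move=> wf wg.
rewrite (_ : sprod_map f g = smap_comp (swap _ _) (smap_comp (sprod_map g (smap_id X'))
    (smap_comp (swap _ _) (sprod_map f (smap_id Y))))); last exact: smap_ext.
have wswap (A B : sset) : weak_equiv (swap A B).
  by apply: (@weak_equiv_iso _ _ _ (swap B A)) => n [].
apply: weak_equiv_comp (wswap _ _); apply: weak_equiv_comp; last exact: weak_equiv_prod.
by apply: weak_equiv_comp (wswap _ _); exact: weak_equiv_prod.
Qed.

Lemma kan_prod (X Y : sset) : kan X -> kan Y -> kan (sprod X Y).
Proof.
move=> kX kY n k h.
have [s sP] := kX n k (smap_comp (sfst _ _) h).
have [t tP] := kY n k (smap_comp (ssnd _ _) h).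
by exists (spair s t) => m x /=; rewrite sP tP /=; case: (h m x).
Qed.

(** * Homotopy fibre products *)

Program Definition path_end (S : sset) (b : bool) : smap (sexp interval S) S :=
  smap_comp (eval interval S) (at_end b (sexp interval S)).

Definition path_ends (S : sset) : smap (sexp interval S) (sprod S S) :=
  spair (path_end S false) (path_end S true).

(** A lift is the transpose of an extension to X x I x I from the two ends of the path coordinate,
    given by [v], and from one end of the homotopy coordinate, given by [w]. *)
Lemma hlp_path_ends (S : sset) : kan S -> hlp (path_ends S).
Proof.
move=> /kan_hep hepS X b w v vw.
pose c : smap (ssum X X) (sprod X interval) := copair (at_end false X) (at_end true X).
pose u := copair_prod (smap_comp (sfst _ _) v) (smap_comp (ssnd _ _) v).
have [||h [hw hu]] := @hep_cover S _ _ c b (uncurry w) u hepS.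
- move=> n [a|a] [a'|a'] t e;
    have := congr1 (fun y : sprod X interval n => y.2) e;
    have := congr1 (fun y : sprod X interval n => y.1) e => {e} /=.
  + by move=> ->.
  + by move=> _ e; case: (nesym (@endpoint_inj n) e).
  + by move=> _ e; case: (@endpoint_inj n e).
  + by move=> ->.
- by move=> n [a|a]; rewrite [LHS]/= vw.
pose sh : smap (sprod (sprod X interval) interval) (sprod (sprod X interval) interval) :=
  spair (spair (smap_comp (sfst _ _) (sfst _ _)) (ssnd _ _)) (smap_comp (ssnd _ _) (sfst _ _)).
exists (curry (smap_comp h sh)); split=> n.
  move=> [x t]; apply: (etrans (y := ((v n (x, t)).1, (v n (x, t)).2))); last by case: (v n (x, t)).
  congr pair; first by rewrite [LHS]curry_eval; exact: (hu n (inl x) t).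
  by rewrite [LHS]curry_eval; exact: (hu n (inr x) t).
move=> x; apply: sexp_ext => l g y; rewrite -smap_nat curry_eval [LHS]/= endpoint_comp hw.
by rewrite -[in RHS]smap_nat.
Qed.

(** * The homotopy lifting property of evaluation at an edge *)

Section Evaluation.
Variables (j : option nat) (F : presheaf (Omegac j)) (X : ctree j).

Section Holim.
Variable P : element X -> Prop.
Let I := op (El P).
Let D : diagram I := pullback (El_functor P) F.

(** [El P] is thin, so a chain is determined by its objects and a transport by its ends. Values on
    chains with the same objects can then be compared without casts. *)
Lemma holim_value n (y : holim D n) m (t t' : simplex_map m n) (s s' : chain m I) (c : I)
    (u : hom (s ord_max) c) (u' : hom (s' ord_max) c) :
  t = t' -> (forall i, s i = s' i) -> dmor D u m (y m t s) = dmor D u' m (y m t' s').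
Proof.
move=> -> ss'; case: s s' u u' ss' => [a v v1 vM] [a' v' v1' vM'] u u' /= /funext aa'.
case: _ / aa' v' v1' vM' u' => v' v1' vM' u'; rewrite (El_thin u' u); congr (smap_fun (dmor D u) m _).
by apply: (@holim_cell_hom_ext I D n y m t' t' a) => // i k ik; exact: El_thin.
Qed.

Lemma holim_value_id n (y : holim D n) m (t t' : simplex_map m n) (s s' : chain m I)
    (u : hom (s ord_max) (s' ord_max)) :
  t = t' -> (forall i, s i = s' i) -> dmor D u m (y m t s) = y m t' s'.
Proof.
by move=> tt' ss'; rewrite -[RHS](@dmor1 I D); exact: holim_value.
Qed.

Definition el_chain n (o : 'I_n.+1 -> El P)
    (om : forall i k : 'I_n.+1, (i <= k)%N -> forall y, el_in (sval (o k)) y -> el_in (sval (o i)) y) :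
    chain n I :=
  @Chain n I o (fun i k ik => El_hom (om i k ik)) (fun _ _ => El_thin _ _)
    (fun _ _ _ _ _ _ => El_thin _ _).

Lemma el_chain_mono n (s : chain n I) (i k : 'I_n.+1) y :
  (i <= k)%N -> el_in (sval (s k)) y -> el_in (sval (s i)) y.
Proof. by move=> ik; apply: ((El_homP _ _).1 _); exists (cmor s ik). Qed.

Variable e : X.
Hypothesis Pe : P (edge_el e).
Definition edge_ob : El P := exist _ (edge_el e) Pe.

Program Definition ev : smap (holim D) (F (point_tree j)) :=
  @SMap (holim D) (F (point_tree j)) (fun n y => y n (simplex_id n) (const_chain n (edge_ob : I))) _.
Next Obligation.
move=> m n f y; rewrite -[RHS](hlfunP y f (simplex_id n)).
apply/esym.
apply: (@holim_value_id n y m _ _ (chain_act f (const_chain n (edge_ob : I))) (const_chain m (edge_ob : I))) => //.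
Qed.

Lemma evE n (y : holim D n) m (t : simplex_map m n) (s : chain m I) (u : hom (s ord_max) (edge_ob : I)) :
  (forall i, s i = edge_ob) -> dmor D u m (y m t s) = sact _ t (ev n y).
Proof.
move=> sE; rewrite -smap_nat /=; apply: (@holim_value_id n y m t _ s (const_chain m (edge_ob : I))) => //.
by rewrite simplex_compm1.
Qed.

Variable pi : El P.
Hypothesis pi_e : el_in (sval pi) e.
Hypothesis P_e : forall p, P p -> el_in p e -> p = edge_el e \/ p = sval pi.
Hypothesis kanF : kan (F (point_tree j)).

(* Apart from the edge e itself, pi is the only element that contains e. Hence a
   chain that ends in e first stays at pi and then at e, and the lift differs from
   w only on such chains. There it is given by K, a homotopy of the path W from the
   value at pi to the value at e that is constant at pi and follows v at e. *)
Lemma hlp_ev_start : forall (M : sset) (w : smap M (holim D)) (v : smap (sprod M interval) (F (point_tree j))),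
  (forall n x, v n (x, endpoint false n) = ev n (w n x)) ->
  exists h : smap (sprod M interval) (holim D),
    (forall n y, ev n (h n y) = v n y) /\ (forall n x, h n (x, endpoint false n) = w n x).
Proof.
move=> M w v vw.
have into (a : I) : el_in (sval a) e -> exists u : hom a (edge_ob : I), True.
  by move=> ae; apply/El_homP => y; rewrite el_in_edge => /eqP ->.
have e_case (a : I) : el_in (sval a) e -> a = edge_ob \/ a = pi.
  by move=> /(P_e (proj2_sig a))[ae|ae]; [left|right]; exact: sig_ext.
(* [b0] marks the part of the chain at the edge [e]; chains go from larger to smaller elements, so
   this is a final segment. *)
pose b0 n (s : chain n I) (i : 'I_n.+1) : 'I_2 := if sval (s i) == edge_el e then ord_max else ord0.
have b0_mono n (s : chain n I) (i k : 'I_n.+1) : (i <= k)%N -> (b0 n s i <= b0 n s k)%N.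
  move=> ik; rewrite /b0; case: eqP => // si; case: eqP => // -[].
  by apply: el_sub_edge => y /(el_chain_mono ik); rewrite si el_in_edge => /eqP.
pose bs n (s : chain n I) : simplex_map n 1 := SimplexMap (b0_mono n s).
pose o n (r : simplex_map n 1) (i : 'I_n.+1) : El P := if r i == ord0 then pi else edge_ob.
have o_e n r i : el_in (sval (o n r i)) e.
  by rewrite /o; case: ifP => // _; rewrite el_in_edge.
have o_mono n r (i k : 'I_n.+1) : (i <= k)%N -> forall y, el_in (sval (o n r k)) y -> el_in (sval (o n r i)) y.
  move=> ik y; rewrite /o; case: (eqVneq (r k) ord0) => [rk|rk].
    suff -> : r i == ord0 by [].
    by have := smfun_mono r ik; rewrite rk leqn0 -val_eqE.
  by rewrite el_in_edge => /eqP ->; exact: o_e.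
pose toE (a : I) (ae : el_in (sval a) e) : hom a (edge_ob : I) := sval (cid (into a ae)).
(* The values along the chains that pass from [pi] to the edge [e], all transported to the edge. *)
pose W0 n (x : sprod (holim D) interval n) : F (point_tree j) n :=
  dmor D (toE _ (o_e n x.2 ord_max)) n (x.1 n (simplex_id n) (el_chain (@o_mono n x.2))).
have W0N m n (f : simplex_map m n) x : W0 m (sact (sprod (holim D) interval) f x) = sact _ f (W0 n x).
  apply: etrans _ (smap_nat (dmor D (toE _ (o_e n x.2 ord_max))) f _).
  rewrite -[X in _ = dmor D _ m X](hlfunP x.1 f (simplex_id n) (el_chain (@o_mono n x.2))).
  rewrite -dmorM; apply: (@holim_value n x.1 m _ _ (el_chain (@o_mono m (simplex_comp x.2 f)))
    (chain_act f (el_chain (@o_mono n x.2)))) => //.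
pose W := SMap W0N.
pose c : smap (ssum M M) (sprod M interval) := copair (at_end false M) (at_end true M).
pose u : smap (sprod (ssum M M) interval) (F (point_tree j)) :=
  copair_prod (smap_comp W (smap_comp (at_end false _) (smap_comp w (sfst M interval)))) v.
have [||K [K0 Kc]] := @hep_cover _ _ _ c false (smap_comp W (sprod_map w (smap_id interval))) u (kan_hep kanF).
- move=> n [a|a] [a'|a'] t ec;
    have := congr1 (fun y : sprod M interval n => y.2) ec;
    have := congr1 (fun y : sprod M interval n => y.1) ec => {ec} /=.
  + by move=> ->.
  + by move=> _ ec; case: (nesym (@endpoint_inj n) ec).
  + by move=> _ ec; case: (@endpoint_inj n ec).
  + by move=> ->.
- move=> n [a|a] //=; rewrite vw /W0 /=.
  apply/esym; apply: (@holim_value_id n (w n a) n _ _ _ (const_chain n (edge_ob : I))) => //.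
have from (a : I) : sval a = edge_el e -> exists u : hom (edge_ob : I) a, True.
  by move=> ae; apply/El_homP => y; rewrite ae.
pose fromE (a : I) (ae : sval a = edge_el e) : hom (edge_ob : I) a := sval (cid (from a ae)).
pose L n (x : sprod M interval n) m (t : simplex_map m n) (s : chain m I) : D (s ord_max) m :=
  match pselect (sval (s ord_max) = edge_el e) with
  | left es => dmor D (fromE _ es) m (K m ((sact M t x.1, bs m s), sact interval t x.2))
  | right _ => w n x.1 m t s
  end.
have LE n (x : sprod M interval n) m (t : simplex_map m n) (s : chain m I) (q : hom (edge_ob : I) (s ord_max)) : sval (s ord_max) = edge_el e ->
    @L n x m t s = dmor D q m (K m ((sact M t x.1, bs m s), sact interval t x.2)).
  by rewrite /L; case: pselect => // es _; rewrite (El_thin q (fromE _ es)).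
have LN n (x : sprod M interval n) m (t : simplex_map m n) (s : chain m I) : sval (s ord_max) <> edge_el e -> @L n x m t s = w n x.1 m t s.
  by rewrite /L; case: pselect.
have chain_e m (s : chain m I) i : sval (s ord_max) = edge_el e -> el_in (sval (s i)) e.
  move=> se; apply: (@el_chain_mono m s i ord_max) => //; first exact: leq_ord.
  by rewrite se el_in_edge.
have Ws n (y : holim D n) m (t : simplex_map m n) (s : chain m I) (q : hom (edge_ob : I) (s ord_max)) :
    sval (s ord_max) = edge_el e ->
    dmor D q m (W m (sact (holim D) t y, bs m s)) = y m t s.
  move=> se; rewrite [W m _]/(W0 m _) /W0 -dmorM.
  apply: (etrans (y := (sact (holim D) t y) m (simplex_id m) s)); last by rewrite /= simplex_compm1.
  apply: (@holim_value_id m (sact (holim D) t y) m _ _ (el_chain (@o_mono m (bs m s))) s) => // i.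
  rewrite /= /o /= /b0; have [->|->] := e_case (s i) (chain_e m s i se); first by rewrite eqxx.
  have [pe|//] := eqVneq (sval pi) (edge_el e); rewrite ?eqxx //=.
  by apply: sig_ext; rewrite pe.
have LP n (x : sprod M interval n) l m (f : simplex_map l m) (t : simplex_map m n) (s : chain m I) :
    dmor D (chain_last f s) l (@L n x l (simplex_comp t f) (chain_act f s)) = sact _ f (@L n x m t s).
  have [se|se] := pselect (sval (s ord_max) = edge_el e); last first.
    rewrite (LN _ _ _ _ _ se) LN; first exact: hlfunP.
    move=> sfe; apply: se; apply: el_sub_edge => y /(el_chain_mono (leq_ord (f ord_max) : (f ord_max <= @ord_max m)%N)).
    by rewrite -[sval _]/(sval (chain_act f s ord_max)) sfe el_in_edge => /eqP.
  have [q _] := from _ se; rewrite (LE _ _ _ _ _ q se) -smap_nat.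
  rewrite -[X in _ = dmor D q l X](smap_nat K).
  have [sfe|sfe] := pselect (sval (chain_act f s ord_max) = edge_el e).
    have [q' _] := from _ sfe; rewrite (LE _ _ _ _ _ q' sfe) -dmorM.
    apply: (etrans (congr1 (fun g => smap_fun (dmor D g) l _) (El_thin _ q))).
    congr (dmor D q l (K l (_, _, _))); first [exact: sactM | exact: simplex_map_ext].
  rewrite (LN _ _ _ _ _ sfe).
  (* A face that does not end at [e] stays at [pi], where [K] is constant in time, so its value is
     that of [w]. *)
  have b_end : simplex_comp (bs m s) f = endpoint false l.
    apply: simplex_map_ext => i; rewrite /= /b0; case: eqP => // fi.
    case: sfe; apply: el_sub_edge => y /(@el_chain_mono l (chain_act f s) i ord_max) ye.
    by have := ye (leq_ord i); rewrite /= fi el_in_edge => /eqP.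
  have Kf z t' : K l ((z, endpoint false l), t') = W l (w l z, endpoint false l).
    by have := Kc l (inl z) t'.
  rewrite [K l _](_ : _ = W l (sact (holim D) (simplex_comp t f) (w n x.1), endpoint false l)); last first.
    by rewrite -[sact _ f _]/(_, simplex_comp (bs m s) f, _) b_end; rewrite [LHS]Kf -smap_nat sactM.
  rewrite [W l _]/(W0 l _) /W0 -dmorM.
  apply: (etrans (y := dmor D (chain_last f s) l (sact (holim D) (simplex_comp t f) (w n x.1) l (simplex_id l) (chain_act f s)))).
    by rewrite /= simplex_compm1.
  apply: (@holim_value l (sact (holim D) (simplex_comp t f) (w n x.1)) l _ _ (chain_act f s) (el_chain (@o_mono l (endpoint false l)))) => // i.
  rewrite /= /o /=; have fi := chain_e m s (f i) se.
  have [fe|//] := e_case (s (f i)) fi.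
  case: sfe; apply: el_sub_edge => y /(@el_chain_mono l (chain_act f s) i ord_max) ye.
  by have := ye (leq_ord i); rewrite /= fe el_in_edge => /eqP.
pose h0 n x : holim D n := @HolimCell I D n (@L n x) (@LP n x).
have h0N m n (f : simplex_map m n) x : h0 m (sact (sprod M interval) f x) = sact (holim D) f (h0 n x).
  apply: holim_cell_ext => l t s; rewrite [LHS]/= [RHS]/=.
  have [se|se] := pselect (sval (s ord_max) = edge_el e); last by rewrite !LN //= smap_nat.
  have [q _] := from _ se; rewrite !(LE _ _ _ _ _ q se) /= -!sactM.
  by congr (dmor D q l (K l _)); congr (_, _); exact: simplex_map_ext.
exists (SMap h0N); split=> [n [x t]|n x].
  rewrite [LHS]/= (LE _ _ _ _ (const_chain n (edge_ob : I)) (idm _) erefl) dmor1.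
  apply: etrans (Kc n (inr x) t); congr (K n (_, _, _)); first exact: sact1.
    by apply: simplex_map_ext => i; rewrite /= /b0 eqxx.
  exact: simplex_compm1.
apply: holim_cell_ext => m t s; rewrite [LHS]/=.
have [se|se] := pselect (sval (s ord_max) = edge_el e); last by rewrite LN.
have [q _] := from _ se; rewrite (LE _ _ _ _ _ q se) -(Ws n (w n x) m t s q se).
congr (dmor D q m _); rewrite -[sact interval t _]/(simplex_comp (endpoint false n) t) endpoint_comp K0.
by rewrite -smap_nat.
Qed.
End Holim.
End Evaluation.

(* The homotopy fibre product of U and V over S, i.e. U x_S S^I x_S V. *)
Definition tens (S U V : sset) (u : smap U S) (v : smap V S) : sset :=
  spull (sprod_map u v) (path_ends S).

Definition const_path (S : sset) : smap S (sexp interval S) := curry (sfst S interval).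

Fact into_tens_proof (W S U V : sset) (u : smap U S) (v : smap V S) (f : smap W U) (g : smap W V) :
  (forall n x, u n (f n x) = v n (g n x)) ->
  forall n x, sprod_map u v n (spair f g n x) =
    path_ends S n (smap_comp (const_path S) (smap_comp u f) n x).
Proof.
move=> e n x.
by apply: (etrans (y := (u n (f n x), u n (f n x)))); [rewrite /= e | rewrite [RHS]/=; congr pair; rewrite sact1].
Qed.

Definition into_tens (W S U V : sset) (u : smap U S) (v : smap V S) (f : smap W U) (g : smap W V)
    (e : forall n x, u n (f n x) = v n (g n x)) : smap W (tens u v) :=
  into_spull (into_tens_proof e).

Fact tens_map_proof (S U V U' V' : sset) (u : smap U S) (v : smap V S) (u' : smap U' S) (v' : smap V' S)
    (f : smap U U') (g : smap V V') :
  (forall n x, u' n (f n x) = u n x) -> (forall n x, v' n (g n x) = v n x) ->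
  forall n x, sprod_map u' v' n (sprod_map f g n x) = sprod_map u v n x.
Proof. by move=> fu gv n [x y]; rewrite /= fu gv. Qed.

Definition tens_map (S U V U' V' : sset) (u : smap U S) (v : smap V S) (u' : smap U' S) (v' : smap V' S)
    (f : smap U U') (g : smap V V') fu gv : smap (tens u v) (tens u' v') :=
  spull_map (path_ends S) (@tens_map_proof S U V U' V' u v u' v' f g fu gv).

Lemma weak_equiv_tens_map (S U V U' V' : sset) (u : smap U S) (v : smap V S) (u' : smap U' S) (v' : smap V' S)
    (f : smap U U') (g : smap V V') fu gv :
  kan S -> weak_equiv f -> weak_equiv g -> weak_equiv (@tens_map S U V U' V' u v u' v' f g fu gv).
Proof.
move=> kS wf wg; apply: weak_equiv_spull; first exact: hlp_path_ends.
  exact: kan_prod.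
exact: weak_equiv_prod_map.
Qed.

(** * Gluing limits along an edge *)

Section Restriction.
Variables (j : option nat) (F : presheaf (Omegac j)) (X : ctree j).

Definition El_diagram (P : element X -> Prop) : diagram (op (El P)) := pullback (El_functor P) F.

Definition El_incl (P Q : element X -> Prop) (PQ : forall p, P p -> Q p) : functor (op (El P)) (op (El Q)) :=
  @Functor (op (El P)) (op (El Q)) (fun p => exist _ (sval p) (PQ _ (proj2_sig p)))
    (fun p q u => u) (fun=> erefl) (fun _ _ _ _ _ => erefl).

Definition El_restrict (P Q : element X -> Prop) (PQ : forall p, P p -> Q p) :
    smap (holim (El_diagram Q)) (holim (El_diagram P)) :=
  holim_pull (@DiagramUnder _ _ (El_diagram Q) (El_diagram P) (El_incl PQ) (fun p => smap_id _) (fun _ _ _ _ _ => erefl)).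

Definition chain_lift (P Q : element X -> Prop) n (s : chain n (op (El Q))) (sP : forall i, P (sval (s i))) :
    chain n (op (El P)) :=
  @Chain n (op (El P)) (fun i => exist _ (sval (s i)) (sP i)) (fun i k ik => cmor s ik)
    (fun i ii => cmor1 s ii) (fun i k l ik kl il => cmorM s ik kl il).

Variable e : X.
Definition below_e (p : element X) : Prop := forall y, el_in p y -> ~~ (e < y).
Definition above_e (p : element X) : Prop := forall y, el_in p y -> e <= y.

(** A vertex whose output is not above [e] has no edge strictly above [e]: an input strictly above
    [e] would have [e] between it and the output. *)
Lemma below_or_above p : below_e p \/ above_e p.
Proof.
case: (elementP p) => [[x ->]|[x [xi ->]]].
  have [ex|ex] := boolP (e < x); last by left=> y; rewrite el_in_edge => /eqP ->.
  by right=> y; rewrite el_in_edge => /eqP ->; exact: ltW.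
have [ex|ex] := boolP (e <= x).
  by right=> y; rewrite el_in_star => /in_star_min; exact: le_trans.
left=> y; rewrite el_in_star => /orP[/eqP->|yx]; apply: contra ex; first exact: ltW.
move=> ey; have /inputs_closed[xy ymin] := yx.
have /orP[//|] := tree_linear (ltW ey) (ltW xy).
rewrite le_eqVlt => /orP[/eqP -> //|xe].
by have yE := ymin e xe (ltW ey); rewrite yE ltxx in ey.
Qed.

Lemma below_and_above p : below_e p -> above_e p -> p = edge_el e.
Proof.
move=> b a; apply: el_sub_edge => y py; apply/eqP; have := b y py.
by rewrite lt_neqAle (a y py) andbT negbK eq_sym.
Qed.

Lemma below_edge : below_e (edge_el e).
Proof. by move=> y; rewrite el_in_edge => /eqP ->; rewrite ltxx. Qed.

Lemma above_edge : above_e (edge_el e).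
Proof. by move=> y; rewrite el_in_edge => /eqP ->; rewrite lexx. Qed.

(** Apart from the edge itself, only the vertex with [e] among its inputs is in question. If [e] is
    the root there is none, and [q] is the edge itself. *)
Lemma below_parent : exists2 q : element X, below_e q /\ el_in q e &
  forall p, below_e p -> el_in p e -> p = edge_el e \/ p = q.
Proof.
have star_case x xi : below_e (@star_el _ _ x xi) -> in_star x e -> e \in inputs x.
  move=> b /orP[/eqP ex|//].
  have [w wx] := set0Pn _ xi; have := b w; rewrite el_in_star /in_star wx orbT => /(_ isT).
  by rewrite [in e < w]ex (inputs_lt wx).
have [[x ex]|nx] := pselect (exists x, e \in inputs x).
  have xi : inputs x != set0 by apply/set0Pn; exists e.
  have /inputs_closed[xe emin] := ex.
  exists (star_el xi).
    split; last by rewrite el_in_star /in_star ex orbT.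
    move=> y; rewrite el_in_star => /orP[/eqP->|yx]; first by rewrite lt_gtF.
    by apply/negP => ey; have := inputs_comp ex yx; rewrite /Order.comparable (ltW ey) => /(_ isT) ey'; rewrite ey' ltxx in ey.
  move=> p; case: (elementP p) => [[y ->]|[y [yi ->]]] b; first by rewrite el_in_edge => /eqP ->; left.
  rewrite el_in_star => /(star_case _ _ b)/inputs_closed[ye emin']; right.
  suff xy : y = x by subst y; apply: val_inj.
  have /orP[] := tree_linear (ltW ye) (ltW xe).
    by rewrite le_eqVlt => /orP[/eqP//|yx]; have xE := emin' x yx (ltW xe); rewrite xE ltxx in xe.
  by rewrite le_eqVlt => /orP[/eqP//|xy]; have yE := emin y xy (ltW ye); rewrite yE ltxx in ye.
exists (edge_el e).
  by split; [exact: below_edge | rewrite el_in_edge].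
move=> p; case: (elementP p) => [[y ->]|[y [yi ->]]] b; first by rewrite el_in_edge => /eqP ->; left.
by rewrite el_in_star => /(star_case _ _ b) ey; case: nx; exists y.
Qed.

Let H0 := holim (El_diagram below_e).
Let H1 := holim (El_diagram above_e).
Let HT := holim (El_diagram (fun=> True)).
Let ev0 := ev F below_edge.
Let ev1 := ev F above_edge.

Section Glue.
Variables (n : nat) (y0 : H0 n) (y1 : H1 n).
Hypothesis y01 : ev0 n y0 = ev1 n y1.

(** Chains in the opposite category start at their largest element, so the first object decides on
    which side the chain lies. *)
Lemma above_of_not_below m (s : chain m (op (@El j X (fun=> True)))) :
  ~ (forall i, below_e (sval (s i))) -> forall i, above_e (sval (s i)).
Proof.
move=> nb i; have [b0|a0] := below_or_above (sval (s ord0)).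
  case: nb => k y yk; apply: b0; apply: (el_chain_mono (i := ord0) (k := k)) yk; exact: leq0n.
by move=> y yi; apply: a0; apply: (el_chain_mono (i := ord0) (k := i)) yi; exact: leq0n.
Qed.

Definition glue_fun m (t : simplex_map m n) (s : chain m (op (@El j X (fun=> True)))) :
    El_diagram (fun=> True) (s ord_max) m :=
  match pselect (forall i, below_e (sval (s i))) with
  | left b => y0 m t (chain_lift b)
  | right nb => y1 m t (chain_lift (above_of_not_below nb))
  end.

Lemma glue_below m (t : simplex_map m n) (s : chain m (op (@El j X (fun=> True)))) (b : forall i, below_e (sval (s i))) :
  @glue_fun m t s = y0 m t (chain_lift b).
Proof. by rewrite /glue_fun; case: pselect => // b'; rewrite (Prop_irrelevance b b'). Qed.

(** A chain that lies on both sides has all its objects equal to the edge [e], where [y01] makes the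
    two definitions agree. *)
Lemma glue_above m (t : simplex_map m n) (s : chain m (op (@El j X (fun=> True)))) (a : forall i, above_e (sval (s i))) :
  @glue_fun m t s = y1 m t (chain_lift a).
Proof.
rewrite /glue_fun; case: pselect => [b|a']; last by rewrite (Prop_irrelevance a (above_of_not_below a')).
have sE i : sval (s i) = edge_el e := below_and_above (b i) (a i).
have [u _] : exists u : @hom (El (fun=> True)) (exist _ (edge_el e) I) (s ord_max), True.
  by apply/El_homP => y; rewrite sE.
have [v _] : exists v : @hom (El (fun=> True)) (s ord_max) (exist _ (edge_el e) I), True.
  by apply/El_homP => y; rewrite sE.
have vu : @comp (op (El below_e)) (chain_lift b ord_max) (edge_ob below_edge) (chain_lift b ord_max) v u = idm _.
  exact: El_thin.
have vu1 : @comp (op (El above_e)) (chain_lift a ord_max) (edge_ob above_edge) (chain_lift a ord_max) v u = idm _.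
  exact: El_thin.
rewrite -[LHS](@dmor1 _ (El_diagram below_e) (chain_lift b ord_max)) -vu dmorM.
rewrite -[RHS](@dmor1 _ (El_diagram above_e) (chain_lift a ord_max)) -vu1 dmorM.
congr (@dmor _ (El_diagram (fun=> True)) (exist _ (edge_el e) I) (s ord_max) v m _).
have sE0 i : chain_lift b i = edge_ob below_edge by apply: sig_ext; exact: sE.
have sE1 i : chain_lift a i = edge_ob above_edge by apply: sig_ext; exact: sE.
have e0 := @evE j F X below_e e below_edge n y0 m t (chain_lift b) u sE0.
have e1 := @evE j F X above_e e above_edge n y1 m t (chain_lift a) u sE1.
exact: etrans e0 (etrans (congr1 (sact (F (point_tree j)) t) y01) (esym e1)).
Qed.

Fact glue_fun_nat l m (f : simplex_map l m) (t : simplex_map m n) (s : chain m (op (@El j X (fun=> True)))) :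
  dmor (El_diagram (fun=> True)) (chain_last f s) l (glue_fun (simplex_comp t f) (chain_act f s)) =
  sact _ f (glue_fun t s).
Proof.
have [b|/above_of_not_below a] := pselect (forall i, below_e (sval (s i))).
  rewrite (glue_below t b) (@glue_below l _ (chain_act f s) (fun i => b (f i))); exact: (hlfunP y0 f t (chain_lift b)).
rewrite (glue_above t a) (@glue_above l _ (chain_act f s) (fun i => a (f i))); exact: (hlfunP y1 f t (chain_lift a)).
Qed.

Definition glue : HT n := @HolimCell _ (El_diagram (fun=> True)) n glue_fun glue_fun_nat.

End Glue.

Let toT P : forall p : element X, P p -> (fun=> True) p := fun _ _ => I.
Let r0 := @El_restrict below_e (fun=> True) (@toT below_e).
Let r1 := @El_restrict above_e (fun=> True) (@toT above_e).

Lemma restrict_ev n (y : HT n) : ev0 n (r0 n y) = ev1 n (r1 n y).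
Proof.
pose c := const_chain n (edge_ob (P := fun=> True) (e := e) I : op _).
apply: (etrans (y := y n (simplex_id n) c)).
  rewrite -[LHS](@dmor1 _ (El_diagram (fun=> True)) (c ord_max)).
  apply: (@holim_value_id j F X _ n y n _ _ (chain_map (El_incl (@toT below_e)) (const_chain n (edge_ob below_edge : op _))) c) => // i.
apply/esym; rewrite -[LHS](@dmor1 _ (El_diagram (fun=> True)) (c ord_max)).
by apply: (@holim_value_id j F X _ n y n _ _ (chain_map (El_incl (@toT above_e)) (const_chain n (edge_ob above_edge : op _))) c) => // i.
Qed.

Lemma glue_restrict n (y : HT n) (y01 : ev0 n (r0 n y) = ev1 n (r1 n y)) : glue y01 = y.
Proof.
apply: holim_cell_ext => m t s; rewrite [LHS]/=.
have [b|/above_of_not_below a] := pselect (forall i, below_e (sval (s i))).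
  rewrite (glue_below _ _ _ b).
  apply: etrans _ (@holim_value_id j F X _ n y m t t (chain_map (El_incl (@toT below_e)) (chain_lift b)) s
    (@idm (op (El _)) (s ord_max)) erefl _) => [|i]; [exact/esym/dmor1 | exact: sig_ext].
rewrite (glue_above y01 _ a).
apply: etrans _ (@holim_value_id j F X _ n y m t t (chain_map (El_incl (@toT above_e)) (chain_lift a)) s
  (@idm (op (El _)) (s ord_max)) erefl _) => [|i]; [exact/esym/dmor1 | exact: sig_ext].
Qed.

Lemma restrict_glue0 n (y0 : H0 n) (y1 : H1 n) (y01 : ev0 n y0 = ev1 n y1) : r0 n (glue y01) = y0.
Proof.
apply: holim_cell_ext => m t s; rewrite [LHS]/=.
pose b i := proj2_sig (s i).
rewrite (@glue_below n y0 y1 m t (chain_map (El_incl (@toT below_e)) s) b).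
apply: etrans _ (@holim_value_id j F X _ n y0 m t t (chain_lift (s := chain_map (El_incl (@toT below_e)) s) b) s
  (@idm (op (El _)) (s ord_max)) erefl _) => [|i]; [exact/esym/dmor1 | exact: sig_ext].
Qed.

Lemma restrict_glue1 n (y0 : H0 n) (y1 : H1 n) (y01 : ev0 n y0 = ev1 n y1) : r1 n (glue y01) = y1.
Proof.
apply: holim_cell_ext => m t s; rewrite [LHS]/=.
pose a i := proj2_sig (s i).
rewrite (@glue_above n y0 y1 y01 m t (chain_map (El_incl (@toT above_e)) s) a).
apply: etrans _ (@holim_value_id j F X _ n y1 m t t (chain_lift (s := chain_map (El_incl (@toT above_e)) s) a) s
  (@idm (op (El _)) (s ord_max)) erefl _) => [|i]; [exact/esym/dmor1 | exact: sig_ext].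
Qed.

Lemma glue_ext n (y0 y0' : H0 n) (y1 y1' : H1 n) (y01 : ev0 n y0 = ev1 n y1) (y01' : ev0 n y0' = ev1 n y1') :
  y0 = y0' -> y1 = y1' -> glue y01 = glue y01'.
Proof. by move=> e0 e1; subst y0' y1'; rewrite (Prop_irrelevance y01 y01'). Qed.

Program Definition glue_map (W : sset) (f : smap W H0) (g : smap W H1)
    (fg : forall n w, ev0 n (f n w) = ev1 n (g n w)) : smap W HT :=
  @SMap W HT (fun n w => glue (fg n w)) _.
Next Obligation.
move=> W f g fg l n k w; apply: holim_cell_ext => m t s; rewrite [LHS]/= [RHS]/=.
have [b|/above_of_not_below a] := pselect (forall i, below_e (sval (s i))).
  by rewrite !(glue_below _ _ _ b) smap_nat.
by rewrite (glue_above (fg l _) _ a) (glue_above (fg n w) _ a) smap_nat.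
Qed.

Hypothesis kanS : kan (F (point_tree j)).

(** [glue] identifies the limit over all elements with the strict fibre product. A point of the
    homotopy fibre product becomes a strict one by transporting its lower component along the path,
    which [below_parent] and [hlp_ev_start] allow; this is the inverse [r]. *)
Lemma weak_equiv_restrict_tens : weak_equiv (into_tens restrict_ev).
Proof.
pose T := tens ev0 ev1; set G := into_tens restrict_ev.
pose p0 : smap T H0 := smap_comp (sfst _ _) (spull_fst _ _).
pose p1 : smap T H1 := smap_comp (ssnd _ _) (spull_fst _ _).
pose v : smap (sprod T interval) (F (point_tree j)) := uncurry (spull_snd _ _).
have v0 n (p : T n) : v n (p, endpoint false n) = ev0 n (p0 n p).
  exact/esym/(congr1 fst (spullP p)).
have v1 n (p : T n) : v n (p, endpoint true n) = ev1 n (p1 n p).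
  exact/esym/(congr1 snd (spullP p)).
have [q [qb qe] qP] := below_parent.
have [h [hv h0]] := @hlp_ev_start j F X below_e e below_edge (exist _ q qb) qe qP kanS T p0 v v0.
have r_eq n (p : T n) : ev0 n (smap_comp h (at_end true _) n p) = ev1 n (p1 n p).
  by rewrite [LHS]hv v1.
pose r : smap T HT := glue_map r_eq.
have vG n y t : v n (G n y, t) = ev1 n (r1 n y).
  by rewrite -restrict_ev; apply: (etrans (curry_eval _ _ _)).
apply: (@weak_equiv_inverse _ _ _ r); apply/weakly_homotopic_sym/homotopic_weakly/homotopicE.
  (* For a strict point the path is constant, so the transport stays in the fibre and can be glued
     at all times. *)
  have K_eq n (y : sprod HT interval n) :
      ev0 n (smap_comp h (sprod_map G (smap_id interval)) n y) = ev1 n (smap_comp r1 (sfst _ _) n y).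
    by rewrite [LHS]hv vG.
  exists (glue_map K_eq); split=> n y; last exact: glue_ext.
  rewrite -[RHS](glue_restrict (restrict_ev y)); apply: glue_ext => //.
  by rewrite [LHS]h0.
(* At time t only the rest of the path after t is kept; the maximum cuts it off and leaves a
   constant path at time 1. *)
pose P : smap (sprod T interval) (sexp interval (F (point_tree j))) :=
  curry (smap_comp v (spair (smap_comp (sfst _ _) (sfst _ _))
    (smap_comp interval_max (sprod_map (ssnd T interval) (smap_id interval))))).
have P_eq n (y : sprod T interval n) :
    sprod_map ev0 ev1 n (spair h (smap_comp p1 (sfst _ _)) n y) = path_ends _ n (P n y).
  change (path_ends _ n (P n y)) with (path_end _ false n (P n y), path_end _ true n (P n y)).
  have P_end b : path_end _ b n (P n y) = v n (y.1, interval_max n (y.2, endpoint b n)) by exact: curry_eval.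
  rewrite !P_end interval_max0 interval_max1 v1; case: y {P_end} => p t.
  by congr pair; exact: hv.
exists (into_spull P_eq); split=> n p; apply: spull_ext.
- by rewrite [LHS]/= h0; case: p => -[[? ?] ?] ?.
- apply: sexp_ext => l g s; rewrite -smap_nat curry_eval.
  rewrite -[RHS]/(v l (sact T g p, s)); congr (v l (_, _)); exact: simplex_map_ext.
- change ((smap_comp h (at_end true T) n p, p1 n p) = (r0 n (glue (r_eq n p)), r1 n (glue (r_eq n p)))).
  by rewrite restrict_glue0 restrict_glue1.
- apply: sexp_ext => l g s; rewrite -smap_nat curry_eval.
  rewrite [LHS](_ : _ = v l (sact T g p, endpoint true l)); last first.
    by congr (v l (_, _)); exact: interval_max1l.
  rewrite v1 -smap_nat; apply/esym; apply: (etrans (curry_eval _ _ _)).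
  by rewrite [LHS]restrict_ev -(smap_nat r) [r1 _ _]restrict_glue1.
Qed.

End Restriction.

Section Decomposition.
Variables (j : option nat) (F : presheaf (Omegac j)) (X X0 X1 : ctree j) (e : X).
Hypothesis segalF : segal F.
Hypothesis kanS : kan (F (point_tree j)).
Variables (m0 : tree_hom X0 X) (m1 : tree_hom X1 X) (e0 : X0) (e1 : X1).
Hypotheses (m0_inj : injective m0) (m1_inj : injective m1).
Hypothesis im0 : forall y, (exists z, m0 z = y) <-> ~~ (e < y).
Hypothesis im1 : forall y, (exists z, m1 z = y) <-> e <= y.
Hypotheses (m0e : m0 e0 = e) (m1e : m1 e1 = e).

(** The edge [e0] is maximal in [X0] while [e] may have inputs in [X], whence the condition. At any
    other edge no input is lost, since one strictly above [e] would have [e] between it and its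
    output. *)
Lemma lower_inputs x : inputs x != set0 -> inputs (m0 x) = m0 @: inputs x.
Proof.
case/set0Pn => w wx; apply/eqP; rewrite eqEsubset andbC inputs_embedding //=; first last.
- by move=> y z _ _ yz; apply/im0; have /im0 := ex_intro (fun t => m0 t = m0 y) y erefl; apply: contra => /lt_le_trans ->.
- exact: ctree_closed.
apply/subsetP => y /inputs_closed[xy ymin].
have [z zE] : exists z, m0 z = y.
  apply/im0/negP => ey.
  have nex : ~~ (e < m0 w) by apply/im0; exists w.
  have xw : m0 x < m0 w by rewrite closed_hom_lt ?inputs_lt // ctree_closed.
  have /orP[ex|] := tree_linear (ltW ey) (ltW xy).
    by rewrite (le_lt_trans ex xw) in nex.
  rewrite le_eqVlt => /orP[/eqP xe|xe]; first by rewrite -xe xw in nex.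
  by have eE := ymin e xe (ltW ey); rewrite eE ltxx in ey.
rewrite -zE imset_f //; apply/inputs_closed; split.
  by rewrite -(closed_hom_lt (f := m0) (ctree_closed X0)) // zE.
move=> v xv vz; apply: m0_inj; rewrite zE; apply: ymin.
  by rewrite closed_hom_lt ?ctree_closed.
by rewrite -zE closed_hom_mono ?ctree_closed.
Qed.

Lemma upper_inputs x : inputs x != set0 -> inputs (m1 x) = m1 @: inputs x.
Proof.
move=> _; apply/eqP; rewrite eqEsubset andbC inputs_embedding //=; first last.
- move=> y z _ xy _; apply/im1; apply: le_trans xy; apply/im1; by exists x.
- exact: ctree_closed.
apply/subsetP => y /inputs_closed[xy ymin].
have ex : e <= m1 x by apply/im1; exists x.
have [z zE] : exists z, m1 z = y by apply/im1; exact: le_trans ex (ltW xy).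
rewrite -zE imset_f //; apply/inputs_closed; split.
  by rewrite -(closed_hom_lt (f := m1) (ctree_closed X1)) // zE.
move=> v xv vz; apply: m1_inj; rewrite zE; apply: ymin.
  by rewrite closed_hom_lt ?ctree_closed.
by rewrite -zE closed_hom_mono ?ctree_closed.
Qed.

Lemma below_image p : below_e e p <-> (forall y, el_in p y -> exists z, m0 z = y).
Proof. by split=> [b y /b/im0|b y /b/im0]. Qed.

Lemma above_image p : above_e e p <-> (forall y, el_in p y -> exists z, m1 z = y).
Proof. by split=> [b y /b/im1|b y /b/im1]. Qed.

Let a0 := lim_map (El_cocone m0_inj below_image) F.
Let a1 := lim_map (El_cocone m1_inj above_image) F.
Let u0 := @restrict (Omegac j) F _ _ (point_map e0).
Let u1 := @restrict (Omegac j) F _ _ (point_map e1).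

Lemma ev_below n x : ev F (@below_edge j X e) n (a0 n x) = u0 n x.
Proof.
rewrite [LHS]/= sact1; congr (smap_fun (@restrict (Omegac j) F _ _ _) n x).
apply: (tree_hom_cancel m0_inj) => z.
by apply: (etrans (el_liftE m0_inj below_image (p := edge_ob (@below_edge j X e)) z)); rewrite [RHS]m0e.
Qed.

Lemma ev_above n x : ev F (@above_edge j X e) n (a1 n x) = u1 n x.
Proof.
rewrite [LHS]/= sact1; congr (smap_fun (@restrict (Omegac j) F _ _ _) n x).
apply: (tree_hom_cancel m1_inj) => z.
by apply: (etrans (el_liftE m1_inj above_image (p := edge_ob (@above_edge j X e)) z)); rewrite [RHS]m1e.
Qed.

Variable u01 : forall n x, u0 n (@restrict (Omegac j) F _ _ m0 n x) = u1 n (@restrict (Omegac j) F _ _ m1 n x).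

(** The Segal condition for [X], [X0] and [X1], each expressed by elements of the same tree [X],
    identifies this map with [into_tens] of [restrict_ev] up to weak equivalence. *)
Lemma weak_equiv_tens_decomposition : weak_equiv (into_tens u01).
Proof.
have id_inj : injective (tree_id X) by [].
have id_inputs (x : X) : inputs x != set0 -> inputs (tree_id X x) = tree_id X @: inputs x.
  by rewrite imset_id.
have id_image (p : element X) : (fun=> True) p <-> (forall y, el_in p y -> exists z, tree_id X z = y).
  by split=> // _ y _; exists y.
pose g := lim_map (El_cocone id_inj id_image) F.
have wg : weak_equiv g by exact: weak_equiv_El_cocone.
have w0 : weak_equiv a0 by apply: weak_equiv_El_cocone => //; exact: lower_inputs.
have w1 : weak_equiv a1 by apply: weak_equiv_El_cocone => //; exact: upper_inputs.
apply: (@weak_equiv_cancel_left _ _ _ (tens_map ev_below ev_above)).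
  exact: weak_equiv_tens_map.
rewrite (_ : smap_comp _ _ = smap_comp (into_tens (@restrict_ev j F X e)) g); last first.
  have E0 n x : a0 n (@restrict (Omegac j) F _ _ m0 n x) = El_restrict F (fun p _ => I) n (g n x).
    apply: holim_cell_ext => l t s; rewrite [LHS]/= -smap_nat [LHS]restrict_comp.
    congr (smap_fun (@restrict (Omegac j) F _ _ _) l _); apply: tree_hom_ext => z.
    exact: etrans (el_liftE m0_inj below_image (p := s ord_max) z)
      (esym (el_liftE id_inj id_image (p := El_incl (fun p _ => I) (s ord_max)) z)).
  have E1 n x : a1 n (@restrict (Omegac j) F _ _ m1 n x) = El_restrict F (fun p _ => I) n (g n x).
    apply: holim_cell_ext => l t s; rewrite [LHS]/= -smap_nat [LHS]restrict_comp.
    congr (smap_fun (@restrict (Omegac j) F _ _ _) l _); apply: tree_hom_ext => z.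
    exact: etrans (el_liftE m1_inj above_image (p := s ord_max) z)
      (esym (el_liftE id_inj id_image (p := El_incl (fun p _ => I) (s ord_max)) z)).
  apply: smap_ext => n x; apply: spull_ext.
    exact: congr2 (E0 n x) (E1 n x).
  apply: (congr1 (const_path _ n)); rewrite -[RHS]/(ev F (@below_edge j X e) n _) -E0.
  exact/esym/ev_below.
apply: weak_equiv_comp wg _; exact: weak_equiv_restrict_tens.
Qed.
End Decomposition.

(** * Cutting a tree at an edge *)

(** Both the canonical parts of a tree and the two factors of a grafting are cuts; the record treats
    them alike, with the parts known only up to isomorphism. *)
Record cut (X X0 X1 : tree) (e : X) (m0 : tree_hom X0 X) (m1 : tree_hom X1 X) (e0 : X0) (e1 : X1) : Prop := Cut {
  cut_inj0 : injective m0;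
  cut_inj1 : injective m1;
  cut_im0 : forall y, (exists z, m0 z = y) <-> ~~ (e < y);
  cut_im1 : forall y, (exists z, m1 z = y) <-> e <= y;
  cut_e0 : m0 e0 = e;
  cut_e1 : m1 e1 = e }.

Section CutHom.
Variables (X X0 X1 : tree) (e : X) (m0 : tree_hom X0 X) (m1 : tree_hom X1 X) (e0 : X0) (e1 : X1).
Hypothesis C : cut e m0 m1 e0 e1.
Hypotheses (X_closed : leaves X = set0) (X0_closed : leaves X0 = set0) (X1_closed : leaves X1 = set0).

Lemma cut_ind (Q : X -> Prop) : (forall x, Q (m0 x)) -> (forall x, Q (m1 x)) -> forall x, Q x.
Proof.
move=> Q0 Q1 x; have [/(cut_im1 C)[z <-] //|ex] := boolP (e <= x).
have [|z <-//] := (cut_im0 C x).2; by apply: contra ex; exact: ltW.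
Qed.

Lemma cut_meet x z : m0 x = m1 z -> x = e0 /\ z = e1.
Proof.
move=> xz; have nex : ~~ (e < m0 x) by apply/(cut_im0 C); exists x.
have ez : e <= m1 z by apply/(cut_im1 C); exists z.
have xe : m0 x = e by apply/eqP; move: nex; rewrite lt_neqAle xz ez andbT negbK eq_sym.
split; first by apply: (cut_inj0 C); rewrite xe (cut_e0 C).
by apply: (cut_inj1 C); rewrite -xz xe (cut_e1 C).
Qed.

Lemma cut_bot1 z : e1 <= z.
Proof.
rewrite -(closed_hom_le X1_closed _ _ (cut_inj1 C)) (cut_e1 C); apply/(cut_im1 C).
by exists z.
Qed.

Lemma cut_cross x z : m0 x >=< m1 z -> x <= e0.
Proof.
rewrite -(closed_hom_le X0_closed _ _ (cut_inj0 C)) (cut_e0 C) => xz.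
have nex : ~~ (e < m0 x) by apply/(cut_im0 C); exists x.
have ez : e <= m1 z by apply/(cut_im1 C); exists z.
have : m0 x >=< e.
  case/orP: xz => xz; first exact: tree_linear xz ez.
  by rewrite /Order.comparable (le_trans ez xz) orbT.
by case/orP => //; rewrite le_eqVlt (negPf nex) orbF => /eqP ->.
Qed.

Variables (W : tree) (a : tree_hom X0 W) (b : tree_hom X1 W).
Hypothesis W_closed : leaves W = set0.
Hypothesis ab : a e0 = b e1.

(** [X] is the pushout of [X0] and [X1] along the edge. The essential point is independence across
    the cut: u (m1 z) lies above a e0, so comparability with it makes a x and a e0 comparable; hence
    m0 x lies below [e], which no edge of [X0] exceeds. *)
Lemma glue_hom_ex : exists u : tree_hom X W, (forall x, u (m0 x) = a x) /\ (forall x, u (m1 x) = b x).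
Proof.
have /choice[u uP] : forall x, exists w, (forall z, m0 z = x -> w = a z) /\ (forall z, m1 z = x -> w = b z).
  apply: cut_ind => x; [exists (a x)|exists (b x)]; split=> z.
  - by move/(cut_inj0 C) ->.
  - by move/esym/cut_meet => [-> ->].
  - by move/cut_meet => [-> ->].
  - by move/(cut_inj1 C) ->.
have u0 x : u (m0 x) = a x by exact: (uP _).1.
have u1 x : u (m1 x) = b x by exact: (uP _).2.
have cross x z : m0 x >=< m1 z -> u (m0 x) <= u (m1 z).
  move=> /cut_cross xe; rewrite u0 u1; apply: le_trans (closed_hom_mono a X0_closed xe) _.
  by rewrite ab; apply: closed_hom_mono (cut_bot1 z).
have umono : {homo u : x y / x <= y}.
  apply: cut_ind => x; apply: cut_ind => y.
  - by rewrite (closed_hom_le X0_closed _ _ (cut_inj0 C)) !u0; exact: closed_hom_mono.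
  - by move=> xy; apply: cross; rewrite /Order.comparable xy.
  - move=> xy; have ey : e <= m0 y by apply: le_trans xy; apply/(cut_im1 C); exists x.
    have [z zE] := (cut_im1 C _).2 ey; rewrite -zE in xy *.
    by move: xy; rewrite (closed_hom_le X1_closed _ _ (cut_inj1 C)) !u1; exact: closed_hom_mono.
  - by rewrite (closed_hom_le X1_closed _ _ (cut_inj1 C)) !u1; exact: closed_hom_mono.
have lift0 x y : x >=< y -> m0 x >=< m0 y.
  by rewrite /Order.comparable !(closed_hom_le X0_closed _ _ (cut_inj0 C)).
have ucross x z : u (m0 x) >=< u (m1 z) -> m0 x >=< m1 z.
  move=> xz; have be : a e0 <= u (m1 z) by rewrite u1 ab; apply: closed_hom_mono (cut_bot1 z).
  have /(closed_hom_reflect X0_closed)/lift0 xe : a x >=< a e0.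
    case/orP: xz; rewrite u0 => xz; first exact: tree_linear xz be.
    by rewrite /Order.comparable (le_trans be xz) orbT.
  have {xe} xe : m0 x <= e.
    move: xe; rewrite (cut_e0 C) => /orP[//|]; rewrite le_eqVlt => /orP[/eqP <- //|].
    by rewrite (negPf ((cut_im0 C _).1 _)) //; exists x.
  have ez : e <= m1 z by apply/(cut_im1 C); exists z.
  by rewrite /Order.comparable (le_trans xe ez).
have urefl x y : u x >=< u y -> x >=< y.
  move: x y; apply: cut_ind => x; apply: cut_ind => y.
  - by rewrite !u0 => /(closed_hom_reflect X0_closed)/lift0.
  - exact: ucross.
  - by rewrite comparable_sym => /ucross; rewrite comparable_sym.
  - rewrite !u1 => /(closed_hom_reflect X1_closed).
    by rewrite /Order.comparable !(closed_hom_le X1_closed _ _ (cut_inj1 C)).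
by exists (closed_hom W_closed umono urefl).
Qed.

End CutHom.

Section CanonicalCut.
Variables (k : option nat) (X : ctree k) (e : X).

Lemma lower_root : ~~ (e < \bot). Proof. by rewrite ltx0. Qed.
Lemma lower_min (x : X) : ~~ (e < x) -> \bot <= x. Proof. by rewrite le0x. Qed.
Lemma lower_convex (x y z : X) : ~~ (e < x) -> ~~ (e < z) -> x <= y -> y <= z -> ~~ (e < y).
Proof. by move=> _ ez _ yz; apply: contra ez => /lt_le_trans; apply. Qed.

Definition lower : ctree k :=
  @CTree k (subtree (Q := fun x => ~~ (e < x)) lower_root lower_min) erefl
    (dendroidal_subtree lower_root lower_min (ctree_closed X) (ctree_dendroidal X) lower_convex).

Lemma upper_convex (x y z : X) : e <= x -> e <= z -> x <= y -> y <= z -> e <= y.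
Proof. by move=> ex _ xy _; exact: le_trans xy. Qed.

Lemma upper_min (x : X) : e <= x -> e <= x. Proof. by []. Qed.

Definition upper : ctree k :=
  @CTree k (subtree (Q := fun x => e <= x) (lexx e) upper_min) erefl
    (dendroidal_subtree (lexx e) upper_min (ctree_closed X) (ctree_dendroidal X) upper_convex).

Definition lower_map : tree_hom lower X := subtree_map lower_root lower_min (ctree_closed X).
Definition upper_map : tree_hom upper X := subtree_map (lexx e) upper_min (ctree_closed X).

Lemma lower_edge_proof : ~~ (e < e). Proof. by rewrite ltxx. Qed.
Definition lower_edge : lower := exist (fun x => ~~ (e < x)) e lower_edge_proof.

Lemma canonical_cut : cut e lower_map upper_map lower_edge \bot.
Proof.
split=> //; first exact: subtree_map_inj.
- exact: subtree_map_inj.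
- move=> y; split=> [[z <-]|]; first exact: (subtree_map_in (Qr := lower_root) (ctree_closed X) z).
  exact: (subtree_map_onto lower_root lower_min).
- move=> y; split=> [[z <-]|]; first exact: (subtree_map_in (Qr := lexx e) (Qmin := upper_min) (ctree_closed X) z).
  exact: (subtree_map_onto (lexx e) upper_min).
Qed.

End CanonicalCut.

Section CutMap.
Variables (X X0 X1 : tree) (e : X) (m0 : tree_hom X0 X) (m1 : tree_hom X1 X) (e0 : X0) (e1 : X1).
Variables (W W0 W1 : tree) (e' : W) (m0' : tree_hom W0 W) (m1' : tree_hom W1 W) (e0' : W0) (e1' : W1).
Hypotheses (C : cut e m0 m1 e0 e1) (C' : cut e' m0' m1' e0' e1').
Hypotheses (X_closed : leaves X = set0) (X0_closed : leaves X0 = set0) (X1_closed : leaves X1 = set0).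
Hypotheses (W_closed : leaves W = set0) (W0_closed : leaves W0 = set0) (W1_closed : leaves W1 = set0).
Variable u : tree_hom X W.
Hypothesis ue : u e = e'.

Lemma hom_lower x : ~~ (e < x) -> ~~ (e' < u x).
Proof.
rewrite -ue => ex; apply/negP => ux.
have /orP[] : e >=< x.
  by apply: (closed_hom_reflect (f := u) X_closed); rewrite /Order.comparable (ltW ux).
  by rewrite le_eqVlt (negPf ex) orbF => /eqP xe; rewrite -xe ltxx in ux.
by move/(closed_hom_mono u X_closed)/(lt_le_trans ux); rewrite ltxx.
Qed.

Lemma cut_map0_ex x : exists y, m0' y = tree_comp u m0 x.
Proof. by apply/(cut_im0 C')/hom_lower/(cut_im0 C); exists x. Qed.

Lemma cut_map1_ex x : exists y, m1' y = tree_comp u m1 x.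
Proof.
by apply/(cut_im1 C'); rewrite -ue; apply: closed_hom_mono => //; apply/(cut_im1 C); exists x.
Qed.

Definition cut_map0 : tree_hom X0 W0 := factor X0_closed W0_closed (cut_inj0 C') cut_map0_ex.
Definition cut_map1 : tree_hom X1 W1 := factor X1_closed W1_closed (cut_inj1 C') cut_map1_ex.

Lemma cut_map0E x : m0' (cut_map0 x) = u (m0 x). Proof. exact: factorE. Qed.
Lemma cut_map1E x : m1' (cut_map1 x) = u (m1 x). Proof. exact: factorE. Qed.

Lemma cut_map0_edge : cut_map0 e0 = e0'.
Proof. by apply: (cut_inj0 C'); rewrite cut_map0E (cut_e0 C) (cut_e0 C'). Qed.

Lemma cut_bot0 : m0 \bot = \bot.
Proof.
have [|z zE] := (cut_im0 C \bot).2; first by rewrite ltx0.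
apply/eqP; rewrite -lex0 -[X in _ <= X]zE; apply: closed_hom_mono => //; exact: le0x.
Qed.

Lemma cut_bot0' : m0' \bot = \bot.
Proof.
have [|z zE] := (cut_im0 C' \bot).2; first by rewrite ltx0.
apply/eqP; rewrite -lex0 -[X in _ <= X]zE; apply: closed_hom_mono => //; exact: le0x.
Qed.

Lemma cut_map_rmax0 : rooted u && max_surjective u -> rooted cut_map0 && max_surjective cut_map0.
Proof.
move=> /andP[/eqP u_bot /forallP u_max]; apply/andP; split.
  by apply/eqP/(cut_inj0 C'); rewrite cut_map0E cut_bot0 cut_bot0'.
apply/forallP => y; apply/existsP; have /existsP[t yt] := u_max (m0' y).
have le_y z : (y <= cut_map0 z) = (m0' y <= u (m0 z)).
  by rewrite -cut_map0E closed_hom_le //; exact: cut_inj0 C'.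
have [et|/(cut_im0 C)[z zE]] := boolP (e < t); last by exists z; rewrite le_y zE.
(* If [t] lies above [e], the edge [e0] takes its place: m0' y is comparable with the image of [e]
   and not strictly above it. *)
exists e0; rewrite le_y (cut_e0 C) ue.
have ut : e' <= u t by rewrite -ue closed_hom_mono ?ltW.
have /orP[//|] := tree_linear yt ut.
have : ~~ (e' < m0' y) by apply/(cut_im0 C'); exists y.
by move=> ney; rewrite le_eqVlt (negPf ney) orbF => /eqP ->.
Qed.

Lemma cut_map_rmax1 : rooted u && max_surjective u -> rooted cut_map1 && max_surjective cut_map1.
Proof.
move=> /andP[/eqP u_bot /forallP u_max]; apply/andP; split.
  rewrite /rooted -lex0; apply: le_trans (cut_bot1 C' W1_closed \bot).
  rewrite -(closed_hom_le W1_closed _ _ (cut_inj1 C')) cut_map1E (cut_e1 C').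
  rewrite -ue closed_hom_mono // -(cut_e1 C); apply: closed_hom_mono => //; exact: le0x.
apply/forallP => y; apply/existsP; have /existsP[t yt] := u_max (m1' y).
have le_y z : (y <= cut_map1 z) = (m1' y <= u (m1 z)).
  by rewrite -cut_map1E closed_hom_le //; exact: cut_inj1 C'.
have ey : e' <= m1' y by apply/(cut_im1 C'); exists y.
have /orP[/(cut_im1 C)[z zE]|te] : e >=< t.
  apply: (closed_hom_reflect (f := u)) => //; rewrite ue /Order.comparable.
  by rewrite (le_trans ey yt).
  by exists z; rewrite le_y zE.
exists e1; rewrite le_y (cut_e1 C) ue; apply: le_trans yt _.
by rewrite -ue closed_hom_mono.
Qed.

End CutMap.

Section GluedTree.
Variables (k : option nat) (Y Z : ctree k) (y0 : Y).
Hypothesis y0_max : forall y, ~~ (y0 < y).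

(* Y x {root} and {y0} x Z in the product order: Z is grafted onto the edge y0. *)
Let E : finType := {z : Y * Z | (z.2 == \bot) || (z.1 == y0)}.
Let le (z w : E) : bool := ((sval z).1 <= (sval w).1) && ((sval z).2 <= (sval w).2).

Lemma glued_in0_proof (y : Y) : ((y, \bot : Z).2 == \bot) || ((y, \bot : Z).1 == y0).
Proof. by rewrite eqxx. Qed.

Lemma glued_in1_proof (z : Z) : ((y0, z).2 == \bot) || ((y0, z).1 == y0).
Proof. by rewrite eqxx orbT. Qed.

Definition glued_in0 (y : Y) : E := exist _ (y, \bot : Z) (glued_in0_proof y).
Definition glued_in1 (z : Z) : E := exist _ (y0, z) (glued_in1_proof z).

Lemma glued_ind (Q : E -> Prop) : (forall y, Q (glued_in0 y)) -> (forall z, Q (glued_in1 z)) -> forall x, Q x.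
Proof.
move=> Q0 Q1 [[y z] yz]; case/orP: (yz) => /= /eqP e; subst.
  by rewrite (_ : exist _ _ _ = glued_in0 y) //; exact: val_inj.
by rewrite (_ : exist _ _ _ = glued_in1 z) //; exact: val_inj.
Qed.

Lemma glued_axioms : poset_axioms le (glued_in0 \bot).
Proof.
split.
- by move=> x; rewrite /le !lexx.
- move=> [[x1 x2] xP] [[y1 y2] yP] /andP[/andP[/= a b] /andP[/= c d]]; apply: val_inj.
  by congr pair; apply/le_anti; rewrite ?a ?b ?c ?d.
- move=> x y z /andP[a b] /andP[c d].
  by rewrite /le (le_trans a c) (le_trans b d).
- by move=> x; rewrite /le !le0x.
have y0_le x : y0 <= x -> x = y0.
  by rewrite le_eqVlt (negPf (y0_max x)) orbF => /eqP.
apply: glued_ind => x; apply: glued_ind => y; apply: glued_ind => z; rewrite /le /= ?lexx ?le0x ?andbT ?andTb.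
- exact: tree_linear.
- by move=> yx /andP[/y0_le xy _]; rewrite -xy yx.
- by move=> /andP[/y0_le xy _] zx; rewrite -[in z <= y0]xy zx orbT.
- by rewrite !lex0 => /andP[_ /eqP ->]; rewrite le0x.
- exact: tree_linear.
- by move=> ->.
- by move=> _ ->; rewrite orbT.
- exact: tree_linear.
Qed.

Definition glued_tree : tree := poset_tree glued_axioms.

Lemma glued_closed : leaves glued_tree = set0. Proof. by []. Qed.

Lemma glued_le0 (y z : Y) : ((glued_in0 y : glued_tree) <= (glued_in0 z : glued_tree)) = (y <= z).
Proof. by rewrite [LHS]/(le _ _) /le /= lexx andbT. Qed.

Lemma glued_le1 (y z : Z) : ((glued_in1 y : glued_tree) <= (glued_in1 z : glued_tree)) = (y <= z).
Proof. by rewrite [LHS]/(le _ _) /le /= lexx. Qed.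

Fact glued_mono0 : {homo (glued_in0 : Y -> glued_tree) : x y / x <= y}.
Proof. by move=> x y; rewrite glued_le0. Qed.

Fact glued_mono1 : {homo (glued_in1 : Z -> glued_tree) : x y / x <= y}.
Proof. by move=> x y; rewrite glued_le1. Qed.

Fact glued_reflect0 (x y : Y) : (glued_in0 x : glued_tree) >=< (glued_in0 y : glued_tree) -> x >=< y.
Proof. by rewrite /Order.comparable !glued_le0. Qed.

Fact glued_reflect1 (x y : Z) : (glued_in1 x : glued_tree) >=< (glued_in1 y : glued_tree) -> x >=< y.
Proof. by rewrite /Order.comparable !glued_le1. Qed.

Definition glued_map0 : tree_hom Y glued_tree := closed_hom glued_closed glued_mono0 glued_reflect0.
Definition glued_map1 : tree_hom Z glued_tree := closed_hom glued_closed glued_mono1 glued_reflect1.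

Lemma glued_cut : cut (glued_in0 y0 : glued_tree) glued_map0 glued_map1 y0 \bot.
Proof.
have y0_le x : y0 <= x -> x = y0.
  by rewrite le_eqVlt (negPf (y0_max x)) orbF => /eqP.
split.
- by move=> x y /(congr1 (fun z : E => (sval z).1)).
- by move=> x y /(congr1 (fun z : E => (sval z).2)).
- move=> x; split=> [[y <-]|].
    apply/negP; rewrite lt_neqAle => /andP[ne]; rewrite [_ <= _](glued_le0 y0 y) => /y0_le e.
    by case/eqP: ne; rewrite e.
  move: x; apply: glued_ind => x; first by exists x.
  have [-> _|x0] := eqVneq x \bot; first by exists y0; exact: val_inj.
  case/negP; rewrite lt_neqAle; apply/andP; split; last by rewrite [_ <= _]/(le _ _) /le /= lexx le0x.
  apply/eqP => /(congr1 (fun z : E => (sval z).2)) /= e.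
  by rewrite -e eqxx in x0.
- move=> x; split=> [[y <-]|].
    by rewrite [_ <= _]/(le _ _) /le /= lexx le0x.
  move: x; apply: glued_ind => x; last by exists x.
  by rewrite glued_le0 => /y0_le ->; exists \bot; exact: val_inj.
- by [].
- exact: val_inj.
Qed.

End GluedTree.

(** Every vertex has all its inputs in one part: in the upper part if its output is at or above [e],
    otherwise in the lower part. *)
Lemma cut_dendroidal k (X : tree) (X0 X1 : ctree k) (e : X) (m0 : tree_hom X0 X) (m1 : tree_hom X1 X) e0 e1 :
  leaves X = set0 -> cut e m0 m1 e0 e1 -> dendroidal k X.
Proof.
move=> X_closed C; apply/forallP.
have [Y0c Y1c] := (ctree_closed X0, ctree_closed X1).
have bound (A : ctree k) (m : tree_hom A X) x :
    inputs (m x) \subset m @: inputs x -> leinf (Some (valence (m x))) k.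
  move=> sub; have /forallP/(_ x) := ctree_dendroidal A; apply: leinf_trans.
  by rewrite /= /valence; apply: leq_trans (subset_leq_card sub) (leq_imset_card _ _).
have sub1 x : inputs (m1 x) \subset m1 @: inputs x.
  apply/subsetP => y /inputs_closed[xy ymin].
  have [|z zE] := (cut_im1 C y).2.
    by apply: le_trans (ltW xy); apply/(cut_im1 C); exists x.
  rewrite -zE imset_f //; apply/inputs_closed; split.
    by rewrite -(closed_hom_lt Y1c _ _ (cut_inj1 C)) zE.
  move=> v xv vz; apply: (cut_inj1 C); rewrite zE; apply: ymin; rewrite -?zE.
    by rewrite (closed_hom_lt Y1c _ _ (cut_inj1 C)).
  exact: closed_hom_mono.
move=> x; have [/(cut_im1 C)[z <-]|ex] := boolP (e <= x); first exact: bound.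
have [|z zE] := (cut_im0 C x).2; first by apply: contra ex; exact: ltW.
rewrite -zE in ex *; apply: bound; apply/subsetP => y /inputs_closed[xy ymin].
have [w wE] : exists w, m0 w = y.
  apply/(cut_im0 C)/negP => ey.
  have /orP[|xe] := tree_linear (ltW ey) (ltW xy); first by rewrite (negPf ex).
  have {}xe : m0 z < e by rewrite lt_neqAle xe andbT; apply: contraNneq ex => ->; exact: lexx.
  by have eE := ymin e xe (ltW ey); rewrite eE ltxx in ey.
rewrite -wE imset_f //; apply/inputs_closed; split.
  by rewrite -(closed_hom_lt Y0c _ _ (cut_inj0 C)) wE.
move=> v xv vz; apply: (cut_inj0 C); rewrite wE; apply: ymin; rewrite -?wE.
  by rewrite (closed_hom_lt Y0c _ _ (cut_inj0 C)).
exact: closed_hom_mono.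
Qed.

(** * Homotopy colimits along equivalences of categories *)

Section EquivalenceOfCategories.
Variables (I J : category) (c : functor I J) (D : diagram J).
Hypothesis full : forall (a b : I) (v : hom (c a) (c b)), exists u : hom a b, fmor c u = v.
Hypothesis faithful : forall (a b : I) (u u' : hom a b), fmor c u = fmor c u' -> u = u'.
Hypothesis es : forall b : J, exists a : I, exists i : hom b (c a), exists i' : hom (c a) b,
  comp i i' = idm _ /\ comp i' i = idm _.

Lemma hocolim_equivalence : weak_equiv (hocolim_push (reindex_over c D)).
Proof.
pose p0 b := sval (cid (es b)).
pose al b : hom b (c (p0 b)) := sval (cid (proj2_sig (cid (es b)))).
pose al' b : hom (c (p0 b)) b := sval (cid (proj2_sig (cid (proj2_sig (cid (es b)))))).
have alP b : comp (al b) (al' b) = idm _ /\ comp (al' b) (al b) = idm _.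
  exact: (proj2_sig (cid (proj2_sig (cid (proj2_sig (cid (es b))))))).
pose p1 b b' (u : hom b b') : hom (p0 b) (p0 b') := sval (cid (full (comp (al b') (comp u (al' b))))).
have p1E b b' (u : hom b b') : fmor c (p1 b b' u) = comp (al b') (comp u (al' b)).
  exact: (proj2_sig (cid (full _))).
have p11 b : p1 b b (idm b) = idm _.
  by apply: faithful; rewrite p1E comp1m fmor1 (alP b).1.
have p1M b b' b'' (v : hom b' b'') (u : hom b b') : p1 _ _ (comp v u) = comp (p1 _ _ v) (p1 _ _ u).
  apply: faithful; rewrite fmorM !p1E -!compA; congr (comp _ (comp _ _)).
  by rewrite compA (alP b').2 comp1m.
pose p : functor J I := Functor p11 p1M.
pose be a : hom a (p (c a)) := sval (cid (full (al (c a)))).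
have beE a : fmor c (be a) = al (c a) by exact: (proj2_sig (cid (full _))).
have alN b b' (u : hom b b') : comp (fmor c (fmor p u)) (al b) = comp (al b') u.
  by rewrite p1E -!compA (alP b).2 compm1.
apply: (@hocolim_cofinal _ _ c p D al alN be) => [a b u|a n x]; last by rewrite beE.
by apply: faithful; rewrite !fmorM !beE; exact: alN.
Qed.

End EquivalenceOfCategories.

(** * Product categories *)

Set Primitive Projections.
(** Primitive projections give definitional eta for objects, so a chain in the product and the pair
    of its projections have the same objects. *)
Record pair_ob (A B : Type) := PairOb { ob1 : A; ob2 : B }.
Unset Primitive Projections.

Program Definition prod_cat (C D : category) : category :=
  @Category (pair_ob C D) (fun a b => hom (ob1 a) (ob1 b) * hom (ob2 a) (ob2 b))%type
    (fun a => (idm (ob1 a), idm (ob2 a)))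
    (fun a b c v u => (comp v.1 u.1, comp v.2 u.2)) _ _ _.
Next Obligation. by move=> C D a b [u v]; rewrite /= !comp1m. Qed.
Next Obligation. by move=> C D a b [u v]; rewrite /= !compm1. Qed.
Next Obligation. by move=> C D a b c d h g f; rewrite /= !compA. Qed.

(** * Cutting rooted max-surjective maps *)

Section CutRmax.
Variables (k j : option nat) (kj : leinf k j) (T : ctree j) (e : T).

Definition rtree (S : ctree j) (x : rmax kj S) : ctree k := tag (sval x).
Definition rmap (S : ctree j) (x : rmax kj S) : tree_hom S (rtree x) := tagged (sval x).

Lemma rmapP (S : ctree j) (x : rmax kj S) : rooted (rmap x) && max_surjective (rmap x).
Proof. exact: (proj2_sig x). Qed.

Lemma rmax_homE (S : ctree j) (x y : rmax kj S) (u : hom x y) t : (sval u : tree_hom _ _) (rmap x t) = rmap y t.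
Proof. exact: (congr1 (fun h : tree_hom S (rtree y) => h t) (svalP u)). Qed.

Definition rmax_hom (S : ctree j) (x y : rmax kj S) (u : tree_hom (rtree x) (rtree y))
    (ux : forall t, u (rmap x t) = rmap y t) : hom x y :=
  exist (fun u : tree_hom (rtree x) (rtree y) => tree_comp u (rmap x) = rmap y) u
    (@tree_hom_ext S (rtree y) (tree_comp u (rmap x)) (rmap y) ux).

Let CT := canonical_cut e.
Let C_ (x : rmax kj T) := canonical_cut (rmap x e).

Definition part0 (x : rmax kj T) : tree_hom (lower e) (lower (rmap x e)) :=
  cut_map0 CT (C_ x) (ctree_closed T) (ctree_closed _) (ctree_closed _) erefl.
Definition part1 (x : rmax kj T) : tree_hom (upper e) (upper (rmap x e)) :=
  cut_map1 CT (C_ x) (ctree_closed T) (ctree_closed _) (ctree_closed _) erefl.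

Lemma part0E x t : lower_map (rmap x e) (part0 x t) = rmap x (lower_map e t).
Proof. exact: cut_map0E. Qed.

Lemma part1E x t : upper_map (rmap x e) (part1 x t) = rmap x (upper_map e t).
Proof. exact: cut_map1E. Qed.

Definition cut_ob0 (x : rmax kj T) : rmax kj (lower e) :=
  rmax_ob kj (X := lower (rmap x e)) (f := part0 x) (cut_map_rmax0 CT (C_ x) _ _ _ _ (rmapP x)).

Definition cut_ob1 (x : rmax kj T) : rmax kj (upper e) :=
  rmax_ob kj (X := upper (rmap x e)) (f := part1 x) (cut_map_rmax1 CT (C_ x) _ _ _ _ (rmapP x)).

Lemma cut_hom0_ex (x y : rmax kj T) (u : hom x y) : exists v : hom (cut_ob0 x) (cut_ob0 y),
  forall t, lower_map (rmap y e) (sval v t) = sval u (lower_map (rmap x e) t).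
Proof.
pose v := cut_map0 (C_ x) (C_ y) (ctree_closed _) (ctree_closed _) (ctree_closed _) (rmax_homE u e).
have vE t : lower_map (rmap y e) (v t) = sval u (lower_map (rmap x e) t) by exact: cut_map0E.
have vx t : v (rmap (cut_ob0 x) t) = rmap (cut_ob0 y) t.
  apply: (cut_inj0 (C_ y)); rewrite vE [RHS]part0E part0E; exact: rmax_homE.
by exists (rmax_hom (x := cut_ob0 x) (y := cut_ob0 y) vx).
Qed.

Lemma cut_hom1_ex (x y : rmax kj T) (u : hom x y) : exists v : hom (cut_ob1 x) (cut_ob1 y),
  forall t, upper_map (rmap y e) (sval v t) = sval u (upper_map (rmap x e) t).
Proof.
pose v := cut_map1 (C_ x) (C_ y) (ctree_closed _) (ctree_closed _) (ctree_closed _) (rmax_homE u e).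
have vE t : upper_map (rmap y e) (v t) = sval u (upper_map (rmap x e) t) by exact: cut_map1E.
have vx t : v (rmap (cut_ob1 x) t) = rmap (cut_ob1 y) t.
  apply: (cut_inj1 (C_ y)); rewrite vE [RHS]part1E part1E; exact: rmax_homE.
by exists (rmax_hom (x := cut_ob1 x) (y := cut_ob1 y) vx).
Qed.

Definition cut_hom0 (x y : rmax kj T) (u : hom x y) := sval (cid (cut_hom0_ex u)).
Definition cut_hom1 (x y : rmax kj T) (u : hom x y) := sval (cid (cut_hom1_ex u)).

Lemma cut_hom0E (x y : rmax kj T) (u : hom x y) t :
  lower_map (rmap y e) (sval (cut_hom0 u) t) = sval u (lower_map (rmap x e) t).
Proof. exact: (proj2_sig (cid (cut_hom0_ex u))). Qed.

Lemma cut_hom1E (x y : rmax kj T) (u : hom x y) t :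
  upper_map (rmap y e) (sval (cut_hom1 u) t) = sval u (upper_map (rmap x e) t).
Proof. exact: (proj2_sig (cid (cut_hom1_ex u))). Qed.

Lemma cut_hom0_eq (x : rmax kj (lower e)) (y : rmax kj T) (u v : hom x (cut_ob0 y)) :
  (forall t, lower_map (rmap y e) (sval u t) = lower_map (rmap y e) (sval v t)) -> u = v.
Proof. by move=> uv; apply: sig_ext; exact: (tree_hom_cancel (cut_inj0 (C_ y))). Qed.

Lemma cut_hom1_eq (x : rmax kj (upper e)) (y : rmax kj T) (u v : hom x (cut_ob1 y)) :
  (forall t, upper_map (rmap y e) (sval u t) = upper_map (rmap y e) (sval v t)) -> u = v.
Proof. by move=> uv; apply: sig_ext; exact: (tree_hom_cancel (cut_inj1 (C_ y))). Qed.

Let R := op (rmax kj T).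
Let AB := prod_cat (op (rmax kj (lower e))) (op (rmax kj (upper e))).

Program Definition cut_functor : functor R AB :=
  @Functor R AB (fun x => PairOb (cut_ob0 x) (cut_ob1 x) : AB)
    (fun x y u => (cut_hom0 u, cut_hom1 u)) _ _.
Next Obligation.
move=> x; congr pair; [apply: cut_hom0_eq|apply: cut_hom1_eq] => t.
  exact: (@cut_hom0E x x (idm _)).
exact: (@cut_hom1E x x (idm _)).
Qed.
Next Obligation.
move=> x y z v u; congr pair; [apply: cut_hom0_eq|apply: cut_hom1_eq] => t.
  rewrite (@cut_hom0E z x (@comp R x y z v u)).
  by apply/esym; rewrite [LHS](@cut_hom0E y x u) (@cut_hom0E z y v).
rewrite (@cut_hom1E z x (@comp R x y z v u)).
by apply/esym; rewrite [LHS](@cut_hom1E y x u) (@cut_hom1E z y v).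
Qed.

Lemma cut_faithful (x y : R) (u u' : hom x y) : fmor cut_functor u = fmor cut_functor u' -> u = u'.
Proof.
move=> uu'; have e0 : cut_hom0 (x := y) (y := x) u = cut_hom0 u' := congr1 fst uu'.
have e1 : cut_hom1 (x := y) (y := x) u = cut_hom1 u' := congr1 snd uu'.
apply: sig_ext; apply: tree_hom_ext => t; move: t; apply: (cut_ind (C_ y)) => t.
  by rewrite -[LHS](@cut_hom0E y x) e0 (@cut_hom0E y x).
by rewrite -[LHS](@cut_hom1E y x) e1 (@cut_hom1E y x).
Qed.

Lemma part0_edge x : part0 x (lower_edge e) = lower_edge (rmap x e).
Proof. exact: cut_map0_edge. Qed.

Lemma part1_bot x : part1 x \bot = \bot.
Proof. by have /andP[/eqP] := rmapP (cut_ob1 x). Qed.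

Lemma cut_full (x y : R) (v : hom (cut_functor x) (cut_functor y)) : exists u : hom x y, fmor cut_functor u = v.
Proof.
case: v => v0 v1.
pose a : tree_hom (lower (rmap y e)) (rtree x) := tree_comp (lower_map (rmap x e)) (sval v0).
pose b : tree_hom (upper (rmap y e)) (rtree x) := tree_comp (upper_map (rmap x e)) (sval v1).
have v0E t : sval v0 (part0 y t) = part0 x t := @rmax_homE _ (cut_ob0 y) (cut_ob0 x) v0 t.
have v1E t : sval v1 (part1 y t) = part1 x t := @rmax_homE _ (cut_ob1 y) (cut_ob1 x) v1 t.
have ab : a (lower_edge (rmap y e)) = b \bot.
  change (lower_map (rmap x e) (sval v0 (lower_edge (rmap y e))) = upper_map (rmap x e) (sval v1 \bot)).
  rewrite -part0_edge v0E part0_edge -part1_bot v1E part1_bot.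
  by rewrite (cut_e0 (C_ x)) (cut_e1 (C_ x)).
have [u [u0 u1]] := glue_hom_ex (C_ y) (ctree_closed _) (ctree_closed _) (ctree_closed _) ab.
have uE t : u (rmap y t) = rmap x t.
  move: t; apply: (cut_ind CT) => t.
    by rewrite -part0E u0 [LHS](congr1 (lower_map (rmap x e)) (v0E t)) part0E.
  by rewrite -part1E u1 [LHS](congr1 (upper_map (rmap x e)) (v1E t)) part1E.
exists (rmax_hom (x := y) (y := x) uE).
congr pair; [apply: cut_hom0_eq|apply: cut_hom1_eq] => t.
  by rewrite cut_hom0E; exact: u0.
by rewrite cut_hom1E; exact: u1.
Qed.

(** [e] is maximal in the lower part, and max-surjectivity transfers this to its image; thus another
    tree can be grafted there. *)
Lemma rmax_edge_max (a : rmax kj (lower e)) y : ~~ (rmap a (lower_edge e) < y).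
Proof.
have /andP[_ /forallP/(_ y)/existsP[t yt]] := rmapP a; apply/negP => ey.
have : lower_edge e >=< t.
  apply: (closed_hom_reflect (f := rmap a) (ctree_closed _)).
  by rewrite /Order.comparable (le_trans (ltW ey) yt).
case/orP => [|/(closed_hom_mono (rmap a) (ctree_closed _)) te].
  have net : ~~ (e < lower_map e t) by apply/(cut_im0 CT); exists t.
  rewrite -(closed_hom_le (ctree_closed _) _ _ (cut_inj0 CT)) (cut_e0 CT) le_eqVlt (negPf net) orbF => /eqP et.
  have {}et : lower_edge e = t by apply: (cut_inj0 CT); rewrite (cut_e0 CT).
  by have := lt_le_trans ey yt; rewrite et ltxx.
by have := lt_le_trans ey (le_trans yt te); rewrite ltxx.
Qed.

Lemma glued_rmax_ex (a : rmax kj (lower e)) (b : rmax kj (upper e)) :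
  exists (x : rmax kj T) (m0 : tree_hom (rtree a) (rtree x)) (m1 : tree_hom (rtree b) (rtree x)),
  [/\ cut (rmap x e) m0 m1 (rmap a (lower_edge e)) \bot,
      forall t, m0 (rmap a t) = rmap x (lower_map e t) &
      forall t, m1 (rmap b t) = rmap x (upper_map e t)].
Proof.
have Cg := glued_cut (rtree b) (@rmax_edge_max a).
set m0 := glued_map0 _ _ in Cg; set m1 := glued_map1 _ _ in Cg.
pose X : ctree k := CTree (glued_closed _ _) (cut_dendroidal (glued_closed _ _) Cg).
have b_bot : rmap b \bot = \bot by have /andP[/eqP] := rmapP b.
have ab : tree_comp m0 (rmap a) (lower_edge e) = tree_comp m1 (rmap b) \bot.
  by rewrite [LHS](cut_e0 Cg) [RHS](congr1 m1 b_bot) (cut_e1 Cg).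
have [f [f0 f1]] := glue_hom_ex CT (ctree_closed _) (ctree_closed _) (ctree_closed X) ab.
have fP : rooted f && max_surjective f.
  apply/andP; split.
    apply/eqP; rewrite -(cut_bot0 CT (ctree_closed _)) f0.
    have /andP[/eqP a_bot _] := rmapP a; rewrite [LHS](congr1 m0 a_bot).
    exact: (cut_bot0 Cg (ctree_closed _)).
  apply/forallP; apply: (cut_ind Cg) => z; apply/existsP.
    have /andP[_ /forallP/(_ z)/existsP[t zt]] := rmapP a.
    by exists (lower_map e t); rewrite f0; apply: closed_hom_mono zt; exact: ctree_closed.
  have /andP[_ /forallP/(_ z)/existsP[t zt]] := rmapP b.
  by exists (upper_map e t); rewrite f1; apply: closed_hom_mono zt; exact: ctree_closed.
exists (rmax_ob kj (X := X) (f := f) fP), m0, m1; split=> [|t|t].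
- suff -> : rmap (rmax_ob kj (X := X) (f := f) fP) e = glued_in0 (rtree b) _ (rmap a (lower_edge e)) by exact: Cg.
  by rewrite -[e in LHS](cut_e0 CT) [LHS]f0; exact: (cut_e0 Cg).
- exact/esym/f0.
- exact/esym/f1.
Qed.

(** Cutting a grafted tree returns its factors only up to isomorphism. The canonical parts and the
    factors are two cuts of one tree at the same edge, which yields the comparison maps. *)
Lemma cut_es (b : AB) : exists x : R, exists i : hom b (cut_functor x), exists i' : hom (cut_functor x) b,
  comp i i' = idm _ /\ comp i' i = idm _.
Proof.
case: b => a b; have [x [m0 [m1 [C m0E m1E]]]] := glued_rmax_ex a b.
have idE : tree_id (rtree x) (rmap x e) = rmap x e by [].
pose i0 := cut_map0 (C_ x) C (ctree_closed _) (ctree_closed _) (ctree_closed _) idE.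
pose i1 := cut_map1 (C_ x) C (ctree_closed _) (ctree_closed _) (ctree_closed _) idE.
pose j0 := cut_map0 C (C_ x) (ctree_closed _) (ctree_closed _) (ctree_closed _) idE.
pose j1 := cut_map1 C (C_ x) (ctree_closed _) (ctree_closed _) (ctree_closed _) idE.
have i0E t : m0 (i0 t) = lower_map (rmap x e) t by exact: cut_map0E.
have i1E t : m1 (i1 t) = upper_map (rmap x e) t by exact: cut_map1E.
have j0E t : lower_map (rmap x e) (j0 t) = m0 t by exact: cut_map0E.
have j1E t : upper_map (rmap x e) (j1 t) = m1 t by exact: cut_map1E.
have i0x t : i0 (rmap (cut_ob0 x) t) = rmap a t.
  by apply: (cut_inj0 C); rewrite i0E [LHS]part0E m0E.
have i1x t : i1 (rmap (cut_ob1 x) t) = rmap b t.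
  by apply: (cut_inj1 C); rewrite i1E [LHS]part1E m1E.
have j0x t : j0 (rmap a t) = rmap (cut_ob0 x) t.
  by apply: (cut_inj0 (C_ x)); rewrite j0E m0E; exact/esym/part0E.
have j1x t : j1 (rmap b t) = rmap (cut_ob1 x) t.
  by apply: (cut_inj1 (C_ x)); rewrite j1E m1E; exact/esym/part1E.
exists x, (rmax_hom (x := cut_ob0 x) (y := a) i0x, rmax_hom (x := cut_ob1 x) (y := b) i1x).
exists (rmax_hom (x := a) (y := cut_ob0 x) j0x, rmax_hom (x := b) (y := cut_ob1 x) j1x).
split; congr pair; apply: sig_ext.
- by apply: (tree_hom_cancel (cut_inj0 (C_ x))) => t; rewrite [LHS]j0E i0E.
- by apply: (tree_hom_cancel (cut_inj1 (C_ x))) => t; rewrite [LHS]j1E i1E.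
- by apply: (tree_hom_cancel (cut_inj0 C)) => t; rewrite [LHS]i0E j0E.
- by apply: (tree_hom_cancel (cut_inj1 C)) => t; rewrite [LHS]i1E j1E.
Qed.

End CutRmax.

(** * The homotopy colimit for a cut tree *)

Lemma weak_equiv_into_tens_cut (j : option nat) (F : presheaf (Omegac j)) (X X0 X1 : ctree j) (e : X)
    (m0 : tree_hom X0 X) (m1 : tree_hom X1 X) (e0 : X0) (e1 : X1)
    (u0 : smap (F X0) (F (point_tree j))) (u1 : smap (F X1) (F (point_tree j))) :
  cut e m0 m1 e0 e1 -> segal F -> kan (F (point_tree j)) ->
  u0 = @restrict (Omegac j) F _ _ (point_map e0) -> u1 = @restrict (Omegac j) F _ _ (point_map e1) ->
  forall u01 : forall n x, u0 n (@restrict (Omegac j) F _ _ m0 n x) = u1 n (@restrict (Omegac j) F _ _ m1 n x),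
  weak_equiv (into_tens u01).
Proof.
move=> [i0 i1 im0 im1 E0 E1] sF kS -> -> u01.
exact: (weak_equiv_tens_decomposition sF kS i0 i1 im0 im1 E0 E1).
Qed.

Section CutHocolim.
Variables (k j : option nat) (kj : leinf k j) (F : presheaf (Omegac j)) (T : ctree j) (e : T).
Hypothesis segalF : segal F.
Hypothesis kanF : kan (F (point_tree j)).

Let S := F (point_tree j).
Let A := op (rmax kj (lower e)).
Let B := op (rmax kj (upper e)).
Let FA : diagram A := pullback (rmax_functor kj (lower e)) F.
Let FB : diagram B := pullback (rmax_functor kj (upper e)) F.
Let u0 : smap (F (lower e)) S := @restrict (Omegac j) F _ _ (point_map (lower_edge e)).
Let u1 : smap (F (upper e)) S := @restrict (Omegac j) F _ _ (point_map (\bot : upper e)).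
Let uA (a : A) : smap (FA a) S := smap_comp u0 (@restrict (Omegac j) F _ (inclusion kj (rtree a)) (rmap a)).
Let uB (b : B) : smap (FB b) S := smap_comp u1 (@restrict (Omegac j) F _ (inclusion kj (rtree b)) (rmap b)).

Lemma uA_nat (a a' : A) (u : hom a a') n x : uA a' n (dmor FA u n x) = uA a n x.
Proof.
congr (u0 n _); rewrite [LHS]restrict_comp; congr (smap_fun (@restrict (Omegac j) F _ _ _) n x).
apply: tree_hom_ext => t; exact: (@rmax_homE k j kj (lower e) a' a u).
Qed.

Lemma uB_nat (a a' : B) (u : hom a a') n x : uB a' n (dmor FB u n x) = uB a n x.
Proof.
congr (u1 n _); rewrite [LHS]restrict_comp; congr (smap_fun (@restrict (Omegac j) F _ _ _) n x).
apply: tree_hom_ext => t; exact: (@rmax_homE k j kj (upper e) a' a u).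
Qed.

Program Definition tens_diagram : diagram (prod_cat A B) :=
  @Diagram (prod_cat A B) (fun ab => tens (uA (ob1 ab)) (uB (ob2 ab)))
    (fun ab ab' uv => tens_map (uA_nat uv.1) (uB_nat uv.2)) _ _.
Next Obligation.
move=> ab n x; apply: spull_ext => //.
case: x => [[[x y] g] xP]; exact: (congr2 pair (@dmor1 _ FA (ob1 ab) n x) (@dmor1 _ FB (ob2 ab) n y)).
Qed.
Next Obligation.
move=> a b c v u n x; apply: spull_ext => //.
case: x => [[[x y] g] xP].
exact: (congr2 pair (@dmorM _ FA _ _ _ v.1 u.1 n x) (@dmorM _ FB _ _ _ v.2 u.2 n y)).
Qed.

Let cA : smap (hocolim FA) S := smap_comp u0 (colim_map (rmax_cone kj (lower e)) F).
Let cB : smap (hocolim FB) S := smap_comp u1 (colim_map (rmax_cone kj (upper e)) F).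

Definition prod_fst : functor (prod_cat A B) A :=
  @Functor (prod_cat A B) A (fun x => ob1 x) (fun _ _ u => u.1) (fun=> erefl) (fun _ _ _ _ _ => erefl).
Definition prod_snd : functor (prod_cat A B) B :=
  @Functor (prod_cat A B) B (fun x => ob2 x) (fun _ _ u => u.2) (fun=> erefl) (fun _ _ _ _ _ => erefl).

Program Definition chain_pair n (s : chain n A) (t : chain n B) : chain n (prod_cat A B) :=
  @Chain n (prod_cat A B) (fun i => PairOb (s i) (t i)) (fun i l il => (cmor s il, cmor t il)) _ _.
Next Obligation. by move=> n s t i ii; exact: (congr2 pair (cmor1 s ii) (cmor1 t ii)). Qed.
Next Obligation. by move=> n s t i l m il lm im; exact: (congr2 pair (cmorM s il lm im) (cmorM t il lm im)). Qed.

Definition split_fun n (x : hocolim tens_diagram n) : tens cA cB n :=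
  exist _ ((hocolim_cell (D := FA) (s := chain_map prod_fst (tag x)) (sval (tagged x)).1.1,
            hocolim_cell (D := FB) (s := chain_map prod_snd (tag x)) (sval (tagged x)).1.2),
           (sval (tagged x)).2) (proj2_sig (tagged x)).

Definition join_fun n (x : tens cA cB n) : hocolim tens_diagram n :=
  hocolim_cell (D := tens_diagram) (s := chain_pair (tag (sval x).1.1) (tag (sval x).1.2))
    (exist _ ((tagged (sval x).1.1, tagged (sval x).1.2), (sval x).2) (proj2_sig x)).

Program Definition split_map : smap (hocolim tens_diagram) (tens cA cB) :=
  @SMap (hocolim tens_diagram) (tens cA cB) split_fun _.
Next Obligation.
move=> m n f [s [[[x y] g] xP]]; apply: spull_ext => //; congr pair.
  by apply: (@chain_hom_ext A m (fun a => FA (a ord0) m)).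
by apply: (@chain_hom_ext B m (fun a => FB (a ord0) m)).
Qed.

Program Definition join_map : smap (tens cA cB) (hocolim tens_diagram) :=
  @SMap (tens cA cB) (hocolim tens_diagram) join_fun _.
Next Obligation.
move=> m n f [[[[s x] [t y]] g] xP].
apply: (@chain_hom_ext (prod_cat A B) m (fun a => tens_diagram (a ord0) m)) => //.
exact: spull_ext.
Qed.

(** [S] does not vary over the index categories, and a chain in the product is a pair of chains. So
    homotopy colimits and homotopy fibre products over [S] commute by an isomorphism of simplicial
    sets. *)
Lemma weak_equiv_split_map : weak_equiv split_map.
Proof.
apply: (@weak_equiv_iso _ _ _ join_map) => n.
  move=> [s [[[x y] g] xP]]; case: s x y xP => [a u p q] x y xP.
  apply: (@chain_hom_ext (prod_cat A B) n (fun a => tens_diagram (a ord0) n)) => [i l il|].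
    exact/esym/surjective_pairing.
  exact: spull_ext.
move=> [[[[s x] [t y]] g] xP]; apply: spull_ext => //; congr pair.
  case: s x xP => [a u p q] x xP.
  by apply: (@chain_hom_ext A n (fun a => FA (a ord0) n)).
case: t y xP => [a u p q] y xP.
by apply: (@chain_hom_ext B n (fun a => FB (a ord0) n)).
Qed.

Let FT := pullback (rmax_functor kj T) F.
Let c := cut_functor kj e.

Definition low (x : op (rmax kj T)) : smap (FT x) (FA (cut_ob0 e x)) :=
  @restrict (Omegac j) F (inclusion kj (lower (rmap x e))) (inclusion kj (rtree x)) (lower_map (rmap x e)).

Definition upp (x : op (rmax kj T)) : smap (FT x) (FB (cut_ob1 e x)) :=
  @restrict (Omegac j) F (inclusion kj (upper (rmap x e))) (inclusion kj (rtree x)) (upper_map (rmap x e)).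

Lemma low_point (x : op (rmax kj T)) :
  uA (cut_ob0 e x) = @restrict (Omegac j) F _ (inclusion kj (lower (rmap x e))) (point_map (lower_edge (rmap x e) : inclusion kj (lower (rmap x e)))).
Proof.
apply: smap_ext => n y; rewrite [LHS]restrict_comp.
congr (smap_fun (@restrict (Omegac j) F _ _ _) n y); apply: tree_hom_ext => t; exact: part0_edge.
Qed.

Lemma upp_point (x : op (rmax kj T)) :
  uB (cut_ob1 e x) = @restrict (Omegac j) F _ (inclusion kj (upper (rmap x e))) (point_map (\bot : inclusion kj (upper (rmap x e)))).
Proof.
apply: smap_ext => n y; rewrite [LHS]restrict_comp.
congr (smap_fun (@restrict (Omegac j) F _ _ _) n y); apply: tree_hom_ext => t; exact: part1_bot.
Qed.

Lemma low_upp (x : op (rmax kj T)) n y :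
  uA (cut_ob0 e x) n (low x n y) = uB (cut_ob1 e x) n (upp x n y).
Proof.
rewrite low_point upp_point [LHS]restrict_comp [RHS]restrict_comp.
by congr (smap_fun (@restrict (Omegac j) F _ _ _) n y); exact: tree_hom_ext.
Qed.

Lemma low_nat (x y : op (rmax kj T)) (u : hom x y) n z :
  low y n (dmor FT u n z) = dmor FA (fmor c u).1 n (low x n z).
Proof.
rewrite [LHS]restrict_comp [RHS]restrict_comp; congr (smap_fun (@restrict (Omegac j) F _ _ _) n z).
apply: tree_hom_ext => t; apply/esym; exact: (@cut_hom0E k j kj T e y x u).
Qed.

Lemma upp_nat (x y : op (rmax kj T)) (u : hom x y) n z :
  upp y n (dmor FT u n z) = dmor FB (fmor c u).2 n (upp x n z).
Proof.
rewrite [LHS]restrict_comp [RHS]restrict_comp; congr (smap_fun (@restrict (Omegac j) F _ _ _) n z).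
apply: tree_hom_ext => t; apply/esym; exact: (@cut_hom1E k j kj T e y x u).
Qed.

Program Definition into_tens_diagram : diagram_map FT (reindex c tens_diagram) :=
  @DiagramMap _ FT (reindex c tens_diagram) (fun x => into_tens (@low_upp x)) _.
Next Obligation.
move=> x y u n z; apply: spull_ext; first exact: congr2 (low_nat u z) (upp_nat u z).
apply: (congr1 (const_path _ n)).
by rewrite -[RHS](@uA_nat (c x).(ob1) (c y).(ob1) (fmor c u).1) -low_nat.
Qed.

Let uT01 n x : u0 n (@restrict (Omegac j) F _ _ (lower_map e) n x) = u1 n (@restrict (Omegac j) F _ _ (upper_map e) n x).
Proof.
rewrite [LHS]restrict_comp [RHS]restrict_comp.
by congr (smap_fun (@restrict (Omegac j) F _ _ _) n x); exact: tree_hom_ext.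
Qed.

(** After composition with the Segal decomposition of F T, the map factors through the homotopy
    fibre product of the two colimits: by the decompositions of the trees X, the equivalence of
    indexing categories and [split_map]. The last factor [tm] is an equivalence by invariance of
    homotopy fibre products. *)
Lemma weak_equiv_colim_cut :
  weak_equiv (colim_map (rmax_cone kj (lower e)) F) ->
  weak_equiv (colim_map (rmax_cone kj (upper e)) F) ->
  weak_equiv (colim_map (rmax_cone kj T) F).
Proof.
move=> w0 w1.
pose tm := @tens_map S _ _ _ _ cA cB u0 u1 (colim_map (rmax_cone kj (lower e)) F)
  (colim_map (rmax_cone kj (upper e)) F) (fun _ _ => erefl) (fun _ _ => erefl).
apply: (@weak_equiv_cancel_left _ _ _ (into_tens uT01)).
  exact: (weak_equiv_into_tens_cut (canonical_cut e)).
rewrite (_ : smap_comp _ _ = smap_comp tm (smap_comp split_map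
    (smap_comp (hocolim_push (reindex_over c tens_diagram)) (hocolim_map into_tens_diagram)))); last first.
  have E0 (x : op (rmax kj T)) n y : @restrict (Omegac j) F _ _ (lower_map e) n
      (@restrict (Omegac j) F _ (inclusion kj (rtree x)) (rmap x) n y) =
      @restrict (Omegac j) F _ (inclusion kj (rtree (cut_ob0 e x))) (rmap (cut_ob0 e x)) n (low x n y).
    rewrite [LHS]restrict_comp [RHS]restrict_comp; congr (smap_fun (@restrict (Omegac j) F _ _ _) n y).
    by apply: tree_hom_ext => t; exact/esym/part0E.
  have E1 (x : op (rmax kj T)) n y : @restrict (Omegac j) F _ _ (upper_map e) n
      (@restrict (Omegac j) F _ (inclusion kj (rtree x)) (rmap x) n y) =
      @restrict (Omegac j) F _ (inclusion kj (rtree (cut_ob1 e x))) (rmap (cut_ob1 e x)) n (upp x n y).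
    rewrite [LHS]restrict_comp [RHS]restrict_comp; congr (smap_fun (@restrict (Omegac j) F _ _ _) n y).
    by apply: tree_hom_ext => t; exact/esym/part1E.
  apply: smap_ext => n [s y]; apply: spull_ext; first exact: congr2 (E0 (s ord0) n y) (E1 (s ord0) n y).
  by apply: (congr1 (const_path _ n)); congr (u0 n _); exact: E0.
apply: weak_equiv_comp; last exact: weak_equiv_tens_map.
apply: weak_equiv_comp; last exact: weak_equiv_split_map.
apply: weak_equiv_comp.
  apply: weak_equiv_hocolim => x.
  exact: (weak_equiv_into_tens_cut (X := inclusion kj (rtree x)) (X0 := inclusion kj (lower (rmap x e)))
    (X1 := inclusion kj (upper (rmap x e))) (canonical_cut (rmap x e)) segalF kanF (low_point x) (upp_point x)).
apply: hocolim_equivalence.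
- exact: cut_full.
- exact: cut_faithful.
- exact: cut_es.
Qed.
End CutHocolim.

(** * Induction on the number of edges *)

Lemma weak_equiv_dmor_iso (J : category) (D : diagram J) (c c' : J) (a : hom c c') (b : hom c' c) :
  comp b a = idm _ -> comp a b = idm _ -> weak_equiv (dmor D a).
Proof.
by move=> ba ab; apply: (@weak_equiv_iso _ _ _ (dmor D b)) => n x; rewrite -dmorM ?ba ?ab dmor1.
Qed.

Lemma lan_counit_iso (I J : category) (p : functor I J) (F : diagram J) (c c' : J)
    (a : hom c c') (b : hom c' c) :
  comp b a = idm _ -> comp a b = idm _ -> weak_equiv (lan_counit p F c) -> weak_equiv (lan_counit p F c').
Proof.
move=> ba ab w; apply: (weak_equiv_cancel_right (weak_equiv_dmor_iso (lan p (reindex p F)) ba ab)).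
rewrite (_ : smap_comp _ _ = smap_comp (dmor F a) (lan_counit p F c)).
  exact: weak_equiv_comp (weak_equiv_dmor_iso F ba ab).
by apply: smap_ext => n x; exact: dmap_nat.
Qed.

Lemma card_proper_inj (A B : finType) (f : A -> B) y :
  injective f -> (forall x, f x != y) -> (#|A| < #|B|)%N.
Proof.
move=> f_inj fy; rewrite -[#|A|]cardsT -(card_imset _ f_inj) -cardsT; apply: proper_card.
apply/properP; split; first exact: subsetT.
by exists y; rewrite ?inE //; apply/imsetP => -[x _ e]; have := fy x; rewrite -e eqxx.
Qed.

Section Induction.
Variables (k j : option nat) (kj : leinf k j) (F : presheaf (Omegac j)).
Hypothesis segalF : segal F.
Hypothesis kanF : kan_valued F.
Let p := op_functor (inclusion kj).

(** At a tree of the subcategory the counit is [lan_restrict] for the restriction of [F]. *)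
Lemma colim_rmax_dendroidal (T : ctree j) : dendroidal k T -> weak_equiv (lan_counit p F T).
Proof.
case: T => T Tc Tj Tk; pose X : ctree k := CTree Tc Tk.
rewrite (_ : CTree Tc Tj = inclusion kj X); last by congr CTree; exact: bool_irrelevance.
exact: (@weak_equiv_lan_restrict _ _ p (fun a b v => v) (fun _ _ _ => erefl) (fun _ _ _ => erefl) (reindex p F) X).
Qed.

(** Without inner edges, all edges lie in the star of the root. *)
Lemma corolla_iso (T : ctree j) : (forall e : T, e != \bot -> forall y, ~~ (e < y)) ->
  exists (nj : leinf (Some (valence (\bot : T))) j) (f : tree_hom (closed_corolla nj) T) (g : tree_hom T (closed_corolla nj)),
    (forall x, f (g x) = x) /\ (forall x, g (f x) = x).
Proof.
move=> Tmax; have /forallP/(_ (\bot : T)) nj := ctree_dendroidal T; exists nj.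
have [a aT aP] := corolla_hom_ex (erefl (valence (\bot : T))).
have all_star (y : T) : in_star \bot y.
  have [->|y0] := eqVneq y \bot; first exact: in_star_root.
  rewrite /in_star orbC; apply/orP; left; apply/inputs_closed; split; first by rewrite lt0x.
  move=> z; rewrite lt0x => z0; rewrite le_eqVlt => /orP[/eqP//|zy].
  by have := Tmax z z0 y; rewrite zy.
case: a aT aP => [[[n|] f] aP'] //= [n_eq] fP; subst n.
have f_inj : injective f := @oel_inj j T (exist _ (existT _ (Some (valence (\bot : T))) f) aP').
have f_onto y : exists x, f x = y by exact/fP.
pose h : tree_hom (closed_corolla nj) T := closure_adjunct (ctree_closed T) f.
pose g := factor (a := tree_id T) (b := h) (ctree_closed T) (ctree_closed (closed_corolla nj)) f_inj f_onto.
have gE x : h (g x) = x by exact: factorE.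
by exists h, g; split=> // x; exact: (f_inj _ _ (gE _)).
Qed.

Hypothesis corollaF : forall (n : nat) (nj : leinf (Some n) j), ~~ leinf (Some n) k ->
  weak_equiv (colim_map (rmax_cone kj (closed_corolla nj)) F).

Lemma weak_equiv_counit_induction (T : ctree j) : weak_equiv (lan_counit p F T).
Proof.
have [n] := ubnP #|T|; elim: n T => // n IH T; rewrite ltnS => le_n.
have [Tk|nTk] := boolP (dendroidal k T); first exact: colim_rmax_dendroidal.
have [[e e0 [y ey]]|ne] := pselect (exists2 e : T, e != \bot & exists y, e < y).
  apply/weak_equiv_colim_rmax/(weak_equiv_colim_cut (e := e) segalF); first exact: kanF.
    apply/weak_equiv_colim_rmax/IH; apply: leq_trans le_n.
    (* The lower part loses the edge [y] above [e]; the upper part loses the root. *)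
    apply: (card_proper_inj (y := y) (cut_inj0 (canonical_cut e))) => x.
    apply/eqP => xy; have : ~~ (e < y) by apply/(cut_im0 (canonical_cut e)); exists x.
    by rewrite ey.
  apply/weak_equiv_colim_rmax/IH; apply: leq_trans le_n.
  apply: (card_proper_inj (y := \bot) (cut_inj1 (canonical_cut e))) => x.
  apply/eqP => xy; have : e <= \bot by apply/(cut_im1 (canonical_cut e)); exists x.
  by rewrite lex0 (negPf e0).
have Tmax (e : T) : e != \bot -> forall y, ~~ (e < y).
  by move=> e0 y; apply/negP => ey; apply: ne; exists e => //; exists y.
have [nj [f [g [fg gf]]]] := corolla_iso Tmax.
apply: (@lan_counit_iso _ _ p F (closed_corolla nj) T g f).
- by apply: tree_hom_ext => x; exact: gf.
- by apply: tree_hom_ext => x; exact: fg.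
(* Edges other than the root have no inputs, so [T] can fail to be k-dendroidal only at the root;
   hence the corolla has more than k leaves. *)
apply/weak_equiv_colim_rmax/corollaF; apply: contra nTk => nk; apply/forallP => e.
have [-> //|e0] := eqVneq e \bot.
rewrite (_ : valence e = 0%N); first by case: (k).
apply/eqP; rewrite cards_eq0; apply/eqP/setP => x; rewrite !inE.
by apply/negP => /andP[ex _]; have := Tmax e e0 x; rewrite ex.
Qed.

End Induction.

(** * Restriction to k-dendroidal trees *)

Lemma ctree_functor_eq j (E : category) (t : E -> tree) (tc : forall a, leaves (t a) = set0)
    (d d' : forall a, dendroidal j (t a)) (m m' : forall a b, hom a b -> tree_hom (t a) (t b)) p1 p2 p1' p2' :
  (forall a b (u : hom a b), m a b u = m' a b u) ->
  @Functor E (Omegac j) (fun a => CTree (tc a) (d a)) m p1 p2 =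
  @Functor E (Omegac j) (fun a => CTree (tc a) (d' a)) m' p1' p2'.
Proof.
move=> mm'; have dd' : d = d' by apply: functional_extensionality_dep => a; exact: bool_irrelevance.
have {}mm' : m = m'.
  apply: functional_extensionality_dep => a; apply: functional_extensionality_dep => b.
  exact: functional_extensionality_dep.
subst d' m'; congr Functor; exact: Prop_irrelevance.
Qed.

Lemma pullback_comp (B C D : category) (f : functor B C) (g : functor C D) (F : presheaf D) :
  pullback f (pullback g F) = pullback (functor_comp g f) F.
Proof. by congr Diagram; exact: Prop_irrelevance. Qed.

Section Restrict.
Variables (k j : option nat) (kj : leinf k j) (F : presheaf (Omegac j)).

(** The closed elementary trees on the two sides carry different proofs of their valence bound, so
    the diagrams are compared by restriction along identities of trees. *)
Lemma segal_restrict : segal F -> segal (pullback (inclusion kj) F).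
Proof.
move=> segalF T; have w := segalF (inclusion kj T).
pose D := pullback (Omega_el_functor (inclusion kj T)) F.
pose E := pullback (Omega_el_functor T) (pullback (inclusion kj) F).
pose W := op (Omega_el T).
pose phi0 (a : W) : smap (D a) (E a) :=
  @restrict (Omegac j) F (inclusion kj (Omega_el_functor T a)) (Omega_el_functor (inclusion kj T) a)
    (tree_id (Omega_el_functor T a)).
pose ga0 (a : W) : smap (E a) (D a) :=
  @restrict (Omegac j) F (Omega_el_functor (inclusion kj T) a) (inclusion kj (Omega_el_functor T a))
    (tree_id (Omega_el_functor T a)).
have phiN (a b : W) (u : hom a b) n (x : D a n) : phi0 b n (dmor D u n x) = dmor E u n (phi0 a n x).
  rewrite [LHS]restrict_comp [RHS]restrict_comp.
  by congr (smap_fun (@restrict (Omegac j) F _ _ _) n x); exact: tree_hom_ext.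
have gaN (a b : W) (u : hom a b) n (x : E a n) : ga0 b n (dmor E u n x) = dmor D u n (ga0 a n x).
  apply: etrans (@restrict_comp j F (Omega_el_functor (inclusion kj T) b) (inclusion kj (Omega_el_functor T b))
    (inclusion kj (Omega_el_functor T a)) (closure_hom (sval u)) (tree_id _) n x) _.
  rewrite [RHS]restrict_comp.
  by congr (smap_fun (@restrict (Omegac j) F _ _ _) n x); exact: tree_hom_ext.
pose phi := @DiagramUnder _ _ D E (functor_id W) phi0 phiN.
pose ga := @DiagramUnder _ _ E D (functor_id W) ga0 gaN.
suff -> : lim_map (Omega_el_cocone T) (pullback (inclusion kj) F) =
    smap_comp (holim_pull phi) (lim_map (Omega_el_cocone (inclusion kj T)) F).
  apply: weak_equiv_comp w _.
  apply: (@holim_pull_equiv W W (functor_id W) (functor_id W) D E phi ga (fun a => idm a) _ (fun a => idm a)).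
  - by move=> a b u; rewrite comp1m compm1.
  - by move=> a b u; rewrite comp1m compm1.
  - by move=> a n x; rewrite dmor1 [LHS]restrict_comp; exact: restrict_id.
  - by move=> a n x; rewrite dmor1 [LHS]restrict_comp; exact: (@restrict_id j F (inclusion kj (Omega_el_functor T a))).
apply: smap_ext => n x; apply: holim_cell_ext => l t s; apply/esym.
rewrite [LHS]restrict_comp; congr (smap_fun (@restrict (Omegac j) F _ _ _) l _).
exact: tree_hom_ext.
Qed.

Lemma complete_restrict (k1 : leinf (Some 1) k) :
  complete (leinf_trans k1 kj) F -> complete k1 (pullback (inclusion kj) F).
Proof.
rewrite /complete pullback_comp.
rewrite (_ : functor_comp (inclusion kj) (Delta_Omegac k1) = Delta_Omegac (leinf_trans k1 kj)) //.
by apply: ctree_functor_eq => a b u; exact: tree_hom_ext.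
Qed.

End Restrict.

Theorem corollary4p12 (k j : option nat) (k1 : leinf (Some 1) k)
    (kj : leinf k j) (F : presheaf (Omegac j))
    (hF : unital_operad (leinf_trans k1 kj) F) :
  in_image_L k1 kj F <->
  (forall (n : nat) (nj : leinf (Some n) j), ~~ leinf (Some n) k ->
     weak_equiv (colim_map (rmax_cone kj (closed_corolla nj)) F)).
Proof.
have [kanF segalF completeF] := hF; split=> [[G _ eqF] n nj _|corollaF].
  apply/weak_equiv_colim_rmax.
  exact: (@lan_image_counit _ _ (op_functor (inclusion kj)) (fun a b v => v) (fun _ _ _ => erefl) (fun _ _ _ => erefl) G F eqF).
exists (pullback (inclusion kj) F).
  split; [by move=> T; exact: kanF | exact: segal_restrict | exact: complete_restrict].
apply: (@DiagramEquivMap _ _ _ (lan_counit (op_functor (inclusion kj)) F)) => T.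
exact: weak_equiv_counit_induction.
Qed.
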